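(* In the setting given in the context (data from $f(y\mid x;\theta)f_X(x)$, sampling probabilities $\pi_N(x,y;\tilde\vartheta_{\mathrm{plt}})$ with a pilot estimator $\tilde\vartheta_{\mathrm{plt}}$ independent of the data and converging in probability to $\vartheta_p$, average subsample size $n$), let $\hat\theta_{s,\tilde\vartheta_{\mathrm{plt}}}$ be the maximizer of the sampled data conditional log-likelihood $\ell_S(\cdot\mid\tilde\vartheta_{\mathrm{plt}})$. Assume: (1') For $\vartheta$ in a neighborhood of $\vartheta_p$, $$\limsup_{n,N\to\infty}\frac Nn\mathbb{E}\{\pi_N(x,y;\vartheta)\|\dot\ell(\theta;x,y)\|^4\}<\infty\quad\text{and}\quad\limsup_{n,N\to\infty}\frac Nn\mathbb{E}\{\pi_N(x,y;\vartheta)\|\ddot\ell(\theta;x,y)\|^2\}<\infty.$$ (2') The parameter space $\Theta$ is compact and there exists a function $B_\vartheta(x,y)$ such that for any components $\theta_{j_1},\theta_{j_2},\theta_{j_3}$ of $\theta$, $$\sup_{\theta\in\Theta}\left|\frac{\partial^3\ell(\theta;x,y)}{\partial\theta_{j_1}\partial\theta_{j_2}\partial\theta_{j_3}}\right|\le B_\vartheta(x,y),\qquad \sup_{\theta\in\Theta}\left|\frac{\partial^3\log\{\bar\pi_N(x;\theta\mid\vartheta)\}}{\partial\theta_{j_1}\partial\theta_{j_2}\partial\theta_{j_3}}\right|\le B_\vartheta(x,y),$$ where for $\vartheta$ in a neighborhood of $\vartheta_p$, $\limsup_{n,N\to\infty}\frac Nn\mathbb{E}\{\pi_N(x,y;\vartheta)B_\vartheta(x,y)\}<\infty$.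 (3') As $n$ and $N$ go to infinity, for $\vartheta$ in a neighborhood of $\vartheta_p$, the matrix $$\Sigma_{N,\theta,\vartheta}=\frac Nn\mathbb{E}\left[\dot\ell(\theta;x,y)^{\otimes2}\pi_N(x,y;\vartheta)-\frac{\big(\mathbb{E}\{\dot\ell(\theta;x,y)\pi_N(x,y;\vartheta)\mid x\}\big)^{\otimes2}}{\mathbb{E}\{\pi_N(x,y;\vartheta)\mid x\}}\right]\to\Sigma_{\theta,\vartheta},$$ where $\Sigma_{N,\theta,\vartheta}$ and $\Sigma_{\theta,\vartheta}$ are finite, positive definite, and continuous with respect to $\vartheta$. Then, as $n$ and $N$ go to infinity, $$\sqrt n\,(\hat\theta_{s,\tilde\vartheta_{\mathrm{plt}}}-\theta)\ \longrightarrow\ \mathcal N(0,\Sigma_{\theta,\vartheta_p}^{-1})\quad\text{in distribution,}$$ where $\Sigma_{\theta,\vartheta_p}$ is the limit of $\Sigma_{N,\theta,\vartheta_p}$.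
   Context: The data $(x_i,y_i)$, $i=1,\dots,N$, are independent realizations of $(x,y)$ with joint density $f(y\mid x;\theta)f_X(x)$ for a true parameter $\theta\in\Theta\subset\mathbb{R}^d$, with $f_X$ unspecified; $f(y\mid x;\theta)$ is a density with respect to $\mathrm dy$ (Lebesgue measure for continuous responses, counting measure for discrete ones). $\ell(\theta;x,y)=\log f(y\mid x;\theta)$; $\dot\ell,\ddot\ell$ are its gradient and Hessian in $\theta$. $\|A\|=\mathrm{tr}^{1/2}(A^{\mathrm T}A)$ and $A^{\otimes2}=AA^{\mathrm T}$. Expectations are under the true parameter. Subsampling: the subsampling probabilities $\pi_N(x,y;\vartheta)\in(0,1]$ depend on $N$ and on a parameter vector $\vartheta$ (which may equal $\theta$ or contain $\theta$ as components). The number $n=n_N$ denotes the average subsample size, $\mathbb{E}\{\pi_N(x_i,y_i;\vartheta)\}=n/N$, and $n=o(N)$ is allowed (so the probabilities may go to zero). A pilot estimator $\tilde\vartheta_{\mathrm{plt}}$ is independent of the data to be sampled and converges in probability to a limit $\vartheta_p$ (not necessarily the true value). Given the data and $\tilde\vartheta_{\mathrm{plt}}$, the sampling indicators $\delta_i\in\{0,1\}$ are independent Bernoulli with success probabilities $\pi_N(x_i,y_i;\tilde\vartheta_{\mathrm{plt}})$. Define $\bar\pi_N(x;t\mid\vartheta)=\int f(y\mid x;t)\pi_N(x,y;\vartheta)\,\mathrm dy$ and $$\ell_S(t\mid\tilde\vartheta_{\mathrm{plt}})=\sum_{i=1}^N\delta_i\big[\log f(y_i\mid x_i;t)-\log\{\bar\pi_N(x_i;t\mid\tilde\vartheta_{\mathrm{plt}})\}\big]+C,\qquad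 t\in\Theta,$$ where $C=\sum_{i=1}^N\delta_i\log\{\pi_N(x_i,y_i;\tilde\vartheta_{\mathrm{plt}})\}$ does not depend on $t$.
   Formalization: Added: the maximizer is assumed consistent; θ is interior to Θ; the integral defining π̄_N may be differentiated in t up to twice under the integral sign at θ; and the bounds and limits in (1')–(3') hold uniformly over one neighborhood of ϑ_p. *)

(* Defs.v *)
From HB Require Import structures.
From mathcomp Require Import all_boot all_order all_algebra.
From mathcomp Require Import all_classical all_reals all_analysis.

Set Implicit Arguments.
Unset Strict Implicit.
Unset Printing Implicit Defensive.

Import Order.TTheory GRing.Theory Num.Theory.
Import numFieldNormedType.Exports.

Local Open Scope classical_set_scope.
Local Open Scope ring_scope.

(* R^d as a Borel space; convertible to 'cV[R]_d. *)
Definition borelV (R : realType) (d : nat) :=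
  g_sigma_algebraType (@open ('cV[R]_d)).

Section Linear.
Context {R : realType} {d : nat}.

Definition frob m n (A : 'M[R]_(m, n)) : R := Num.sqrt (\tr (A^T *m A)).

Definition outer2 m n (A : 'M[R]_(m, n)) : 'M[R]_m := A *m A^T.

Definition posdef (A : 'M[R]_d) : Prop :=
  A^T = A /\ forall v : 'cV[R]_d, v != 0 -> 0 < (v^T *m A *m v) 0 0.

Definition basisv (j : 'I_d) : 'cV[R]_d := delta_mx j 0.

(* pderiv [:: j1; ...; jk] g = d^k g / dt_j1 ... dt_jk *)
Definition pderiv (js : seq 'I_d) (g : 'cV[R]_d -> R) : 'cV[R]_d -> R :=
  foldr (fun j h => 'D_(basisv j) h) g js.

Definition gradient (g : 'cV[R]_d -> R) (t : 'cV[R]_d) : 'cV[R]_d :=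
  \col_j pderiv [:: j] g t.

Definition hessian (g : 'cV[R]_d -> R) (t : 'cV[R]_d) : 'M[R]_d :=
  \matrix_(j, k) pderiv [:: j; k] g t.

(* All iterated partial derivatives of g up to order 3 exist on A. *)
Definition partials3 (A : set 'cV[R]_d) (g : 'cV[R]_d -> R) : Prop :=
  forall (js : seq 'I_d) (j : 'I_d) (t : 'cV[R]_d),
    (size js <= 2)%N -> A t -> derivable (pderiv js g) t (basisv j).

Definition third_bounded (A : set 'cV[R]_d) (g : 'cV[R]_d -> R) (b : R) : Prop :=
  forall (j1 j2 j3 : 'I_d) (t : 'cV[R]_d),
    A t -> `|pderiv [:: j1; j2; j3] g t| <= b.

End Linear.

Section Probability.
Context {R : realType} {dO : measure_display} {Omega : measurableType dO}.
Variable P : probability Omega R.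

Definition mutually_independent (dT : measure_display) (T : measurableType dT)
    (Z : nat -> Omega -> T) : Prop :=
  forall (s : seq nat) (D : nat -> set T), uniq s ->
    (forall i, measurable (D i)) ->
    P (\big[setI/setT]_(i <- s) (Z i @^-1` D i)) =
      (\prod_(i <- s) P (Z i @^-1` D i))%E.

Definition independent2 (d1 d2 : measure_display) (T1 : measurableType d1)
    (T2 : measurableType d2) (U : Omega -> T1) (V : Omega -> T2) : Prop :=
  forall (A : set T1) (B : set T2), measurable A -> measurable B ->
    P (U @^-1` A `&` V @^-1` B) = (P (U @^-1` A) * P (V @^-1` B))%E.

Definition cvg_in_probability (d : nat) (Z : nat -> Omega -> 'cV[R]_d)
    (l : 'cV[R]_d) : Prop :=
  forall eps : R, 0 < eps ->
    P [set w | eps <= frob (Z N w - l)] @[N --> \oo] --> 0%E.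

Definition cvg_in_distribution (d : nat) (Z : nat -> Omega -> 'cV[R]_d)
    (nu : probability (borelV R d) R) : Prop :=
  forall h : 'cV[R]_d -> R, continuous h ->
    (exists M : R, forall z, `|h z| <= M) ->
    (\int[P]_w (h (Z N w))%:E)%E @[N --> \oo] --> (\int[nu]_z (h z)%:E)%E.

End Probability.

(* nu = N(m, V) for V positive definite: every nontrivial linear form a^T z is
   univariate normal with mean a^T m and variance a^T V a; normal_prob takes
   the standard deviation. *)
Definition is_mvnormal (R : realType) (d : nat)
    (nu : probability (borelV R d) R) (m : 'cV[R]_d) (V : 'M[R]_d) : Prop :=
  forall (a : 'cV[R]_d) (A : set R), a != 0 -> measurable A ->
    nu [set z : 'cV[R]_d | A ((a^T *m z) 0 0)] =
      normal_prob ((a^T *m m) 0 0) (Num.sqrt ((a^T *m V *m a) 0 0)) A.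

Section Sampling.
Context {R : realType} {dX dY : measure_display}.
Context {X : measurableType dX} {Y : measurableType dY} {d q : nat}.
Variable muX : {sigma_finite_measure set X -> \bar R}.
Variable muY : {sigma_finite_measure set Y -> \bar R}.
Variable f : 'cV[R]_d -> X -> Y -> R. (* f t x y = f(y | x; t) *)
Variable fX : X -> R.
Variable theta : 'cV[R]_d.            (* the true parameter *)
Variable p : nat -> X -> Y -> 'cV[R]_q -> R. (* p N x y vt = pi_N(x, y; vt) *)

Definition joint_density (z : X * Y) : R := f theta z.1 z.2 * fX z.1.

(* E{g(x, y)} under the true parameter *)
Definition Exy (g : X -> Y -> R) : \bar R :=
  (\int[muX \x muY]_z (g z.1 z.2 * joint_density z)%:E)%E.

(* E{g(x, y) | x} *)
Definition condE (x : X) (g : Y -> R) : R :=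
  \int[muY]_y (g y * f theta x y).

Definition loglik (x : X) (y : Y) (t : 'cV[R]_d) : R := ln (f t x y).

Definition score (x : X) (y : Y) : 'cV[R]_d := gradient (loglik x y) theta.

Definition info (x : X) (y : Y) : 'M[R]_d := hessian (loglik x y) theta.

Definition pibar (N : nat) (x : X) (vt : 'cV[R]_q) (t : 'cV[R]_d) : R :=
  \int[muY]_y (f t x y * p N x y vt).

Definition log_pibar (N : nat) (x : X) (vt : 'cV[R]_q) (t : 'cV[R]_d) : R :=
  ln (pibar N x vt t).

Definition Sigma_integrand (N : nat) (vt : 'cV[R]_q) (x : X) (y : Y) : 'M[R]_d :=
  p N x y vt *: outer2 (score x y)
  - (condE x (fun y' => p N x y' vt))^-1 *:
    outer2 (\col_j condE x (fun y' => score x y' j 0 * p N x y' vt)).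

Definition SigmaN (n : nat -> R) (N : nat) (vt : 'cV[R]_q) : 'M[R]_d :=
  (N%:R / n N) *: \matrix_(j, k) fine (Exy (fun x y => Sigma_integrand N vt x y j k)).

Definition SigmaN_finite (N : nat) (vt : 'cV[R]_q) : Prop :=
  forall j k : 'I_d, (muX \x muY)%E.-integrable setT
    (fun z => (Sigma_integrand N vt z.1 z.2 j k * joint_density z)%:E).

(* limsup_N sup_{vt in U} (N / n) E{pi_N(x, y; vt) g_vt(x, y)} < oo; the
   supremum makes the bound usable at a random vt = pilot_N that varies with N. *)
Definition bounded_moment (n : nat -> R) (U : set 'cV[R]_q)
    (g : 'cV[R]_q -> X -> Y -> R) : Prop :=
  (limn_esup (fun N : nat => ereal_sup
     [set ((N%:R / n N)%:E * Exy (fun x y => (p N x y vt * g vt x y)%R))%E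
        | vt in U]) < +oo)%E.

(* The last clause (common support in t) is what makes log f(y | x; .) a genuine
   function of t on Theta: off the support ln (f t x y) = ln 0 = 0 for all t. *)
Definition conditional_density_family (Theta : set 'cV[R]_d) : Prop :=
  [/\ forall t, Theta t -> measurable_fun setT (fun z : X * Y => f t z.1 z.2),
      forall t x y, Theta t -> 0 <= f t x y,
      forall t x, Theta t -> (\int[muY]_y (f t x y)%:E = 1)%E
    & forall t t' x y, Theta t -> Theta t' -> 0 < f t x y -> 0 < f t' x y].

Definition covariate_density : Prop :=
  [/\ measurable_fun setT fX, forall x, 0 <= fX x
    & (\int[muX]_x (fX x)%:E = 1)%E].

Definition sampling_probabilities (n : nat -> R) : Prop :=
  [/\ forall N : nat, (0 < N)%N ->
        measurable_fun [set: X * Y * borelV R q]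
          (fun u : X * Y * borelV R q => p N u.1.1 u.1.2 u.2),
      forall N x y vt, (0 < N)%N -> 0 < p N x y vt <= 1
    & forall N vt, (0 < N)%N -> Exy (fun x y => p N x y vt) = (n N / N%:R)%:E].

(* At the true parameter, pibar may be differentiated up to twice under the
   integral sign. *)
Definition diff_under_integral (U : set 'cV[R]_q) : Prop :=
  forall (N : nat) (x : X) (vt : 'cV[R]_q) (js : seq 'I_d),
    (0 < N)%N -> U vt -> (size js <= 2)%N ->
    pderiv js (pibar N x vt) theta =
      \int[muY]_y (pderiv js (fun t => f t x y) theta * p N x y vt).

Section Sample.
Context {dO : measure_display} {Omega : measurableType dO}.
Variable P : probability Omega R.
Variable Z : nat -> Omega -> X * Y.
Variable pilot : nat -> Omega -> borelV R q.
Variable delta : nat -> nat -> Omega -> bool. (* delta N i, used for i < N *)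

Definition iid_data : Prop :=
  [/\ forall i, measurable_fun setT (Z i),
      mutually_independent P Z
    & forall i (D : set (X * Y)), measurable D ->
        (P (Z i @^-1` D) = \int[muX \x muY]_(z in D) (joint_density z)%:E)%E].

Definition data (N : nat) (w : Omega) : N.-tuple (X * Y) :=
  [tuple Z i w | i < N].

Definition pilot_independent : Prop :=
  forall N, measurable_fun setT (pilot N) /\ independent2 P (pilot N) (data N).

(* Conditionally on (pilot N, data N), the delta N i, i < N, are independent
   Bernoulli: the conditional probability of a pattern b is the product below,
   tested against every event C of the conditioning sigma-algebra. *)
Definition poisson_sampling : Prop :=
  (forall N i, measurable [set w | delta N i w]) /\
  forall (N : nat) (b : 'I_N -> bool)
      (C : set (borelV R q * N.-tuple (X * Y))), (0 < N)%N -> measurable C ->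
    let E := [set w | C (pilot N w, data N w)] in
    P (E `&` [set w | forall i : 'I_N, delta N i w = b i]) =
      (\int[P]_(w in E) (\prod_(i < N)
         (let s := p N (Z i w).1 (Z i w).2 (pilot N w) in
          if b i then s else 1 - s))%:E)%E.

(* The sampled data conditional log-likelihood, including the constant C. *)
Definition ellS (N : nat) (w : Omega) (t : 'cV[R]_d) : R :=
  \sum_(i < N) (delta N i w)%:R *
    (loglik (Z i w).1 (Z i w).2 t - log_pibar N (Z i w).1 (pilot N w) t)
  + \sum_(i < N) (delta N i w)%:R * ln (p N (Z i w).1 (Z i w).2 (pilot N w)).

Definition is_maximizer (Theta : set 'cV[R]_d) (hat : nat -> Omega -> borelV R d)
  : Prop :=
  forall N, measurable_fun setT (hat N) /\
    {ae P, forall w, Theta (hat N w) /\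
       forall t, Theta t -> ellS N w t <= ellS N w (hat N w)}.

End Sample.
End Sampling.

(* Main.v *)
(* The estimator solves the sampled score equation.  A second order Taylor
   expansion around theta writes sqrt n (hat - theta) as Sigma^-1 times the
   normalized sampled score, up to an error which is small once the sampled
   Hessian obeys a law of large numbers.  Differentiating pibar under the
   integral sign shows that the sampled score is centered, with covariance
   SigmaN, and that the Hessian has mean - SigmaN.
   Both limit theorems are obtained by a Lindeberg replacement argument that
   handles the random pilot and the dependent indicators directly: conditionally
   on the pilot and the first k sampled terms, the k-th term contributes the
   p-weighted integral over the law of one observation.  Weak convergence is
   tested against smooth functions built from piecewise cubic steps. *)
Require Import Defs.
From HB Require Import structures.
From mathcomp Require Import all_boot all_order all_algebra.
From mathcomp Require Import all_classical all_reals all_analysis.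
From mathcomp Require Import zify ring lra.

Set Implicit Arguments.
Unset Strict Implicit.
Unset Printing Implicit Defensive.

Import Order.TTheory GRing.Theory Num.Theory.
Import numFieldNormedType.Exports.
Import measurable_realfun HBNNSimple.

Local Open Scope classical_set_scope.
Local Open Scope ring_scope.

(** The obstacle is that the pilot changes with N and is shared by all sampled terms, which are
    independent only conditionally on it. No conditional expectation is built: the product formula
    for patterns of indicators is summed over the pattern of the past, and this gives the exact
    one-step identity [next_indicator]. The pilot is confined to a small ball around its limit,
    where moments and covariances are controlled uniformly; leaving the ball costs a small
    probability. The bound B is measurable in the observation at each fixed pilot value only, so it
    cannot be evaluated at the random pilot. It is replaced by a Taylor constant taken over rational
    points, which is jointly measurable and at most a dimensional factor times B. Consistency is the
    hypothesis [hconsistent] and carries no rate. The rate sqrt n comes from the expansion: its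
    error is at most half of the scaled deviation and is absorbed. The limit law is that of a
    combination, with independent normal coefficients, of the vectors of a rank one decomposition of
    the inverse of Sigma. Its stability under sums cuts it into N increments. *)

Lemma sum_le_const (R : realType) (d : nat) (F : 'I_d -> R) (c : R) :
  (forall j, F j <= c) -> \sum_j F j <= d%:R * c.
Proof.
move=> Fc; apply: (@le_trans _ _ (\sum_(j < d) c)); first exact: ler_sum.
by rewrite sumr_const card_ord mulr_natl.
Qed.

(** * Max norm of column vectors against coordinates and the Frobenius norm *)

Section norms.
Context {R : realType} {d : nat}.
Implicit Types v w : 'cV[R]_d.

Lemma coord_le_norm v j : `|v j 0| <= `|v|.
Proof.
rewrite [leRHS]mx_normrE.
exact: (le_bigmax _ (fun ij : 'I_d * 'I_1 => `|v ij.1 ij.2|) (j, 0)).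
Qed.

Lemma norm_le_coord v c : 0 <= c -> (forall j, `|v j 0| <= c) -> `|v| <= c.
Proof.
move=> c0 H; rewrite [leLHS]mx_normrE; apply: bigmax_le => // -[i k] _ /=.
by rewrite ord1.
Qed.

Lemma norm_lt_coord v c : 0 < c -> (forall j, `|v j 0| < c) -> `|v| < c.
Proof.
move=> c0 H; rewrite [ltLHS]mx_normrE; apply: bigmax_lt => // -[i k] _ /=.
by rewrite ord1.
Qed.

Lemma frobE v : frob v = Num.sqrt (\sum_j (v j 0) ^+ 2).
Proof.
rewrite /frob; congr Num.sqrt; rewrite /mxtrace big_ord1 mxE.
by apply: eq_bigr => j _; rewrite mxE expr2.
Qed.

Lemma norm_le_frob v : `|v| <= frob v.
Proof.
apply: norm_le_coord => [|j]; first exact: sqrtr_ge0.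
rewrite frobE -sqrtr_sqr; apply: ler_wsqrtr.
by rewrite (bigD1 j)//= lerDl sumr_ge0// => i _; rewrite sqr_ge0.
Qed.

Lemma sum_norm_le (a b : 'I_d -> R) (c e : R) : 0 <= c -> 
  (forall j, `|a j| <= c) -> (forall j, `|b j| <= e) ->
  `|\sum_j a j * b j| <= d%:R * (c * e).
Proof.
move=> c0 ha hb; apply: (le_trans (ler_norm_sum _ _ _)).
by apply: sum_le_const => j; rewrite normrM ler_pM.
Qed.

Lemma frob_le_norm v : frob v <= d%:R * `|v|.
Proof.
rewrite frobE -(ger0_norm (mulr_ge0 (ler0n R d) (normr_ge0 v))) -sqrtr_sqr.
apply: ler_wsqrtr; rewrite exprMn.
have h : \sum_j v j 0 ^+ 2 <= d%:R * `|v| ^+ 2.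
  apply: sum_le_const => j.
  by rewrite -real_normK ?num_real// lerXn2r ?nnegrE// coord_le_norm.
apply: (le_trans h); apply: ler_wpM2r; first by rewrite sqr_ge0.
rewrite -natrX ler_nat; have [->//|d0] := posnP d.
by rewrite -{1}(expn1 d) leq_pexp2l.
Qed.

Lemma norm_colP v c : 0 <= c -> reflect (forall j, `|v j 0| <= c) (`|v| <= c).
Proof.
move=> c0; apply: (iffP idP) => [h j|]; last exact: norm_le_coord.
exact: le_trans (coord_le_norm _ _) h.
Qed.

End norms.

(** * The Borel sigma-algebra of R^d *)

Section borel.
Context {R : realType} {d : nat}.

Lemma borelV_open (A : set 'cV[R]_d) : open A -> measurable (A : set (borelV R d)).
Proof. by move=> oA; apply: sub_sigma_algebra. Qed.

Lemma continuous_borelV (h : 'cV[R]_d -> R) :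
  continuous h -> measurable_fun setT (h : borelV R d -> R).
Proof.
move=> ch; apply: (measurability _ (measurable_realfun.RGenOpens.measurableE R)) => _ [_ [a [b ->] <-]].
rewrite setTI; apply: borelV_open; apply: open_comp; last exact: interval_open.
by move=> x _; exact: ch.
Qed.

Lemma measurable_coord (j : 'I_d) : measurable_fun setT (fun v : borelV R d => (v : 'cV[R]_d) j 0).
Proof. by apply: continuous_borelV; exact: coord_continuous. Qed.

Let box (q : 'cV[rat]_d * nat) : set 'cV[R]_d :=
  [set v | forall j, `|v j 0 - ratr (q.1 j 0)| < q.2.+1%:R^-1].

Lemma dense_ratr (v : 'cV[R]_d) (e : R) : 0 < e ->
  exists q : 'cV[rat]_d, forall j, `|v j 0 - ratr (q j 0)| < e.
Proof.
move=> e0.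
have h j : {q : rat | `|v j 0 - ratr q| < e}.
  apply: cid; have lt : v j 0 - e < v j 0 + e by lra.
  have [q] := rat_in_itvoo lt.
  by rewrite in_itv/= => /andP[q1 q2]; exists q; rewrite ltr_norml; lra.
by exists (\col_j sval (h j)) => j; rewrite mxE; case: (h j).
Qed.

(** An open set is the union of the rational boxes that it contains, and there are countably many
    boxes. The preimage of a box is a finite intersection of conditions on single coordinates. *)
Lemma measurable_borelV (dT : measure_display) (T : measurableType dT) (F : T -> borelV R d) :
  (forall j, measurable_fun setT (fun x => (F x : 'cV[R]_d) j 0)) ->
  measurable_fun setT F.
Proof.
move=> mF; apply: (@measurability _ _ T (borelV R d) setT F (@open _)); first by [].
move=> _ [D oD <-].
rewrite setTI.
have -> : F @^-1` D = \bigcup_(q in [set q | box q `<=` D]) (F @^-1` box q).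
  apply/seteqP; split => [x Dx|x [q qD]]; last exact: qD.
  have /nbhs_ballP[e /= e0 eD] : nbhs (F x : 'cV[R]_d) D by exact: open_nbhs_nbhs.
  have [n ne] : exists n : nat, n.+1%:R^-1 < e / 2.
    have e20 : 0 < e / 2 by lra.
    have [n _ /(_ n (leqnn _))] := near_infty_natSinv_lt (PosNum e20).
    by exists n.
  have n0 : 0 < n.+1%:R^-1 :> R by rewrite invr_gt0.
  have [q hq] := dense_ratr (F x : 'cV[R]_d) n0.
  exists (q, n) => //= u /= hu; apply: eD.
  rewrite -ball_normE /= -normrN opprB; apply: norm_lt_coord => // j.
  rewrite !mxE -(subrKA (ratr (q j 0))).
  apply: (le_lt_trans (ler_normD _ _)); rewrite [X in _ + X < _]distrC.
  rewrite (splitr e); apply: ltrD; apply: lt_trans ne; [exact: hu|exact: hq].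
rewrite bigcup_mkcond; apply: countable_bigcupT_measurable => [|q]; first exact: countableP.
case: ifPn => // _.
have -> : F @^-1` box q = \bigcap_(j in [set: 'I_d])
    (fun x => `|(F x : 'cV[R]_d) j 0 - ratr (q.1 j 0)|) @^-1` `]-oo, q.2.+1%:R^-1[%classic.
  apply/seteqP; split => [x h j _|x h j]; first by rewrite /= in_itv/=; exact: h.
  by have := h j I; rewrite /= in_itv.
apply: fin_bigcap_measurable; first exact: finite_finset.
move=> j _; rewrite -[X in measurable X]setTI.
by apply: measurableT_comp => //; exact: measurable_funB.
Qed.

End borel.

(** * Bounded integrals, image laws and densities *)

Section meas.
Context d (T : measurableType d) (R : realType).

Lemma bounded_integrable (P : probability T R) (f : T -> R) (K : R) :
  measurable_fun setT f -> (forall x, `|f x| <= K) -> P.-integrable setT (EFin \o f).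
Proof.
move=> mf fK; apply: measurable_bounded_integrable => //.
  by apply: (@le_lt_trans _ _ 1%E); [exact: probability_le1|exact: ltry].
exists K; split; first exact: num_real.
by move=> x Kx y _; apply: (le_trans (fK y)); exact: ltW.
Qed.

Lemma Rint_cst (P : probability T R) (c : R) : \int[P]_x c = c.
Proof. by rewrite Rintegral_cst//= probability_setT mulr1. Qed.

Lemma Rint_bound (P : probability T R) (f : T -> R) (K : R) :
  measurable_fun setT f -> (forall x, `|f x| <= K) -> `|\int[P]_x f x| <= K.
Proof.
move=> mf fK; have fi := bounded_integrable P mf fK.
apply: (le_trans (le_normr_Rintegral _ _)) => //.
rewrite -[K](Rint_cst P).
apply: le_Rintegral => //.
  by apply: (@bounded_integrable _ _ K); [exact: measurableT_comp|move=> x; rewrite normr_id].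
by apply: (@bounded_integrable _ _ `|K|).
Qed.

End meas.

Section law.
Context d1 d2 (T1 : measurableType d1) (T2 : measurableType d2) (R : realType).

Definition mfun_of (f : T1 -> T2) (mf : measurable_fun setT f) : {mfun T1 >-> T2} :=
  HB.pack f (isMeasurableFun.Build _ _ _ _ f mf).

Definition image_measure (mu : {measure set T1 -> \bar R}) (f : T1 -> T2)
  (mf : measurable_fun setT f) : {measure set T2 -> \bar R} :=
  measure_function_pushforward__canonical__measure_function_Measure mu mf.

Definition law (P : probability T1 R) (f : T1 -> T2) (mf : measurable_fun setT f) :
  probability T2 R := distribution P (mfun_of mf).

Lemma ge0_integral_law (P : probability T1 R) (f : T1 -> T2) (mf : measurable_fun setT f)
  (F : T2 -> \bar R) : measurable_fun setT F -> (forall y, (0 <= F y)%E) ->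
  (\int[law P mf]_y F y = \int[P]_x F (f x))%E.
Proof. by move=> mF F0; rewrite ge0_integral_distribution. Qed.

Lemma Rintegral_law (P : probability T1 R) (f : T1 -> T2) (mf : measurable_fun setT f)
  (F : T2 -> R) : measurable_fun setT F -> P.-integrable setT (EFin \o (F \o f)) ->
  \int[law P mf]_y F y = \int[P]_x F (f x).
Proof.
move=> mF iF; rewrite /Rintegral integral_distribution//.
exact/measurable_EFinP.
Qed.

End law.

(** Here nu is the image under [tau] of the measure with density g. One statement serves the normal
    density and the joint density, where [tau] is the identity, and the sampling design, where [tau]
    collects the pilot and the data. The formula passes from sets to simple functions by linearity
    and to F by monotone convergence. *)
Lemma integral_density d1 d2 (T1 : measurableType d1) (T2 : measurableType d2) (R : realType)
  (mu : {measure set T1 -> \bar R}) (nu : {measure set T2 -> \bar R})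
  (tau : T1 -> T2) (g : T1 -> R) :
  measurable_fun setT tau -> measurable_fun setT g -> (forall x, 0 <= g x) ->
  (forall C, measurable C -> nu C = (\int[mu]_(x in tau @^-1` C) (g x)%:E)%E) ->
  forall F : T2 -> \bar R, measurable_fun setT F -> (forall y, (0 <= F y)%E) ->
  (\int[nu]_y F y = \int[mu]_x (F (tau x) * (g x)%:E))%E.
Proof.
move=> mtau mg g0 H F mF F0.
pose F_ := nnsfun_approx measurableT mF.
have cF y : (F_ n y)%:E @[n --> \oo] --> F y.
  by apply: (cvg_nnsfun_approx measurableT mF).
have simple (h : {nnsfun T2 >-> R}) :
    (\int[nu]_y (h y)%:E = \int[mu]_x (h (tau x) * g x)%:E)%E.
  have mt : measurable_fun setT (h \o tau) by exact: measurableT_comp.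
  transitivity (\int[nu]_y \sum_(r \in range h) (r * \1_(h @^-1` [set r]) y)%:E)%E.
    by apply: eq_integral => y _; rewrite fsumEFin// {1}(fimfunE h).
  rewrite ge0_integral_fsum//; last 2 first.
    by move=> r; apply/measurable_EFinP/measurable_funM => //; exact: measurable_indic.
    by move=> r y _; rewrite EFinM nnfun_muleindic_ge0.
  transitivity (\int[mu]_x \sum_(r \in range h) (r * \1_(h @^-1` [set r]) (tau x) * g x)%:E)%E; last first.
    by apply: eq_integral => x _; rewrite fsumEFin// (fimfunE h) -mulr_fsuml.
  rewrite ge0_integral_fsum//; last 2 first.
    move=> r; apply/measurable_EFinP/measurable_funM => //; apply: measurable_funM => //.
    by apply: measurableT_comp => //; exact: measurable_indic.
    move=> r x _; rewrite lee_fin mulr_ge0//.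
    by have := nnfun_muleindic_ge0 h r (tau x); rewrite -EFinM lee_fin.
  apply: eq_fsbigr => r /set_mem [y0 _ hr].
  have r0 : 0 <= r by rewrite -hr.
  under eq_integral do rewrite EFinM.
  rewrite ge0_integralZl//; last exact/measurable_EFinP/measurable_indic.
  rewrite integral_indic// setIT H//.
  under [in RHS]eq_integral do rewrite -mulrA EFinM.
  rewrite ge0_integralZl//; last 2 first.
    apply/measurable_EFinP/measurable_funM => //; apply: measurableT_comp => //; exact: measurable_indic.
    by move=> x _; rewrite lee_fin mulr_ge0.
  congr (_ * _)%E; rewrite integral_mkcond; apply: eq_integral => x _.
  rewrite patchE indicE; case: ifPn => xC.
    by rewrite (mem_set (A:=h @^-1` [set r])) ?mul1r//; move/set_mem : xC.
  by rewrite (memNset (A:=h @^-1` [set r])) ?mul0r//; move/negP : xC => xC /mem_set.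
have c1 : (\int[nu]_y (F_ n y)%:E)%E @[n --> \oo] --> (\int[nu]_y F y)%E.
  have -> : (\int[nu]_y F y = \int[nu]_y limn (fun n => (F_ n y)%:E))%E.
    by apply: eq_integral => y _; apply/esym/cvg_lim => //; exact: cF.
  apply: cvg_monotone_convergence => //.
  - by move=> n; exact/measurable_EFinP.
  - by move=> n y _; rewrite lee_fin.
  - by move=> y _ n m nm; rewrite lee_fin; exact/lefP/nd_nnsfun_approx.
have c2 : (\int[mu]_x (F_ n (tau x) * g x)%:E)%E @[n --> \oo] -->
    (\int[mu]_x (F (tau x) * (g x)%:E))%E.
  have -> : (\int[mu]_x (F (tau x) * (g x)%:E) =
     \int[mu]_x limn (fun n => (F_ n (tau x) * g x)%:E))%E.
    apply: eq_integral => x _; apply/esym/cvg_lim => //.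
    have gfin : (g x)%:E \is a fin_num by [].
    exact: (cvgeZr gfin (cF (tau x))).
  apply: cvg_monotone_convergence => //.
  - move=> n; apply/measurable_EFinP/measurable_funM => //; exact: measurableT_comp.
  - by move=> n y _; rewrite lee_fin mulr_ge0.
  - move=> y _ n m nm; rewrite lee_fin ler_wpM2r//; exact/lefP/nd_nnsfun_approx.
apply: (cvg_unique _ c1) => //.
rewrite (_ : (fun n => _) = (fun n => \int[mu]_x (F_ n (tau x) * g x)%:E)%E)//.
by apply/funext => n; exact: simple.
Qed.

(** * Law of one more sampled term given the past *)

Section sampling.
Context {R : realType} {dE dO : measure_display}.
Context {E : measurableType dE} {Omega : measurableType dO} {q m : nat}.
Variables (P : probability Omega R) (mu : probability E R).
Variables (N : nat) (Z : nat -> Omega -> E) (pilot : Omega -> borelV R q).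
Variables (delta : nat -> Omega -> bool) (p : E -> borelV R q -> R).

Definition dat (k : nat) (w : Omega) : k.-tuple E := [tuple Z i w | i < k].

Hypothesis mZ : forall i, measurable_fun setT (Z i).
Hypothesis lawZ : forall i D, measurable D -> P (Z i @^-1` D) = mu D.
Hypothesis indZ : mutually_independent P Z.
Hypothesis mpilot : measurable_fun setT pilot.
Hypothesis indpilot : independent2 P pilot (dat N).
Hypothesis mdelta : forall i, measurable [set w | delta i w].
Hypothesis mp : measurable_fun setT (fun u : E * borelV R q => p u.1 u.2).
Hypothesis p01 : forall z v, 0 <= p z v <= 1.
Hypothesis poisson : forall (b : 'I_N -> bool) (C : set (borelV R q * N.-tuple E)),
  measurable C ->
  (P ([set w | C (pilot w, dat N w)] `&` [set w | forall i : 'I_N, delta i w = b i]) =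
   \int[P]_(w in [set w | C (pilot w, dat N w)])
     (\prod_(i < N) (if b i then p (Z i w) (pilot w) else 1 - p (Z i w) (pilot w)))%:E)%E.

Let tau k w := (pilot w, dat k w).

Lemma measurable_tau k : measurable_fun setT (tau k).
Proof.
apply: measurable_fun_pair => //; apply/measurable_fun_tnthP => i.
by rewrite (_ : _ \o _ = Z i)//; apply/funext => w /=; rewrite tnth_mktuple.
Qed.

(** A pattern is a function on all of [nat], so that one b serves every prefix length. [wt j b] is
    the conditional probability of [pat j b] given the pilot and the data. *)
Let pat j (b : nat -> bool) := [set w | forall i, (i < j)%N -> delta i w = b i].
Let wt1 (b : bool) (z : E) (v : borelV R q) := if b then p z v else 1 - p z v.
Let wt j (b : nat -> bool) w := \prod_(i < j) wt1 (b i) (Z i w) (pilot w).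

Let wt1_ge0 b z v : 0 <= wt1 b z v.
Proof. by rewrite /wt1; have /andP[? ?] := p01 z v; case: b => //; rewrite subr_ge0. Qed.

Let mwt1 b : measurable_fun setT (fun u : E * borelV R q => wt1 b u.1 u.2).
Proof. by rewrite /wt1; case: b => //; apply: measurable_funB. Qed.

Let mwt j b : measurable_fun setT (wt j b).
Proof.
apply: measurable_prod => i _.
have h : measurable_fun setT (fun w => (Z i w, pilot w)) by exact: measurable_fun_pair.
exact: (measurableT_comp (mwt1 (b i)) h).
Qed.

Let mpat j b : measurable (pat j b).
Proof.
have -> : pat j b = \bigcap_i (if (i < j)%N then [set w | delta i w = b i] else setT).
  apply/seteqP; split => w h i; first by move=> _; case: ifPn => // ij; exact: h.
  by move=> ij; have := h i I; rewrite ij.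
apply: bigcapT_measurable => i; case: ifPn => // _.
case: (b i); first exact: mdelta.
rewrite (_ : [set w | _] = ~` [set w | delta i w]); first exact: measurableC.
by apply/seteqP; split => w /=; case: (delta i w).
Qed.

(** The design is given for full patterns only, which is the case j = N. Descending induction on j
    splits a pattern on its next indicator, whose two weights p and 1 - p add up to 1. *)
Let pois j b C : (j <= N)%N -> measurable C ->
  (P (tau N @^-1` C `&` pat j b) = \int[P]_(w in tau N @^-1` C) (wt j b w)%:E)%E.
Proof.
have [k] := ubnP (N - j); elim: k j b => // k IH j b kj jN mC.
have mtC : measurable (tau N @^-1` C).
  by rewrite -[X in measurable X]setTI; exact: (@measurable_tau _).
have [jN1|jN1] := eqVneq j N.
  subst j; apply: etrans (poisson (fun i : 'I_N => b i) mC).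
  congr (P (_ `&` _)).
  apply/seteqP; split => w h i; first exact: h.
  by move=> iN; exact: (h (Ordinal iN)).
have {jN1 jN}jN : (j < N)%N by rewrite ltn_neqAle jN1.
pose bb c i := if i == j then c else b i.
have patE : pat j b = pat j.+1 (bb true) `|` pat j.+1 (bb false).
  apply/seteqP; split => [w h|w].
    case dj : (delta j w); [left|right] => i; rewrite ltnS leq_eqVlt /bb;
      by have [->|_ /= ij] := eqVneq i j; [rewrite dj|exact: h].
  by case=> h i ij; rewrite (h i (leqW ij)) /bb ltn_eqF.
have disj : (tau N @^-1` C `&` pat j.+1 (bb true)) `&`
            (tau N @^-1` C `&` pat j.+1 (bb false)) = set0.
  apply/seteqP; split => // w [[_ h1] [_ h2]].
  by have := h1 j (leqnn _); rewrite (h2 j (leqnn _)) /bb eqxx.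
rewrite patE setIUr measureU//=; [|exact: measurableI|exact: measurableI].
rewrite !IH//; [|lia|lia].
rewrite -ge0_integralD//; last 4 first.
- by move=> w _; rewrite lee_fin prodr_ge0.
- by apply/measurable_EFinP; apply: measurable_funTS.
- by move=> w _; rewrite lee_fin prodr_ge0.
- by apply/measurable_EFinP; apply: measurable_funTS.
apply: eq_integral => w _; rewrite -EFinD; congr EFin.
rewrite /wt !big_ord_recr/= /bb eqxx.
have e c : \prod_(i < j) wt1 (if i == j :> nat then c else b i) (Z i w) (pilot w)
  = \prod_(i < j) wt1 (b i) (Z i w) (pilot w).
  by apply: eq_bigr => i _; rewrite ltn_eqF.
by rewrite !e -mulrDr /wt1 addrC subrK mulr1.
Qed.

(** This plays the part of conditioning on the pilot and the data. The measure that sends C to the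
    probability that [tau N] falls in C and the pattern occurs has two densities relative to P: the
    indicator of the pattern and, by [pois], the product weight. Hence both integrate functions of
    [tau N] alike. *)
Let fold j b (F : borelV R q * N.-tuple E -> \bar R) : (j <= N)%N ->
  measurable_fun setT F -> (forall y, (0 <= F y)%E) ->
  (\int[P]_w (F (tau N w) * (\1_(pat j b) w)%:E) =
   \int[P]_w (F (tau N w) * (wt j b w)%:E))%E.
Proof.
move=> jN mF F0.
have mt := @measurable_tau N.
pose nu := image_measure (mrestr P (mpat j b)) mt.
have h1 := @integral_density _ _ _ _ R P nu (tau N) \1_(pat j b) mt.
have h2 := @integral_density _ _ _ _ R P nu (tau N) (wt j b) mt.
rewrite -h1//; last first.
  move=> C mC; rewrite integral_indic//; last first.
    by rewrite -[X in measurable X]setTI; apply: (@measurable_tau N).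
  by rewrite /nu /= setIC.
rewrite h2//.
- by move=> w; rewrite prodr_ge0.
- by move=> C mC; rewrite -pois.
Qed.

Let box k (D : nat -> set E) : set (k.-tuple E) := [set t | forall i : 'I_k, D i (tnth t i)].

Let mbox k D : (forall i, measurable (D i)) -> measurable (@box k D).
Proof.
move=> mD; have -> : @box k D = \bigcap_(i in [set: 'I_k]) (fun t => tnth t i) @^-1` D i.
  by apply/seteqP; split => t h i; [move=> _; exact: h|exact: h].
apply: fin_bigcap_measurable; first exact: finite_finset.
move=> i _; rewrite -[X in measurable X]setTI.
by apply: measurable_tnth.
Qed.

Let indbox k A (D : nat -> set E) : (k <= N)%N -> measurable A -> (forall i, measurable (D i)) ->
  (P (pilot @^-1` A `&` dat k @^-1` @box k D) = P (pilot @^-1` A) * \prod_(i < k) mu (D i))%E.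
Proof.
move=> kN mA mD.
(* The pilot is known to be independent of the full N-tuple, so the coordinates from k on are left
   unconstrained. *)
pose D' i := if (i < k)%N then D i else setT.
have mD' i : measurable (D' i) by rewrite /D'; case: ifP.
have -> : dat k @^-1` @box k D = dat N @^-1` @box N D'.
  apply/seteqP; split => w h i.
    rewrite tnth_mktuple /D'; case: ifPn => // ik.
    by have := h (Ordinal ik); rewrite tnth_mktuple.
  rewrite tnth_mktuple; have := h (widen_ord kN i).
  by rewrite tnth_mktuple /D' /= ltn_ord.
rewrite indpilot//; last exact: mbox.
congr (_ * _)%E.
have -> : dat N @^-1` @box N D' = \big[setI/setT]_(i <- iota 0 N) (Z i @^-1` D' i).
  rewrite -bigcap_seq; apply/seteqP; split => w h i.
    move=> /=; rewrite mem_iota add0n => iN.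
    by have := h (Ordinal iN); rewrite tnth_mktuple.
  by rewrite tnth_mktuple; apply: h; rewrite /= mem_iota add0n /= ltn_ord.
rewrite indZ ?iota_uniq//.
transitivity (\prod_(0 <= i < N) P (Z i @^-1` D' i))%E; first by rewrite /index_iota subn0.
rewrite (big_cat_nat (n:=k))//= [X in (_ * X)%E]big_nat_cond [X in (_ * X)%E]big1 ?mule1.
  by rewrite big_mkord; apply: eq_bigr => i _; rewrite lawZ// /D' ltn_ord.
by move=> i /andP[/andP[ki _] _]; rewrite /D' ltnNge ki/= preimage_setT probability_setT.
Qed.

Let rect k : set (set ((borelV R q * k.-tuple E) * E)) :=
  [set X | exists A Ds D, [/\ measurable A, forall i, measurable (Ds i), measurable D
    & X = (A `*` @box k Ds) `*` D]].

Let rectI k : setI_closed (@rect k).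
Proof.
move=> _ _ [A [Ds [D [mA mDs mD ->]]]] [A' [Ds' [D' [mA' mDs' mD' ->]]]].
exists (A `&` A'), (fun i => Ds i `&` Ds' i), (D `&` D'); split.
- exact: measurableI.
- by move=> i; exact: measurableI.
- exact: measurableI.
apply/seteqP; split => [[[v t] z]|[[v t] z]] /=.
  by move=> [[[a b] c] [[a' b'] c']]; split=> //; split=> // i.
by move=> [[[a a'] b] [c c']]; split; split=> //; split=> // i; case: (b i).
Qed.

(** The inclusion that takes work says that the identity is measurable for the sigma-algebra
    generated by the rectangles; this is checked on the pilot, on each observation and on the last
    component. *)
Let rect_gen k : @measurable _ ((borelV R q * k.-tuple E) * E)%type = <<s @rect k >>.
Proof.
apply/seteqP; split; last first.
  apply: smallest_sub; first exact: sigma_algebra_measurable.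
  move=> _ [A [Ds [D [mA mDs mD ->]]]]; apply: measurableX => //.
  by apply: measurableX => //; exact: mbox.
move=> X mX.
pose T' := g_sigma_algebraType (@rect k).
suff mid : measurable_fun setT (idfun : T' -> (borelV R q * k.-tuple E) * E).
  by have := mid measurableT X mX; rewrite setTI.
have rectm (Y : set T') : @rect k Y -> measurable Y by move=> h; apply: sub_sigma_algebra.
apply/measurable_fun_pairP; split; last first.
  move=> _ D mD; rewrite setTI; apply: rectm; exists setT, (fun=> setT), D; split => //.
  by apply/seteqP; split => [[[v t] z]|[[v t] z]] // -[].
apply/measurable_fun_pairP; split.
  move=> _ A mA; rewrite setTI; apply: rectm; exists A, (fun=> setT), setT; split => //.
  by apply/seteqP; split => [[[v t] z]|[[v t] z]] // -[[]].
apply/measurable_fun_tnthP => i _ D mD; rewrite setTI; apply: rectm.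
exists setT, (fun j => if j == i :> nat then D else setT), setT; split => //.
  by move=> j; case: ifP.
apply/seteqP; split => [[[v t] z]|[[v t] z]] /=.
  by move=> Dt; split=> //; split=> // j /=; case: ifPn => // /eqP/val_inj ->.
by move=> [[_ h] _]; have := h i; rewrite eqxx.
Qed.

Let next k w := (tau k w, Z k w).

Let mnext k : measurable_fun setT (next k).
Proof. by apply: measurable_fun_pair => //; exact: (@measurable_tau _). Qed.

(** Uniqueness of measures on the rectangles, where both sides agree because the pilot is
    independent of the data and the observations are independent of each other. *)
Lemma law_next k (X : set ((borelV R q * k.-tuple E) * E)) : (k < N)%N -> measurable X ->
  law P (@mnext k) X = (law P (@measurable_tau k) \x mu)%E X.
Proof.
move=> kN; apply: (measure_unique (@rect k) (fun=> setT) (rect_gen k) (@rectI k)).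
- move=> _; exists setT, (fun=> setT), setT; split => //.
  by apply/seteqP; split => [[[v t] z]|[[v t] z]].
- by rewrite bigcup_const//; exists 0%N.
- move=> _ [A [Ds [D [mA mDs mD ->]]]] /=.
  rewrite [RHS]product_measure1E//; last by apply: measurableX => //; exact: mbox.
  (* The constraint on the new observation becomes side number k of a box on k + 1 observations. *)
  pose Ds' i := if i == k then D else Ds i.
  have mDs' i : measurable (Ds' i) by rewrite /Ds'; case: ifP.
  transitivity (P (pilot @^-1` A `&` dat k.+1 @^-1` @box k.+1 Ds')).
    congr (P _); apply/seteqP; split => [w /= [[Aw bw] Dw]|w [Aw bw]]/=.
      split => // i; rewrite tnth_mktuple /Ds'; case: eqVneq => [->//|ik].
      have ik' : (i < k)%N by have := ltn_ord i; rewrite ltnS leq_eqVlt (negbTE ik).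
      by have := bw (Ordinal ik'); rewrite tnth_mktuple.
    split; first split => // i.
      have := bw (widen_ord (leqnSn k) i).
      by rewrite !tnth_mktuple /Ds' /= ltn_eqF.
    by have := bw ord_max; rewrite tnth_mktuple /Ds' /= eqxx.
  rewrite indbox// big_ord_recr/= muleA (_ : Ds' k = D); last by rewrite /Ds' eqxx.
  congr (_ * _)%E.
  transitivity (P (pilot @^-1` A `&` dat k @^-1` @box k Ds)); last by [].
  rewrite indbox ?(ltnW kN)//; congr (_ * _)%E; apply: eq_bigr => i _.
  by rewrite /Ds' ltn_eqF.
- by move=> _; apply: (@le_lt_trans _ _ 1%E); [exact: probability_le1|exact: ltry].
Qed.

Lemma indep_next k (Phi : (borelV R q * k.-tuple E) * E -> \bar R) : (k < N)%N ->
  measurable_fun setT Phi -> (forall u, (0 <= Phi u)%E) ->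
  (\int[P]_w Phi (tau k w, Z k w) = \int[P]_w \int[mu]_z Phi (tau k w, z))%E.
Proof.
move=> kN mPhi Phi0.
rewrite -(ge0_integral_law P (@mnext k))//.
rewrite (eq_measure_integral (law P (@measurable_tau k) \x mu)%E); last first.
  by move=> A mA _; exact: law_next.
rewrite fubini_tonelli1//.
rewrite ge0_integral_law//.
  exact: measurable_fun_fubini_tonelli_F.
by move=> u; apply: integral_ge0.
Qed.

Section state.
Variable xi : borelV R q * E -> borelV R m.
Hypothesis mxi : measurable_fun setT xi.

(** Partial sum over the sampled units among the first k: the state of the walk followed by the
    replacement argument. *)
Definition state (k : nat) (w : Omega) : borelV R m :=
  \sum_(i < k) (delta i w)%:R *: (xi (pilot w, Z i w) : 'cV[R]_m).

Let sig k (b : nat -> bool) (u : borelV R q * k.-tuple E) : borelV R m :=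
  \sum_(i < k) (b i)%:R *: (xi (u.1, tnth u.2 i) : 'cV[R]_m).

Let msig k b : measurable_fun setT (@sig k b).
Proof.
apply: measurable_borelV => j.
rewrite (_ : (fun x => _) = (fun u => \sum_(i < k) (b i)%:R * (xi (u.1, tnth u.2 i) : 'cV[R]_m) j 0)).
  apply: measurable_sum => i; apply: measurable_funM => //.
  apply: (measurableT_comp (measurable_coord j)).
  apply: (measurableT_comp mxi); apply: measurable_fun_pair => //.
  by apply: (measurableT_comp (measurable_tnth i)).
by apply/funext => u; rewrite summxE; apply: eq_bigr => i _; rewrite mxE.
Qed.

Lemma measurable_state k : measurable_fun setT (state k).
Proof.
apply: measurable_borelV => j.
rewrite (_ : (fun x => _) = (fun w => \sum_(i < k) \1_[set w | delta i w] w * (xi (pilot w, Z i w) : 'cV[R]_m) j 0)).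
  apply: measurable_sum => i; apply: measurable_funM => //.
  apply: (measurableT_comp (measurable_coord j)).
  by apply: (measurableT_comp mxi); exact: measurable_fun_pair.
apply/funext => u; rewrite summxE; apply: eq_bigr => i _; rewrite mxE indicE.
congr ((nat_of_bool _)%:R * _); by apply/idP/idP => [h|/set_mem//]; apply: mem_set.
Qed.

(** The default [true] matters: at index k it makes [pat k.+1 (ext b)] the event that the first k
    indicators follow b and that unit k is sampled. *)
Let ext k (b : {ffun 'I_k -> bool}) (i : nat) : bool :=
  if insub i is Some j then b j else true.

Let extE k (b : {ffun 'I_k -> bool}) (i : 'I_k) : ext b i = b i.
Proof. by rewrite /ext insubT//= => h; congr (b _); apply: val_inj. Qed.

Let sum_pat k w : \sum_(b : {ffun 'I_k -> bool}) \1_(pat k (ext b)) w = 1 :> R.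
Proof.
pose b0 := [ffun i : 'I_k => delta i w].
rewrite (bigD1 b0)//= big1 ?addr0.
  rewrite indicE mem_set// => i ik.
  by have -> : i = Ordinal ik :> nat by []; rewrite extE ffunE.
move=> b bb0; rewrite indicE memNset// => h; move/eqP : bb0; apply.
by apply/ffunP => i; rewrite ffunE h// extE.
Qed.

Let state_pat k b w : pat k b w -> state k w = @sig k b (tau k w).
Proof.
by move=> h; apply: eq_bigr => i _; rewrite tnth_mktuple h.
Qed.

Let first k (kN : (k <= N)%N) (t : N.-tuple E) : k.-tuple E :=
  [tuple tnth t (widen_ord kN i) | i < k].

Let first_tau k (kN : (k <= N)%N) w : ((tau N w).1, first kN (tau N w).2) = tau k w.
Proof.
by congr pair; apply: eq_from_tnth => i; rewrite !tnth_mktuple.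
Qed.

Let mfirst k (kN : (k <= N)%N) :
  measurable_fun setT (fun u : borelV R q * N.-tuple E => (u.1, first kN u.2)).
Proof.
apply: measurable_fun_pair => //; apply/measurable_fun_tnthP => i.
rewrite (_ : _ \o _ = (fun t => tnth t (widen_ord kN i)) \o snd); last first.
  by apply/funext => u /=; rewrite tnth_mktuple.
by apply: measurableT_comp => //; exact: measurable_tnth.
Qed.

Let wtt k (b : nat -> bool) (u : borelV R q * k.-tuple E) :=
  \prod_(i < k) wt1 (b i) (tnth u.2 i) u.1.

Let mwtt k b : measurable_fun setT (@wtt k b).
Proof.
apply: measurable_prod => i _.
have h : measurable_fun setT (fun u : borelV R q * k.-tuple E => (tnth u.2 i, u.1)).
  apply: measurable_fun_pair => //.
  by apply: (measurableT_comp (measurable_tnth i)).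
exact: (measurableT_comp (mwt1 (b i)) h).
Qed.

Let wtt_tau k b w : @wtt k b (tau k w) = wt k b w.
Proof. by apply: eq_bigr => i _; rewrite tnth_mktuple. Qed.

Let patS k b w : \1_(pat k.+1 b) w = \1_(pat k b) w * (delta k w == b k)%:R :> R.
Proof.
rewrite !indicE -natrM mulnb; congr ((nat_of_bool _)%:R).
apply/idP/andP => [/set_mem h|[/set_mem h /eqP e]].
  by split; [apply/mem_set => i ik; exact/h/leqW|apply/eqP/h].
apply/mem_set => i; rewrite ltnS leq_eqVlt => /orP[/eqP ->//|]; exact: h.
Qed.

(** Split on the pattern of the first k indicators. On each piece the state is a function of the
    pilot and the first k observations, so [fold] trades the indicators of the pattern and of unit k
    for their weights, independence integrates out the new observation, and [fold] restores the
    pattern. *)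
Lemma next_indicator k (Psi : (borelV R q * borelV R m) * E -> R) : (k < N)%N ->
  measurable_fun setT Psi -> (forall u, 0 <= Psi u) ->
  (\int[P]_w ((delta k w)%:R * Psi ((pilot w, state k w), Z k w))%:E =
   \int[P]_w \int[mu]_z (p z (pilot w) * Psi ((pilot w, state k w), z))%:E)%E.
Proof.
move=> kN mPsi Psi0.
have kN' := ltnW kN.
have mpPsi : measurable_fun setT (fun u : (borelV R q * borelV R m) * E =>
    (p u.2 u.1.1 * Psi u)%:E).
  apply/measurable_EFinP/measurable_funM => //.
  have h : measurable_fun setT (fun u : (borelV R q * borelV R m) * E => (u.2, u.1.1)).
    apply: measurable_fun_pair => //.
    exact: (measurableT_comp measurable_fst measurable_fst).
  exact: (measurableT_comp mp h).
have p0 z v : 0 <= p z v by have /andP[] := p01 z v.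
have pPsi0 u : (0 <= (p u.2 u.1.1 * Psi u)%:E)%E by rewrite lee_fin mulr_ge0.
pose H u : \bar R := (\int[mu]_z (p z u.1 * Psi (u, z))%:E)%E.
have mH : measurable_fun setT H by have := measurable_fun_fubini_tonelli_F _ mpPsi pPsi0; exact.
have H0 u : (0 <= H u)%E by apply: integral_ge0 => z _; exact: (pPsi0 (u, z)).
pose sg (b : {ffun 'I_k -> bool}) := @sig k (ext b).
have msg b : measurable_fun setT (fun u : borelV R q * k.-tuple E => (u.1, sg b u)).
  by apply: measurable_fun_pair => //; exact: msig.
have extk (b : {ffun 'I_k -> bool}) : ext b k = true by rewrite /ext insubN// ltnn.
have patb b w : pat k (ext b) w -> (pilot w, sg b (tau k w)) = (pilot w, state k w).
  by move=> h; rewrite (state_pat h).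
pose F (b : {ffun 'I_k -> bool}) (u : borelV R q * N.-tuple E) : \bar R :=
  (Psi ((u.1, sg b (u.1, first kN' u.2)), tnth u.2 (Ordinal kN)))%:E.
have mF b : measurable_fun setT (F b).
  apply/measurable_EFinP; apply: (measurableT_comp mPsi).
  apply: measurable_fun_pair.
    exact: (measurableT_comp (msg b) (@mfirst _ kN')).
  exact: (measurableT_comp (measurable_tnth _) measurable_snd).
have FE b w : F b (tau N w) = (Psi ((pilot w, sg b (tau k w)), Z k w))%:E.
  by rewrite /F first_tau tnth_mktuple.
transitivity (\int[P]_w \sum_(b : {ffun 'I_k -> bool})
    (F b (tau N w) * (\1_(pat k.+1 (ext b)) w)%:E))%E.
  apply: eq_integral => w _.
  rewrite (_ : _%:E = ((delta k w)%:R * Psi ((pilot w, state k w), Z k w) *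
      \sum_(b : {ffun 'I_k -> bool}) \1_(pat k (ext b)) w)%:E); last by rewrite sum_pat mulr1.
  rewrite mulr_sumr -sumEFin; apply: eq_bigr => b _.
  rewrite FE -EFinM patS extk eqb_id; congr EFin.
  rewrite indicE; case: (boolP (w \in _)) => [/set_mem/patb -> |_]; last by rewrite !(mul0r, mulr0).
  by rewrite mulr1 mul1r mulrC.
rewrite ge0_integral_sum//; last 2 first.
- move=> b; apply: emeasurable_funM; first exact: (measurableT_comp (mF b) (@measurable_tau N)).
  by apply/measurable_EFinP/measurable_indic.
- by move=> b w _; rewrite mule_ge0// lee_fin.
transitivity (\sum_(b : {ffun 'I_k -> bool})
    \int[P]_w (H (pilot w, sg b (tau k w)) * (\1_(pat k (ext b)) w)%:E))%E; last first.
  rewrite -ge0_integral_sum//; last 2 first.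
  - move=> b; apply: emeasurable_funM; last by apply/measurable_EFinP/measurable_indic.
    exact: (measurableT_comp mH (measurableT_comp (msg b) (@measurable_tau k))).
  - by move=> b w _; rewrite mule_ge0// lee_fin.
  apply: eq_integral => w _.
  transitivity (\sum_(b : {ffun 'I_k -> bool}) H (pilot w, state k w) * (\1_(pat k (ext b)) w)%:E)%E.
    apply: eq_bigr => b _; rewrite indicE.
    by case: (boolP (w \in _)) => [/set_mem/patb ->//|_]; rewrite !mule0.
  rewrite -ge0_sume_distrr; last by move=> b _; rewrite lee_fin.
  by rewrite sumEFin sum_pat mule1.
apply: eq_bigr => b _.
rewrite fold//; last by move=> u; rewrite lee_fin.
(* The weight of unit k goes with the new observation; the weights of the first k units depend on
   the past only. *)
pose Phi (uz : (borelV R q * k.-tuple E) * E) : \bar R :=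
  ((wtt (ext b) uz.1) * (p uz.2 uz.1.1 * Psi ((uz.1.1, sg b uz.1), uz.2)))%:E.
have mPhi : measurable_fun setT Phi.
  apply/measurable_EFinP/measurable_funM; first exact: (measurableT_comp (@mwtt k (ext b)) measurable_fst).
  have h : measurable_fun setT (fun uz : (borelV R q * k.-tuple E) * E =>
      ((uz.1.1, sg b uz.1), uz.2)).
    by apply: measurable_fun_pair => //; exact: (measurableT_comp (msg b) measurable_fst).
  apply/measurable_EFinP; exact: (measurableT_comp mpPsi h).
have wtt0 u : 0 <= wtt (ext b) u by rewrite /wtt prodr_ge0.
transitivity (\int[P]_w Phi (tau k w, Z k w))%E.
  apply: eq_integral => w _; rewrite FE -EFinM /Phi/= wtt_tau; congr EFin.
  rewrite /wt big_ord_recr/= extk [RHS]mulrA [RHS]mulrC.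
  by [].
rewrite indep_next//; last first.
  by move=> u; rewrite lee_fin mulr_ge0// mulr_ge0.
(* [fold] in the opposite direction turns the weights of the first k units back into the indicator
   of their pattern. *)
pose G (u : borelV R q * N.-tuple E) : \bar R := H (u.1, sg b (u.1, first kN' u.2)).
transitivity (\int[P]_w (G (tau N w) * (\1_(pat k (ext b)) w)%:E))%E; last first.
  by apply: eq_integral => w _; rewrite /G first_tau.
have mG : measurable_fun setT G.
  exact: (measurableT_comp mH (measurableT_comp (msg b) (@mfirst _ kN'))).
have G0 u : (0 <= G u)%E by exact: H0.
rewrite (@fold k (ext b) G kN' mG G0).
apply: eq_integral => w _; rewrite /G first_tau -wtt_tau muleC.
rewrite /H -ge0_integralZl_EFin//.
  by move=> z _; exact: (pPsi0 ((_, _), z)).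
exact: (measurable_fun_pair2 ((_, _) : _ * borelV R m) mpPsi).
Qed.

End state.
End sampling.

(** * Fubini for bounded real functions *)

Section fubini_bounded.
Context d1 d2 (T1 : measurableType d1) (T2 : measurableType d2) (R : realType).
Variables (P1 : probability T1 R) (P2 : probability T2 R).
Variables (f : T1 * T2 -> R) (K : R).
Hypotheses (mf : measurable_fun setT f) (fK : forall x, `|f x| <= K).

Lemma bounded_integrable2 : (P1 \x P2)%E.-integrable setT (EFin \o f).
Proof. exact: (bounded_integrable (P1 \x P2)%E mf fK). Qed.

Lemma measurable_Rintegral2 : measurable_fun setT (fun x => \int[P2]_y f (x, y)).
Proof.
have := measurable_fubini_F bounded_integrable2.
move=> /(measurableT_comp (fine_measurable measurableT)); exact.
Qed.

Lemma Rintegral_sec x : P2.-integrable setT (fun y => (f (x, y))%:E).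
Proof.
apply: (@bounded_integrable _ _ _ P2 (fun y => f (x, y)) K) => //.
exact: measurableT_comp.
Qed.

Lemma Rfubini1 : \int[P1]_x \int[P2]_y f (x, y) = \int[(P1 \x P2)%E]_z f z.
Proof.
rewrite [RHS]/Rintegral -(integral12_prod_meas1 bounded_integrable2).
congr fine; apply: eq_integral => x _ /=.
by rewrite /Rintegral fineK//; apply: integrable_fin_num => //; exact: Rintegral_sec.
Qed.

End fubini_bounded.

Lemma Rfubini d1 d2 (T1 : measurableType d1) (T2 : measurableType d2) (R : realType)
  (P1 : probability T1 R) (P2 : probability T2 R) (f : T1 * T2 -> R) (K : R) :
  measurable_fun setT f -> (forall x, `|f x| <= K) ->
  \int[P1]_x \int[P2]_y f (x, y) = \int[P2]_y \int[P1]_x f (x, y).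
Proof.
move=> mf fK; rewrite (Rfubini1 P1 P2 mf fK) /Rintegral.
rewrite -(integral21_prod_meas1 (bounded_integrable2 P1 P2 mf fK)).
congr fine; apply: eq_integral => y _ /=.
rewrite /Rintegral fineK//; apply: integrable_fin_num => //.
apply: (@bounded_integrable _ _ _ P1 (fun x => f (x, y)) K) => //.
exact: measurableT_comp.
Qed.

(** * The normal law on the line: affine images, stability, moments *)

Section normal.
Context {R : realType}.
Notation mu := (@lebesgue_measure R).

Lemma normal_peakE (s : R) : normal_peak s = (`|s| * Num.sqrt (pi *+ 2))^-1.
Proof. by rewrite /normal_peak -mulrnAr sqrtrM ?sqr_ge0// sqrtr_sqr. Qed.

Lemma ge0_integral_normal (m s : R) (F : R -> \bar R) :
  measurable_fun setT F -> (forall y, (0 <= F y)%E) ->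
  (\int[normal_prob m s]_y F y = \int[mu]_x (F x * (normal_pdf m s x)%:E))%E.
Proof.
move=> mF F0.
have := @integral_density _ _ _ _ R mu (normal_prob m s) idfun (normal_pdf m s).
apply => //; [exact: measurable_id|exact: measurable_normal_pdf|exact: normal_pdf_ge0].
Qed.

(** Lebesgue measure and |s| times its image under x -> m + s x agree on half-open intervals. For
    negative s the preimage is closed on the other side, with the same length. *)
Lemma ge0_integral_affine (m s : R) (F : R -> \bar R) : s != 0 ->
  measurable_fun setT F -> (forall y, (0 <= F y)%E) ->
  (\int[mu]_x F x = `|s|%:E * \int[mu]_x F (m + s * x)%R)%E.
Proof.
move=> s0 mF F0.
pose T : measurableTypeR R -> measurableTypeR R := fun x => m + s * x.
have mT : measurable_fun setT T by apply: measurable_funD => //; exact: measurable_funM.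
have muE A : measurable A -> mu A = mscale (NngNum (normr_ge0 s)) (image_measure mu mT) A.
  apply: lebesgue_measure_unique => _ [[a b]] _ <- /=.
  rewrite /mscale /= /image_measure/= /pushforward.
  have [s1|s1|] := ltgtP s 0; last by move/eqP; rewrite (negbTE s0).
    have -> : T @^-1` `]a, b] = `[(b - m) / s, (a - m) / s[%classic.
      apply/seteqP; split => x /=; rewrite !in_itv/= /T ler_ndivrMr// ltr_ndivlMr//; 
        move=> /andP[h1 h2]; apply/andP; split; rewrite mulrC; lra.
    rewrite !lebesgue_measure_itv/= !lte_fin ltr_nM2r ?invr_lt0// ltrD2r.
    case: ifPn => ab; last by rewrite mule0.
    by rewrite -!EFinB -EFinM ltr0_norm//; congr EFin; field.
  have -> : T @^-1` `]a, b] = `](a - m) / s, (b - m) / s]%classic.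
    apply/seteqP; split => x /=; rewrite !in_itv/= /T ler_pdivlMr// ltr_pdivrMr//; 
      move=> /andP[h1 h2]; apply/andP; split; rewrite mulrC; lra.
  rewrite !lebesgue_measure_itv/= !lte_fin ltr_pM2r ?invr_gt0// ltrD2r.
  case: ifPn => ab; last by rewrite mule0.
  by rewrite -!EFinB -EFinM gtr0_norm//; congr EFin; field.
rewrite (eq_measure_integral (mscale (NngNum (normr_ge0 s)) (image_measure mu mT))); last first.
  by move=> A mA _; exact: muE.
rewrite ge0_integral_mscale//=; congr (_ * _)%E.
by rewrite ge0_integral_pushforward.
Qed.

Lemma ge0_normal_affine (m s : R) (F : R -> \bar R) : s != 0 ->
  measurable_fun setT F -> (forall y, (0 <= F y)%E) ->
  (\int[normal_prob 0 1]_x F (m + s * x)%R = \int[normal_prob m s]_x F x)%E.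
Proof.
move=> s0 mF F0.
have ma : measurable_fun setT (fun x : R => m + s * x).
  by apply: measurable_funD => //; exact: measurable_funM.
rewrite (ge0_integral_normal 0 1 (measurableT_comp mF ma)); last by move=> x; exact: F0.
rewrite (ge0_integral_normal m s mF F0).
rewrite [RHS](ge0_integral_affine m s0); last 2 first.
- apply: emeasurable_funM => //; apply/measurable_EFinP; exact: measurable_normal_pdf.
- by move=> x; rewrite mule_ge0// lee_fin normal_pdf_ge0.
rewrite -ge0_integralZl_EFin//; last 2 first.
- by move=> x _; rewrite mule_ge0// lee_fin normal_pdf_ge0.
- apply: emeasurable_funM; first exact: (measurableT_comp mF ma).
  apply/measurable_EFinP; exact: (measurableT_comp (measurable_normal_pdf _ _) ma).
apply: eq_integral => x _; rewrite muleCA -EFinM; congr (_ * _%:E)%E.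
rewrite !normal_pdfE ?oner_neq0// !normal_peakE /normal_fun.
rewrite [m + _]addrC addrK subr0 mulrA; congr (_ * expR _); last by field.
by rewrite normr1 mul1r invfM mulrA divff ?mul1r// normr_eq0.
Qed.

Let N01 : probability _ R := normal_prob 0 1.

(** The sum of two independent centred normal variables is normal with the sum of the variances: the
    joint density factors into the density of the sum and a conditional density of total mass 1. *)
Lemma normal_stable1 (a b : R) (F : R -> \bar R) :
  measurable_fun setT F -> (forall y, (0 <= F y)%E) ->
  (\int[N01]_x \int[N01]_y F (a * x + b * y)%R =
   \int[N01]_x F (Num.sqrt (a ^+ 2 + b ^+ 2) * x)%R)%E.
Proof.
move=> mF F0.
have lin (s : R) : s != 0 -> (\int[N01]_x F (s * x)%R = \int[normal_prob 0 s]_x F x)%E.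
  by move=> s0; rewrite -ge0_normal_affine//; apply: eq_integral => x _; rewrite add0r.
(* The law of s X depends on s through s^2 only, as its density does; this handles the sign when a
   or b vanishes. *)
have meq (s t : R) : s ^+ 2 = t ^+ 2 ->
    (\int[N01]_x F (s * x)%R = \int[N01]_x F (t * x)%R)%E.
  move=> st; have [s0|s0] := eqVneq s 0.
    by move: st; rewrite s0 expr0n/= => /esym/eqP; rewrite sqrf_eq0 => /eqP ->.
  have t0 : t != 0 by rewrite -sqrf_eq0 -st sqrf_eq0.
  rewrite (lin s s0) (lin t t0) (ge0_integral_normal _ _ mF F0) (ge0_integral_normal _ _ mF F0).
  apply: eq_integral => x _.
  by rewrite !normal_pdfE// /normal_peak /normal_fun st.
have [a0|a0] := eqVneq a 0.
  rewrite a0 expr0n/= add0r.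
  under eq_integral do under eq_integral do rewrite mul0r add0r.
  rewrite integral_cst//= probability_setT mule1; apply: meq.
  by rewrite sqr_sqrtr// sqr_ge0.
have [b0|b0] := eqVneq b 0.
  rewrite b0 expr0n/= addr0.
  transitivity (\int[N01]_x F (a * x)%R)%E; last by apply: meq; rewrite sqr_sqrtr// sqr_ge0.
  apply: eq_integral => x _; under eq_integral do rewrite mul0r addr0.
  by rewrite integral_cst//= probability_setT mule1.
set c := Num.sqrt _.
have c2 : c ^+ 2 = a ^+ 2 + b ^+ 2 by rewrite sqr_sqrtr// addr_ge0// sqr_ge0.
have c0 : c != 0 by rewrite -sqrf_eq0 c2 paddr_eq0 ?sqr_ge0// negb_and !sqrf_eq0 a0.
transitivity (\int[N01]_x \int[normal_prob (a * x) b]_y F y)%E.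
  by apply: eq_integral => x _; rewrite ge0_normal_affine.
rewrite (lin c c0) (ge0_integral_normal _ _ mF F0).
pose h (z : R * R) : \bar R := (F z.2 * (normal_pdf (a * z.1) b z.2)%:E)%E.
have mpdf : measurable_fun setT (fun z : R * R => normal_pdf (a * z.1) b z.2).
  have -> : (fun z : R * R => normal_pdf (a * z.1) b z.2) =
      (fun z : R * R => normal_pdf 0 b (z.2 - a * z.1)).
    by apply/funext => z; rewrite !normal_pdfE// /normal_fun subr0.
  apply: (measurableT_comp (measurable_normal_pdf 0 b)).
  by apply: measurable_funB => //; exact: measurable_funM.
have mh : measurable_fun setT h.
  apply: emeasurable_funM; first exact: (measurableT_comp mF measurable_snd).
  exact/measurable_EFinP.
have h0 z : (0 <= h z)%E by rewrite mule_ge0// lee_fin normal_pdf_ge0.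
transitivity (\int[N01]_x \int[mu]_y h (x, y))%E.
  by apply: eq_integral => x _; rewrite ge0_integral_normal.
rewrite (@fubini_tonelli _ _ _ _ _ N01 mu h)//; apply: eq_integral => y _; rewrite /h/=.
rewrite ge0_integralZl//; last first.
- by move=> x _; rewrite lee_fin normal_pdf_ge0.
- apply/measurable_EFinP; exact: (measurableT_comp mpdf (measurable_fun_pair _ _)).
congr (_ * _)%E.
rewrite ge0_integral_normal//; last first.
- by move=> x; rewrite lee_fin normal_pdf_ge0.
- apply/measurable_EFinP; exact: (measurableT_comp mpdf (measurable_fun_pair _ _)).
(* Completing the square: the density of x times that of y given x is the density of y times that of
   x given y, which is normal with mean y a / c^2 and deviation b / c. *)
transitivity (\int[mu]_x ((normal_pdf 0 c y)%:E * (normal_pdf (y * a / c ^+ 2) (b / c) x)%:E))%E.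
  apply: eq_integral => x _; rewrite -!EFinM; congr EFin.
  have bc : b / c != 0 by rewrite mulf_neq0// invr_neq0.
  rewrite !normal_pdfE ?oner_neq0// !normal_peakE /normal_fun.
  rewrite mulrACA [RHS]mulrACA -!expRD; congr (_ * expR _); last first.
    have c20 : a ^+ 2 + b ^+ 2 != 0 by rewrite -c2 sqrf_eq0.
    by rewrite exprMn exprVn c2; field; rewrite b0 c20.
  rewrite normrM normfV normr1 mul1r; field.
  by rewrite !normr_eq0 c0 b0 gt_eqF// sqrtr_gt0 mulrn_wgt0// pi_gt0.
have k1 : (0 <= (normal_pdf 0 c y)%:E)%E by rewrite lee_fin normal_pdf_ge0.
have m1 : measurable_fun setT (fun x : R => (normal_pdf (y * a / c ^+ 2) (b / c) x)%:E).
  apply/measurable_EFinP; exact: measurable_normal_pdf.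
rewrite ge0_integralZl//; last by move=> x _; rewrite lee_fin normal_pdf_ge0.
by rewrite integral_normal_pdf mule1.
Qed.

End normal.

Section moments.
Context {R : realType}.
Let N01 : probability _ R := @normal_prob R 0 1.

(** Times the standard density, the integrand is s times the density of deviation s. This one
    identity yields both the variance and the finiteness of the fourth moment. *)
Lemma normal_exp_moment (s : R) : 0 < s ->
  (\int[N01]_x (expR ((1 - (s ^+ 2)^-1) * x ^+ 2 / 2))%:E = s%:E)%E.
Proof.
move=> s0; have sn0 : s != 0 by rewrite gt_eqF.
have mf : measurable_fun setT (fun x : R => (expR ((1 - (s ^+ 2)^-1) * x ^+ 2 / 2))%:E).
  apply/measurable_EFinP; apply: measurableT_comp => //.
  apply: measurable_funM => //; apply: measurable_funM => //; exact: measurable_funX.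
rewrite (ge0_integral_normal _ _ mf); last by move=> x; rewrite lee_fin expR_ge0.
have m1 : measurable_fun setT (fun x : R => (normal_pdf 0 s x)%:E).
  apply/measurable_EFinP; exact: measurable_normal_pdf.
transitivity (\int[lebesgue_measure]_x (s%:E * (normal_pdf 0 s x)%:E))%E.
  apply: eq_integral => x _; rewrite -!EFinM; congr EFin.
  rewrite !normal_pdfE ?oner_neq0// !normal_peakE /normal_fun !subr0.
  rewrite normr1 mul1r gtr0_norm// mulrCA -expRD.
  have e q : s * (s * q)^-1 = q^-1 by rewrite invfM mulrA divff// mul1r.
  rewrite [RHS]mulrA e.
  by congr (_ * expR _); field.
rewrite ge0_integralZl//; last 2 first.
- by move=> x _; rewrite lee_fin normal_pdf_ge0.
- by rewrite lee_fin ltW.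
by rewrite integral_normal_pdf mule1.
Qed.

Let mX n : measurable_fun setT (fun x : R => (x ^+ n)%:E).
Proof. by apply/measurable_EFinP; exact: measurable_funX. Qed.

Lemma normal_pow4_fin : (\int[N01]_x (x ^+ 4)%:E < +oo)%E.
Proof.
have s20 : 0 < Num.sqrt 2 :> R by rewrite sqrtr_gt0.
have e := normal_exp_moment s20.
apply: (@le_lt_trans _ _ (\int[N01]_x (64%:E * (expR ((1 - (Num.sqrt 2 ^+ 2)^-1) * x ^+ 2 / 2))%:E)))%E.
  apply: ge0_le_integral => //.
  - by move=> x _; rewrite lee_fin exprn_even_ge0.
  - exact: mX.
  - apply: emeasurable_funM => //; apply/measurable_EFinP; apply: measurableT_comp => //.
    apply: measurable_funM => //; apply: measurable_funM => //; exact: measurable_funX.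
  - move=> x _; rewrite -EFinM lee_fin sqr_sqrtr//.
    (* At s = sqrt 2 the integrand is exp(x^2/4), the square of exp(x^2/8), which is at least 1 +
       x^2/8; hence x^4 is at most 8^2 = 64 times it. *)
    have -> : (1 - 2^-1) * x ^+ 2 / 2 = x ^+ 2 / 8 + x ^+ 2 / 8 by field.
    rewrite expRD; set y := expR _; have h : 1 + x ^+ 2 / 8 <= y by exact: expR_ge1Dx.
    have x2 := sqr_ge0 x; rewrite (_ : x ^+ 4 = (x ^+ 2) ^+ 2); last by rewrite -exprM.
    move: h x2; move: (x ^+ 2) => t h t0; nra.
rewrite ge0_integralZl//; last first.
  apply/measurable_EFinP; apply: measurableT_comp => //.
  apply: measurable_funM => //; apply: measurable_funM => //; exact: measurable_funX.
by rewrite e -EFinM ltry.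
Qed.

(** Bounding exp(u) below by 1 + u in [normal_exp_moment] gives 1 + (1 - s^-2) M / 2 <= s for every
    s > 0, where M is the second moment. Both sides equal 1 at s = 1, so their slopes there, M and
    1, must agree; no integration by parts is involved. *)
Lemma normal_sqr : (\int[N01]_x (x ^+ 2)%:E = 1)%E.
Proof.
have fin : (\int[N01]_x (x ^+ 2)%:E)%E \is a fin_num.
  rewrite ge0_fin_numE; last by apply: integral_ge0 => x _; rewrite lee_fin sqr_ge0.
  apply: (@le_lt_trans _ _ (\int[N01]_x (1%:E + (x ^+ 4)%:E)))%E.
    apply: ge0_le_integral => //.
    - by move=> x _; rewrite lee_fin sqr_ge0.
    - exact: mX.
    - by apply: emeasurable_funD => //; exact: mX.
    - move=> x _; rewrite -EFinD lee_fin (_ : x ^+ 4 = (x ^+ 2) ^+ 2); last by rewrite -exprM.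
      have := sqr_ge0 (x ^+ 2 - 1); have := sqr_ge0 x; move: (x ^+ 2) => t; nra.
  rewrite ge0_integralD//; [|by move=> x _; rewrite lee_fin exprn_even_ge0|exact: mX].
  by rewrite integral_cst//= probability_setT mule1 lte_add_pinfty ?ltry// normal_pow4_fin.
set M := (\int[N01]_x _)%E in fin *.
have key (s : R) : 0 < s -> s != 1 -> 1 + (1 - (s ^+ 2)^-1) / 2 * fine M <= s.
  move=> s0 s1; rewrite -lee_fin -(normal_exp_moment s0) EFinD EFinM fineK//.
  have i2 : N01.-integrable setT (fun x => (x ^+ 2)%:E).
    apply/integrableP; split; first exact: mX.
    under eq_integral do rewrite gee0_abs ?lee_fin ?sqr_ge0//.
    by rewrite -ge0_fin_numE//; apply: integral_ge0 => x _; rewrite lee_fin sqr_ge0.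
  rewrite -(integralZl measurableT i2).
  have -> : 1%:E = (\int[N01]_x (cst 1%:E) x)%E :> \bar R.
    by rewrite integral_cst//= probability_setT mule1.
  rewrite -integralD//; last 2 first.
  - by apply: (@bounded_integrable _ _ _ N01 (cst 1) 1) => // x; rewrite normr1.
  - exact: integrableZl.
  apply: le_integral => //.
  - apply: integrableD => //; last exact: integrableZl.
    by apply: (@bounded_integrable _ _ _ N01 (cst 1) 1) => // x; rewrite normr1.
  - apply/integrableP; split.
      apply/measurable_EFinP; apply: measurableT_comp => //.
      apply: measurable_funM => //; apply: measurable_funM => //; exact: measurable_funX.
    under eq_integral do rewrite gee0_abs ?lee_fin ?expR_ge0//.
    by rewrite normal_exp_moment// ltry.
  move=> x _; rewrite -EFinM -EFinD lee_fin; apply: le_trans (expR_ge1Dx _).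
  by rewrite lerD2l mulrAC.
have M0 : 0 <= fine M by apply/fine_ge0/integral_ge0 => x _; rewrite lee_fin sqr_ge0.
have key2 (s : R) : 0 < s -> s != 1 ->
    s ^+ 2 + (s ^+ 2 - 1) / 2 * fine M <= s * s ^+ 2.
  move=> s0 s1; have s20 : 0 < s ^+ 2 by rewrite exprn_gt0.
  rewrite (_ : s ^+ 2 + _ = (1 + (1 - (s ^+ 2)^-1) / 2 * fine M) * s ^+ 2).
    by rewrite ler_pM2r//; exact: key.
  by field; rewrite gt_eqF.
rewrite -(fineK fin); congr EFin; apply/eqP; rewrite eq_le; apply/andP; split.
  rewrite leNgt; apply/negP => M1.
  (* Take s^2 = t halfway between 1 and M. Whichever side M lies on, t + (t - 1) M / 2 exceeds t (t
     + 1) / 2, hence also t s because 2 s < s^2 + 1, against [key2]. *)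
  pose t := (1 + fine M) / 2; pose s := Num.sqrt t.
  have t1 : 1 < t by rewrite /t; lra.
  have tM : t < fine M by rewrite /t; lra.
  have s2 : s ^+ 2 = t by rewrite sqr_sqrtr; lra.
  have s1 : 1 < s by rewrite -sqrtr1 ltr_sqrt//; lra.
  have := key2 s (lt_trans ltr01 s1); rewrite (gt_eqF s1) s2 => /(_ isT) h.
  have h1 : 0 < (fine M - t) * (t - 1) by rewrite mulr_gt0; lra.
  have h2 : 0 < t * (s - 1) ^+ 2 by rewrite mulr_gt0// ?exprn_gt0; lra.
  have s2' : s ^+ 2 = s * s by rewrite expr2.
  nra.
rewrite leNgt; apply/negP => M1.
pose t := (1 + fine M) / 2; pose s := Num.sqrt t.
have t1 : t < 1 by rewrite /t; lra.
have t0 : 0 < t by rewrite /t; lra.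
have tM : fine M < t by rewrite /t; lra.
have s2 : s ^+ 2 = t by rewrite sqr_sqrtr; lra.
have s1 : s < 1 by rewrite -[ltRHS]sqrtr1 ltr_sqrt//; lra.
have s0 : 0 < s by rewrite sqrtr_gt0.
have := key2 s s0; rewrite (lt_eqF s1) s2 => /(_ isT) h.
have h1 : 0 < (t - fine M) * (1 - t) by rewrite mulr_gt0; lra.
have h2 : 0 < t * (s - 1) ^+ 2 by rewrite mulr_gt0// exprn_even_gt0//= subr_eq0 lt_eqF.
have s2' : s ^+ 2 = s * s by rewrite expr2.
nra.
Qed.

Lemma normal_sym (F : R -> \bar R) :
  measurable_fun setT F -> (forall y, (0 <= F y)%E) ->
  (\int[N01]_x F (- x)%R = \int[N01]_x F x)%E.
Proof.
move=> mF F0; have n1 : -1 != 0 :> R by rewrite oppr_eq0 oner_eq0.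
transitivity (\int[N01]_x F (0 + -1 * x)%R)%E.
  by apply: eq_integral => x _; rewrite add0r mulN1r.
rewrite (ge0_normal_affine 0 n1 mF F0) (ge0_integral_normal _ _ mF F0) (ge0_integral_normal _ _ mF F0).
apply: eq_integral => x _.
by rewrite !normal_pdfE ?oner_eq0// /normal_peak /normal_fun !sqrrN !expr1n.
Qed.

Lemma normal_integrable_id : N01.-integrable setT (EFin \o (fun x : R => x)).
Proof.
apply/integrableP; split; first exact/measurable_EFinP/measurable_id.
apply: (@le_lt_trans _ _ (\int[N01]_x (1%:E + (x ^+ 2)%:E)))%E.
  apply: ge0_le_integral => //.
  - by apply: measurableT_comp => //; exact/measurable_EFinP/measurable_id.
  - by apply: emeasurable_funD => //; exact: mX.
  - move=> x _ /=; rewrite -EFinD lee_fin.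
    have := real_normK (num_real x); have := sqr_ge0 (`|x| - 1); have := normr_ge0 x.
    by move: (`|x|) => t; nra.
rewrite ge0_integralD//; [|by move=> x _; rewrite lee_fin sqr_ge0|exact: mX].
by rewrite integral_cst//= probability_setT mule1 normal_sqr -EFinD ltry.
Qed.

Lemma normal_mean : \int[N01]_x x = 0.
Proof.
have i1 := normal_integrable_id.
have m1 : measurable_fun setT (fun x : R => x%:E) by exact: (measurable_int _ i1).
have mp := measurable_funepos m1.
rewrite /Rintegral integralE.
have -> : (\int[N01]_x (EFin^\- x) = \int[N01]_x (EFin^\+ x))%E.
  rewrite -[RHS](normal_sym mp)//; apply: eq_integral => x _.
  by rewrite funenegE funeposE EFinN.
rewrite subee//; apply: integrable_pos_fin_num => //.
Qed.

End moments.

(** * Gaussian vectors *)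

Section gauss.
Context {R : realType} {d : nat}.
Local Notation N01 := (@normal_prob R 0 1 : probability (measurableTypeR R) R).
Local Notation V := (borelV R d).

Definition dot (a u : 'cV[R]_d) : R := (a^T *m u) 0 0.

Lemma dotE a u : dot a u = \sum_j a j 0 * u j 0.
Proof. by rewrite /dot mxE; apply: eq_bigr => j _; rewrite mxE. Qed.

Lemma dotD a u w : dot a (u + w) = dot a u + dot a w.
Proof. by rewrite /dot mulmxDr mxE. Qed.

Lemma dotZ a x u : dot a (x *: u) = x * dot a u.
Proof. by rewrite /dot -scalemxAr mxE. Qed.

Lemma measurable_dot a : measurable_fun setT (dot a : V -> R).
Proof.
rewrite (_ : dot a = fun u => \sum_j a j 0 * u j 0); last by apply/funext => u; rewrite dotE.
by apply: measurable_sum => j; apply: measurable_funM => //; exact: measurable_coord.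
Qed.

Lemma measurable_borelVD dT (T : measurableType dT) (f g : T -> V) :
  measurable_fun setT f -> measurable_fun setT g ->
  measurable_fun setT ((fun x => (f x : 'cV[R]_d) + g x) : T -> V).
Proof.
move=> mf mg; apply: measurable_borelV => j.
rewrite (_ : (fun x => _) = (fun x => (f x : 'cV[R]_d) j 0 + (g x : 'cV[R]_d) j 0)); last first.
  by apply/funext => x; rewrite mxE.
apply: measurable_funD.
  exact: (measurableT_comp (measurable_coord j) mf).
exact: (measurableT_comp (measurable_coord j) mg).
Qed.

Lemma measurable_borelVZ dT (T : measurableType dT) (a : T -> R) (f : T -> V) :
  measurable_fun setT a -> measurable_fun setT f ->
  measurable_fun setT ((fun x => a x *: (f x : 'cV[R]_d)) : T -> V).
Proof.
move=> mf mg; apply: measurable_borelV => j.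
rewrite (_ : (fun x => _) = (fun x => a x * (f x : 'cV[R]_d) j 0)); last first.
  by apply/funext => x; rewrite mxE.
by apply: measurable_funM => //; exact: (measurableT_comp (measurable_coord j) mg).
Qed.

Let addv (v : 'cV[R]_d) (u : measurableTypeR R * V) : V := u.1 *: v + u.2.

Let maddv v : measurable_fun setT (addv v).
Proof.
apply: measurable_borelVD => //; apply: measurable_borelVZ => //.
Qed.

(** Law of the sum of x_v v over the vectors v of the list, with independent standard normal x_v, so
    with covariance the sum of the v v^T. Adding one vector at a time makes its properties
    inductive; singular covariances are included. *)
Fixpoint gauss (l : seq 'cV[R]_d) : probability V R :=
  if l is v :: l' then law (N01 \x gauss l')%E (maddv v)
  else \d_(0 : V).

Lemma ge0_integral_gauss_cons v l (F : V -> \bar R) :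
  measurable_fun setT F -> (forall u, (0 <= F u)%E) ->
  (\int[gauss (v :: l)]_u F u = \int[N01]_x \int[gauss l]_z F (x *: v + z : 'cV[R]_d)%R)%E.
Proof.
move=> mF F0; rewrite (ge0_integral_law _ (maddv v) mF F0).
rewrite (fubini_tonelli1 (fun z => F (addv v z)))//.
exact: (measurableT_comp mF (maddv v)).
Qed.

Lemma integral_gauss_nil (F : V -> \bar R) :
  measurable_fun setT F -> (\int[gauss [::]]_u F u = F (0 : V)%R)%E.
Proof. by move=> mF; rewrite integral_dirac// diracE mem_set// mul1e. Qed.

(** Each new vector adds an independent normal term to the linear form, and [normal_stable1] adds up
    the variances. *)
Lemma gauss_lin l (a : 'cV[R]_d) (F : R -> \bar R) :
  measurable_fun setT F -> (forall u, (0 <= F u)%E) ->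
  (\int[gauss l]_u F (dot a u) =
   \int[N01]_x F (Num.sqrt (\sum_(v <- l) dot a v ^+ 2) * x)%R)%E.
Proof.
elim: l F => [|v l IH] F mF F0.
  rewrite integral_gauss_nil; last exact: (measurableT_comp mF (measurable_dot a)).
  rewrite big_nil sqrtr0 (_ : dot a 0 = 0); last by rewrite /dot mulmx0 mxE.
  under eq_integral do rewrite mul0r.
  by rewrite integral_cst//= probability_setT mule1.
rewrite ge0_integral_gauss_cons//; last exact: (measurableT_comp mF (measurable_dot a)).
under eq_integral do under eq_integral do rewrite dotD dotZ mulrC.
set c := Num.sqrt (\sum_(v <- l) dot a v ^+ 2) in IH.
transitivity (\int[N01]_x \int[N01]_y F (dot a v * x + c * y)%R)%E.
  apply: eq_integral => x _; rewrite (IH (fun y => F (dot a v * x + y)))//.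
  by apply: (measurableT_comp mF); exact: measurable_funD.
rewrite normal_stable1// big_cons /c sqr_sqrtr//.
by apply: sumr_ge0 => i _; rewrite sqr_ge0.
Qed.

Let mcomb (a b : R) : measurable_fun setT
  ((fun u : V * V => a *: (u.1 : 'cV[R]_d) + b *: (u.2 : 'cV[R]_d)) : V * V -> V).
Proof. by apply: measurable_borelVD; exact: measurable_borelVZ. Qed.

Let mscal (a : R) : measurable_fun setT ((fun u : V => a *: (u : 'cV[R]_d)) : V -> V).
Proof. exact: measurable_borelVZ. Qed.

(** This lets the Gaussian side be cut into increments: the law at one scale is that of a smaller
    scale plus an independent Gaussian step. *)
Lemma ge0_gauss_stable l (a b : R) (F : V -> \bar R) :
  measurable_fun setT F -> (forall u, (0 <= F u)%E) ->
  (\int[gauss l]_u \int[gauss l]_w F (a *: (u : 'cV[R]_d) + b *: (w : 'cV[R]_d))%R =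
   \int[gauss l]_u F (Num.sqrt (a ^+ 2 + b ^+ 2) *: (u : 'cV[R]_d))%R)%E.
Proof.
set c := Num.sqrt _.
elim: l F => [|v l IH] F mF F0.
  have mFab := measurableT_comp mF (mcomb a b).
  rewrite [RHS](integral_gauss_nil (measurableT_comp mF (mscal c))).
  rewrite (integral_gauss_nil (measurable_fun_fubini_tonelli_F _ mFab (fun u => F0 _))).
  rewrite /fubini_F (integral_gauss_nil (measurable_fun_pair2 (0 : V) mFab)).
  by rewrite /= !scaler0 addr0.
have mFab := measurableT_comp mF (mcomb a b).
rewrite ge0_integral_gauss_cons; last 2 first.
- apply: (measurable_fun_fubini_tonelli_F _ mFab) => u; exact: F0.
- by move=> u; exact: integral_ge0.
(* The coefficients of v are grouped apart from the rest, so that after an exchange of integrals the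
   induction applies to the rest and [normal_stable1] to the coefficients. *)
transitivity (\int[N01]_x \int[gauss l]_z \int[N01]_y \int[gauss l]_t
   F ((a * x + b * y) *: v + (a *: (z : 'cV[R]_d) + b *: (t : 'cV[R]_d)))%R)%E.
  apply: eq_integral => x _; apply: eq_integral => z _.
  have e := @ge0_integral_gauss_cons v l (fun w : V => F (a *: (x *: v + z) + b *: (w : 'cV[R]_d))%R)
    (measurable_fun_pair2 (x *: v + z : V) mFab) (fun u => F0 _).
  apply: (etrans e).
  apply: eq_integral => y _; apply: eq_integral => t _; rewrite /=; congr F.
  by rewrite !scalerDr !scalerA scalerDl addrACA.
transitivity (\int[N01]_x \int[N01]_y \int[gauss l]_z F ((a * x + b * y) *: v + c *: (z : 'cV[R]_d))%R)%E.
  apply: eq_integral => x _.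
  pose h (zy : V * measurableTypeR R) := (\int[gauss l]_t
    F ((a * x + b * zy.2) *: v + (a *: (zy.1 : 'cV[R]_d) + b *: (t : 'cV[R]_d)))%R)%E.
  have mh : measurable_fun setT h.
    have mk : measurable_fun setT ((fun u : (V * measurableTypeR R) * V =>
        (a * x + b * u.1.2) *: v + (a *: (u.1.1 : 'cV[R]_d) + b *: (u.2 : 'cV[R]_d))) : _ -> V).
      apply: measurable_borelVD.
        apply: measurable_borelVZ => //; apply: measurable_funD => //; apply: measurable_funM => //.
        exact: (measurableT_comp measurable_snd measurable_fst).
      apply: measurable_borelVD; apply: measurable_borelVZ => //.
      exact: (measurableT_comp measurable_fst measurable_fst).
    have mFk := measurableT_comp mF mk.
    by apply: (measurable_fun_fubini_tonelli_F _ mFk) => u; exact: F0.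
  rewrite (@fubini_tonelli _ _ _ _ _ (gauss l) N01 h)//; last by move=> u; exact: integral_ge0.
  apply: eq_integral => y _; rewrite /h/=.
  have mFv : measurable_fun setT (F \o (fun w : V => (a * x + b * y) *: v + (w : 'cV[R]_d)%R)).
    by apply: (measurableT_comp mF); apply: measurable_borelVD.
  exact: (IH _ mFv (fun u => F0 _)).
have mK : measurable_fun setT (fun x : measurableTypeR R =>
    \int[gauss l]_z F (x *: v + c *: (z : 'cV[R]_d))%R)%E.
  have mk : measurable_fun setT ((fun u : measurableTypeR R * V =>
      u.1 *: v + c *: (u.2 : 'cV[R]_d)) : _ -> V).
    by apply: measurable_borelVD; exact: measurable_borelVZ.
  have mFk := measurableT_comp mF mk.
  by apply: (measurable_fun_fubini_tonelli_F _ mFk) => u; exact: F0.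
rewrite (normal_stable1 a b mK); last by move=> u; exact: integral_ge0.
rewrite (ge0_integral_gauss_cons v l (measurableT_comp mF (mscal c)) (fun u => F0 _)).
by apply: eq_integral => x _; apply: eq_integral => z _; rewrite /= scalerDr scalerA.
Qed.

Lemma gauss_stable l (a b : R) (F : V -> R) (K : R) :
  measurable_fun setT F -> (forall u, `|F u| <= K) ->
  \int[gauss l]_u \int[gauss l]_w F (a *: (u : 'cV[R]_d) + b *: (w : 'cV[R]_d))%R =
   \int[gauss l]_u F (Num.sqrt (a ^+ 2 + b ^+ 2) *: (u : 'cV[R]_d))%R.
Proof.
move=> mF FK; set c := Num.sqrt _.
have mFab := measurableT_comp mF (mcomb a b).
rewrite (Rfubini1 (gauss l) (gauss l) mFab (fun u => FK _)).
rewrite -(@Rintegral_law _ _ _ _ R (gauss l \x gauss l)%E _ (mcomb a b) F)//; last first.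
  exact: (bounded_integrable _ mFab (fun u => FK _)).
have mFc := measurableT_comp mF (mscal c).
rewrite -(@Rintegral_law _ _ _ _ R (gauss l) _ (mscal c) F)//; last first.
  exact: (bounded_integrable _ mFc (fun u => FK _)).
(* The nonnegative case on indicators identifies the two image laws, and with them their integrals
   of bounded functions. *)
rewrite /Rintegral; congr fine; apply: eq_measure_integral => A mA _.
have mA1 : measurable_fun setT (fun u : V => (\1_A u : R)%:E).
  by apply/measurable_EFinP; apply: measurable_indic.
have A0 (u : V) : (0 <= (\1_A u : R)%:E)%E by rewrite lee_fin.
have e (mu : {measure set V -> \bar R}) : mu A = (\int[mu]_x (\1_A x)%:E)%E.
  by rewrite integral_indic// setIT.
rewrite (e (law (gauss l \x gauss l)%E (mcomb a b))) (e (law (gauss l) (mscal c))).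
rewrite (ge0_integral_law _ (mcomb a b) mA1 A0) (ge0_integral_law _ (mscal c) mA1 A0).
rewrite -(ge0_gauss_stable l a b mA1 A0).
by rewrite fubini_tonelli1//; exact: (measurableT_comp mA1 (mcomb a b)).
Qed.

(** Growth of order four covers every moment used below, the fourth moment of the standard normal
    law being finite. *)
Lemma gauss_lin_R l (a : 'cV[R]_d) (g : R -> R) (C : R) :
  measurable_fun setT g -> (forall x, `|g x| <= C * (1 + x ^+ 4)) ->
  (gauss l).-integrable setT (EFin \o (g \o dot a)) /\
  \int[gauss l]_u g (dot a u) =
  \int[N01]_x g (Num.sqrt (\sum_(v <- l) dot a v ^+ 2) * x).
Proof.
move=> mg gC; set c := Num.sqrt _.
have mEg : measurable_fun setT (EFin \o g) by exact/measurable_EFinP.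
have C0 : 0 <= C by have := gC 0; rewrite expr0n/= addr0 mulr1; apply: le_trans.
split.
  apply/integrableP; split.
    by apply/measurable_EFinP; exact: (measurableT_comp mg (measurable_dot a)).
  have mabs : measurable_fun setT (fun x => `|(g x)%:E|)%E by exact: measurableT_comp.
  rewrite (gauss_lin l a mabs); last by [].
  have mX4 : measurable_fun setT (fun x : R => (x ^+ 4)%:E).
    by apply/measurable_EFinP; exact: measurable_funX.
  have X40 (x : R) : (0 <= (x ^+ 4)%:E)%E by rewrite lee_fin exprn_even_ge0.
  apply: (@le_lt_trans _ _ (\int[N01]_x (C%:E + (C * c ^+ 4)%:E * (x ^+ 4)%:E)))%E.
    apply: ge0_le_integral => //.
    - apply: (measurableT_comp mabs); exact: measurable_funM.
    - by apply: emeasurable_funD => //; apply: emeasurable_funM.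
    - move=> x _; rewrite -EFinM -EFinD lee_fin; apply: le_trans (gC _) _.
      by rewrite exprMn mulrDr mulr1 mulrA.
  have Cc0 : (0 <= (C * c ^+ 4)%:E)%E by rewrite lee_fin mulr_ge0// exprn_even_ge0.
  rewrite ge0_integralD//; last 2 first.
  - by move=> x _; rewrite mule_ge0.
  - by apply: emeasurable_funM.
  rewrite ge0_integralZl// integral_cst//= probability_setT mule1.
  rewrite lte_add_pinfty ?ltry// lte_mul_pinfty//; exact: normal_pow4_fin.
have mp := measurable_funepos mEg; have mn := measurable_funeneg mEg.
rewrite /Rintegral integralE [in RHS]integralE; congr fine.
have e1 : (fun u : V => (g (dot a u))%:E)^\+%E = (fun u => (EFin \o g)^\+%E (dot a u)).
  by apply/funext => u; rewrite !funeposE.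
have e2 : (fun u : V => (g (dot a u))%:E)^\-%E = (fun u => (EFin \o g)^\-%E (dot a u)).
  by apply/funext => u; rewrite !funenegE.
have e3 : (fun x : R => (g (c * x))%:E)^\+%E = (fun x => (EFin \o g)^\+%E (c * x)).
  by apply/funext => u; rewrite !funeposE.
have e4 : (fun x : R => (g (c * x))%:E)^\-%E = (fun x => (EFin \o g)^\-%E (c * x)).
  by apply/funext => u; rewrite !funenegE.
by rewrite e1 e2 e3 e4 (gauss_lin l a mp)// (gauss_lin l a mn).
Qed.

Lemma gauss_mvnormal l (W : 'M[R]_d) :
  (forall a, dot a (W *m a) = \sum_(v <- l) dot a v ^+ 2) ->
  (forall a, a != 0 -> 0 < dot a (W *m a)) ->
  is_mvnormal (gauss l) 0 W.
Proof.
move=> WE W0 a A a0 mA.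
rewrite mulmx0 mxE -mulmxA -/(dot a (W *m a)) WE.
set c := Num.sqrt _.
have c0 : c != 0 by rewrite gt_eqF// sqrtr_gt0 -WE W0.
have mA1 : measurable_fun setT (fun u : R => (\1_A u : R)%:E).
  by apply/measurable_EFinP; apply: measurable_indic.
have A0 (u : R) : (0 <= (\1_A u : R)%:E)%E by rewrite lee_fin.
transitivity (\int[gauss l]_u (\1_A (dot a u))%:E)%E.
  rewrite (_ : (fun u => _) = (fun u => (\1_[set z : V | A (dot a z)] u)%:E)).
    rewrite integral_indic// ?setIT//.
    by rewrite -[X in measurable X]setTI; exact: (measurable_dot a).
  by apply/funext => u.
rewrite (gauss_lin l a mA1 A0).
transitivity (\int[N01]_x (\1_A (0 + c * x)%R)%:E)%E.
  by apply: eq_integral => x _; rewrite add0r.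
rewrite (ge0_normal_affine 0 c0 mA1 A0) (ge0_integral_normal _ _ mA1 A0).
rewrite /normal_prob [RHS]integral_mkcond; apply: eq_integral => x _.
by rewrite patchE indicE; case: ifPn => _; rewrite ?mul1e ?mul0e.
Qed.

End gauss.

(** * Smooth steps built from truncated cubes *)

Section spline.
Context {R : realType}.
Implicit Types x v : R.

Definition cube_pos x : R := Num.max x 0 ^+ 3.

Lemma cube_pos0 x : x <= 0 -> cube_pos x = 0.
Proof. by move=> x0; rewrite /cube_pos max_r// expr0n. Qed.

Lemma cube_posE x : 0 <= x -> cube_pos x = x ^+ 3.
Proof. by move=> x0; rewrite /cube_pos max_l. Qed.

(** Third finite difference of x_+^3 / 6, that is, the primitive of the quadratic B-spline: it rises
    from 0 to 1 on [0, 3]. *)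
Definition spline_step x : R :=
  (cube_pos x - 3 * cube_pos (x - 1) + 3 * cube_pos (x - 2) - cube_pos (x - 3)) / 6.

Let g3 x : R := 3 * Num.max x 0 ^+ 2.
Let h3 x : R := 6 * Num.max x 0.

(** The remainder is exactly v^3 while both points are positive; when 0 is crossed, the missing cube
    is no larger than |v|^3. *)
Lemma cube_pos_taylor x v :
  `|cube_pos (x + v) - cube_pos x - g3 x * v - 2^-1 * h3 x * v ^+ 2| <= `|v| ^+ 3.
Proof.
rewrite /g3 /h3; have [x0|x0] := lerP x 0.
  rewrite (cube_pos0 x0) expr0n/= !mulr0 !mul0r !subr0 /cube_pos.
  have h0 : 0 <= Num.max (x + v) 0 by rewrite le_max lexx orbT.
  rewrite ger0_norm ?exprn_ge0// lerXn2r ?nnegrE// ge_max normr_ge0 andbT.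
  by have := ler_norm v; lra.
rewrite (cube_posE (ltW x0)).
have [xv|xv] := lerP 0 (x + v).
  by rewrite (cube_posE xv) -normrX (_ : _ - _ = v ^+ 3); last by field.
rewrite (cube_pos0 (ltW xv)) (ltr0_norm (x := v)); last lra.
have h1 : (- (x + v)) ^+ 3 <= (- v) ^+ 3 by rewrite lerXn2r ?nnegrE; lra.
have h2 : 0 <= (- (x + v)) ^+ 3 by rewrite exprn_ge0; lra.
rewrite (_ : 0 - _ - _ - _ = (- (x + v)) ^+ 3 - (- v) ^+ 3); last by field.
by rewrite ler0_norm; lra.
Qed.

Let cubes x : (cube_pos x = 0 /\ x <= 0) \/ (cube_pos x = x ^+ 3 /\ 0 <= x).
Proof.
by have [x0|x0] := lerP x 0; [left; rewrite cube_pos0|right; rewrite cube_posE ltW].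
Qed.

Let expand3 x c : (x - c) ^+ 3 = x ^+ 3 - 3 * c * x ^+ 2 + 3 * c ^+ 2 * x - c ^+ 3.
Proof. ring. Qed.

Lemma spline_step_lt0 x : x <= 0 -> spline_step x = 0.
Proof. by move=> x0; rewrite /spline_step !cube_pos0 ?mulr0 ?subr0 ?addr0 ?mul0r//; lra. Qed.

Lemma spline_step_gt3 x : 3 <= x -> spline_step x = 1.
Proof. by move=> x0; rewrite /spline_step !cube_posE; [field|lra..]. Qed.

Lemma spline_step_ge0 x : 0 <= spline_step x <= 1.
Proof.
rewrite /spline_step; have [x0|x0] := lerP x 0.
  by rewrite !cube_pos0; [apply/andP; split; lra|lra..].
have [x1|x1] := lerP x 1.
  rewrite (cube_posE (ltW x0)) !cube_pos0; [|lra..].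
  have h1 : 0 <= x ^+ 3 by rewrite exprn_ge0 ?ltW.
  have h2 : x ^+ 3 <= 1 by apply: exprn_ile1 => //; exact: ltW.
  by apply/andP; split; lra.
have [x2|x2] := lerP x 2.
  rewrite (cube_posE (ltW x0)) (@cube_posE (x - 1)); last lra.
  rewrite !cube_pos0; [|lra..].
  have -> : x ^+ 3 = (x - 1) ^+ 3 + 3 * (x - 1) ^+ 2 + 3 * (x - 1) + 1 by ring.
  have [y0 y1] : 0 <= x - 1 /\ x - 1 <= 1 by lra.
  move: (x - 1) y0 y1 => y y0 y1; rewrite (exprS y 2) expr2; apply/andP; split; nra.
have [x3|x3] := lerP x 3.
  rewrite (cube_posE (ltW x0)) (@cube_posE (x - 1)); last lra.
  rewrite (@cube_posE (x - 2)); last lra.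
  rewrite !cube_pos0; [|lra..].
  have -> : x ^+ 3 - 3 * (x - 1) ^+ 3 + 3 * (x - 2) ^+ 3 - 0 = 6 - (3 - x) ^+ 3 by ring.
  have h1 : 0 <= (3 - x) ^+ 3 by rewrite exprn_ge0; lra.
  have h2 : (3 - x) ^+ 3 <= 1 by apply: exprn_ile1; lra.
  by apply/andP; split; lra.
by rewrite !cube_posE; [|lra..]; rewrite !expand3; apply/andP; split; lra.
Qed.

(** This difference is the cubic B-spline, supported in [0, 4]; the sign is checked on each
    polynomial piece. *)
Lemma spline_bump_ge0 x : 0 <= spline_step x - spline_step (x - 1).
Proof.
rewrite /spline_step.
have -> : x - 1 - 1 = x - 2 by ring.
have -> : x - 1 - 2 = x - 3 by ring.
have -> : x - 1 - 3 = x - 4 by ring.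
have [x0|x0] := lerP x 0.
  by rewrite !cube_pos0; [lra|lra..].
have [x1|x1] := lerP x 1.
  rewrite (cube_posE (ltW x0)) !cube_pos0; [|lra..].
  have h1 : 0 <= x ^+ 3 by rewrite exprn_ge0 ?ltW.
  lra.
have [x2|x2] := lerP x 2.
  rewrite (cube_posE (ltW x0)) (@cube_posE (x - 1)); last lra.
  rewrite !cube_pos0; [|lra..].
  have -> : x ^+ 3 = (x - 1) ^+ 3 + 3 * (x - 1) ^+ 2 + 3 * (x - 1) + 1 by ring.
  have [y0 y1] : 0 <= x - 1 /\ x - 1 <= 1 by lra.
  move: (x - 1) y0 y1 => y y0 y1; rewrite (exprS y 2) expr2; nra.
have [x3|x3] := lerP x 3.
  rewrite (cube_posE (ltW x0)) (@cube_posE (x - 1)); last lra.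
  rewrite (@cube_posE (x - 2)); last lra.
  rewrite !cube_pos0; [|lra..].
  have -> : x ^+ 3 = 27 - 27 * (3 - x) + 9 * (3 - x) ^+ 2 - (3 - x) ^+ 3 by ring.
  have -> : (x - 1) ^+ 3 = 8 - 12 * (3 - x) + 6 * (3 - x) ^+ 2 - (3 - x) ^+ 3 by ring.
  have -> : (x - 2) ^+ 3 = 1 - 3 * (3 - x) + 3 * (3 - x) ^+ 2 - (3 - x) ^+ 3 by ring.
  have [y0 y1] : 0 <= 3 - x /\ 3 - x <= 1 by lra.
  move: (3 - x) y0 y1 => y y0 y1; rewrite (exprS y 2) expr2; nra.
have [x4|x4] := lerP x 4.
  rewrite (@cube_pos0 (x - 4)); last lra.
  rewrite !cube_posE; [|lra..].
  have h1 : 0 <= (4 - x) ^+ 3 by rewrite exprn_ge0; lra.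
  have : x ^+ 3 - 4 * (x - 1) ^+ 3 + 6 * (x - 2) ^+ 3 - 4 * (x - 3) ^+ 3 = (4 - x) ^+ 3 by ring.
  lra.
by rewrite !cube_posE; [|lra..]; rewrite !expand3; lra.
Qed.

(** Regularity is expressed by the Taylor estimate itself, with bounded coefficients g and h
    standing for the two derivatives. This is all that the replacement argument consumes, and it is
    stable under the operations needed without differential calculus. *)
Definition smooth1 (s : R -> R) := exists K g h, [/\ 0 <= K,
  forall x, `|s x| <= K, forall x, `|g x| <= K, forall x, `|h x| <= K &
  forall x v, `|s (x + v) - s x - g x * v - 2^-1 * h x * v ^+ 2| <= K * `|v| ^+ 3].

Lemma smooth1_spline_step : smooth1 spline_step.
Proof.
pose D (f : R -> R) x := (f x - 3 * f (x - 1) + 3 * f (x - 2) - f (x - 3)) / 6.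
have sE x v c : x + v - c = x - c + v by ring.
have T x v : `|spline_step (x + v) - spline_step x - D g3 x * v - 2^-1 * D h3 x * v ^+ 2|
    <= 2 * `|v| ^+ 3.
  have := cube_pos_taylor x v; have := cube_pos_taylor (x - 1) v.
  have := cube_pos_taylor (x - 2) v; have := cube_pos_taylor (x - 3) v.
  rewrite /D /spline_step (sE x v 1) (sE x v 2) (sE x v 3).
  set t := `|v| ^+ 3; have t0 : 0 <= t by rewrite exprn_ge0.
  rewrite !ler_norml => /andP[a1 a2] /andP[b1 b2] /andP[c1 c2] /andP[d1 d2].
  by apply/andP; split; lra.
(* The estimates at v = 1 and v = -1, added and subtracted, isolate the two coefficients, since the
   step has values in [0, 1]. *)
have B x : `|D g3 x| <= 6 /\ `|D h3 x| <= 6.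
  have := T x 1; have := T x (-1); have := spline_step_ge0 x.
  have := spline_step_ge0 (x + 1); have := spline_step_ge0 (x - 1).
  rewrite normrN normr1 !expr1n sqrrN expr1n !ler_norml.
  by move=> /andP[? ?] /andP[? ?] /andP[? ?] /andP[? ?] /andP[? ?]; split; apply/andP; split; lra.
exists 6, (D g3), (D h3); split => //.
- by move=> x; have /andP[? ?] := spline_step_ge0 x; rewrite ger0_norm//; lra.
- by move=> x; have [] := B x.
- by move=> x; have [] := B x.
move=> x v; apply: le_trans (T x v) _; rewrite ler_wpM2r ?exprn_ge0//; lra.
Qed.

Lemma smooth1_lin (s t : R -> R) (a b : R) : smooth1 s -> smooth1 t ->
  smooth1 (fun x => a * s x + b * t x).
Proof.
move=> [K [g [h [K0 sK gK hK T]]]] [K' [g' [h' [K'0 sK' gK' hK' T']]]].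
have ab (u w C C' : R) : `|u| <= C -> `|w| <= C' -> `|a * u + b * w| <= `|a| * C + `|b| * C'.
  move=> uC wC; apply: (le_trans (ler_normD _ _)); rewrite !normrM.
  by apply: lerD; exact: ler_wpM2l.
exists (`|a| * K + `|b| * K'), (fun x => a * g x + b * g' x), (fun x => a * h x + b * h' x).
split; try by move=> x; exact: ab.
  by rewrite addr_ge0// mulr_ge0.
move=> x v.
rewrite (_ : _ - _ = a * (s (x + v) - s x - g x * v - 2^-1 * h x * v ^+ 2) +
  b * (t (x + v) - t x - g' x * v - 2^-1 * h' x * v ^+ 2)); last ring.
rewrite mulrDl -(mulrA `|a|) -(mulrA `|b|); apply: ab; [exact: T|exact: T'].
Qed.

Lemma smooth1_affine (s : R -> R) (a b : R) : smooth1 s -> smooth1 (fun x => s (a * x + b)).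
Proof.
move=> [K [g [h [K0 sK gK hK T]]]].
have e1 : 1 <= 1 + `|a| by rewrite lerDl.
have l1 n : 1 <= (1 + `|a|) ^+ n by rewrite exprn_ege1.
have ln n : (n <= 3)%N -> `|a| ^+ n <= (1 + `|a|) ^+ 3.
  move=> n3; apply: (@le_trans _ _ ((1 + `|a|) ^+ n)); last by rewrite ler_weXn2l.
  by rewrite lerXn2r ?nnegrE// ?addr_ge0// lerDr.
exists (K * (1 + `|a|) ^+ 3), (fun x => g (a * x + b) * a), (fun x => h (a * x + b) * a ^+ 2).
split.
- by rewrite mulr_ge0// exprn_ge0// addr_ge0.
- by move=> x; rewrite -[leLHS]mulr1; apply: ler_pM => //; exact: l1.
- move=> x; rewrite normrM; apply: ler_pM => //; by have := ln 1%N isT; rewrite expr1.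
- by move=> x; rewrite normrM normrX; apply: ler_pM => //; exact: ln.
move=> x v; have := T (a * x + b) (a * v).
have -> : a * (x + v) + b = a * x + b + a * v by ring.
have -> : g (a * x + b) * (a * v) = g (a * x + b) * a * v by ring.
have -> : 2^-1 * h (a * x + b) * (a * v) ^+ 2 = 2^-1 * (h (a * x + b) * a ^+ 2) * v ^+ 2 by ring.
move=> h0; apply: le_trans h0 _; rewrite normrM exprMn mulrA ler_wpM2r ?exprn_ge0//.
by rewrite ler_wpM2l//; exact: ln.
Qed.

Lemma smooth1_cst (c : R) : smooth1 (fun=> c).
Proof.
exists `|c|, (fun=> 0), (fun=> 0); split => //; try by move=> x; rewrite normr0.
by move=> x v; rewrite !(mulr0, mul0r, subr0) subrr normr0 mulr_ge0// exprn_ge0.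
Qed.

End spline.

(** * Positive semidefinite matrices as sums of rank one squares *)

Section psd.
Context {R : realType} {d : nat}.
Implicit Types (A S : 'M[R]_d) (x y v : 'cV[R]_d).

Lemma dotC x y : dot x y = dot y x.
Proof. by rewrite !dotE; apply: eq_bigr => j _; rewrite mulrC. Qed.

Lemma dotDl x y v : dot (x + y) v = dot x v + dot y v.
Proof. by rewrite dotC dotD !(dotC v). Qed.

Lemma dotZl a x v : dot (a *: x) v = a * dot x v.
Proof. by rewrite dotC dotZ dotC. Qed.

Lemma dot_sym A x y : A^T = A -> dot x (A *m y) = dot y (A *m x).
Proof.
move=> AT; rewrite dotC /dot trmx_mul AT -mulmxA.
by [].
Qed.

Lemma dot_basisl i x : dot (basisv i) x = x i 0.
Proof.
rewrite dotE (bigD1 i)//= big1 ?addr0; first by rewrite mxE !eqxx mul1r.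
by move=> j ji; rewrite mxE (negbTE ji) mul0r.
Qed.

Lemma mul_basis A i j : (A *m basisv i) j 0 = A j i.
Proof.
rewrite mxE (bigD1 i)//= big1 ?addr0; first by rewrite mxE !eqxx mulr1.
by move=> k ki; rewrite mxE (negbTE ki) mulr0.
Qed.

(** Symmetric elimination. Subtracting v v^T with v = A e_i / sqrt(A_ii) kills the diagonal entry at
    i and keeps zero the diagonal entries that were zero, so their number grows. Once the diagonal
    is zero, the form at e_i + e_j and e_i - e_j forces A = 0. *)
Lemma psd_decomp A : A^T = A -> (forall x, 0 <= dot x (A *m x)) ->
  exists l : seq 'cV[R]_d, forall i j, A i j = \sum_(v <- l) v i 0 * v j 0.
Proof.
have [n] := ubnP #|[pred i | A i i != 0]|; elim: n A => // n IH A An AT A0.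
have diag0 i : dot (basisv i) (A *m basisv i) = A i i by rewrite dot_basisl mul_basis.
have [Z|/existsNP[i /eqP Ai]] := pselect (forall i, A i i = 0).
  exists [::] => i j; rewrite big_nil; apply/eqP; rewrite eq_le; apply/andP.
  have q t : dot (basisv i + t *: basisv j) (A *m (basisv i + t *: basisv j)) = 2 * t * A i j.
    rewrite mulmxDr -scalemxAr !(dotD, dotZ, dotDl, dotZl) !diag0 !Z.
    rewrite [dot (basisv j) _](dot_sym _ _ AT) !dot_basisl mul_basis; ring.
  by have := A0 (basisv i + 1 *: basisv j); have := A0 (basisv i + (-1) *: basisv j);
    rewrite !q; split; lra.
have Aii : 0 < A i i by rewrite lt_neqAle eq_sym Ai -diag0 A0.
set a := A i i in Aii Ai.
have s0 : 0 < Num.sqrt a by rewrite sqrtr_gt0.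
pose v : 'cV[R]_d := (Num.sqrt a)^-1 *: (A *m basisv i).
have vE j : v j 0 = (Num.sqrt a)^-1 * A j i by rewrite mxE mul_basis.
have vv j k : v j 0 * v k 0 = A j i * A k i / a.
  by rewrite !vE mulrACA -invfM -expr2 sqr_sqrtr ?ltW// mulrC.
pose A' := A - v *m v^T.
have A'E j k : A' j k = A j k - A j i * A k i / a.
  have vvE : (v *m v^T) j k = v j 0 * v k 0 by rewrite [LHS]mxE big_ord1 [v^T _ _]mxE.
  by rewrite [A' _ _]mxE [X in _ + X]mxE vvE vv.
have A'T : A'^T = A'.
  apply/matrixP => j k; rewrite [LHS]mxE !A'E.
  have -> : A k j = A j k by rewrite -{1}AT mxE.
  by rewrite [A k i * _]mulrC.
(* The form of A' at x is the form of A at x - (c/a) e_i, by completing the square. *)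
have A'0 x : 0 <= dot x (A' *m x).
  pose c := dot x (A *m basisv i).
  have := A0 (x + (- (c / a)) *: basisv i).
  rewrite mulmxDr -scalemxAr !(dotD, dotZ, dotDl, dotZl) diag0 -/a.
  rewrite [dot (basisv i) (A *m x)](dot_sym _ _ AT) -/c.
  have -> : dot x (A' *m x) = dot x (A *m x) - c ^+ 2 / a.
    rewrite mulmxBl dotE; under eq_bigr do rewrite mxE mulrDr.
    rewrite big_split/= -dotE; congr (_ + _).
    have -> : (- (v *m v^T *m x) = (- dot v x) *: v).
      apply/matrixP => j k; rewrite ord1 -mulmxA [LHS]mxE [X in - X]mxE big_ord1.
      by rewrite [RHS]mxE -/(dot v x) mulNr [dot v x * _]mulrC.
    under eq_bigr do rewrite -[X in X * _]/(x _ 0).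
    rewrite -[LHS]dotE dotZ /v dotZ dotZl [dot (A *m _) x]dotC -/c.
    have sa : a = Num.sqrt a ^+ 2 by rewrite sqr_sqrtr// ltW.
    by rewrite [in RHS]sa; field; rewrite gt_eqF.
  move=> h; apply: le_trans h _; rewrite le_eqVlt; apply/orP; left; apply/eqP; by field.
have [|//|//|l lE] := IH A'.
  have i_in : i \in [pred i | A i i != 0] by rewrite inE.
  rewrite (cardD1 i) i_in/= add1n ltnS in An.
  apply: leq_ltn_trans An; apply: subset_leq_card; apply/fintype.subsetP => j; rewrite !inE => Aj.
  apply/andP; split; apply: contraNneq Aj.
    by move=> ->; rewrite A'E -/a mulfK// subrr.
  move=> Aj; rewrite eq_le; apply/andP; split.
    have Aji : 0 <= A j i * A j i by rewrite -expr2 sqr_ge0.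
    by rewrite A'E Aj sub0r oppr_le0 divr_ge0// ltW.
  by have := A'0 (basisv j); rewrite dot_basisl mul_basis.
exists (v :: l) => j k; rewrite big_cons -lE A'E vv; ring.
Qed.

Lemma posdef_unit S : posdef S -> S \in unitmx.
Proof.
move=> [ST S0]; rewrite -row_free_unit -kermx_eq0; apply/rowV0P => v /sub_kermxP vS.
apply/eqP; apply: contraT => v0.
have vT0 : v^T != 0 by apply: contraNneq v0 => /(congr1 trmx); rewrite trmxK trmx0 => ->.
by have := S0 _ vT0; rewrite trmxK vS mul0mx mxE ltxx.
Qed.

Lemma posdef_inv S : posdef S -> [/\ (invmx S)^T = invmx S,
  forall a, a != 0 -> 0 < dot a (invmx S *m a)
  & forall a, 0 <= dot a (invmx S *m a)].
Proof.
move=> pS; have uS := posdef_unit pS; have [ST S0] := pS.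
have h a : a != 0 -> 0 < dot a (invmx S *m a).
  move=> a0; have Wa0 : invmx S *m a != 0.
    by apply: contraNneq a0 => h; rewrite -[a]mul1mx -(mulmxV uS) -mulmxA h mulmx0.
  have := S0 _ Wa0; rewrite -!mulmxA mulKVmx// => h.
  by rewrite dotC /dot.
split => //; first by rewrite trmx_inv ST.
move=> a; have [->|/h/ltW//] := eqVneq a 0.
by rewrite mulmx0 /dot mulmx0 mxE.
Qed.

Lemma posdef_inv_decomp S : posdef S -> exists l : seq 'cV[R]_d,
  (forall i j, invmx S i j = \sum_(v <- l) v i 0 * v j 0) /\
  is_mvnormal (gauss l) 0 (invmx S).
Proof.
move=> pS; have [WT W1 W0] := posdef_inv pS.
have [l lE] := psd_decomp WT W0; exists l; split => //.
apply: gauss_mvnormal => // a.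
rewrite dotE; under eq_bigr do rewrite mxE mulr_sumr.
under eq_bigr do under eq_bigr do rewrite lE mulr_suml mulr_sumr.
transitivity (\sum_(v <- l) \sum_i \sum_j (a i 0 * v i 0) * (a j 0 * v j 0)).
  under eq_bigr do rewrite exchange_big/=.
  rewrite exchange_big/=; apply: eq_bigr => v _; apply: eq_bigr => i _; apply: eq_bigr => j _; ring.
apply: eq_bigr => v _; rewrite expr2 {1}dotE mulr_suml; apply: eq_bigr => i _.
by rewrite dotE mulr_sumr.
Qed.

End psd.

(** * Test functions on R^d with a second order Taylor estimate *)

Section smooth.
Context {R : realType} {d : nat}.
Implicit Types (z v : 'cV[R]_d) (h : 'cV[R]_d -> R).
Let D : R := d%:R.

Definition lin (G : 'I_d -> R) v : R := \sum_j G j * v j 0.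
Definition quad (H : 'I_d -> 'I_d -> R) v : R := \sum_i \sum_j H i j * v i 0 * v j 0.

(** The analogue of [smooth1] in d variables, with G and H in the place of gradient and Hessian. *)
Definition smooth h := exists K G H, [/\ 0 <= K,
  forall z, `|h z| <= K, forall z j, `|G z j| <= K, forall z i j, `|H z i j| <= K &
  forall z v, `|h (z + v) - h z - lin (G z) v - 2^-1 * quad (H z) v| <= K * `|v| ^+ 3].

Lemma lin_bound (G : 'I_d -> R) K v : 0 <= K -> (forall j, `|G j| <= K) ->
  `|lin G v| <= K * D * `|v|.
Proof.
move=> K0 GK; apply: le_trans (sum_norm_le K0 GK (coord_le_norm v)) _.
by rewrite /D le_eqVlt; apply/orP; left; apply/eqP; ring.
Qed.

Lemma quad_bound (H : 'I_d -> 'I_d -> R) K v : 0 <= K -> (forall i j, `|H i j| <= K) ->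
  `|quad H v| <= K * D ^+ 2 * `|v| ^+ 2.
Proof.
move=> K0 HK; rewrite /quad; apply: (le_trans (ler_norm_sum _ _ _)).
apply: (@le_trans _ _ (\sum_(i < d) (D * (K * `|v| * `|v|)))); last first.
  rewrite sumr_const card_ord -mulr_natl -/D le_eqVlt; apply/orP; left; apply/eqP; ring.
apply: ler_sum => i _; apply: sum_norm_le (coord_le_norm v); first by rewrite mulr_ge0.
by move=> j; rewrite normrM ler_pM// coord_le_norm.
Qed.

(** For each factor, a, b, c are the terms of order 0, 1, 2 and x is the displaced value. For t <= 1
    the product of the expansions is regrouped so that every leftover has order 3; for t > 1 each
    term is bounded by itself, lower powers of t being below t^3. *)
Let prod_taylor (K E t a1 b1 c1 x1 a2 b2 c2 x2 : R) : 0 <= K -> 1 <= E -> 0 <= t ->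
  `|a1| <= K -> `|a2| <= K -> `|x1| <= K -> `|x2| <= K ->
  `|b1| <= K * E * t -> `|b2| <= K * E * t ->
  `|c1| <= K * E * t ^+ 2 -> `|c2| <= K * E * t ^+ 2 ->
  `|x1 - a1 - b1 - c1| <= K * t ^+ 3 -> `|x2 - a2 - b2 - c2| <= K * t ^+ 3 ->
  `|x1 * x2 - a1 * a2 - (a1 * b2 + a2 * b1) - (a1 * c2 + a2 * c1 + b1 * b2)|
   <= 8 * E ^+ 2 * K ^+ 2 * t ^+ 3.
Proof.
move=> K0 E1 t0 A1 A2 X1 X2 B1 B2 C1 C2 R1 R2.
have E0 : 0 <= E by lra.
have KE0 : 0 <= K * E by rewrite mulr_ge0.
have K20 : 0 <= K ^+ 2 by rewrite exprn_ge0.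
have nM (x y u w : R) : `|x| <= u -> `|y| <= w -> `|x * y| <= u * w.
  by move=> xu yw; rewrite normrM ler_pM.
have nD (x y u w : R) : `|x| <= u -> `|y| <= w -> `|x + y| <= u + w.
  by move=> xu yw; apply: (le_trans (ler_normD _ _)); exact: lerD.
have nN (x u : R) : `|x| <= u -> `|- x| <= u by rewrite normrN.
have EE : E <= E ^+ 2 by rewrite expr2 ler_peMl.
have EE1 : 1 <= E ^+ 2 by lra.
have [t1|t1] := lerP t 1.
  set r1 := x1 - a1 - b1 - c1 in R1; set r2 := x2 - a2 - b2 - c2 in R2.
  have -> : x1 * x2 - a1 * a2 - (a1 * b2 + a2 * b1) - (a1 * c2 + a2 * c1 + b1 * b2) =
    a1 * r2 + r1 * x2 + b1 * (c2 + r2) + c1 * (b2 + (c2 + r2)) by rewrite /r1 /r2; ring.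
  have t2 : t ^+ 2 <= t by rewrite expr2 ler_piMl.
  have t3 : t ^+ 3 <= t ^+ 2 by rewrite exprS ler_piMl// exprn_ge0.
  have t30 : 0 <= t ^+ 3 by rewrite exprn_ge0.
  have C2' : `|c2 + r2| <= 2 * K * E * t ^+ 2.
    apply: le_trans (nD _ _ _ _ C2 R2) _.
    have : K * t ^+ 3 <= K * E * t ^+ 2 by apply: ler_pM => //; rewrite ler_peMr.
    lra.
  have B2' : `|b2 + (c2 + r2)| <= 3 * K * E * t.
    apply: le_trans (nD _ _ _ _ B2 C2') _.
    have : K * E * t ^+ 2 <= K * E * t by rewrite ler_wpM2l.
    lra.
  apply: le_trans (nD _ _ _ _ (nD _ _ _ _ (nD _ _ _ _ (nM _ _ _ _ A1 R2) (nM _ _ _ _ R1 X2))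
    (nM _ _ _ _ B1 C2')) (nM _ _ _ _ C1 B2')) _.
  have -> : K * (K * t ^+ 3) + K * t ^+ 3 * K + K * E * t * (2 * K * E * t ^+ 2) +
    K * E * t ^+ 2 * (3 * K * E * t) = (2 + 5 * E ^+ 2) * (K ^+ 2 * t ^+ 3) by ring.
  have -> : 8 * E ^+ 2 * K ^+ 2 * t ^+ 3 = (8 * E ^+ 2) * (K ^+ 2 * t ^+ 3) by ring.
  by apply: ler_wpM2r; [rewrite mulr_ge0|lra].
have t2 : t <= t ^+ 2 by rewrite expr2 ler_peMl// ltW.
have t3 : t ^+ 2 <= t ^+ 3 by rewrite [leRHS]exprS ler_peMl ?exprn_ge0// ltW.
have t31 : 1 <= t ^+ 3 by lra.
rewrite -!addrA; apply: le_trans (nD _ _ _ _ (nM _ _ _ _ X1 X2) (nD _ _ _ _ (nN _ _ (nM _ _ _ _ A1 A2))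
  (nD _ _ _ _ (nN _ _ (nD _ _ _ _ (nM _ _ _ _ A1 B2) (nM _ _ _ _ A2 B1)))
   (nN _ _ (nD _ _ _ _ (nM _ _ _ _ A1 C2) (nD _ _ _ _ (nM _ _ _ _ A2 C1) (nM _ _ _ _ B1 B2))))))) _.
have -> : K * K + (K * K + (K * (K * E * t) + K * (K * E * t) + (K * (K * E * t ^+ 2) +
   (K * (K * E * t ^+ 2) + K * E * t * (K * E * t))))) =
   K ^+ 2 * (2 + 2 * E * t + 2 * E * t ^+ 2 + E ^+ 2 * t ^+ 2) by ring.
have -> : 8 * E ^+ 2 * K ^+ 2 * t ^+ 3 = K ^+ 2 * (8 * E ^+ 2 * t ^+ 3) by ring.
apply: ler_wpM2l => //.
have h1 : E * t <= E ^+ 2 * t ^+ 3 by apply: ler_pM => //; lra.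
have h2 : E * t ^+ 2 <= E ^+ 2 * t ^+ 3 by apply: ler_pM => //; rewrite ?exprn_ge0.
have h3 : E ^+ 2 * t ^+ 2 <= E ^+ 2 * t ^+ 3 by rewrite ler_wpM2l//; lra.
have h4 : 1 * 1 <= E ^+ 2 * t ^+ 3 by apply: ler_pM.
lra.
Qed.

Lemma smooth_mul h1 h2 : smooth h1 -> smooth h2 -> smooth (fun z => h1 z * h2 z).
Proof.
move=> [K1 [G1 [H1 [K10 hK1 GK1 HK1 T1]]]] [K2 [G2 [H2 [K20 hK2 GK2 HK2 T2]]]].
pose K := Num.max K1 K2.
have K1K : K1 <= K by rewrite le_max lexx.
have K2K : K2 <= K by rewrite le_max lexx orbT.
have K0 : 0 <= K by exact: le_trans K1K.
(* Dominates both D and D^2, the dimensional factors of [lin_bound] and [quad_bound]. *)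
pose E := (1 + D) ^+ 2.
have D0 : 0 <= D by rewrite /D.
have E1 : 1 <= E by rewrite /E exprn_ege1// lerDl.
have DE : D <= E by rewrite /E sqrrD; have := sqr_ge0 D; lra.
have DE2 : D ^+ 2 <= E by rewrite /E sqrrD; lra.
have nM (x y : R) : `|x| <= K -> `|y| <= K -> `|x * y| <= K ^+ 2.
  by move=> xu yw; rewrite normrM expr2 ler_pM.
have hK1' z : `|h1 z| <= K by exact: le_trans K1K.
have hK2' z : `|h2 z| <= K by exact: le_trans K2K.
have GK1' z j : `|G1 z j| <= K by exact: le_trans K1K.
have GK2' z j : `|G2 z j| <= K by exact: le_trans K2K.
have HK1' z i j : `|H1 z i j| <= K by exact: le_trans K1K.
have HK2' z i j : `|H2 z i j| <= K by exact: le_trans K2K.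
have KK : 0 <= K ^+ 2 by exact: sqr_ge0.
have EK : 8 * K ^+ 2 <= 8 * E ^+ 2 * K ^+ 2.
  by rewrite ler_wpM2r// ler_peMr// exprn_ege1.
exists (8 * E ^+ 2 * K ^+ 2), (fun z j => h1 z * G2 z j + h2 z * G1 z j),
  (fun z i j => h1 z * H2 z i j + h2 z * H1 z i j + (G1 z i * G2 z j + G2 z i * G1 z j)).
split.
- by apply: le_trans EK; rewrite mulr_ge0.
- move=> z; apply: le_trans (nM _ _ (hK1' z) (hK2' z)) _; lra.
- move=> z j; apply: le_trans (ler_normD _ _) _.
  have := nM _ _ (hK1' z) (GK2' z j); have := nM _ _ (hK2' z) (GK1' z j); lra.
- move=> z i j; apply: le_trans (ler_normD _ _) _.
  have a1 := ler_normD (h1 z * H2 z i j) (h2 z * H1 z i j).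
  have a2 := ler_normD (G1 z i * G2 z j) (G2 z i * G1 z j).
  have := nM _ _ (hK1' z) (HK2' z i j); have := nM _ _ (hK2' z) (HK1' z i j).
  have := nM _ _ (GK1' z i) (GK2' z j); have := nM _ _ (GK2' z i) (GK1' z j); lra.
move=> z v.
have linE : lin (fun j => h1 z * G2 z j + h2 z * G1 z j) v =
    h1 z * lin (G2 z) v + h2 z * lin (G1 z) v.
  rewrite /lin !mulr_sumr -big_split; apply: eq_bigr => j _ /=; ring.
have quadE : 2^-1 * quad (fun i j => h1 z * H2 z i j + h2 z * H1 z i j + (G1 z i * G2 z j + G2 z i * G1 z j)) v =
    h1 z * (2^-1 * quad (H2 z) v) + h2 z * (2^-1 * quad (H1 z) v) + lin (G1 z) v * lin (G2 z) v.
  have -> : lin (G1 z) v * lin (G2 z) v = 2^-1 * (lin (G1 z) v * lin (G2 z) v + lin (G2 z) v * lin (G1 z) v) by field.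
  have e (a b : 'I_d -> R) : lin a v * lin b v = quad (fun i j => a i * b j) v.
    rewrite /lin /quad mulr_suml; apply: eq_bigr => i _; rewrite mulr_sumr; apply: eq_bigr => j _; ring.
  rewrite !e mulrCA [h2 z * _]mulrCA -!mulrDr; congr (_ * _).
  rewrite /quad !mulr_sumr -!big_split; apply: eq_bigr => i _ /=.
  rewrite !mulr_sumr -!big_split; apply: eq_bigr => j _ /=; ring.
rewrite linE quadE; apply: prod_taylor => //.
- apply: le_trans (lin_bound v K0 (GK1' z)) _; rewrite ler_wpM2r// ler_wpM2l//.
- apply: le_trans (lin_bound v K0 (GK2' z)) _; rewrite ler_wpM2r// ler_wpM2l//.
- have b := quad_bound v K0 (HK1' z); rewrite normrM ger0_norm ?invr_ge0//.
  apply: (@le_trans _ _ (K * D ^+ 2 * `|v| ^+ 2)); first by have := normr_ge0 (quad (H1 z) v); lra.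
  by rewrite ler_wpM2r ?exprn_ge0// ler_wpM2l.
- have b := quad_bound v K0 (HK2' z); rewrite normrM ger0_norm ?invr_ge0//.
  apply: (@le_trans _ _ (K * D ^+ 2 * `|v| ^+ 2)); first by have := normr_ge0 (quad (H2 z) v); lra.
  by rewrite ler_wpM2r ?exprn_ge0// ler_wpM2l.
- by apply: le_trans (T1 z v) _; rewrite ler_wpM2r ?exprn_ge0.
- by apply: le_trans (T2 z v) _; rewrite ler_wpM2r ?exprn_ge0.
Qed.

Lemma smooth_add h1 h2 : smooth h1 -> smooth h2 -> smooth (fun z => h1 z + h2 z).
Proof.
move=> [K1 [G1 [H1 [K10 hK1 GK1 HK1 T1]]]] [K2 [G2 [H2 [K20 hK2 GK2 HK2 T2]]]].
have nD (x y u w : R) : `|x| <= u -> `|y| <= w -> `|x + y| <= u + w.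
  by move=> xu yw; apply: (le_trans (ler_normD _ _)); exact: lerD.
exists (K1 + K2), (fun z j => G1 z j + G2 z j), (fun z i j => H1 z i j + H2 z i j).
split; [by rewrite addr_ge0|by move=> z; exact: nD|by move=> z j; exact: nD|
  by move=> z i j; exact: nD|].
move=> z v.
have -> : lin (fun j => G1 z j + G2 z j) v = lin (G1 z) v + lin (G2 z) v.
  rewrite /lin -big_split; apply: eq_bigr => j _ /=; ring.
have -> : quad (fun i j => H1 z i j + H2 z i j) v = quad (H1 z) v + quad (H2 z) v.
  rewrite /quad -!big_split; apply: eq_bigr => i _ /=.
  rewrite -!big_split; apply: eq_bigr => j _ /=; ring.
have := nD _ _ _ _ (T1 z v) (T2 z v); rewrite -mulrDl; congr (`|_| <= _); ring.
Qed.

Lemma smooth_cst (c : R) : smooth (fun=> c).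
Proof.
exists `|c|, (fun _ _ => 0), (fun _ _ _ => 0); split=> //; try by move=> *; rewrite normr0.
move=> z v; rewrite /lin /quad.
have -> : \sum_(j < d) 0 * v j 0 = 0 by rewrite big1// => j _; rewrite mul0r.
rewrite [X in 2^-1 * X]big1; last by move=> i _; rewrite big1// => j _; rewrite !mul0r.
by rewrite mulr0 !subr0 subrr normr0 mulr_ge0// exprn_ge0.
Qed.

Lemma smooth_coord (s : R -> R) (j : 'I_d) : smooth1 s -> smooth (fun z => s (z j 0)).
Proof.
move=> [K [g [h [K0 sK gK hK T]]]].
exists K, (fun z i => if i == j then g (z j 0) else 0),
  (fun z i k => if (i == j) && (k == j) then h (z j 0) else 0); split=> //.
- by move=> z i; case: ifP => // _; rewrite normr0.
- by move=> z i k; case: ifP => // _; rewrite normr0.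
move=> z v.
have -> : lin (fun i => if i == j then g (z j 0) else 0) v = g (z j 0) * v j 0.
  by rewrite /lin (bigD1 j)//= eqxx big1 ?addr0// => i /negbTE ->; rewrite mul0r.
have -> : quad (fun i k => if (i == j) && (k == j) then h (z j 0) else 0) v = h (z j 0) * v j 0 ^+ 2.
  rewrite /quad (bigD1 j)//= [X in _ + X]big1 ?addr0; last first.
    by move=> i /negbTE ->; rewrite big1// => k _; rewrite !mul0r.
  rewrite (bigD1 j)//= !eqxx big1 ?addr0; last by move=> i /negbTE ->; rewrite !mul0r.
  by rewrite expr2 mulrA.
rewrite mxE mulrA; apply: le_trans (T _ _) _; rewrite ler_wpM2l//.
by rewrite lerXn2r ?nnegrE// coord_le_norm.
Qed.

Lemma smooth_sum I (r : seq I) (F : I -> 'cV[R]_d -> R) : (forall i, smooth (F i)) ->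
  smooth (fun z => \sum_(i <- r) F i z).
Proof.
move=> sF; elim: r => [|i r IH].
  by under eq_fun do rewrite big_nil; exact: smooth_cst.
by under eq_fun do rewrite big_cons; exact: smooth_add.
Qed.

Lemma smooth_prod I (r : seq I) (F : I -> 'cV[R]_d -> R) : (forall i, smooth (F i)) ->
  smooth (fun z => \prod_(i <- r) F i z).
Proof.
move=> sF; elim: r => [|i r IH].
  by under eq_fun do rewrite big_nil; exact: smooth_cst.
by under eq_fun do rewrite big_cons; exact: smooth_mul.
Qed.

Lemma smooth_bounded h : smooth h -> exists2 K, 0 <= K & forall z, `|h z| <= K.
Proof. by move=> [K [G [H [K0 hK _ _ _]]]]; exists K. Qed.

(** Increments of norm at most 1 are controlled by the Taylor estimate, larger ones by
    boundedness. *)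
Lemma smooth_lipschitz h : smooth h ->
  exists2 C, 0 < C & forall z v, `|h (z + v) - h z| <= C * `|v|.
Proof.
move=> [K [G [H [K0 hK GK HK T]]]].
have D0 : 0 <= D by rewrite /D.
exists (K * (D + D ^+ 2 + 3) + 1); first by rewrite ltr_wpDl// mulr_ge0// !addr_ge0// exprn_ge0.
move=> z v; set t := `|v|; have t0 : 0 <= t by rewrite /t.
have Kt : 0 <= K * t by rewrite mulr_ge0.
have KDt : 0 <= K * D * t by rewrite !mulr_ge0.
have KD2t : 0 <= K * D ^+ 2 * t by rewrite !mulr_ge0// exprn_ge0.
have [t1|t1] := lerP t 1.
  have := T z v; have := lin_bound v K0 (GK z); have := quad_bound v K0 (HK z).
  rewrite -/t => q l T'.
  have t2 : K * D ^+ 2 * t ^+ 2 <= K * D ^+ 2 * t.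
    by rewrite ler_wpM2l ?mulr_ge0 ?exprn_ge0// expr2 ler_piMl.
  have t3 : K * t ^+ 3 <= K * t.
    by rewrite ler_wpM2l// exprS ler_piMr// exprn_ile1.
  move: q l T'; rewrite !ler_norml => /andP[q1 q2] /andP[l1 l2] /andP[T1 T2].
  by apply/andP; split; nra.
have := hK (z + v); have := hK z; rewrite !ler_norml => /andP[a1 a2] /andP[b1 b2].
have K1 : K * 1 <= K * t by rewrite ler_wpM2l// ltW.
by apply/andP; split; nra.
Qed.

Lemma smooth_continuous h : smooth h -> continuous h.
Proof.
move=> /smooth_lipschitz[C C0 L] z.
apply: (iffRL (@cvgrPdist_lt _ R^o _ (nbhs z) _ h (h z))) => e e0.
have eC : 0 < e / C by rewrite divr_gt0.
apply/nbhs_ballP; exists (e / C) => //= w; rewrite -ball_normE /= => zw.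
have -> : w = z + (w - z) by rewrite addrC subrK.
rewrite distrC; apply: le_lt_trans (L _ _) _.
by rewrite -ltr_pdivlMl// mulrC distrC.
Qed.

Lemma smooth_measurable h : smooth h -> measurable_fun setT (h : borelV R d -> R).
Proof. by move=> /smooth_continuous; exact: continuous_borelV. Qed.

End smooth.

(** Heine's theorem in a form where only z has to lie in the box. The compactness used is that of a
    box of row vectors, hence the transposes. *)
Lemma continuous_unif_box (R : realType) (d : nat) (h : 'cV[R]_d -> R) (A e : R) :
  continuous h -> 0 < e ->
  exists2 r : R, 0 < r & forall z w, `|z| <= A -> `|z - w| < r -> `|h z - h w| <= e.
Proof.
move=> ch e0.
have cbox : compact [set v : 'rV[R]_d | forall i, `[- A, A]%classic (v ord0 i)].
  by apply: (@rV_compact R d (fun=> `[- A, A]%classic)) => i; exact: (@segment_compact R (- A) A).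
have trnorm (x : 'rV[R]_d) : `|x^T| = `|x|.
  apply/eqP; rewrite eq_le; apply/andP; split.
    apply: norm_le_coord => // j; rewrite mxE [leRHS]mx_normrE.
    exact: (le_bigmax _ (fun ij : 'I_1 * 'I_d => `|x ij.1 ij.2|) (0, j)).
  rewrite [leLHS]mx_normrE; apply: bigmax_le => // -[i j] _ /=.
  by have := coord_le_norm x^T j; rewrite mxE ord1.
move/compact_near_coveringP : cbox.
move=> /(_ R (0^'+) (fun r x => forall w, `|x^T - w| < r -> `|h x^T - h w| <= e) _).
case=> [x _|r /= r0 Hr].
  have e20 : 0 < e / 2 by rewrite divr_gt0.
  have /nbhs_ballP[r /= r0 rP] : nbhs (x^T : 'cV[R]_d) [set w | `|h x^T - h w| < e / 2].
    exact: (iffLR (@cvgrPdist_lt _ R^o _ (nbhs (x^T : 'cV[R]_d)) _ h (h x^T)) (ch x^T) _ e20).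
  have r20 : 0 < r / 2 by rewrite divr_gt0.
  exists (ball x (r / 2), [set t | t < r / 2]).
    split; first exact: nbhsx_ballx.
    exact: nbhs_right_lt.
  move=> [y t] /= [xy tr] w yw; rewrite -ball_normE /= in xy.
  have hy : `|h x^T - h y^T| < e / 2.
    apply: rP; rewrite -ball_normE /= -linearB/= trnorm.
    by apply: lt_trans xy _; rewrite ltr_pdivrMr// ltr_pMr// ltr1n.
  have hw : `|h x^T - h w| < e / 2.
    apply: rP; rewrite -ball_normE /= -(subrKA y^T) (splitr r).
    apply: le_lt_trans (ler_normD _ _) _; apply: ltrD; first by rewrite -linearB/= trnorm.
    exact: lt_trans tr.
  rewrite -(subrKA (h x^T)) (splitr e); apply: le_trans (ler_normD _ _) _.
  by apply: lerD; apply: ltW => //; rewrite distrC.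
exists (r / 2); first by rewrite divr_gt0.
move=> z w zA zw.
have r2 : 0 < r / 2 by rewrite divr_gt0.
have r2r : r / 2 < r by rewrite ltr_pdivrMr// ltr_pMr// ltr1n.
have br : ball_ Num.norm 0 r (r / 2) by rewrite /= sub0r normrN gtr0_norm.
have := Hr _ br r2 z^T; rewrite trmxK; apply => // i /=; rewrite in_itv/= mxE -ler_norml.
exact: le_trans (coord_le_norm _ _) zA.
Qed.

(** * Approximation of bounded continuous functions by test functions *)

Section approx.
Context {R : realType} {d : nat}.
Local Notation s := (@spline_step R).

(** [psi B i] is the cubic B-spline bump moved to [i - B, i - B + 4]. The 2 B bumps telescope to the
    plateau [rho B], which is 1 for |x| <= B - 3. *)
Let psi (B : nat) (i : nat) (x : R) := s (x + B%:R - i%:R) - s (x + B%:R - i%:R - 1).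
Let rho (B : nat) (x : R) := s (x + B%:R) - s (x - B%:R).

Let psi_ge0 B i x : 0 <= psi B i x.
Proof. exact: spline_bump_ge0. Qed.

Let psi_supp B i x : psi B i x != 0 -> `|i%:R - B%:R - x| <= 4.
Proof.
rewrite /psi => h.
have [h1|h1] := lerP (x + B%:R - i%:R) 0.
  by rewrite !spline_step_lt0 ?subrr ?eqxx// in h; lra.
have [h2|h2] := lerP 3 (x + B%:R - i%:R - 1).
  by rewrite !spline_step_gt3 ?subrr ?eqxx// in h; lra.
by rewrite ler_norml; apply/andP; split; lra.
Qed.

Let psi_sum B x : \sum_(i < (2 * B)%N) psi B i x = rho B x.
Proof.
rewrite -(big_mkord predT (fun i => psi B i x)) /psi /rho.
transitivity (\sum_(0 <= i < (2 * B)%N) (- s (x + B%:R - i.+1%:R) - - s (x + B%:R - i%:R))).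
  apply: eq_bigr => i _; rewrite opprK [RHS]addrC; congr (_ - s _).
  by rewrite -addn1 natrD; ring.
rewrite telescope_sumr// opprK addrC subr0; congr (_ - s _).
by rewrite mul2n -addnn natrD; ring.
Qed.

Let rho01 B x : 0 <= rho B x <= 1.
Proof.
apply/andP; split; first by rewrite -psi_sum sumr_ge0.
rewrite /rho; have /andP[_ h1] := spline_step_ge0 (x + B%:R).
have /andP[h2 _] := spline_step_ge0 (x - B%:R); lra.
Qed.

Let rho_eq1 B x : `|x| <= B%:R - 3 -> rho B x = 1.
Proof.
rewrite ler_norml => /andP[h1 h2].
by rewrite /rho spline_step_gt3 ?spline_step_lt0 ?subr0//; lra.
Qed.

(** g samples h at the nodes of a grid and glues the values with products of bumps, and [chi] is the
    sum of these weights. The last clause bounds the defect of [chi] by second moments, which turns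
    a bound on the variance of the limit into tightness. *)
Lemma smooth_approx (h : 'cV[R]_d -> R) (M e : R) : continuous h -> (forall z, `|h z| <= M) ->
  0 < e -> exists g chi : 'cV[R]_d -> R, [/\ smooth g, smooth chi,
    forall z, chi z <= 1,
    forall z, `|h z - g z| <= M * (1 - chi z) + e &
    forall z, 1 - chi z <= e * \sum_j z j 0 ^+ 2].
Proof.
move=> ch hM e0.
have M0 : 0 <= M := le_trans (normr_ge0 _) (hM 0).
(* Chosen so that e A^2 >= 1: outside the box of half-side A the bound on 1 - [chi] is then
   trivial. *)
pose A := (Num.trunc (1 + e^-1)).+1.
have Ae : 1 <= e * A%:R ^+ 2.
  have h1 : 1 + e^-1 < A%:R by apply: truncnS_gt.
  have ei0 : 0 < e^-1 by rewrite invr_gt0.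
  have h2 : e^-1 <= A%:R ^+ 2 by rewrite expr2; nra.
  have : e * e^-1 <= e * A%:R ^+ 2 by rewrite ler_wpM2l// ltW.
  by rewrite mulfV// gt_eqF.
(* The nodes have coordinates at most B / m <= A + 3 in absolute value, so they all lie in this
   box. *)
have [r r0 rP] := continuous_unif_box (A%:R + 3) ch e0.
(* A bump reaches at most 4 / m away from its node, hence less than r. *)
pose m := (Num.trunc (5 / r)).+1.
have mr : 5 / r < m%:R by apply: truncnS_gt.
have m0 : 0 < m%:R :> R by rewrite ltr0n.
(* After scaling by m, the plateau |x| <= B - 3 is exactly the box of half-side A. *)
pose B := (m * A + 3)%N.
have BE : B%:R = m%:R * A%:R + 3 :> R by rewrite /B natrD natrM.
pose pt (k : {ffun 'I_d -> 'I_(2 * B)}) : 'cV[R]_d := \col_j (((k j)%:R - B%:R) / m%:R).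
pose w (k : {ffun 'I_d -> 'I_(2 * B)}) (z : 'cV[R]_d) := \prod_j psi B (k j) (m%:R * z j 0).
pose chi (z : 'cV[R]_d) := \prod_j rho B (m%:R * z j 0).
pose g (z : 'cV[R]_d) := \sum_k h (pt k) * w k z.
have chiE z : chi z = \sum_k w k z.
  rewrite /chi /w; under eq_bigr do rewrite -psi_sum.
  by rewrite bigA_distr_bigA.
have w0 k z : 0 <= w k z by apply: prodr_ge0 => j _; exact: psi_ge0.
have chi01 z : 0 <= chi z <= 1.
  have h1 j : 0 <= rho B (m%:R * z j 0) <= 1 by exact: rho01.
  apply/andP; split; first by apply: prodr_ge0 => j _; have /andP[] := h1 j.
  by apply: prodr_ile1 => j _; exact: h1.
have sm (a b : R) j : smooth (fun z : 'cV[R]_d => s (a * z j 0 + b)).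
  exact: (smooth_coord j (smooth1_affine a b smooth1_spline_step)).
have smB (a b c : R) j : smooth (fun z : 'cV[R]_d => s (a * z j 0 + b) - s (a * z j 0 + c)).
  rewrite (_ : (fun z => _) = (fun z : 'cV[R]_d => s (a * z j 0 + b) + (-1) * s (a * z j 0 + c))).
    by apply: smooth_add => //; apply: smooth_mul => //; exact: smooth_cst.
  by apply/funext => z; rewrite mulN1r.
exists g, chi; split.
- apply: smooth_sum => k; apply: smooth_mul; first exact: smooth_cst.
  apply: smooth_prod => j; rewrite /psi.
  rewrite (_ : (fun z => _) = (fun z : 'cV[R]_d => s (m%:R * z j 0 + (B%:R - (k j)%:R)) -
     s (m%:R * z j 0 + (B%:R - (k j)%:R - 1)))); first exact: smB.
  by apply/funext => z; rewrite !addrA.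
- by apply: smooth_prod => j; rewrite /rho; exact: smB.
- by move=> z; have /andP[] := chi01 z.
- move=> z; have /andP[chi0 chi1] := chi01 z.
  have -> : h z - g z = h z * (1 - chi z) + \sum_k (h z - h (pt k)) * w k z.
    rewrite mulrBr mulr1 chiE mulr_sumr -addrA; congr (_ + _).
    rewrite /g -!sumrN -big_split; apply: eq_bigr => k _ /=; ring.
  apply: le_trans (ler_normD _ _) _; apply: lerD.
    by rewrite normrM [X in _ * X]ger0_norm ?subr_ge0// ler_wpM2r// subr_ge0.
  apply: (@le_trans _ _ (\sum_k e * w k z)); last first.
    by rewrite -mulr_sumr -chiE -[leRHS]mulr1 ler_wpM2l// ltW.
  apply: le_trans (ler_norm_sum _ _ _) _; apply: ler_sum => k _.
  rewrite normrM [X in _ * X]ger0_norm//.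
  have [->|wk] := eqVneq (w k z) 0; first by rewrite !mulr0.
  apply: ler_wpM2r => //; rewrite distrC; apply: rP.
    apply: norm_le_coord => [|j]; first by rewrite addr_ge0.
    rewrite mxE normrM [X in _ * X]gtr0_norm ?invr_gt0// ler_pdivrMr//.
    have kB : (k j)%:R <= 2 * B%:R :> R by rewrite -natrM ler_nat ltnW.
    have k0 : 0 <= (k j)%:R :> R by [].
    have A0 : 0 <= A%:R :> R by [].
    have m1 : 1 <= m%:R :> R by rewrite ler1n.
    rewrite ler_norml; apply/andP; split; nra.
  apply: (@le_lt_trans _ _ (4 / m%:R)); last first.
    rewrite ltr_pdivrMr// mulrC -ltr_pdivrMr//; apply: lt_trans mr.
    by rewrite ltr_pM2r ?invr_gt0//; lra.
  apply: norm_le_coord => [|j]; first by rewrite divr_ge0// ltW.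
  have pj : psi B (k j) (m%:R * z j 0) != 0.
    apply: contraNneq wk => pj; rewrite /w (bigD1 j)//= pj mul0r.
    by [].
  rewrite !mxE ler_pdivlMr// -[X in _ * X]gtr0_norm// -normrM.
  have -> : (((k j)%:R - B%:R) / m%:R - z j 0) * m%:R = (k j)%:R - B%:R - m%:R * z j 0.
    by field; rewrite gt_eqF.
  exact: psi_supp.
- move=> z; have /andP[chi0 chi1] := chi01 z.
  have s0 : 0 <= \sum_j z j 0 ^+ 2 by apply: sumr_ge0 => j _; exact: sqr_ge0.
  have [zA|/existsNP[j /negP zj]] := pselect (forall j, `|z j 0| <= A%:R).
    have -> : chi z = 1.
      rewrite /chi big1// => j _; apply: rho_eq1; rewrite BE addrK normrM gtr0_norm//.
      by rewrite ler_wpM2l// ltW.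
    by rewrite subrr mulr_ge0// ltW.
  rewrite -ltNge in zj.
  apply: (@le_trans _ _ 1); first by rewrite gerBl.
  apply: le_trans Ae _; apply: ler_wpM2l; first exact: ltW.
  rewrite (bigD1 j)//=; apply: (@le_trans _ _ (z j 0 ^+ 2)).
    by rewrite -(real_normK (num_real (z j 0))) lerXn2r ?nnegrE// ltW.
  by rewrite lerDl sumr_ge0// => i _; exact: sqr_ge0.
Qed.

End approx.

(** * Weak convergence from test functions *)

Section portmanteau.
Context {R : realType} {d : nat} {dO : measure_display} {Omega : measurableType dO}.
Variables (P : probability Omega R) (nu : probability (borelV R d) R).
Variable Z : nat -> Omega -> borelV R d.
Hypothesis mZ : forall N, measurable_fun setT (Z N).

Lemma Rintegral_dist d1 (T : measurableType d1) (Q : probability T R) (f g u : T -> R) (K : R) :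
  measurable_fun setT f -> measurable_fun setT g -> measurable_fun setT u ->
  (forall x, `|f x| <= K) -> (forall x, `|g x| <= K) -> (forall x, `|u x| <= K) ->
  (forall x, `|f x - g x| <= u x) ->
  `|\int[Q]_x f x - \int[Q]_x g x| <= \int[Q]_x u x.
Proof.
move=> mf mg mu fK gK uK fgu.
have fi := bounded_integrable Q mf fK; have gi := bounded_integrable Q mg gK.
have ui := bounded_integrable Q mu uK.
rewrite -RintegralB//; apply: le_trans (le_normr_Rintegral _ _) _ => //.
  by have := integrableB measurableT fi gi.
apply: le_Rintegral => //.
apply: (@bounded_integrable _ _ _ _ _ (K + K)).
  by apply: measurableT_comp => //; exact: measurable_funB.
move=> x; rewrite normr_id; apply: le_trans (ler_normB _ _) _; exact: lerD.
Qed.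

(** Tightness is assumed of the limit only. Convergence for the test function [chi] carries it over
    to the laws of [Z N], after which h may be replaced by its approximation on both sides. *)
Lemma portmanteau (C : R) :
  (forall j, (\int[nu]_z (((z : 'cV[R]_d) j 0) ^+ 2)%:E <= C%:E)%E) ->
  (forall h, smooth h -> \int[P]_w h (Z N w) @[N --> \oo] --> \int[nu]_z h z) ->
  cvg_in_distribution P Z nu.
Proof.
move=> HC H h ch [M hM].
have M0 : 0 <= M := le_trans (normr_ge0 _) (hM 0).
have mh := continuous_borelV ch.
have mhZ N : measurable_fun setT (fun w => h (Z N w)) := measurableT_comp mh (mZ N).
have E1 N : (\int[P]_w (h (Z N w))%:E)%E = (\int[P]_w h (Z N w))%:E.
  by rewrite fineK//; apply: integrable_fin_num => //; exact: (bounded_integrable P (mhZ N) (fun w => hM _)).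
have E2 : (\int[nu]_z (h z)%:E)%E = (\int[nu]_z h z)%:E.
  by rewrite fineK//; apply: integrable_fin_num => //; exact: (bounded_integrable nu mh hM).
rewrite E2; under eq_fun do rewrite E1.
apply: cvg_EFin; first by near=> N.
rewrite (_ : fine \o _ = (fun N => \int[P]_w h (Z N w))); last by apply/funext.
apply/cvgrPdist_le => e e0.
pose DC := d%:R * `|C|.
(* The total error is 2 M DC + M + 3 times e / q: two truncations, the transfer of [chi] to [Z N],
   and three terms of size e / q. *)
pose q := 2 * M * DC + M + 3.
have DC0 : 0 <= DC by rewrite mulr_ge0.
have q0 : 0 < q by rewrite /q ltr_wpDl// addr_ge0// !mulr_ge0.
have eq0 : 0 < e / q by rewrite divr_gt0.
have [g [chi [sg schi chi1 hg chis]]] := smooth_approx ch hM eq0.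
have gNear := iffLR (@cvgrPdist_le _ R^o nat \oo _ _ _) (H g sg) _ eq0.
have cNear := iffLR (@cvgrPdist_le _ R^o nat \oo _ _ _) (H chi schi) _ eq0.
have [Kg Kg0 gK] := smooth_bounded sg; have [Kc Kc0 chiK] := smooth_bounded schi.
have mg := smooth_measurable sg; have mchi := smooth_measurable schi.
have MKc : 0 <= M * (1 + Kc) by rewrite mulr_ge0// addr_ge0.
have [K KE] : exists K, K = M + Kg + (M * (1 + Kc) + e / q) by exists (M + Kg + (M * (1 + Kc) + e / q)).
have kM : M <= K by rewrite KE; lra.
have kg : Kg <= K by rewrite KE; lra.
have kc : M * (1 + Kc) + e / q <= K by rewrite KE; lra.
have dst d1 (T : measurableType d1) (Q : probability T R) (zeta : T -> borelV R d) :
   measurable_fun setT zeta ->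
   `|\int[Q]_x h (zeta x) - \int[Q]_x g (zeta x)| <= M * (1 - \int[Q]_x chi (zeta x)) + e / q.
  move=> mzeta.
  have mgz := measurableT_comp mg mzeta; have mcz := measurableT_comp mchi mzeta.
  have mhz := measurableT_comp mh mzeta.
  have ic := bounded_integrable Q mcz (fun x => chiK (zeta x)).
  have i1 (c : R) : Q.-integrable setT (EFin \o (fun=> c)) by apply: (@bounded_integrable _ _ _ Q _ `|c|).
  have i1c : Q.-integrable setT (EFin \o (fun x => 1 - chi (zeta x))).
    by have := integrableB measurableT (i1 1) ic.
  have iM : Q.-integrable setT (EFin \o (fun x => M * (1 - chi (zeta x)))).
    by have := integrableZl measurableT M i1c.
  have -> : M * (1 - \int[Q]_x chi (zeta x)) + e / q = \int[Q]_x (M * (1 - chi (zeta x)) + e / q).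
    by rewrite RintegralD// Rint_cst RintegralZl// RintegralB// Rint_cst.
  apply: (@Rintegral_dist _ _ _ _ _ _ K) => //.
  - apply: measurable_funD => //; apply: measurable_funM => //; exact: measurable_funB.
  - by move=> x; exact: le_trans (hM _) kM.
  - by move=> x; exact: le_trans (gK _) kg.
  - move=> x; apply: (@le_trans _ _ (M * (1 + Kc) + e / q)); last exact: kc.
    apply: le_trans (ler_normD _ _) _; rewrite (gtr0_norm eq0) lerD2r normrM (ger0_norm M0).
    rewrite ler_wpM2l//; apply: le_trans (ler_normB _ _) _; rewrite normr1 lerD2l; exact: chiK.
have chinu : 1 - \int[nu]_z chi z <= e / q * DC.
  have ic := bounded_integrable nu mchi chiK.
  have i1 : nu.-integrable setT (EFin \o (fun=> 1 : R)) by apply: (@bounded_integrable _ _ _ nu _ `|1|).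
  rewrite -[X in X - _](Rint_cst nu) -RintegralB// -lee_fin /Rintegral fineK; last first.
    by apply: integrable_fin_num => //; have := integrableB measurableT i1 ic.
  have mz (j : 'I_d) : measurable_fun setT (fun z : borelV R d => ((z : 'cV[R]_d) j 0 ^+ 2)%:E).
    by apply/measurable_EFinP; apply: measurable_funX; exact: measurable_coord.
  apply: (@le_trans _ _ (\int[nu]_z ((e / q)%:E * \sum_j ((z : 'cV[R]_d) j 0 ^+ 2)%:E)))%E.
    apply: ge0_le_integral => //.
    - by move=> z _; rewrite lee_fin subr_ge0.
    - by apply/measurable_EFinP; exact: measurable_funB.
    - by apply: emeasurable_funM => //; apply: emeasurable_sum.
    - by move=> z _; rewrite sumEFin -EFinM lee_fin; exact: chis.
  rewrite ge0_integralZl//; last 3 first.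
  - by apply: emeasurable_sum.
  - by move=> z _; rewrite sumEFin lee_fin sumr_ge0// => j _; exact: sqr_ge0.
  - by rewrite lee_fin ltW.
  rewrite [leRHS]EFinM; apply: lee_wpmul2l; first by rewrite lee_fin ltW.
  rewrite ge0_integral_sum//; last by move=> j z _; rewrite lee_fin sqr_ge0.
  apply: (@le_trans _ _ (\sum_(j < d) (`|C|)%:E))%E.
    apply: lee_sum => j _; apply: le_trans (HC j) _; rewrite lee_fin; exact: ler_norm.
  by rewrite sumEFin lee_fin sumr_const card_ord -mulr_natl.
near=> N.
have cN : `|\int[nu]_z chi z - \int[P]_w chi (Z N w)| <= e / q by near: N; exact: cNear.
have gN : `|\int[nu]_z g z - \int[P]_w g (Z N w)| <= e / q by near: N; exact: gNear.
have a1 := dst _ _ P (Z N) (mZ N).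
have a2 := dst _ _ nu idfun (@measurable_id _ _ _).
rewrite /= in a2 cN gN.
have a3 : M * (1 - \int[nu]_z chi z) <= M * (e / q * DC) by rewrite ler_wpM2l.
have a4 : M * (1 - \int[P]_w chi (Z N w)) <= M * (e / q * DC + e / q).
  by rewrite ler_wpM2l//; move: cN; rewrite ler_norml => /andP[c1 c2]; lra.
have eE : e = 2 * (M * (e / q * DC)) + M * (e / q) + 3 * (e / q).
  by rewrite /q; field; rewrite gt_eqF.
rewrite eE; move: a1 a2 gN; rewrite !ler_norml => /andP[b1 b2] /andP[b3 b4] /andP[b5 b6].
by apply/andP; split; lra.
Unshelve. all: by end_near.
Qed.

End portmanteau.

Section integrable_aux.
Context d1 (T : measurableType d1) (R : realType).

Lemma Rintegral_sum_seq (Q : {measure set T -> \bar R}) (I : Type) (r : seq I) (F : I -> T -> R) :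
  (forall i, Q.-integrable setT (EFin \o F i)) ->
  Q.-integrable setT (EFin \o (fun x => \sum_(i <- r) F i x)) /\
  \int[Q]_x (\sum_(i <- r) F i x) = \sum_(i <- r) \int[Q]_x F i x.
Proof.
move=> iF; elim: r => [|i r [IH1 IH2]].
  have -> : (fun x => \sum_(i <- [::]) F i x) = (fun=> 0) by apply/funext => x; rewrite big_nil.
  rewrite big_nil; split; first exact: integrable0.
  by rewrite /Rintegral integral0.
have -> : (fun x => \sum_(i0 <- i :: r) F i0 x) = (fun x => F i x + \sum_(i <- r) F i x).
  by apply/funext => x; rewrite big_cons.
split; first by have := integrableD measurableT (iF i) IH1.
by rewrite RintegralD// IH2 big_cons.
Qed.

Lemma integrable_le (Q : {measure set T -> \bar R}) (f g : T -> R) :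
  measurable_fun setT f -> (forall x, `|f x| <= g x) ->
  Q.-integrable setT (EFin \o g) -> Q.-integrable setT (EFin \o f).
Proof.
move=> mf fg ig; apply: (le_integrable measurableT _ _ ig).
  exact/measurable_EFinP.
by move=> x _ /=; rewrite lee_fin; apply: le_trans (fg x) (ler_norm _).
Qed.

End integrable_aux.

(** * Moments of Gaussian vectors *)

Section gauss_moments.
Context {R : realType} {d : nat}.
Variable l : seq 'cV[R]_d.
Local Notation V := (borelV R d).
Local Notation N01 := (@normal_prob R 0 1 : probability (measurableTypeR R) R).

Let pow4 (x : R) : x ^+ 4 = (x ^+ 2) ^+ 2. Proof. by rewrite -exprM. Qed.

Let b1 (x : R) : `|x| <= 1 * (1 + x ^+ 4).
Proof.
rewrite mul1r pow4 -(real_normK (num_real x)); move: (`|x|) (normr_ge0 x) => t t0.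
have := sqr_ge0 (t ^+ 2 - 1); have := sqr_ge0 (t - 1); nra.
Qed.

Let b2 (x : R) : `|x ^+ 2| <= 1 * (1 + x ^+ 4).
Proof. by rewrite mul1r pow4 ger0_norm ?sqr_ge0//; have := sqr_ge0 x; move: (x ^+ 2) => t; nra. Qed.

Let b4 (x : R) : `|x ^+ 4| <= 1 * (1 + x ^+ 4).
Proof. by rewrite mul1r ger0_norm ?lerDr// pow4 sqr_ge0. Qed.

Lemma gauss_coord_mean j : (gauss l).-integrable setT (EFin \o (fun u : V => (u : 'cV[R]_d) j 0)) /\
  \int[gauss l]_u (u : 'cV[R]_d) j 0 = 0.
Proof.
have [i1 e1] := gauss_lin_R l (basisv j) (@measurable_id _ _ setT) b1.
split; first by apply: eq_integrable i1 => // u _; rewrite /= dot_basisl.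
have <- : \int[gauss l]_u dot (basisv j) u = \int[gauss l]_u (u : 'cV[R]_d) j 0.
  by apply: eq_Rintegral => u _; rewrite dot_basisl.
rewrite e1 RintegralZl//; last exact: normal_integrable_id.
by rewrite normal_mean mulr0.
Qed.

Lemma gauss_dot_sqr (a : 'cV[R]_d) : (gauss l).-integrable setT (EFin \o (fun u : V => dot a u ^+ 2)) /\
  \int[gauss l]_u dot a u ^+ 2 = \sum_(v <- l) dot a v ^+ 2.
Proof.
have m2 : measurable_fun setT (fun x : R => x ^+ 2) by exact: measurable_funX.
have [i1 e1] := gauss_lin_R l a m2 b2.
split; first exact: i1.
rewrite e1 /Rintegral; under eq_integral do rewrite exprMn EFinM.
have mE2 : measurable_fun setT (fun x : R => (x ^+ 2)%:E) by exact/measurable_EFinP.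
rewrite ge0_integralZl// ?lee_fin ?sqr_ge0//; last by move=> x _; rewrite lee_fin sqr_ge0.
by rewrite normal_sqr mule1 sqr_sqrtr// sumr_ge0// => v _; exact: sqr_ge0.
Qed.

Lemma gauss_coord_cov i j :
  (gauss l).-integrable setT (EFin \o (fun u : V => (u : 'cV[R]_d) i 0 * (u : 'cV[R]_d) j 0)) /\
  \int[gauss l]_u ((u : 'cV[R]_d) i 0 * (u : 'cV[R]_d) j 0) = \sum_(v <- l) v i 0 * v j 0.
Proof.
(* Polarization reduces the covariance to variances of linear forms. *)
have E (u : 'cV[R]_d) : u i 0 * u j 0 =
    4^-1 * (dot (basisv i + basisv j) u ^+ 2 - dot (basisv i + (-1) *: basisv j) u ^+ 2).
  by rewrite !(dotDl, dotZl) !dot_basisl; field.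
have [i1 e1] := gauss_dot_sqr (basisv i + basisv j).
have [i2 e2] := gauss_dot_sqr (basisv i + (-1) *: basisv j).
have iB : (gauss l).-integrable setT (EFin \o (fun u : V =>
    dot (basisv i + basisv j) u ^+ 2 - dot (basisv i + (-1) *: basisv j) u ^+ 2)).
  by have := integrableB measurableT i1 i2.
have -> : (fun u : V => (u : 'cV[R]_d) i 0 * (u : 'cV[R]_d) j 0) = (fun u : V => 4^-1 *
    (dot (basisv i + basisv j) u ^+ 2 - dot (basisv i + (-1) *: basisv j) u ^+ 2)).
  by apply/funext => u; exact: E.
split; first by have := integrableZl measurableT 4^-1 iB.
rewrite RintegralZl// RintegralB// e1 e2 -sumrB mulr_sumr.
by apply: eq_bigr => v _; rewrite E.
Qed.

Lemma gauss_norm3 : (gauss l).-integrable setT (EFin \o (fun u : V => `|(u : 'cV[R]_d)| ^+ 3)).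
Proof.
have m4 : measurable_fun setT (fun x : R => x ^+ 4) by exact: measurable_funX.
have i4 j : (gauss l).-integrable setT (EFin \o (fun u : V => (u : 'cV[R]_d) j 0 ^+ 4)).
  have [i1 _] := gauss_lin_R l (basisv j) m4 b4.
  by apply: eq_integrable i1 => // u _; rewrite /= dot_basisl.
have [iS _] := Rintegral_sum_seq (index_enum 'I_d) i4.
have i1 : (gauss l).-integrable setT (EFin \o (fun u : V => 1 : R)).
  by apply: (@bounded_integrable _ _ _ (gauss l) _ 1) => // x; rewrite normr1.
apply: (@integrable_le _ _ _ _ _ (fun u : V => 1 + \sum_j (u : 'cV[R]_d) j 0 ^+ 4)).
- apply: measurable_funX; apply: continuous_borelV; exact: norm_continuous.
- move=> u; rewrite ger0_norm ?exprn_ge0//.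
  have [u0|u0] := eqVneq (`|(u : 'cV[R]_d)|) 0.
    rewrite u0 expr0n/= addr_ge0// sumr_ge0// => j _; exact: exprn_even_ge0.
  have [[j k] uE] := mx_norm_neq0 u0.
  have -> : `|(u : 'cV[R]_d)| = `|(u : 'cV[R]_d) j 0| by rewrite -[LHS]/(mx_norm u) uE /= ord1.
  apply: (@le_trans _ _ (1 + (u : 'cV[R]_d) j 0 ^+ 4)).
    rewrite pow4 -(real_normK (num_real ((u : 'cV[R]_d) j 0))).
    move: (`|_|) (normr_ge0 ((u : 'cV[R]_d) j 0)) => t t0; rewrite exprS.
    have := sqr_ge0 (t ^+ 2 - t); have := sqr_ge0 (t - 1); have := sqr_ge0 (t ^+ 2 - 1).
    rewrite !expr2; nra.
  rewrite lerD2l (bigD1 j)//= lerDl sumr_ge0// => i _; exact: exprn_even_ge0.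
- by have := integrableD measurableT i1 iS.
Qed.

Lemma gauss_sqr_fin j : (\int[gauss l]_u (((u : 'cV[R]_d) j 0) ^+ 2)%:E <=
  (\sum_(v <- l) (v j 0) ^+ 2)%:E)%E.
Proof.
have [i1 e1] := gauss_dot_sqr (basisv j).
have E : (fun u : V => (((u : 'cV[R]_d) j 0) ^+ 2)%:E) = (EFin \o (fun u : V => dot (basisv j) u ^+ 2)).
  by apply/funext => u; rewrite /= dot_basisl.
rewrite E -[leLHS]fineK; last exact: integrable_fin_num.
rewrite lee_fin -[leLHS]/(Rintegral _ _ _) e1; apply: ler_sum => v _; by rewrite dot_basisl.
Qed.

End gauss_moments.

(** * Expansion of one step *)

Section onestep.
Context {R : realType} {m : nat} d1 {T : measurableType d1}.
Variables (Q : probability T R) (p : T -> R) (xi : T -> borelV R m).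
Hypotheses (mp : measurable_fun setT p) (p01 : forall z, 0 <= p z <= 1).
Hypothesis mxi : measurable_fun setT xi.
Hypothesis i3 : Q.-integrable setT (EFin \o (fun z => p z * `|(xi z : 'cV[R]_m)| ^+ 3)).

Let p0 z : 0 <= p z. Proof. by have /andP[] := p01 z. Qed.
Let p1 z : p z <= 1. Proof. by have /andP[] := p01 z. Qed.

Let mxij j : measurable_fun setT (fun z => (xi z : 'cV[R]_m) j 0).
Proof. exact: (measurableT_comp (measurable_coord j) mxi). Qed.

Let i3' : Q.-integrable setT (EFin \o (fun z => 1 + p z * `|(xi z : 'cV[R]_m)| ^+ 3)).
Proof.
have i1 : Q.-integrable setT (EFin \o (fun z : T => 1 : R)).
  by apply: (@bounded_integrable _ _ _ Q _ 1) => // x; rewrite normr1.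
by have := integrableD measurableT i1 i3.
Qed.

Let pow_le (t : R) : 0 <= t -> t <= 1 + t ^+ 3 /\ t * t <= 1 + t ^+ 3.
Proof.
move=> t0; have h : 0 <= (t - 1) ^+ 2 * (t + 1) by rewrite mulr_ge0 ?sqr_ge0// addr_ge0.
have -> : t ^+ 3 = (t - 1) ^+ 2 * (t + 1) + t * t + t - 1 by ring.
have t2 : 0 <= t * t by exact: mulr_ge0.
by split; lra.
Qed.

Let dom (z : T) (x : R) : `|x| <= 1 + `|(xi z : 'cV[R]_m)| ^+ 3 ->
  `|p z * x| <= 1 + p z * `|(xi z : 'cV[R]_m)| ^+ 3.
Proof.
move=> h; rewrite normrM ger0_norm//.
apply: (@le_trans _ _ (p z * (1 + `|(xi z : 'cV[R]_m)| ^+ 3))); first exact: ler_wpM2l.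
by rewrite mulrDr mulr1 lerD2r.
Qed.

Lemma onestep_integrable1 j : Q.-integrable setT (EFin \o (fun z => p z * (xi z : 'cV[R]_m) j 0)).
Proof.
apply: integrable_le i3'; first exact: measurable_funM.
move=> z; apply: dom; apply: le_trans (coord_le_norm _ _) _.
by have [] := pow_le (normr_ge0 (xi z : 'cV[R]_m)).
Qed.

Lemma onestep_integrable2 i j : Q.-integrable setT
  (EFin \o (fun z => p z * ((xi z : 'cV[R]_m) i 0 * (xi z : 'cV[R]_m) j 0))).
Proof.
apply: integrable_le i3'; first by apply: measurable_funM => //; exact: measurable_funM.
move=> z; apply: dom; rewrite normrM.
apply: (@le_trans _ _ (`|(xi z : 'cV[R]_m)| * `|(xi z : 'cV[R]_m)|)).
  by apply: ler_pM => //; exact: coord_le_norm.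
by have [] := pow_le (normr_ge0 (xi z : 'cV[R]_m)).
Qed.

(** The Taylor estimate integrated against the weight p: first and second moments appear exactly and
    the third moment is the error. With p = 1 it also treats a Gaussian increment. *)
Lemma onestep (h : 'cV[R]_m -> R) K (G : 'I_m -> R) (H : 'I_m -> 'I_m -> R) (s : 'cV[R]_m) :
  measurable_fun setT (h : borelV R m -> R) -> (forall z, `|h z| <= K) ->
  (forall v, `|h (s + v) - h s - lin G v - 2^-1 * quad H v| <= K * `|v| ^+ 3) ->
  `|\int[Q]_z (p z * (h (s + (xi z : 'cV[R]_m)) - h s))
    - \sum_j G j * \int[Q]_z (p z * (xi z : 'cV[R]_m) j 0)
    - 2^-1 * \sum_i \sum_j H i j * \int[Q]_z (p z * ((xi z : 'cV[R]_m) i 0 * (xi z : 'cV[R]_m) j 0))|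
  <= K * \int[Q]_z (p z * `|(xi z : 'cV[R]_m)| ^+ 3).
Proof.
move=> mh hK tay.
pose f1 z := p z * (h (s + (xi z : 'cV[R]_m)) - h s).
have mf1 : measurable_fun setT f1.
  apply: measurable_funM => //; apply: measurable_funB => //.
  by apply: (measurableT_comp mh); apply: measurable_borelVD.
have if1 : Q.-integrable setT (EFin \o f1).
  apply: (@bounded_integrable _ _ _ Q f1 (1 * (K + K))) => // z.
  rewrite normrM; apply: ler_pM => //; first by rewrite ger0_norm.
  by apply: le_trans (ler_normB _ _) _; exact: lerD.
pose g1 j z := G j * (p z * (xi z : 'cV[R]_m) j 0).
have ig1 j : Q.-integrable setT (EFin \o g1 j).
  by have := integrableZl measurableT (G j) (onestep_integrable1 j).
pose g2 i j z := H i j * (p z * ((xi z : 'cV[R]_m) i 0 * (xi z : 'cV[R]_m) j 0)).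
have ig2 i j : Q.-integrable setT (EFin \o g2 i j).
  by have := integrableZl measurableT (H i j) (onestep_integrable2 i j).
have [iS1 eS1] := Rintegral_sum_seq (index_enum 'I_m) ig1.
have iS2' i := (Rintegral_sum_seq (index_enum 'I_m) (ig2 i)).1.
have eS2' i := (Rintegral_sum_seq (index_enum 'I_m) (ig2 i)).2.
have [iS2 eS2] := Rintegral_sum_seq (index_enum 'I_m) iS2'.
have iS3 : Q.-integrable setT (EFin \o (fun z => 2^-1 * \sum_i \sum_j g2 i j z)).
  by have := integrableZl measurableT 2^-1 iS2.
have iB1 : Q.-integrable setT (EFin \o (fun z => f1 z - \sum_j g1 j z)).
  by have := integrableB measurableT if1 iS1.
have iB2 : Q.-integrable setT (EFin \o (fun z => f1 z - \sum_j g1 j z - 2^-1 * \sum_i \sum_j g2 i j z)).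
  by have := integrableB measurableT iB1 iS3.
have -> : \sum_j G j * \int[Q]_z (p z * (xi z : 'cV[R]_m) j 0) = \int[Q]_z \sum_j g1 j z.
  by rewrite eS1; apply: eq_bigr => j _; rewrite RintegralZl//; exact: onestep_integrable1.
have -> : 2^-1 * \sum_i \sum_j H i j * \int[Q]_z (p z * ((xi z : 'cV[R]_m) i 0 * (xi z : 'cV[R]_m) j 0)) =
   \int[Q]_z (2^-1 * \sum_i \sum_j g2 i j z).
  rewrite RintegralZl// eS2; congr (_ * _); apply: eq_bigr => i _; rewrite eS2'.
  by apply: eq_bigr => j _; rewrite RintegralZl//; exact: onestep_integrable2.
rewrite -RintegralB// -RintegralB//.
apply: le_trans (le_normr_Rintegral _ _) _ => //.
rewrite -RintegralZl//; apply: le_Rintegral => //.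
- by have := integrable_norm iB2.
- by have := integrableZl measurableT K i3.
move=> z _; rewrite /f1 /g1 /g2.
have -> : p z * (h (s + (xi z : 'cV[R]_m)) - h s) - \sum_j G j * (p z * (xi z : 'cV[R]_m) j 0) -
   2^-1 * (\sum_i \sum_j H i j * (p z * ((xi z : 'cV[R]_m) i 0 * (xi z : 'cV[R]_m) j 0))) =
   p z * (h (s + (xi z : 'cV[R]_m)) - h s - lin G (xi z) - 2^-1 * quad H (xi z)).
  rewrite !mulrBr; congr (_ - _ - _).
    by rewrite /lin mulr_sumr; apply: eq_bigr => j _; ring.
  rewrite mulrCA; congr (_ * _); rewrite /quad mulr_sumr; apply: eq_bigr => i _.
  by rewrite mulr_sumr; apply: eq_bigr => j _; ring.
by rewrite normrM ger0_norm// mulrCA ler_wpM2l.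
Qed.

End onestep.

(** * Telescoping along the sampled terms *)

Section lindeberg.
Context {R : realType} {dE dO : measure_display}.
Context {E : measurableType dE} {Omega : measurableType dO} {q : nat}.
Variables (P : probability Omega R) (mu : probability E R).
Variables (N : nat) (Z : nat -> Omega -> E) (pilot : Omega -> borelV R q).
Variables (delta : nat -> Omega -> bool) (p : E -> borelV R q -> R).
Hypothesis mZ : forall i, measurable_fun setT (Z i).
Hypothesis mpilot : measurable_fun setT pilot.
Hypothesis mdelta : forall i, measurable [set w | delta i w].
Hypothesis mp : measurable_fun setT (fun u : E * borelV R q => p u.1 u.2).
Hypothesis p01 : forall z v, 0 <= p z v <= 1.

(** The form in which the sampling design reaches the limit theorems: the conclusion of
    [next_indicator], for all summands [xi] of any dimension. *)
Definition next_property := forall (m : nat) (xi : borelV R q * E -> borelV R m),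
  measurable_fun setT xi ->
  forall (k : nat) (Psi : (borelV R q * borelV R m) * E -> R), (k < N)%N ->
  measurable_fun setT Psi -> (forall u, 0 <= Psi u) ->
  (\int[P]_w ((delta k w)%:R * Psi ((pilot w, state Z pilot delta xi k w), Z k w))%:E =
   \int[P]_w \int[mu]_z (p z (pilot w) * Psi ((pilot w, state Z pilot delta xi k w), z))%:E)%E.

Hypothesis next : next_property.

Lemma measurable_delta k : measurable_fun setT (fun w => (delta k w)%:R : R).
Proof.
rewrite (_ : (fun w => _) = (\1_[set w | delta k w] : Omega -> R)).
  by apply: measurable_indic; exact: mdelta.
apply/funext => w; rewrite indicE; congr ((nat_of_bool _)%:R).
by apply/idP/idP => [h|/set_mem//]; apply: mem_set.
Qed.

Lemma measurable_sampling v : measurable_fun setT (fun z => p z v).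
Proof. exact: (measurable_fun_pair1 v mp). Qed.

Section state.
Variables (m : nat) (xi : borelV R q * E -> borelV R m).
Hypothesis mxi : measurable_fun setT xi.
Local Notation S := (state Z pilot delta xi).

Let mS k : measurable_fun setT (S k).
Proof. exact: measurable_state. Qed.

Let mpS k : measurable_fun setT (fun w => (pilot w, S k w)).
Proof. exact: measurable_fun_pair. Qed.

Let mpP (Psi : (borelV R q * borelV R m) * E -> R) : measurable_fun setT Psi ->
  measurable_fun setT (fun u : (borelV R q * borelV R m) * E => p u.2 u.1.1 * Psi u).
Proof.
move=> mPsi; apply: measurable_funM => //.
have h : measurable_fun setT (fun u : (borelV R q * borelV R m) * E => (u.2, u.1.1)).
  apply: measurable_fun_pair => //.
  exact: (measurableT_comp measurable_fst measurable_fst).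
exact: (measurableT_comp mp h).
Qed.

Let bP (Psi : (borelV R q * borelV R m) * E -> R) (K : R) : (forall u, `|Psi u| <= K) ->
  forall u : (borelV R q * borelV R m) * E, `|p u.2 u.1.1 * Psi u| <= K.
Proof.
move=> PK u; have /andP[a b] := p01 u.2 u.1.1; rewrite normrM ger0_norm//.
by apply: le_trans (PK u); rewrite ler_piMl.
Qed.

(** From nonnegative to bounded integrands: the identity for Psi + K minus the one for the constant
    K. *)
Lemma next_Rintegral k (Psi : (borelV R q * borelV R m) * E -> R) (K : R) : (k < N)%N ->
  measurable_fun setT Psi -> (forall u, `|Psi u| <= K) ->
  \int[P]_w ((delta k w)%:R * Psi ((pilot w, S k w), Z k w)) =
  \int[P]_w \int[mu]_z (p z (pilot w) * Psi ((pilot w, S k w), z)).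
Proof.
move=> kN mPsi PK.
have mA (F : (borelV R q * borelV R m) * E -> R) : measurable_fun setT F ->
    measurable_fun setT (fun w => (delta k w)%:R * F ((pilot w, S k w), Z k w)).
  move=> mF; apply: measurable_funM; first exact: measurable_delta.
  by apply: (measurableT_comp mF); apply: measurable_fun_pair.
have iA (F : (borelV R q * borelV R m) * E -> R) (C : R) : measurable_fun setT F ->
    (forall u, `|F u| <= C) ->
    P.-integrable setT (EFin \o (fun w => (delta k w)%:R * F ((pilot w, S k w), Z k w))).
  move=> mF FC; apply: (@bounded_integrable _ _ _ P _ C); first exact: mA.
  move=> w; rewrite normrM; apply: le_trans (FC ((pilot w, S k w), Z k w)).
  by case: (delta k w); rewrite ?normr1 ?mul1r// normr0 mul0r.
have mB (F : (borelV R q * borelV R m) * E -> R) (C : R) : measurable_fun setT F ->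
    (forall u, `|F u| <= C) ->
    measurable_fun setT (fun w => \int[mu]_z (p z (pilot w) * F ((pilot w, S k w), z))).
  move=> mF FC.
  have := @measurable_Rintegral2 _ _ _ _ R (law P (mpS k)) mu _ C (mpP mF) (bP FC).
  by move=> h; exact: (measurableT_comp h (mpS k)).
have isec (F : (borelV R q * borelV R m) * E -> R) (C : R) w : measurable_fun setT F ->
    (forall u, `|F u| <= C) ->
    mu.-integrable setT (EFin \o (fun z => p z (pilot w) * F ((pilot w, S k w), z))).
  move=> mF FC; apply: (@bounded_integrable _ _ _ mu _ C).
    exact: (measurable_fun_pair2 (pilot w, S k w) (mpP mF)).
  by move=> z; exact: (bP FC ((pilot w, S k w), z)).
have iB (F : (borelV R q * borelV R m) * E -> R) (C : R) : measurable_fun setT F ->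
    (forall u, `|F u| <= C) ->
    P.-integrable setT (EFin \o (fun w => \int[mu]_z (p z (pilot w) * F ((pilot w, S k w), z)))).
  move=> mF FC; apply: (@bounded_integrable _ _ _ P _ C); first exact: (mB F C).
  move=> w; apply: Rint_bound; first exact: (measurable_fun_pair2 (pilot w, S k w) (mpP mF)).
  by move=> z; exact: (bP FC ((pilot w, S k w), z)).
have pos (F : (borelV R q * borelV R m) * E -> R) (C : R) : measurable_fun setT F ->
    (forall u, `|F u| <= C) -> (forall u, 0 <= F u) ->
    \int[P]_w ((delta k w)%:R * F ((pilot w, S k w), Z k w)) =
    \int[P]_w \int[mu]_z (p z (pilot w) * F ((pilot w, S k w), z)).
  move=> mF FC F0; rewrite /Rintegral next//; congr fine; apply: eq_integral => w _.
  by rewrite fineK//; apply: integrable_fin_num => //; exact: (isec F C).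
have K0 : 0 <= K by apply: le_trans (PK ((pilot point, S k point), Z k point)).
have mPK : measurable_fun setT (fun u => Psi u + K) by exact: measurable_funD.
have bPK u : `|Psi u + K| <= K + K.
  by apply: le_trans (ler_normD _ _) _; rewrite (ger0_norm K0) lerD2r.
have p1 := pos (fun u => Psi u + K) (K + K) mPK bPK.
have bK (u : (borelV R q * borelV R m) * E) : `|cst K u| <= K by rewrite /= ger0_norm.
have mK : measurable_fun setT (cst K : (borelV R q * borelV R m) * E -> R) by [].
have p2 := pos (cst K) K mK bK (fun=> K0).
transitivity (\int[P]_w ((delta k w)%:R * (Psi ((pilot w, S k w), Z k w) + K)) -
    \int[P]_w ((delta k w)%:R * K)).
  rewrite -RintegralB//; last 2 first.
  - exact: (iA (fun u => Psi u + K) (K + K)).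
  - exact: (iA (cst K) K).
  by apply: eq_Rintegral => w _; ring.
rewrite p1; last by move=> u; have := PK u; rewrite ler_norml; lra.
rewrite p2 -RintegralB//; last 2 first.
- exact: (iB (fun u => Psi u + K) (K + K)).
- exact: (iB (cst K) K).
apply: eq_Rintegral => w _; rewrite -RintegralB//; last 2 first.
- exact: (isec (fun u => Psi u + K) (K + K)).
- exact: (isec (cst K) K).
by apply: eq_Rintegral => z _ /=; ring.
Qed.

Variables (W : set (borelV R q)) (h : nat -> borelV R m -> R) (K eps : R).
Hypotheses (mW : measurable W) (mh : forall k, measurable_fun setT (h k)).
Hypothesis hK : forall k s, `|h k s| <= K.
Hypothesis hstep : forall k v (s : 'cV[R]_m), (k < N)%N -> W v ->
  `|\int[mu]_z (p z v * (h k.+1 (s + (xi (v, z) : 'cV[R]_m)) - h k.+1 s))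
    + h k.+1 s - h k s| <= eps.

(** [h k] predicts the final value from the state after k terms. The quantity in [hstep] is the
    expected prediction after one more step, the term being added with probability p, minus the
    present prediction; N steps therefore cost N times eps. The indicator of W keeps the pilots for
    which [hstep] is available. *)
Lemma lindeberg : 0 <= eps ->
  `|\int[P]_w (\1_W (pilot w) * h N (S N w)) - \int[P]_w (\1_W (pilot w) * h 0%N 0)| <= N%:R * eps.
Proof.
move=> eps0.
have mW1 : measurable_fun setT (fun w => \1_W (pilot w) : R).
  by apply: (measurableT_comp _ mpilot); exact: measurable_indic.
have W1 v : `|\1_W v : R| <= 1 by rewrite indicE; case: (_ \in _); rewrite ?normr1 ?normr0.
have mD k j : measurable_fun setT (fun w => \1_W (pilot w) * h j (S k w)).
  apply: measurable_funM => //; exact: (measurableT_comp (mh j) (mS k)).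
have K0 : 0 <= K := le_trans (normr_ge0 _) (hK 0 0).
have bD k j w : `|\1_W (pilot w) * h j (S k w)| <= K.
  by rewrite normrM -[leRHS]mul1r; apply: ler_pM.
have iD k j := bounded_integrable P (mD k j) (bD k j).
have S0 w : S 0 w = 0 by rewrite /state big_ord0.
have -> : \int[P]_w (\1_W (pilot w) * h 0%N 0) = \int[P]_w (\1_W (pilot w) * h 0%N (S 0 w)).
  by apply: eq_Rintegral => w _; rewrite S0.
suff main k : (k <= N)%N -> `|\int[P]_w (\1_W (pilot w) * h k (S k w)) -
    \int[P]_w (\1_W (pilot w) * h 0%N (S 0 w))| <= k%:R * eps by exact: main.
elim: k => [|k IH] kN; first by rewrite subrr normr0 mul0r.
rewrite -(subrKA (\int[P]_w (\1_W (pilot w) * h k (S k w)))).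
apply: le_trans (ler_normD _ _) _.
have -> : k.+1%:R * eps = eps + k%:R * eps by rewrite -addn1 natrD mulrDl mul1r addrC.
apply: lerD; last exact/IH/ltnW.
pose Psi (u : (borelV R q * borelV R m) * E) : R :=
  \1_W u.1.1 * (h k.+1 ((u.1.2 : 'cV[R]_m) + (xi (u.1.1, u.2) : 'cV[R]_m)) - h k.+1 u.1.2).
have m11 : measurable_fun setT (fun u : (borelV R q * borelV R m) * E => u.1.1).
  exact: (measurableT_comp measurable_fst measurable_fst).
have m12 : measurable_fun setT (fun u : (borelV R q * borelV R m) * E => u.1.2).
  exact: (measurableT_comp measurable_snd measurable_fst).
have mPsi : measurable_fun setT Psi.
  apply: measurable_funM.
    by apply: (measurableT_comp _ m11); exact: measurable_indic.
  apply: measurable_funB; last exact: (measurableT_comp (mh k.+1) m12).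
  apply: (measurableT_comp (mh k.+1)); apply: measurable_borelVD => //.
  apply: (measurableT_comp mxi); exact: measurable_fun_pair.
have bPsi u : `|Psi u| <= K + K.
  rewrite normrM -[leRHS]mul1r; apply: ler_pM => //.
  by apply: le_trans (ler_normB _ _) _; exact: lerD.
have Sk w : S k.+1 w = (S k w : 'cV[R]_m) + (delta k w)%:R *: (xi (pilot w, Z k w) : 'cV[R]_m).
  by rewrite /state big_ord_recr.
have split w : \1_W (pilot w) * h k.+1 (S k.+1 w) =
    \1_W (pilot w) * h k.+1 (S k w) + (delta k w)%:R * Psi ((pilot w, S k w), Z k w).
  rewrite Sk /Psi/=; case: (delta k w); first by rewrite scale1r mul1r mulrBr [RHS]addrC subrK.
  by rewrite scale0r addr0 mul0r addr0.
have mPdel : measurable_fun setT (fun w => (delta k w)%:R * Psi ((pilot w, S k w), Z k w)).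
  apply: measurable_funM; first exact: measurable_delta.
  by apply: (measurableT_comp mPsi); apply: measurable_fun_pair.
have iPdel : P.-integrable setT (EFin \o (fun w => (delta k w)%:R * Psi ((pilot w, S k w), Z k w))).
  apply: (@bounded_integrable _ _ _ P _ (K + K)) => // w; rewrite normrM.
  apply: le_trans (bPsi ((pilot w, S k w), Z k w)).
  by case: (delta k w); rewrite ?normr1 ?mul1r// normr0 mul0r.
have -> : \int[P]_w (\1_W (pilot w) * h k.+1 (S k.+1 w)) =
   \int[P]_w (\1_W (pilot w) * h k.+1 (S k w)) +
   \int[P]_w \int[mu]_z (p z (pilot w) * Psi ((pilot w, S k w), z)).
  rewrite -(next_Rintegral kN mPsi bPsi) -RintegralD//.
  by apply: eq_Rintegral => w _; exact: split.
have mB : measurable_fun setT (fun w => \int[mu]_z (p z (pilot w) * Psi ((pilot w, S k w), z))).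
  have := @measurable_Rintegral2 _ _ _ _ R (law P (mpS k)) mu _ _ (mpP mPsi) (bP bPsi).
  by move=> hh; exact: (measurableT_comp hh (mpS k)).
have bB w : `|\int[mu]_z (p z (pilot w) * Psi ((pilot w, S k w), z))| <= K + K.
  apply: Rint_bound; first exact: (measurable_fun_pair2 (pilot w, S k w) (mpP mPsi)).
  by move=> z; exact: (bP bPsi ((pilot w, S k w), z)).
have iB := bounded_integrable P mB bB.
have iDB : P.-integrable setT (EFin \o (fun w => \1_W (pilot w) * h k.+1 (S k w) +
    \int[mu]_z (p z (pilot w) * Psi ((pilot w, S k w), z)))).
  by have := integrableD measurableT (iD k k.+1) iB.
rewrite -RintegralD// -RintegralB//.
apply: Rint_bound.
  by apply: measurable_funB => //; exact: measurable_funD.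
move=> w; rewrite indicE; case: (boolP (pilot w \in W)) => [/set_mem Ww|nW]; last first.
  have -> : \int[mu]_z (p z (pilot w) * Psi ((pilot w, S k w), z)) = 0.
    transitivity (\int[mu]_z (0 : R)); last by rewrite Rint_cst.
    by apply: eq_Rintegral => z _; rewrite /Psi /= indicE (negbTE nW) mul0r mulr0.
  by rewrite !mul0r subr0 add0r normr0.
rewrite !mul1r; apply: le_trans _ (hstep (S k w) kN Ww).
have -> : \int[mu]_z (p z (pilot w) * Psi (pilot w, S k w, z)) =
  \int[mu]_z (p z (pilot w) * (h k.+1 ((S k w : 'cV[R]_m) + (xi (pilot w, z) : 'cV[R]_m)) - h k.+1 (S k w))).
  by apply: eq_Rintegral => z _; rewrite /Psi /= indicE mem_set// mul1r.
by rewrite [X in `|X - _|]addrC.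
Qed.

End state.
End lindeberg.

(** * Quantitative central limit theorem and law of large numbers *)

Section limit_bounds.
Context {R : realType} {dE dO : measure_display}.
Context {E : measurableType dE} {Omega : measurableType dO} {q : nat}.
Variables (P : probability Omega R) (mu : probability E R).
Variables (N : nat) (Z : nat -> Omega -> E) (pilot : Omega -> borelV R q).
Variables (delta : nat -> Omega -> bool) (p : E -> borelV R q -> R).
Hypothesis mZ : forall i, measurable_fun setT (Z i).
Hypothesis mpilot : measurable_fun setT pilot.
Hypothesis mdelta : forall i, measurable [set w | delta i w].
Hypothesis mp : measurable_fun setT (fun u : E * borelV R q => p u.1 u.2).
Hypothesis p01 : forall z v, 0 <= p z v <= 1.
Hypothesis next : next_property P mu N Z pilot delta p.
Hypothesis N0 : (0 < N)%N.
Variable W : set (borelV R q).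
Hypothesis mW : measurable W.

Let Nr0 : 0 < N%:R :> R. Proof. by rewrite ltr0n. Qed.
Let mpv v : measurable_fun setT (fun z => p z v) := measurable_sampling mp v.

Section clt.
Context {m : nat}.
Variables (xi : borelV R q * E -> borelV R m).
Hypothesis mxi : measurable_fun setT xi.
Variables (l : seq 'cV[R]_m) (h : 'cV[R]_m -> R) (K : R).
Variables (G : 'cV[R]_m -> 'I_m -> R) (H : 'cV[R]_m -> 'I_m -> 'I_m -> R).
Hypotheses (mh : measurable_fun setT (h : borelV R m -> R)) (hK : forall z, `|h z| <= K).
Hypotheses (HK : forall z i j, `|H z i j| <= K).
Hypothesis tay : forall z v,
  `|h (z + v) - h z - lin (G z) v - 2^-1 * quad (H z) v| <= K * `|v| ^+ 3.
Variables (eta tau : R).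
Hypothesis c1 : forall v, W v ->
  mu.-integrable setT (EFin \o (fun z => p z v * `|(xi (v, z) : 'cV[R]_m)| ^+ 3)).
Hypothesis c1' : forall v, W v -> N%:R * \int[mu]_z (p z v * `|(xi (v, z) : 'cV[R]_m)| ^+ 3) <= tau.
Hypothesis c2 : forall v j, W v -> \int[mu]_z (p z v * (xi (v, z) : 'cV[R]_m) j 0) = 0.
Hypothesis c3 : forall v i j, W v ->
  `|N%:R * \int[mu]_z (p z v * ((xi (v, z) : 'cV[R]_m) i 0 * (xi (v, z) : 'cV[R]_m) j 0))
    - \sum_(u <- l) u i 0 * u j 0| <= eta.
Hypotheses (eta0 : 0 <= eta) (tau0 : 0 <= tau).

Local Notation nu := (gauss l).
Local Notation V := (borelV R m).
Let M3 := \int[nu]_u (`|(u : 'cV[R]_m)| ^+ 3).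
Let b := Num.sqrt (N%:R^-1) : R.
Let c (k : nat) : R := Num.sqrt ((N - k)%:R / N%:R).
Let K0 : 0 <= K := le_trans (normr_ge0 _) (hK 0).
Let b2 : b ^+ 2 = N%:R^-1. Proof. by rewrite sqr_sqrtr// invr_ge0 ltW. Qed.
Let b0 : 0 <= b. Proof. exact: sqrtr_ge0. Qed.

(** Gaussian smoothing with the variance (N - k) / N still to come: at k = N it is h, at k = 0 and s
    = 0 it is the Gaussian integral of h. The scale b is that of one of the N Gaussian
    increments. *)
Let hh (k : nat) (s : V) : R := \int[nu]_u h ((s : 'cV[R]_m) + c k *: (u : 'cV[R]_m)).

Let maff (a : R) : measurable_fun setT ((fun x : V * V => (x.1 : 'cV[R]_m) + a *: (x.2 : 'cV[R]_m)) : V * V -> V).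
Proof. by apply: measurable_borelVD => //; exact: measurable_borelVZ. Qed.

Let mhaff a (s : 'cV[R]_m) : measurable_fun setT (fun u : V => h (s + a *: (u : 'cV[R]_m))).
Proof. exact: (measurableT_comp mh (measurable_fun_pair2 (s : V) (maff a))). Qed.

Let mhh k : measurable_fun setT (hh k).
Proof.
exact: (measurable_Rintegral2 nu nu (measurableT_comp mh (maff (c k))) (fun x => hK _)).
Qed.

Let hhK k s : `|hh k s| <= K.
Proof. by apply: Rint_bound => //; exact: mhaff. Qed.

Let onestep_gauss (s : 'cV[R]_m) :
  `|\int[nu]_u h (s + b *: (u : 'cV[R]_m)) - h s
    - 2^-1 * \sum_i \sum_j H s i j * (N%:R^-1 * \sum_(v <- l) v i 0 * v j 0)| <= K * (N%:R^-1 * b * M3).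
Proof.
have mb : measurable_fun setT ((fun u : V => b *: (u : 'cV[R]_m)) : V -> V) by exact: measurable_borelVZ.
have i3 : nu.-integrable setT (EFin \o (fun u : V => cst 1 u * `|(b *: (u : 'cV[R]_m))| ^+ 3)).
  have i := integrableZl measurableT (b ^+ 3) (gauss_norm3 l).
  by apply: eq_integrable i => // u _; rewrite /= normrZ exprMn ger0_norm// mul1r EFinM.
have := @onestep _ _ _ _ nu (cst 1) _ (measurable_cst _) _ mb i3 h K (G s) (H s) s mh hK (tay s).
have p1 : forall z : V, 0 <= cst (1 : R) z <= 1 by move=> z; rewrite /= ler01 lexx.
move=> /(_ p1).
have i1 : nu.-integrable setT (EFin \o (fun u : V => h (s + b *: (u : 'cV[R]_m)))).
  exact: (bounded_integrable nu (mhaff b s) (fun u => hK _)).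
have ics (r : R) : nu.-integrable setT (EFin \o (fun u : V => r)).
  by apply: (@bounded_integrable _ _ _ nu _ `|r|).
have -> : \int[nu]_z (cst 1 z * (h (s + b *: (z : 'cV[R]_m)) - h s)) =
   \int[nu]_u h (s + b *: (u : 'cV[R]_m)) - h s.
  rewrite -[X in _ - X](Rint_cst nu) -RintegralB//.
  by apply: eq_Rintegral => u _; rewrite /= mul1r.
have -> : \sum_j G s j * \int[nu]_z (cst 1 z * (b *: (z : 'cV[R]_m)) j 0) = 0.
  apply: big1 => j _; have [i e] := gauss_coord_mean l j.
  rewrite (_ : \int[nu]_z _ = b * \int[nu]_z (z : 'cV[R]_m) j 0); first by rewrite e !mulr0.
  by rewrite -RintegralZl//; apply: eq_Rintegral => u _; rewrite /= mul1r mxE.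
have -> : \sum_i \sum_j H s i j * \int[nu]_z (cst 1 z * ((b *: (z : 'cV[R]_m)) i 0 * (b *: (z : 'cV[R]_m)) j 0)) =
    \sum_i \sum_j H s i j * (N%:R^-1 * \sum_(v <- l) v i 0 * v j 0).
  apply: eq_bigr => i _; apply: eq_bigr => j _; congr (_ * _).
  have [ic ec] := gauss_coord_cov l i j.
  rewrite -ec -RintegralZl//; apply: eq_Rintegral => u _; rewrite /= mul1r !mxE -b2 expr2; ring.
rewrite subr0.
have -> : \int[nu]_z (cst 1 z * `|b *: (z : 'cV[R]_m)| ^+ 3) = N%:R^-1 * b * M3.
  rewrite /M3 -RintegralZl//; last exact: gauss_norm3.
  apply: eq_Rintegral => u _; rewrite /= mul1r normrZ exprMn ger0_norm// -b2; ring.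
by [].
Qed.

Let eps := K * (m%:R ^+ 2 * eta + tau + b * M3) / N%:R.

Let M30 : 0 <= M3.
Proof. by apply: Rintegral_ge0 => u _; rewrite exprn_ge0. Qed.

(** One sampled term against one Gaussian increment of scale b. Both have mean zero, the second
    moments differ by at most eta / N, and the third order errors are tau / N and b M3 / N, all up
    to the factor K and the dimension. *)
Let local_step (v : borelV R q) (s : 'cV[R]_m) : W v ->
  `|\int[mu]_z (p z v * (h (s + (xi (v, z) : 'cV[R]_m)) - h s))
    + h s - \int[nu]_u h (s + b *: (u : 'cV[R]_m))| <= eps.
Proof.
move=> Wv; have B := onestep_gauss s.
have mxiv : measurable_fun setT (fun z => xi (v, z)) by exact: (measurable_fun_pair2 v mxi).
have A := @onestep _ _ _ _ mu (fun z => p z v) (fun z => xi (v, z)) (mpv v) (fun z => p01 z v)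
  mxiv (c1 Wv) h K (G s) (H s) s mh hK (tay s).
have e1 : \sum_j G s j * \int[mu]_z (p z v * (xi (v, z) : 'cV[R]_m) j 0) = 0.
  by apply: big1 => j _; rewrite c2// mulr0.
rewrite e1 subr0 in A.
set I1 := \int[mu]_z _ in A *; set I2 := \int[nu]_u _ in B *.
set Q1 := \sum_i \sum_j _ in A; set Q2 := \sum_i \sum_j _ in B.
have QQ : `|Q1 - Q2| <= m%:R * (m%:R * (K * (eta / N%:R))).
  rewrite /Q1 /Q2 -sumrB; apply: le_trans (ler_norm_sum _ _ _) _.
  apply: sum_le_const => i; rewrite -sumrB; apply: le_trans (ler_norm_sum _ _ _) _.
  apply: sum_le_const => j; rewrite -mulrBr normrM; apply: ler_pM => //.
  rewrite ler_pdivlMr// -[X in _ * X]gtr0_norm// -normrM mulrBl mulrC mulrAC mulVf ?gt_eqF// mul1r.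
  exact: c3.
have T1 : K * \int[mu]_z (p z v * `|(xi (v, z) : 'cV[R]_m)| ^+ 3) <= K * (tau / N%:R).
  by rewrite ler_wpM2l// ler_pdivlMr// mulrC c1'.
have epsE : eps = m%:R * (m%:R * (K * (eta / N%:R))) + K * (tau / N%:R) + K * (N%:R^-1 * b * M3).
  by rewrite /eps; field; rewrite gt_eqF.
have QQ0 : 0 <= m%:R * (m%:R * (K * (eta / N%:R))) by rewrite !mulr_ge0// divr_ge0// ltW.
rewrite epsE; move: A B QQ; rewrite !ler_norml => /andP[A1 A2] /andP[B1 B2] /andP[Q1' Q2'].
by apply/andP; split; lra.
Qed.

Lemma clt_bound :
  `|\int[P]_w (\1_W (pilot w) * h (state Z pilot delta xi N w))
    - \int[P]_w (\1_W (pilot w) * \int[nu]_u h u)|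
  <= K * (m%:R ^+ 2 * eta + tau + b * M3).
Proof.
have eps0 : 0 <= eps.
  by rewrite /eps divr_ge0 ?(ltW Nr0)// mulr_ge0// !addr_ge0// mulr_ge0// exprn_ge0.
have hN : hh N = h.
  apply/funext => s; rewrite /hh /c subnn mul0r sqrtr0.
  transitivity (\int[nu]_u h s); last by rewrite Rint_cst.
  by apply: eq_Rintegral => u _; rewrite scale0r addr0.
have h0 : hh 0%N 0 = \int[nu]_u h u.
  rewrite /hh /c subn0 mulfV ?gt_eqF// sqrtr1.
  by apply: eq_Rintegral => u _; rewrite scale1r add0r.
have := @lindeberg _ _ _ _ _ _ P mu N Z pilot delta p mZ mpilot mdelta mp p01 next m xi mxi W hh K eps
  mW mhh hhK.
rewrite hN h0 (_ : N%:R * eps = K * (m%:R ^+ 2 * eta + tau + b * M3)); last first.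
  by rewrite /eps; field; rewrite gt_eqF.
apply => // k v s kN Wv.
(* The remaining variance loses 1 / N at each step, so by stability the smoothing at k is the
   smoothing at k + 1 followed by one increment. *)
have cE : c k = Num.sqrt (c k.+1 ^+ 2 + b ^+ 2).
  rewrite b2 [c k.+1 ^+ 2]sqr_sqrtr; last by rewrite divr_ge0// ltW.
  by rewrite /c -[X in _ / _ + X]mul1r -mulrDl natr1 subnSK.
have hhk : hh k s = \int[nu]_u \int[nu]_w h (s + c k.+1 *: (u : 'cV[R]_m) + b *: (w : 'cV[R]_m)).
  have mF : measurable_fun setT (fun w : V => h (s + (w : 'cV[R]_m))).
    have := mhaff 1 s; congr (measurable_fun _ _); apply/funext => u; by rewrite scale1r.
  have := gauss_stable l (c k.+1) b mF (fun u => hK _).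
  rewrite -cE /hh => <-; apply: eq_Rintegral => u _; apply: eq_Rintegral => w _.
  by rewrite addrA.
(* Exchanging the smoothing with the law of the observation allows [local_step] to be applied at
   each smoothed point s + c u. *)
pose f (zu : E * V) : R := p zu.1 v * (h (s + (xi (v, zu.1) : 'cV[R]_m) + c k.+1 *: (zu.2 : 'cV[R]_m))
   - h (s + c k.+1 *: (zu.2 : 'cV[R]_m))).
have mf : measurable_fun setT f.
  apply: measurable_funM; first exact: (measurableT_comp (mpv v) measurable_fst).
  apply: measurable_funB; last first.
    exact: (measurableT_comp (mhaff (c k.+1) s) measurable_snd).
  apply: (measurableT_comp mh); apply: measurable_borelVD; last exact: measurable_borelVZ.
  apply: measurable_borelVD => //; apply: (measurableT_comp mxi).
  exact: measurable_fun_pair.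
have fK x : `|f x| <= K + K.
  have /andP[p0 p1] := p01 x.1 v; rewrite normrM -[leRHS]mul1r; apply: ler_pM => //.
    by rewrite ger0_norm.
  by apply: le_trans (ler_normB _ _) _; exact: lerD.
have is1 (s' : 'cV[R]_m) : nu.-integrable setT (EFin \o (fun u : V => h (s' + c k.+1 *: (u : 'cV[R]_m)))).
  exact: (bounded_integrable nu (mhaff _ s') (fun u => hK _)).
have -> : \int[mu]_z (p z v * (hh k.+1 (s + (xi (v, z) : 'cV[R]_m)) - hh k.+1 s)) =
    \int[nu]_u \int[mu]_z f (z, u).
  rewrite -(Rfubini mu nu mf fK); apply: eq_Rintegral => z _.
  rewrite /f /hh -RintegralB// -RintegralZl//.
  by have := integrableB measurableT (is1 (s + (xi (v, z) : 'cV[R]_m))) (is1 s).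
pose f2 (u : V) := \int[nu]_w h (s + c k.+1 *: (u : 'cV[R]_m) + b *: (w : 'cV[R]_m)).
have mf2 : measurable_fun setT f2.
  have m1 : measurable_fun setT ((fun x : V * V => s + c k.+1 *: (x.1 : 'cV[R]_m) + b *: (x.2 : 'cV[R]_m)) : V * V -> V).
    apply: measurable_borelVD; last exact: measurable_borelVZ.
    by apply: measurable_borelVD => //; exact: measurable_borelVZ.
  exact: (measurable_Rintegral2 nu nu (measurableT_comp mh m1) (fun x => hK _)).
have f2K u : `|f2 u| <= K by apply: Rint_bound => //; exact: mhaff.
have i2 := bounded_integrable nu mf2 f2K.
have mf1 : measurable_fun setT (fun u => \int[mu]_z f (z, u)).
  have msw : measurable_fun setT (fun uz : V * E => f (uz.2, uz.1)).
    by apply: (measurableT_comp mf); exact: measurable_fun_pair.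
  exact: (measurable_Rintegral2 nu mu msw (fun x => fK _)).
have f1K u : `|\int[mu]_z f (z, u)| <= K + K.
  by apply: Rint_bound => //; exact: (measurable_fun_pair1 u mf).
have i1 := bounded_integrable nu mf1 f1K.
rewrite hhk -/(f2 _) /(hh k.+1 s).
have i12 : nu.-integrable setT (EFin \o (fun u => \int[mu]_z f (z, u) + h (s + c k.+1 *: (u : 'cV[R]_m)))).
  by have := integrableD measurableT i1 (is1 s).
rewrite -RintegralD// -RintegralB//.
apply: Rint_bound.
  by apply: measurable_funB => //; apply: measurable_funD => //; exact: mhaff.
move=> u; rewrite /f /f2.
have := local_step (s + c k.+1 *: (u : 'cV[R]_m)) Wv.
rewrite (_ : \int[mu]_z (p z v * (h (s + c k.+1 *: (u : 'cV[R]_m) + (xi (v, z) : 'cV[R]_m)) -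
     h (s + c k.+1 *: (u : 'cV[R]_m)))) = \int[mu]_z f (z, u))//.
by apply: eq_Rintegral => z _; rewrite /f/= addrAC.
Qed.

End clt.

Section lln.
Variables (phi : borelV R q * E -> R).
Hypothesis mphi : measurable_fun setT phi.
Variables (g g1 g2 : R -> R) (K m0 eta tau : R).
Hypotheses (mg : measurable_fun setT g) (K0 : 0 <= K).
Hypotheses (gK : forall x, `|g x| <= K) (g1K : forall x, `|g1 x| <= K) (g2K : forall x, `|g2 x| <= K).
Hypothesis gT : forall x v, `|g (x + v) - g x - g1 x * v - 2^-1 * g2 x * v ^+ 2| <= K * `|v| ^+ 3.
Hypothesis c1 : forall v, W v -> mu.-integrable setT (EFin \o (fun z => p z v * phi (v, z) ^+ 2)).
Hypothesis c1' : forall v, W v -> N%:R * \int[mu]_z (p z v * phi (v, z) ^+ 2) <= tau.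
Hypothesis c2 : forall v, W v -> `|N%:R * \int[mu]_z (p z v * phi (v, z)) - m0| <= eta.
Hypotheses (eta0 : 0 <= eta) (tau0 : 0 <= tau).

(** For |v| <= 1 the second order terms are absorbed in K v^2; for larger v three bounded or linear
    terms give the constant 3. *)
Let taylor1 x v : `|g (x + v) - g x - g1 x * v| <= 3 * K * v ^+ 2.
Proof.
rewrite -(real_normK (num_real v)).
have h1 : `|g1 x * v| <= K * `|v| by rewrite normrM ler_wpM2r.
have T := gT x v; have a1 := gK (x + v); have a2 := gK x; have a3 := g2K x.
have v0 := normr_ge0 v; have [v1|v1] := lerP `|v| 1.
  have h2 : `|2^-1 * g2 x * v ^+ 2| <= 2^-1 * K * `|v| ^+ 2.
    rewrite -mulrA normrM ger0_norm ?invr_ge0// -[leRHS]mulrA ler_wpM2l ?invr_ge0// normrM.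
    by rewrite [X in _ * X]normrX ler_wpM2r ?exprn_ge0.
  have h3 : K * `|v| ^+ 3 <= K * `|v| ^+ 2.
    by rewrite ler_wpM2l// exprS ler_piMl// exprn_ge0.
  have h4 : 0 <= K * `|v| ^+ 2 by rewrite mulr_ge0// exprn_ge0.
  move: T h2; rewrite !ler_norml => /andP[T1 T2] /andP[b1 b2]; apply/andP; split; lra.
have h2 : K * 1 <= K * `|v| ^+ 2 by rewrite ler_wpM2l// exprn_ege1// ltW.
have h3 : K * `|v| <= K * `|v| ^+ 2 by rewrite ler_wpM2l// expr2 ler_peMl// ltW.
move: h1 a1 a2; rewrite !ler_norml => /andP[b1 b2] /andP[b3 b4] /andP[b5 b6].
by apply/andP; split; lra.
Qed.

Let xi (u : borelV R q * E) : borelV R 1 := const_mx (phi u) : 'cV[R]_1.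

Let mxi : measurable_fun setT xi.
Proof. by apply: measurable_borelV => j; under eq_fun do rewrite mxE. Qed.

Let stateE w : (state Z pilot delta xi N w : 'cV[R]_1) 0 0 =
  \sum_(i < N) (delta i w)%:R * phi (pilot w, Z i w).
Proof. by rewrite /state summxE; apply: eq_bigr => i _; rewrite !mxE. Qed.

(** The same telescoping without Gaussian smoothing. The prediction subtracts the drift k m0 / N, a
    first order expansion is enough, and the error is governed by second moments. *)
Lemma lln_bound :
  `|\int[P]_w (\1_W (pilot w) * g (\sum_(i < N) (delta i w)%:R * phi (pilot w, Z i w) - m0))
    - \int[P]_w (\1_W (pilot w) * g 0)| <= 3 * K * (eta + tau + m0 ^+ 2 / N%:R).
Proof.
pose hh (k : nat) (s : borelV R 1) : R := g ((s : 'cV[R]_1) 0 0 - k%:R / N%:R * m0).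
have mhh k : measurable_fun setT (hh k).
  by apply: (measurableT_comp mg); apply: measurable_funB => //; exact: measurable_coord.
pose eps := 3 * K * (eta + tau + m0 ^+ 2 / N%:R) / N%:R.
have eps0 : 0 <= eps.
  by rewrite /eps divr_ge0 ?(ltW Nr0)// !mulr_ge0// !addr_ge0// divr_ge0 ?sqr_ge0// ltW.
have := @lindeberg _ _ _ _ _ _ P mu N Z pilot delta p mZ mpilot mdelta mp p01 next 1 xi mxi W hh K eps
  mW mhh (fun k s => gK _).
rewrite (_ : N%:R * eps = 3 * K * (eta + tau + m0 ^+ 2 / N%:R)); last first.
  by rewrite /eps; field; rewrite gt_eqF.
have h0 : hh 0%N 0 = g 0 by rewrite /hh mxE mul0r mul0r subr0.
have hN w : hh N (state Z pilot delta xi N w) =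
    g (\sum_(i < N) (delta i w)%:R * phi (pilot w, Z i w) - m0).
  by rewrite /hh stateE mulfV ?gt_eqF// mul1r.
rewrite h0; under eq_Rintegral do rewrite hN.
apply => // k v s kN Wv.
set y := (s : 'cV[R]_1) 0 0 - k.+1%:R / N%:R * m0.
have e1 : hh k.+1 s = g y by [].
have e2 : hh k s = g (y + m0 / N%:R).
  by rewrite /hh /y -natr1; congr g; field; rewrite gt_eqF.
have mphiv : measurable_fun setT (fun z => phi (v, z)) := measurable_fun_pair2 v mphi.
have i1 : mu.-integrable setT (EFin \o (fun z => p z v * phi (v, z))).
  have ic : mu.-integrable setT (EFin \o (fun z : E => 1 : R)).
    by apply: (@bounded_integrable _ _ _ mu _ 1) => // x; rewrite normr1.
  have i2 : mu.-integrable setT (EFin \o (fun z => 1 + p z v * phi (v, z) ^+ 2)).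
    by have := integrableD measurableT ic (c1 Wv).
  apply: integrable_le i2; first exact: measurable_funM.
  move=> z; have /andP[p0 p1] := p01 z v; rewrite normrM ger0_norm//.
  rewrite -(real_normK (num_real (phi (v, z)))); move: (`|phi (v, z)|) (normr_ge0 (phi (v, z))) => t t0.
  have := mulr_ge0 p0 (sqr_ge0 (t - 1)); rewrite sqrrB expr1n; nra.
have ig : mu.-integrable setT (EFin \o (fun z => p z v * (g (y + phi (v, z)) - g y))).
  apply: (@bounded_integrable _ _ _ mu _ (1 * (K + K))).
    by apply: measurable_funM => //; apply: measurable_funB => //; apply: (measurableT_comp mg); exact: measurable_funD.
  move=> z; have /andP[p0 p1] := p01 z v; rewrite normrM; apply: ler_pM => //.
    by rewrite ger0_norm.
  by apply: le_trans (ler_normB _ _) _; exact: lerD.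
have ig1 : mu.-integrable setT (EFin \o (fun z => g1 y * (p z v * phi (v, z)))).
  by have := integrableZl measurableT (g1 y) i1.
have iD : mu.-integrable setT (EFin \o (fun z => p z v * (g (y + phi (v, z)) - g y) - g1 y * (p z v * phi (v, z)))).
  by have := integrableB measurableT ig ig1.
have A : `|\int[mu]_z (p z v * (g (y + phi (v, z)) - g y)) - g1 y * \int[mu]_z (p z v * phi (v, z))|
    <= 3 * K * \int[mu]_z (p z v * phi (v, z) ^+ 2).
  rewrite -RintegralZl// -RintegralB//; apply: le_trans (le_normr_Rintegral _ _) _ => //.
  have iK := c1 Wv; rewrite -RintegralZl//; apply: le_Rintegral => //.
  - by have := integrable_norm iD.
  - by have := integrableZl measurableT (3 * K) iK.
  move=> z _; have /andP[p0 p1] := p01 z v.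
  have -> : p z v * (g (y + phi (v, z)) - g y) - g1 y * (p z v * phi (v, z)) =
    p z v * (g (y + phi (v, z)) - g y - g1 y * phi (v, z)) by ring.
  by rewrite normrM ger0_norm// mulrCA ler_wpM2l.
have -> : \int[mu]_z (p z v * (hh k.+1 (s + (xi (v, z) : 'cV[R]_1)) - hh k.+1 s)) =
   \int[mu]_z (p z v * (g (y + phi (v, z)) - g y)).
  by apply: eq_Rintegral => z _; rewrite /hh !mxE /y addrAC.
rewrite e1 e2.
have B := taylor1 y (m0 / N%:R).
have C : `|g1 y * (\int[mu]_z (p z v * phi (v, z)) - m0 / N%:R)| <= K * (eta / N%:R).
  rewrite normrM; apply: ler_pM => //.
  rewrite ler_pdivlMr// -[X in _ * X]gtr0_norm// -normrM mulrBl divfK ?gt_eqF// mulrC.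
  exact: c2.
have T1 : 3 * K * \int[mu]_z (p z v * phi (v, z) ^+ 2) <= 3 * K * (tau / N%:R).
  by rewrite ler_wpM2l ?mulr_ge0// ler_pdivlMr// mulrC c1'.
have epsE : eps = 3 * K * (tau / N%:R) + 3 * (K * (eta / N%:R)) + 3 * K * (m0 / N%:R) ^+ 2.
  by rewrite /eps; field; rewrite gt_eqF.
have eta0' : 0 <= K * (eta / N%:R) by rewrite mulr_ge0// divr_ge0// ltW.
rewrite mulrBr in C.
rewrite epsE; move: A B C; rewrite !ler_norml => /andP[A1 A2] /andP[B1 B2] /andP[C1 C2].
by apply/andP; split; lra.
Qed.

Lemma measurable_sum_sampled :
  measurable_fun setT (fun w => \sum_(i < N) (delta i w)%:R * phi (pilot w, Z i w)).
Proof.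
apply: measurable_sum => i; apply: measurable_funM; first exact: measurable_delta.
by apply: (measurableT_comp mphi); exact: measurable_fun_pair.
Qed.

(** Since g vanishes at 0 and is at least 1 at distance rho from it, the bound on its integral is a
    bound on the probability of a deviation. *)
Lemma lln_prob (rho : R) (g0 : forall x, 0 <= g x) (g00 : g 0 = 0)
    (ge1 : forall x, rho <= `|x| -> 1 <= g x) :
  let A := [set w | W (pilot w) /\ rho <= `|\sum_(i < N) (delta i w)%:R * phi (pilot w, Z i w) - m0|] in
  measurable A /\ (P A <= (3 * K * (eta + tau + m0 ^+ 2 / N%:R))%:E)%E.
Proof.
set D := fun w => \sum_(i < N) (delta i w)%:R * phi (pilot w, Z i w) - m0.
have mD : measurable_fun setT D by apply: measurable_funB => //; exact: measurable_sum_sampled.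
move=> A; have mA : measurable A.
  have -> : A = (pilot @^-1` W) `&` [set w | rho <= `|D w|] by [].
  apply: measurableI; first by rewrite -[X in measurable X]setTI; exact: mpilot.
  have : measurable_fun setT (fun w => rho <= `|D w|).
    by apply: measurable_fun_ler => //; exact: measurableT_comp.
  by move=> /(_ measurableT [set true] I); rewrite setTI.
split => //.
have mW1 : measurable_fun setT (fun w => \1_W (pilot w) : R).
  by apply: (measurableT_comp _ mpilot); exact: measurable_indic.
have m1 : measurable_fun setT (fun w => \1_W (pilot w) * g (D w)).
  by apply: measurable_funM => //; exact: measurableT_comp.
have W01 v : 0 <= (\1_W v : R) <= 1 by rewrite indicE; case: (_ \in _); rewrite /= ?lexx ler01.
have b1 w : `|\1_W (pilot w) * g (D w)| <= K.
  have /andP[w0 w1] := W01 (pilot w).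
  by rewrite normrM -[leRHS]mul1r ler_pM// ger0_norm.
have i1 := bounded_integrable P m1 b1.
have A1 : (P A <= \int[P]_w (\1_W (pilot w) * g (D w))%:E)%E.
  rewrite -[X in P X]setIT -(integral_indic P measurableT mA).
  apply: ge0_le_integral => //.
  - by apply/measurable_EFinP; exact: measurable_indic.
  - exact/measurable_EFinP.
  move=> w _; rewrite lee_fin indicE; case: (boolP (w \in A)) => [|_]; last first.
    by rewrite mulr_ge0//; case/andP: (W01 (pilot w)).
  by rewrite inE => -[w1 w2]; rewrite indicE mem_set// mul1r; exact: ge1.
apply: le_trans A1 _.
have fi := integrable_fin_num measurableT i1.
rewrite -(fineK fi) lee_fin; have := lln_bound.
rewrite g00; under [X in _ - X]eq_Rintegral do rewrite mulr0.
rewrite Rint_cst subr0; apply: le_trans; exact: ler_norm.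
Qed.

End lln.
End limit_bounds.

(** * Events of probability close to one *)

Section whp.
Context {R : realType} {dO : measure_display} {Omega : measurableType dO}.
Variable P : probability Omega R.

(** The exceptional set A is measurable and need only contain the failures of Q, which may
    themselves form a nonmeasurable set. The level e is fixed while N grows. *)
Definition whp (e : R) (Q : nat -> Omega -> Prop) := \forall N \near \oo,
  exists A, [/\ measurable A, (P A <= e%:E)%E & forall w, ~ A w -> Q N w].

Lemma whp_le e1 e2 Q1 Q2 : e1 <= e2 ->
  (\forall N \near \oo, forall w, Q1 N w -> Q2 N w) -> whp e1 Q1 -> whp e2 Q2.
Proof.
move=> le12; apply: filterS2 => N Q12 [A [mA PA AQ]]; exists A; split => //.
  by apply: le_trans PA _; rewrite lee_fin.
by move=> w /AQ; exact: Q12.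
Qed.

Lemma whp_and e1 e2 Q1 Q2 : whp e1 Q1 -> whp e2 Q2 ->
  whp (e1 + e2) (fun N w => Q1 N w /\ Q2 N w).
Proof.
apply: filterS2 => N [A [mA PA AQ]] [B [mB PB BQ]]; exists (A `|` B); split.
- exact: measurableU.
- by apply: le_trans (measureU2 _ mA mB) _; rewrite EFinD; exact: leeD.
- by move=> w AB; split; [apply: AQ => ?; apply: AB; left|apply: BQ => ?; apply: AB; right].
Qed.

Lemma whp_forall (I : finType) e (Q : I -> nat -> Omega -> Prop) :
  (forall i, whp e (Q i)) -> whp (#|I|%:R * e) (fun N w => forall i, Q i N w).
Proof.
move=> HQ.
have : whp ((size (enum I))%:R * e) (fun N w => forall i, i \in enum I -> Q i N w).
  elim: (enum I) => [|i s IH].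
    by near=> N; exists set0; split => //; rewrite measure0 mul0r.
  rewrite /= -natr1 addrC mulrDl mul1r; apply: (@whp_le (e + (size s)%:R * e)) (whp_and (HQ i) IH) => //.
  by near=> N => w [h1 h2] j; rewrite inE => /orP[/eqP ->//|]; exact: h2.
rewrite -cardE; apply: whp_le => //; near=> N => w h i; apply: h; exact: mem_enum.
Unshelve. all: by end_near. Qed.

Lemma whp_imp e (Q1 Q2 : nat -> Omega -> Prop) : (forall e, 0 < e -> whp e Q1) -> 0 < e ->
  whp (e / 2) (fun N w => Q1 N w -> Q2 N w) -> whp e Q2.
Proof.
move=> h1 e0 h2; have e2 : 0 < e / 2 by rewrite divr_gt0.
apply: whp_le (whp_and (h1 _ e2) h2); first lra.
by near=> N => w [w1 w2]; exact: (w2 w1).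
Unshelve. all: by end_near. Qed.

End whp.

Section bump.
Context {R : realType}.

(** Two mirrored steps. The step reaches 1 at 3, so the scale 3 / rho makes each of them reach 1 at
    distance rho. *)
Lemma bump_exists (rho : R) : 0 < rho -> exists K g g1 g2,
  [/\ measurable_fun setT (g : R -> R), [/\ 0 <= K, forall x, `|g x| <= K,
      forall x, `|g1 x| <= K & forall x, `|g2 x| <= K],
    forall x v, `|g (x + v) - g x - g1 x * v - 2^-1 * g2 x * v ^+ 2| <= K * `|v| ^+ 3
  & [/\ forall x, 0 <= g x, g 0 = 0 & forall x, rho <= `|x| -> 1 <= g x]].
Proof.
move=> rho0; pose r := 3 / rho.
pose g (x : R) := 1 * spline_step (r * x + 0) + 1 * spline_step (- r * x + 0).
have sg : smooth1 g.
  by apply: smooth1_lin; apply: smooth1_affine; exact: smooth1_spline_step.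
have mg : measurable_fun setT g.
  have mc : measurable_fun setT ((fun x : R => const_mx x : 'cV[R]_1) : R -> borelV R 1).
    apply: measurable_borelV => j.
    by rewrite (_ : (fun x => _) = id)//; apply/funext => x; rewrite mxE.
  have := measurableT_comp (smooth_measurable (smooth_coord (ord0 : 'I_1) sg)) mc.
  by congr (measurable_fun _ _); apply/funext => x /=; rewrite mxE.
move: (sg) => [K [g1 [g2 [K0 gK g1K g2K T]]]]; exists K, g, g1, g2; split => //; split.
- move=> x; have /andP[a _] := spline_step_ge0 (r * x + 0).
  by have /andP[b _] := spline_step_ge0 (- r * x + 0); rewrite /g; lra.
- by rewrite /g !mulr0 addr0 spline_step_lt0// !mulr0 addr0.
- move=> x; have /andP[a _] := spline_step_ge0 (r * x + 0).
  have /andP[b _] := spline_step_ge0 (- r * x + 0).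
  have r0 : 0 < r by rewrite divr_gt0.
  have rr : r * rho = 3 by rewrite /r divfK// gt_eqF.
  rewrite ler_normr => /orP[h|h].
    have := ler_wpM2l (ltW r0) h; rewrite rr => h'.
    have s3 : spline_step (r * x + 0) = 1 by apply: spline_step_gt3; rewrite addr0.
    by rewrite /g s3; lra.
  have := ler_wpM2l (ltW r0) h; rewrite rr => h'.
  have s3 : spline_step (- r * x + 0) = 1 by apply: spline_step_gt3; rewrite addr0 mulNr -mulrN.
  by rewrite /g s3; lra.
Qed.

End bump.

(** * Sums over the subsample: Markov bound, law of large numbers, tightness *)

Section sampled_sums.
Context {R : realType} {dE dO : measure_display}.
Context {E : measurableType dE} {Omega : measurableType dO} {q : nat}.
Variables (P : probability Omega R) (mu : probability E R).
Variables (Z : nat -> Omega -> E) (pilot : nat -> Omega -> borelV R q).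
Variables (delta : nat -> nat -> Omega -> bool) (p : nat -> E -> borelV R q -> R).
Hypothesis mZ : forall i, measurable_fun setT (Z i).
Hypothesis mpilot : forall N, measurable_fun setT (pilot N).
Hypothesis mdelta : forall N i, measurable [set w | delta N i w].
Hypothesis mp : forall N, (0 < N)%N ->
  measurable_fun setT (fun u : E * borelV R q => p N u.1 u.2).
Hypothesis p01 : forall N z v, (0 < N)%N -> 0 <= p N z v <= 1.
Hypothesis next : forall N, (0 < N)%N ->
  next_property P mu N Z (pilot N) (delta N) (p N).

(** For the remainder terms only a mean is controlled, so this is Markov's inequality, summed unit
    by unit through [next] and restricted to pilots in W. *)
Lemma sampled_markov N (W : set (borelV R q)) (L : borelV R q * E -> R) (C A : R) :
  (0 < N)%N -> measurable W -> measurable_fun setT L -> (forall u, 0 <= L u) -> 0 < A ->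
  0 <= C ->
  (forall v, W v -> (\int[mu]_z (p N z v * L (v, z))%:E <= (C / N%:R)%:E)%E) ->
  let B := [set w | W (pilot N w) /\
    A <= \sum_(i < N) (delta N i w)%:R * L (pilot N w, Z i w)] in
  measurable B /\ (P B <= (C / A)%:E)%E.
Proof.
move=> N0 mW mL L0 A0 C0 LC B.
have mS : measurable_fun setT (fun w => \sum_(i < N) (delta N i w)%:R * L (pilot N w, Z i w)).
  exact: (@measurable_sum_sampled _ _ _ _ _ _ N Z (pilot N) (delta N) mZ (mpilot N) (mdelta N) L mL).
have mB : measurable B.
  apply: (@measurableI _ _ (pilot N @^-1` W) [set w | A <= \sum_(i < N) (delta N i w)%:R * L (pilot N w, Z i w)]).
    by rewrite -[X in measurable X]setTI; exact: mpilot.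
  have : measurable_fun setT (fun w => A <= \sum_(i < N) (delta N i w)%:R * L (pilot N w, Z i w)).
    exact: measurable_fun_ler.
  by move=> /(_ measurableT [set true] I); rewrite setTI.
split => //.
have W0 v : 0 <= (\1_W v : R) by rewrite indicE; case: (_ \in _).
have mW1 : measurable_fun setT (\1_W : borelV R q -> R) by exact: measurable_indic.
pose Psi (u : (borelV R q * borelV R 0) * E) : R := \1_W u.1.1 * L (u.1.1, u.2).
have mPsi : measurable_fun setT Psi.
  apply: measurable_funM.
    by apply: (measurableT_comp mW1); exact: (measurableT_comp measurable_fst measurable_fst).
  apply: (measurableT_comp mL); apply: measurable_fun_pair => //.
  exact: (measurableT_comp measurable_fst measurable_fst).
have Psi0 u : 0 <= Psi u by rewrite mulr_ge0.
have st k : (k < N)%N ->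
    (\int[P]_w ((delta N k w)%:R * (\1_W (pilot N w) * L (pilot N w, Z k w)))%:E <= (C / N%:R)%:E)%E.
  move=> kN.
  have mx0 : measurable_fun setT ((fun=> 0 : 'cV[R]_0) : borelV R q * E -> borelV R 0) by [].
  rewrite (next N0 mx0 kN mPsi Psi0) /Psi/=.
  have : (\int[P]_w \int[mu]_z (p N z (pilot N w) * (\1_W (pilot N w) * L (pilot N w, z)))%:E <= \int[P]_w (C / N%:R)%:E)%E.
    have mf : measurable_fun setT (fun u : Omega * E => (p N u.2 (pilot N u.1) * (\1_W (pilot N u.1) * L (pilot N u.1, u.2)))%:E).
      have m1 : measurable_fun setT (fun u : Omega * E => pilot N u.1) by exact: (measurableT_comp (mpilot N) measurable_fst).
      apply/measurable_EFinP; apply: measurable_funM.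
        have m2 : measurable_fun setT (fun u : Omega * E => (u.2, pilot N u.1)) by exact: measurable_fun_pair.
        exact: (measurableT_comp (mp N0) m2).
      apply: measurable_funM; first exact: (measurableT_comp mW1 m1).
      by apply: (measurableT_comp mL); exact: measurable_fun_pair.
    have mf0 u : (0 <= (p N u.2 (pilot N u.1) * (\1_W (pilot N u.1) * L (pilot N u.1, u.2)))%:E)%E.
      by have /andP[p0 _] := p01 u.2 (pilot N u.1) N0; rewrite lee_fin !mulr_ge0.
    apply: ge0_le_integral => //.
    - by move=> w _; apply: integral_ge0 => z _; exact: (mf0 (w, z)).
    - by have := measurable_fun_fubini_tonelli_F _ mf mf0; exact.
    - move=> w _; rewrite indicE; case: (boolP (pilot N w \in W)) => [|_].
        rewrite inE => Wv; under eq_integral do rewrite mul1r; exact: LC.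
      under eq_integral do rewrite mul0r mulr0; rewrite integral0 lee_fin divr_ge0//.
  by rewrite integral_cst//= probability_setT mule1.
have mk k : measurable_fun setT (fun w => ((delta N k w)%:R * (\1_W (pilot N w) * L (pilot N w, Z k w)))%:E).
  apply/measurable_EFinP; apply: measurable_funM; first exact: (measurable_delta (mdelta N)).
  apply: measurable_funM; first exact: (measurableT_comp mW1 (mpilot N)).
  by apply: (measurableT_comp mL); exact: measurable_fun_pair.
have k0 k w : (0 <= ((delta N k w)%:R * (\1_W (pilot N w) * L (pilot N w, Z k w)))%:E)%E.
  by rewrite lee_fin !mulr_ge0.
have tot : (\int[P]_w (\sum_(k < N) ((delta N k w)%:R * (\1_W (pilot N w) * L (pilot N w, Z k w)))%:E) <= C%:E)%E.
  rewrite ge0_integral_sum//.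
  apply: (@le_trans _ _ (\sum_(k < N) (C / N%:R)%:E)%E).
    by apply: lee_sum => k _; exact: st.
  by rewrite sumEFin lee_fin sumr_const card_ord -[leLHS]mulr_natr divfK ?lexx ?gt_eqF ?ltr0n.
have AP : (A%:E * P B <= \int[P]_w (\sum_(k < N) ((delta N k w)%:R * (\1_W (pilot N w) * L (pilot N w, Z k w)))%:E))%E.
  rewrite -[X in P X]setIT -(integral_indic P measurableT mB) -ge0_integralZl//; last 2 first.
  - by apply/measurable_EFinP; exact: measurable_indic.
  - by rewrite lee_fin ltW.
  apply: ge0_le_integral => //.
  - by move=> w _; rewrite mule_ge0 ?lee_fin ?(ltW A0).
  - by apply: measurable_funeM; apply/measurable_EFinP; exact: measurable_indic.
  - exact: emeasurable_sum.
  move=> w _; rewrite indicE; case: (boolP (w \in B)) => [|_]; last first.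
    by rewrite mule0; apply: sume_ge0 => k _; exact: k0.
  rewrite inE => -[w1 w2]; rewrite mule1 sumEFin lee_fin; apply: le_trans w2 _.
  by apply: ler_sum => k _; rewrite indicE mem_set// mul1r.
have := le_trans AP tot.
have Pf : P B \is a fin_num by exact: fin_num_measure.
by rewrite -(fineK Pf) -EFinM !lee_fin ler_pdivlMr// mulrC.
Qed.

Lemma lln_whp (phi : nat -> borelV R q * E -> R) (m0 rho : R) : 0 < rho ->
  (forall N, (0 < N)%N -> measurable_fun setT (phi N)) ->
  (forall eta, 0 < eta -> exists W, [/\ measurable W,
    forall e, 0 < e -> whp P e (fun N w => W (pilot N w))
    & \forall N \near \oo, forall v, W v ->
     [/\ mu.-integrable setT (EFin \o (fun z => p N z v * phi N (v, z) ^+ 2)),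
      N%:R * \int[mu]_z (p N z v * phi N (v, z) ^+ 2) <= eta
     & `|N%:R * \int[mu]_z (p N z v * phi N (v, z)) - m0| <= eta]]) ->
  forall e, 0 < e ->
  whp P e (fun N w => `|\sum_(i < N) (delta N i w)%:R * phi N (pilot N w, Z i w) - m0| < rho).
Proof.
move=> rho0 mphi H e e0.
have [K [g [g1 [g2 [mg [K0 gK g1K g2K] T [g0 g00 ge1]]]]]] := bump_exists rho0.
have K4 : 0 < 12 * (3 * K + 1) by rewrite mulr_gt0// ltr_wpDl// mulr_ge0.
(* With all three error terms at most eta, [lln_prob] gives 9 K eta, which is below e / 2; the other
   half of e pays for the pilot leaving W. *)
pose eta := e / (12 * (3 * K + 1)).
have eta0 : 0 < eta by rewrite divr_gt0.
have [W [mW Wp HW]] := H _ eta0.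
apply: (whp_imp Wp e0).
near=> N.
have N0 : (0 < N)%N by near: N; exact: nbhs_infty_gt.
have hN : m0 ^+ 2 / N%:R <= eta.
  rewrite ler_pdivrMr ?ltr0n// mulrC -ler_pdivrMr//.
  by near: N; exact: nbhs_infty_ger.
have HN : forall v, W v -> [/\ mu.-integrable setT (EFin \o (fun z => p N z v * phi N (v, z) ^+ 2)),
      N%:R * \int[mu]_z (p N z v * phi N (v, z) ^+ 2) <= eta
     & `|N%:R * \int[mu]_z (p N z v * phi N (v, z)) - m0| <= eta] by near: N.
have c1 v (Wv : W v) : mu.-integrable setT (EFin \o (fun z => p N z v * phi N (v, z) ^+ 2)).
  by have [] := HN v Wv.
have c2 v (Wv : W v) : N%:R * \int[mu]_z (p N z v * phi N (v, z) ^+ 2) <= eta.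
  by have [] := HN v Wv.
have c3 v (Wv : W v) : `|N%:R * \int[mu]_z (p N z v * phi N (v, z)) - m0| <= eta.
  by have [] := HN v Wv.
have [mA PA] := @lln_prob _ _ _ _ _ _ P mu N Z (pilot N) (delta N) (p N) mZ (mpilot N) (mdelta N) (mp N0)
  (fun z v => p01 z v N0) (next N0) N0 W mW (phi N) (mphi N N0) g g1 g2 K m0 eta eta mg K0 gK g1K g2K T
  c1 c2 c3 (ltW eta0) (ltW eta0) rho g0 g00 ge1.
exists [set w | W (pilot N w) /\ rho <= `|\sum_(i < N) (delta N i w)%:R * phi N (pilot N w, Z i w) - m0|].
split => //.
  apply: le_trans PA _; rewrite lee_fin.
  have : e = eta * (12 * (3 * K + 1)) by rewrite /eta divfK// gt_eqF.
  have : 0 <= K * eta by rewrite mulr_ge0// ltW.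
  have : 3 * K * (m0 ^+ 2 / N%:R) <= 3 * K * eta by rewrite ler_wpM2l// mulr_ge0.
  move: (m0 ^+ 2 / N%:R) => a *; lra.
move=> w nw Wv; rewrite ltNge; apply/negP => h; exact: nw.
Unshelve. all: by end_near. Qed.

Lemma tight_whp (phi : nat -> borelV R q * E -> R) (W : set (borelV R q)) (C : R) : 0 <= C ->
  (forall N, (0 < N)%N -> measurable_fun setT (phi N)) -> measurable W ->
  (forall e, 0 < e -> whp P e (fun N w => W (pilot N w))) ->
  (\forall N \near \oo, forall v, W v ->
     [/\ mu.-integrable setT (EFin \o (fun z => p N z v * phi N (v, z) ^+ 2)),
      N%:R * \int[mu]_z (p N z v * phi N (v, z) ^+ 2) <= C
     & \int[mu]_z (p N z v * phi N (v, z)) = 0]) ->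
  forall e, 0 < e -> exists2 A, 0 < A &
  whp P e (fun N w => `|\sum_(i < N) (delta N i w)%:R * phi N (pilot N w, Z i w)| < A).
Proof.
move=> C0 mphi mW Wp HW e e0.
have [K [g [g1 [g2 [mg [K0 gK g1K g2K] T [g0 g00 ge1]]]]]] := bump_exists (ltr01 : 0 < 1 :> R).
(* The sum divided by A deviates by 1 with probability at most 3 K C / A^2. Since A >= 1 this is at
   most 3 K C / A, hence at most e / 2. *)
pose A := 6 * K * C / e + 1.
have A1 : 1 <= A by rewrite lerDr divr_ge0 ?(ltW e0)// !mulr_ge0.
have A0 : 0 < A by rewrite (lt_le_trans ltr01).
exists A => //.
apply: (whp_imp Wp e0).
near=> N.
have N0 : (0 < N)%N by near: N; exact: nbhs_infty_gt.
have HN : forall v, W v -> [/\ mu.-integrable setT (EFin \o (fun z => p N z v * phi N (v, z) ^+ 2)),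
      N%:R * \int[mu]_z (p N z v * phi N (v, z) ^+ 2) <= C
     & \int[mu]_z (p N z v * phi N (v, z)) = 0] by near: N.
pose psi u := A^-1 * phi N u.
have psi2 v : (fun z => p N z v * psi (v, z) ^+ 2) = (fun z => A^-1 ^+ 2 * (p N z v * phi N (v, z) ^+ 2)).
  by apply/funext => z; rewrite /psi exprMn; ring.
have mpsi : measurable_fun setT psi by apply: measurable_funM => //; exact: mphi.
have c1 v : W v -> mu.-integrable setT (EFin \o (fun z => p N z v * psi (v, z) ^+ 2)).
  by move=> Wv; rewrite psi2; have [a _ _] := HN v Wv; have := integrableZl measurableT (A^-1 ^+ 2) a.
have c2 v : W v -> N%:R * \int[mu]_z (p N z v * psi (v, z) ^+ 2) <= A^-1 ^+ 2 * C.
  move=> Wv; rewrite psi2; have [a b _] := HN v Wv; rewrite RintegralZl// mulrCA ler_wpM2l//.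
  by rewrite exprn_ge0// invr_ge0 ltW.
have c3 v : W v -> `|N%:R * \int[mu]_z (p N z v * psi (v, z)) - 0| <= 0.
  move=> Wv; have [a b c] := HN v Wv.
  have -> : \int[mu]_z (p N z v * psi (v, z)) = A^-1 * \int[mu]_z (p N z v * phi N (v, z)).
    rewrite -RintegralZl//; first by apply: eq_Rintegral => z _; rewrite /psi mulrCA.
    have ic : mu.-integrable setT (EFin \o (fun z : E => 1 : R)).
      by apply: (@bounded_integrable _ _ _ mu _ 1) => // x; rewrite normr1.
    have i2 : mu.-integrable setT (EFin \o (fun z => 1 + p N z v * phi N (v, z) ^+ 2)).
      by have := integrableD measurableT ic a.
    apply: integrable_le i2.
      apply: measurable_funM; first exact: (measurable_sampling (mp N0)).
      exact: (measurable_fun_pair2 v (mphi N N0)).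
    move=> z; have /andP[p0 p1] := p01 z v N0; rewrite normrM ger0_norm//.
    rewrite -(real_normK (num_real (phi N (v, z)))); move: (`|phi N (v, z)|) (normr_ge0 (phi N (v, z))) => t t0.
    by have := mulr_ge0 p0 (sqr_ge0 (t - 1)); rewrite sqrrB expr1n; nra.
  by rewrite c !mulr0 subr0 normr0.
have [mB PB] := @lln_prob _ _ _ _ _ _ P mu N Z (pilot N) (delta N) (p N) mZ (mpilot N) (mdelta N) (mp N0)
  (fun z v => p01 z v N0) (next N0) N0 W mW psi mpsi g g1 g2 K 0 0 (A^-1 ^+ 2 * C) mg K0 gK g1K g2K T
  c1 c2 c3 (lexx _) (mulr_ge0 (sqr_ge0 _) C0) 1 g0 g00 ge1.
exists [set w | W (pilot N w) /\ 1 <= `|\sum_(i < N) (delta N i w)%:R * psi (pilot N w, Z i w) - 0|].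
split => //.
  apply: le_trans PB _; rewrite lee_fin expr0n/= mul0r addr0 add0r.
  have h1 : 6 * K * C <= A * e.
    have -> : A * e = 6 * K * C + e by rewrite /A; field; rewrite gt_eqF.
    by rewrite lerDl ltW.
  have h2 : A^-1 ^+ 2 <= A^-1 by rewrite expr2 ler_piMl// ?invf_le1// invr_ge0 ltW.
  have KC0 : 0 <= 3 * K * C by rewrite !mulr_ge0.
  have h3 := ler_wpM2l KC0 h2.
  have h4 : 3 * K * C * A^-1 <= e / 2.
    by rewrite ler_pdivrMr//; lra.
  by apply: le_trans h4; apply: le_trans h3; rewrite le_eqVlt; apply/orP; left; apply/eqP; ring.
move=> w nw Wv; rewrite ltNge; apply/negP => h; apply: nw; split => //.
rewrite subr0 /psi; under eq_bigr do rewrite mulrCA.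
by rewrite -mulr_sumr normrM gtr0_norm ?invr_gt0// -ler_pdivrMl ?invr_gt0// invrK mulr1.
Unshelve. all: by end_near. Qed.

End sampled_sums.

(** * Solving the expanded score equation deterministically *)

Section linear_bounds.
Context {R : realType} {d : nat}.
Implicit Types (A : 'M[R]_d) (x : 'cV[R]_d).

Definition abs_sum A : R := \sum_i \sum_j `|A i j|.

Lemma abs_sum_ge0 A : 0 <= abs_sum A.
Proof. by rewrite /abs_sum; apply: sumr_ge0 => i _; exact: sumr_ge0. Qed.

Lemma entry_le_abs_sum A i j : `|A i j| <= abs_sum A.
Proof.
rewrite /abs_sum (bigD1 i)//= (bigD1 j)//= -addrA lerDl addr_ge0//.
  exact: sumr_ge0.
by apply: sumr_ge0 => k _; exact: sumr_ge0.
Qed.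

Lemma norm_mulmx_le A x : `|A *m x| <= abs_sum A * `|x|.
Proof.
apply: norm_le_coord; first by rewrite mulr_ge0// abs_sum_ge0.
move=> i; rewrite mxE; apply: le_trans (ler_norm_sum _ _ _) _.
apply: (@le_trans _ _ ((\sum_j `|A i j|) * `|x|)).
  rewrite mulr_suml; apply: ler_sum => j _; rewrite normrM ler_wpM2l//.
  exact: coord_le_norm.
rewrite ler_wpM2r// /abs_sum [leRHS](bigD1 i)//= lerDl.
by apply: sumr_ge0 => k _; exact: sumr_ge0.
Qed.

(** The max norm is attained at a coordinate, and t^r is at most 1 or t^4 according to whether t is
    below or above 1. *)
Lemma norm_pow_le x r : (0 < r <= 4)%N -> `|x| ^+ r <= \sum_k (1 + x k 0 ^+ 4).
Proof.
move=> /andP[r0 r4].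
have pos k : 0 <= 1 + x k 0 ^+ 4 by rewrite addr_ge0// (exprM _ 2 2) sqr_ge0.
have [x0|x0] := eqVneq `|x| 0.
  by rewrite x0 expr0n gtn_eqF//; exact: sumr_ge0.
have [[k z] /= kE] := mx_norm_neq0 (x0 : mx_norm x != 0).
have -> : `|x| = `|x k 0| by rewrite -[LHS]/(mx_norm x) kE ord1.
apply: (@le_trans _ _ (1 + x k 0 ^+ 4)); last first.
  by rewrite (bigD1 k)//= lerDl; exact: sumr_ge0.
have -> : x k 0 ^+ 4 = `|x k 0| ^+ 4 by rewrite (exprM _ 2 2) -(real_normK (num_real (x k 0))) -exprM.
have [h|h] := lerP `|x k 0| 1.
  by apply: (@le_trans _ _ 1); [exact: exprn_ile1|rewrite lerDl exprn_ge0].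
by apply: (@le_trans _ _ (`|x k 0| ^+ 4)); [rewrite ler_weXn2l// ltW|rewrite lerDr].
Qed.

(** With D = sqrt n t, the vector S (D - Y) equals (H / n + S)^T D minus the residual of the score
    equation over sqrt n. Both are small multiples of |D|, the residual because one factor |t| is at
    most rho. So |D - Y| <= kappa |D|, and kappa <= 1/2 yields |D| <= 2 |Y|: the deviation is
    bounded at the scale 1 / sqrt n without assuming it. *)
Lemma onestep_error S (sv t Y : 'cV[R]_d) (H : 'I_d -> 'I_d -> R) (l n rho A1 A2 kappa : R) :
  S^T = S -> S \in unitmx -> 0 < n -> 0 <= A1 -> 0 <= rho ->
  Y = (Num.sqrt n)^-1 *: (invmx S *m sv) ->
  (forall k, `|sv k 0 + \sum_j H j k * t j 0| <= l * `|t| ^+ 2) ->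
  (forall j k, `|n^-1 * H j k + S j k| <= rho) -> l <= A1 * n -> `|t| <= rho -> `|Y| <= A2 ->
  abs_sum (invmx S) * ((d%:R + A1) * rho) <= kappa -> kappa <= 2^-1 ->
  `|Num.sqrt n *: t - Y| <= 2 * A2 * kappa.
Proof.
move=> ST Su n0 A10 rho0 YE sc HS lA tr YA ck k2.
set nu := Num.sqrt n; have nu0 : 0 < nu by rewrite sqrtr_gt0.
have nu2 : nu ^+ 2 = n by rewrite sqr_sqrtr// ltW.
set D := nu *: t.
pose F : 'cV[R]_d := S *m (D - Y).
have FE k : F k 0 = \sum_j (n^-1 * H j k + S j k) * D j 0 - nu^-1 * (sv k 0 + \sum_j H j k * t j 0).
  have -> : F k 0 = (S *m D) k 0 - nu^-1 * sv k 0.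
    by rewrite /F mulmxBr YE -[S *m (_ *: (invmx S *m _))]scalemxAr mulmxA mulmxV// mul1mx !mxE.
  have -> : \sum_j (n^-1 * H j k + S j k) * D j 0 =
      nu^-1 * (\sum_j H j k * t j 0) + (S *m D) k 0.
    rewrite mxE mulr_sumr -big_split; apply: eq_bigr => j _ /=.
    have -> : S k j = S j k by rewrite -{1}ST mxE.
    by rewrite mxE -nu2; field; rewrite gt_eqF.
  by ring.
have Fb : `|F| <= (d%:R + A1) * rho * `|D|.
  apply: norm_le_coord; first by rewrite !mulr_ge0// addr_ge0.
  move=> k; rewrite FE; apply: le_trans (ler_normB _ _) _; rewrite !mulrDl lerD//.
    have := @sum_norm_le R d (fun j => n^-1 * H j k + S j k) (fun j => D j 0) rho `|D| rho0 (fun j => HS j k)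
      (coord_le_norm D).
    by rewrite -mulrA.
  rewrite normrM gtr0_norm ?invr_gt0//.
  apply: (@le_trans _ _ (nu^-1 * (l * `|t| ^+ 2))); first by rewrite ler_wpM2l// invr_ge0 ltW.
  apply: (@le_trans _ _ (nu^-1 * (A1 * n * `|t| ^+ 2))).
    by rewrite ler_wpM2l ?invr_ge0 ?(ltW nu0)// ler_wpM2r// exprn_ge0.
  have -> : nu^-1 * (A1 * n * `|t| ^+ 2) = A1 * (nu * `|t|) * `|t|.
    by rewrite -nu2; field; rewrite gt_eqF.
  have -> : `|D| = nu * `|t| by rewrite /D normrZ gtr0_norm.
  rewrite [leRHS]mulrAC; apply: ler_wpM2l => //.
  by rewrite !mulr_ge0// ltW.
have DY : D - Y = invmx S *m F by rewrite /F mulmxA mulVmx// mul1mx.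
have d1 : `|D - Y| <= kappa * `|D|.
  rewrite DY; apply: le_trans (norm_mulmx_le _ _) _.
  apply: le_trans (ler_wpM2l (abs_sum_ge0 _) Fb) _.
  by rewrite mulrA ler_wpM2r.
have d2 : `|D| <= `|Y| + `|D - Y| by rewrite -{1}(subrK Y D) addrC ler_normD.
have d3 : kappa * `|D| <= 2^-1 * `|D| by rewrite ler_wpM2r.
have kap0 : 0 <= kappa.
  by apply: le_trans ck; rewrite !mulr_ge0 ?abs_sum_ge0// addr_ge0.
have d4 : `|D| <= 2 * A2 by lra.
by apply: le_trans d1 _; rewrite mulrC ler_wpM2r.
Qed.

End linear_bounds.

Section whp_integral.
Context {R : realType} {dO : measure_display} {Omega : measurableType dO}.
Variable P : probability Omega R.

Lemma whp_Rintegral (F G : nat -> Omega -> R) (K rho e : R) : 0 <= rho ->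
  (\forall N \near \oo, measurable_fun setT (F N)) ->
  (\forall N \near \oo, measurable_fun setT (G N)) ->
  (forall N w, `|F N w| <= K) -> (forall N w, `|G N w| <= K) ->
  whp P e (fun N w => `|F N w - G N w| <= rho) ->
  \forall N \near \oo, `|\int[P]_w F N w - \int[P]_w G N w| <= rho + 2 * K * e.
Proof.
move=> rho0 mF mG FK GK; apply: filterS3 mF mG => N mFN mGN [A [mA PA AQ]].
have K0 : 0 <= K := le_trans (normr_ge0 _) (FK N point).
have m1 : measurable_fun setT (\1_A : Omega -> R) by exact: measurable_indic.
have mu1 : measurable_fun setT (fun w => rho + 2 * K * \1_A w).
  by apply: measurable_funD => //; exact: measurable_funM.
have i01 w : 0 <= (\1_A w : R) <= 1 by rewrite indicE; case: (_ \in _); rewrite /= ?lexx ler01.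
have b1 w : `|\1_A w : R| <= 1 by have /andP[a b] := i01 w; rewrite ger0_norm.
have uK w : `|rho + 2 * K * \1_A w| <= rho + 2 * K.
  have /andP[a b] := i01 w.
  have c0 : 0 <= 2 * K * \1_A w by rewrite !mulr_ge0.
  by rewrite ger0_norm ?addr_ge0// lerD2l ler_piMr// mulr_ge0.
have FG w : `|F N w - G N w| <= rho + 2 * K * \1_A w.
  rewrite indicE; case: (boolP (w \in A)) => [_|]; last first.
    by rewrite notin_setE => /AQ; rewrite mulr0 addr0.
  rewrite mulr1; apply: le_trans (ler_normB _ _) _; have := FK N w; have := GK N w; lra.
have FK' w : `|F N w| <= rho + 2 * K by have := FK N w; lra.
have GK' w : `|G N w| <= rho + 2 * K by have := GK N w; lra.
have := Rintegral_dist P mFN mGN mu1 FK' GK' uK FG.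
move=> /le_trans; apply.
have ir : P.-integrable setT (EFin \o (fun w : Omega => rho)).
  by apply: (@bounded_integrable _ _ _ P _ `|rho|).
have i1 := bounded_integrable P m1 b1.
have i2 : P.-integrable setT (EFin \o (fun w => 2 * K * \1_A w)).
  by have := integrableZl measurableT (2 * K) i1.
rewrite RintegralD// Rint_cst lerD2l RintegralZl// ler_wpM2l ?mulr_ge0//.
have : (\int[P]_w (\1_A w)%:E <= e%:E)%E.
  by rewrite (integral_indic P measurableT mA) setIT.
have fi := integrable_fin_num measurableT i1.
by rewrite -(fineK fi) lee_fin.
Qed.

End whp_integral.

(** * Asymptotic normality of an abstract estimating equation *)

Section one_step.
Context {R : realType} {dE dO : measure_display}.
Context {E : measurableType dE} {Omega : measurableType dO} {q d : nat}.
Variables (P : probability Omega R) (mu : probability E R).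
Variables (Z : nat -> Omega -> E) (pilot : nat -> Omega -> borelV R q).
Variables (delta : nat -> nat -> Omega -> bool) (p : nat -> E -> borelV R q -> R).
Hypothesis mZ : forall i, measurable_fun setT (Z i).
Hypothesis mpilot : forall N, measurable_fun setT (pilot N).
Hypothesis mdelta : forall N i, measurable [set w | delta N i w].
Hypothesis mp : forall N, (0 < N)%N ->
  measurable_fun setT (fun u : E * borelV R q => p N u.1 u.2).
Hypothesis p01 : forall N z v, (0 < N)%N -> 0 <= p N z v <= 1.
Hypothesis next : forall N, (0 < N)%N ->
  next_property P mu N Z (pilot N) (delta N) (p N).
Variable n : nat -> R.
Hypothesis n_infty : n N @[N --> \oo] --> +oo.
Hypothesis n_mean : forall N v, (0 < N)%N -> N%:R * \int[mu]_z p N z v = n N.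

Variables (V : set (borelV R q)) (s : nat -> borelV R q * E -> borelV R d).
Variables (hs : nat -> 'I_d -> 'I_d -> borelV R q * E -> R).
Variables (L : nat -> borelV R q * E -> R).
Variables (SigN : nat -> borelV R q -> 'M[R]_d) (S : 'M[R]_d).
Variables (theta : 'cV[R]_d) (hat : nat -> Omega -> borelV R d).
Hypothesis ms : forall N, (0 < N)%N -> measurable_fun setT (s N).
Hypothesis mhs : forall N j k, (0 < N)%N -> measurable_fun setT (hs N j k).
Hypothesis mL : forall N, (0 < N)%N -> measurable_fun setT (L N).
Hypothesis L0 : forall N u, (0 < N)%N -> 0 <= L N u.
Hypothesis mhat : forall N, measurable_fun setT (hat N).
Local Notation sc N v z k := ((s N (v, z) : 'cV[R]_d) k 0).
Variable M : R.
Hypothesis M0 : 0 <= M.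
Hypothesis moments : \forall N \near \oo, forall v, V v -> [/\
  forall k, mu.-integrable setT (EFin \o (fun z => p N z v * sc N v z k ^+ 4)) /\
    N%:R * \int[mu]_z (p N z v * sc N v z k ^+ 4) <= n N * M,
  forall j k, mu.-integrable setT (EFin \o (fun z => p N z v * hs N j k (v, z) ^+ 2)) /\
    N%:R * \int[mu]_z (p N z v * hs N j k (v, z) ^+ 2) <= n N * M
  & (\int[mu]_z (p N z v * L N (v, z))%:E <= (n N * M / N%:R)%:E)%E].
Hypothesis means : \forall N \near \oo, forall v, V v -> [/\
  forall k, \int[mu]_z (p N z v * sc N v z k) = 0,
  forall j k, N%:R * \int[mu]_z (p N z v * (sc N v z j * sc N v z k)) = n N * SigN N v j k
  & forall j k, N%:R * \int[mu]_z (p N z v * hs N j k (v, z)) = - (n N * SigN N v j k)].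
Hypothesis concentration : forall eta, 0 < eta -> exists W, [/\ measurable W, W `<=` V,
  forall e, 0 < e -> whp P e (fun N w => W (pilot N w))
  & \forall N \near \oo, forall v j k, W v -> `|SigN N v j k - S j k| <= eta].
Hypothesis consistent : forall e rho, 0 < e -> 0 < rho ->
  whp P e (fun N w => `|(hat N w : 'cV[R]_d) - theta| <= rho).
Hypothesis score_expansion : forall e, 0 < e -> whp P e (fun N w => forall k,
  `|\sum_(i < N) (delta N i w)%:R * sc N (pilot N w) (Z i w) k
    + \sum_j (\sum_(i < N) (delta N i w)%:R * hs N j k (pilot N w, Z i w))
             * ((hat N w : 'cV[R]_d) - theta) j 0|
  <= (\sum_(i < N) (delta N i w)%:R * L N (pilot N w, Z i w))
     * `|(hat N w : 'cV[R]_d) - theta| ^+ 2).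
Hypothesis ST : S^T = S.
Hypothesis Su : S \in unitmx.
Variable l : seq 'cV[R]_d.
Hypothesis lE : forall i j, invmx S i j = \sum_(v <- l) v i 0 * v j 0.

Let n0 : \forall N \near \oo, 0 < n N.
Proof. by move/cvgryPgt : n_infty; apply. Qed.

Let c := abs_sum (invmx S).
Let c0 : 0 <= c. Proof. exact: abs_sum_ge0. Qed.

(** The score is multiplied by the inverse of S in advance, so that the limit covariance is the
    inverse of S. *)
Let xi N (u : borelV R q * E) : borelV R d :=
  (Num.sqrt (n N))^-1 *: (invmx S *m (s N u : 'cV[R]_d)).

Let mxi N : (0 < N)%N -> measurable_fun setT (xi N).
Proof.
move=> N0; apply: measurable_borelVZ => //; apply: measurable_borelV => j.
rewrite (_ : (fun x => _) = (fun u => \sum_k invmx S j k * (s N u : 'cV[R]_d) k 0)); last first.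
  by apply/funext => u; rewrite mxE.
apply: measurable_sum => k; apply: measurable_funM => //.
exact: (measurableT_comp (measurable_coord k) (ms N0)).
Qed.

Let msc N v k : (0 < N)%N -> measurable_fun setT (fun z => sc N v z k).
Proof.
by move=> N0; exact: (measurableT_comp (measurable_coord k) (measurable_fun_pair2 v (ms N0))).
Qed.

Let mpv N v : (0 < N)%N -> measurable_fun setT (fun z => p N z v).
Proof. by move=> N0; exact: (measurable_sampling (mp N0)). Qed.

Let ip N v : (0 < N)%N -> mu.-integrable setT (EFin \o (fun z => p N z v)).
Proof.
move=> N0; apply: (@bounded_integrable _ _ _ mu _ 1); first exact: mpv.
by move=> z; have /andP[a b] := p01 z v N0; rewrite ger0_norm.
Qed.

(* |x|^r <= sum_k (1 + x_k^4) for 0 < r <= 4 turns the fourth moments of the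
   score into the second and third moments of the summands. *)
Let xi_moment : \forall N \near \oo, forall v r, V v -> (0 < r <= 4)%N ->
  mu.-integrable setT (EFin \o (fun z => p N z v * `|(xi N (v, z) : 'cV[R]_d)| ^+ r)) /\
  N%:R * \int[mu]_z (p N z v * `|(xi N (v, z) : 'cV[R]_d)| ^+ r) <=
    (Num.sqrt (n N))^-1 ^+ r * (c ^+ r * (d%:R * (n N * (1 + M)))).
Proof.
near=> N => v r Vv r4.
have N0 : (0 < N)%N by near: N; exact: nbhs_infty_gt.
have nN0 : 0 < n N by near: N.
have [mom _ _] : [/\
  forall k, mu.-integrable setT (EFin \o (fun z => p N z v * sc N v z k ^+ 4)) /\
    N%:R * \int[mu]_z (p N z v * sc N v z k ^+ 4) <= n N * M,
  forall j k, mu.-integrable setT (EFin \o (fun z => p N z v * hs N j k (v, z) ^+ 2)) /\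
    N%:R * \int[mu]_z (p N z v * hs N j k (v, z) ^+ 2) <= n N * M
  & (\int[mu]_z (p N z v * L N (v, z))%:E <= (n N * M / N%:R)%:E)%E] by move: v Vv; near: N.
set a := (Num.sqrt (n N))^-1.
have a0 : 0 <= a by rewrite invr_ge0 sqrtr_ge0.
pose F (k : 'I_d) (z : E) := p N z v + p N z v * sc N v z k ^+ 4.
have iF k : mu.-integrable setT (EFin \o F k).
  by have := integrableD measurableT (ip v N0) (mom k).1.
have eF k : \int[mu]_z F k z = \int[mu]_z p N z v + \int[mu]_z (p N z v * sc N v z k ^+ 4).
  by rewrite /F RintegralD//; [exact: ip|exact: (mom k).1].
have [iS eS] := @Rintegral_sum_seq _ _ _ mu _ (index_enum 'I_d) F iF.
have pw z : `|p N z v * `|(xi N (v, z) : 'cV[R]_d)| ^+ r| <= a ^+ r * c ^+ r * \sum_k F k z.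
  have /andP[p0 _] := p01 z v N0.
  rewrite ger0_norm ?mulr_ge0// ?exprn_ge0//.
  have -> : \sum_k F k z = p N z v * \sum_k (1 + sc N v z k ^+ 4).
    by rewrite mulr_sumr; apply: eq_bigr => k _; rewrite /F mulrDr mulr1.
  rewrite mulrCA; apply: ler_wpM2l => //.
  rewrite /xi normrZ ger0_norm// exprMn -mulrA; apply: ler_wpM2l; first exact: exprn_ge0.
  apply: (@le_trans _ _ ((c * `|(s N (v, z) : 'cV[R]_d)|) ^+ r)).
    by apply: lerXn2r; rewrite ?nnegrE ?mulr_ge0//; exact: norm_mulmx_le.
  by rewrite exprMn ler_wpM2l ?exprn_ge0//; exact: norm_pow_le.
have iB : mu.-integrable setT (EFin \o (fun z => a ^+ r * c ^+ r * \sum_k F k z)).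
  by have := integrableZl measurableT (a ^+ r * c ^+ r) iS.
have mx : measurable_fun setT (fun z => p N z v * `|(xi N (v, z) : 'cV[R]_d)| ^+ r).
  apply: measurable_funM; first exact: mpv.
  have mn : measurable_fun setT ((fun x => `|x|) : borelV R d -> R).
    by apply: continuous_borelV; exact: norm_continuous.
  apply: (measurableT_comp (f := fun x : R => x ^+ r)); first exact: measurable_funX.
  exact: (measurableT_comp mn (measurable_fun_pair2 v (mxi N0))).
have i1 := integrable_le mx pw iB; split => //.
apply: (@le_trans _ _ (N%:R * \int[mu]_z (a ^+ r * c ^+ r * \sum_k F k z))).
  rewrite ler_wpM2l//; apply: le_Rintegral => // z _.
  by apply: le_trans (pw z); exact: ler_norm.
rewrite RintegralZl// eS mulrCA -mulrA; apply: ler_wpM2l; first exact: exprn_ge0.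
apply: ler_wpM2l; first exact: exprn_ge0.
rewrite mulr_sumr; apply: sum_le_const => k; rewrite eF mulrDr n_mean// mulrDr mulr1 lerD2l.
exact: (mom k).2.
Unshelve. all: by end_near. Qed.

Let xiE N v z i : (xi N (v, z) : 'cV[R]_d) i 0 = \sum_k (Num.sqrt (n N))^-1 * invmx S i k * sc N v z k.
Proof. by rewrite /xi !mxE mulr_sumr; apply: eq_bigr => k _; rewrite mulrA. Qed.

Let sc_integrable : \forall N \near \oo, forall v, V v ->
  (forall k, mu.-integrable setT (EFin \o (fun z => p N z v * sc N v z k))) /\
  (forall j k, mu.-integrable setT (EFin \o (fun z => p N z v * (sc N v z j * sc N v z k)))).
Proof.
near=> N => v Vv.
have N0 : (0 < N)%N by near: N; exact: nbhs_infty_gt.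
have [mom _ _] : [/\
  forall k, mu.-integrable setT (EFin \o (fun z => p N z v * sc N v z k ^+ 4)) /\
    N%:R * \int[mu]_z (p N z v * sc N v z k ^+ 4) <= n N * M,
  forall j k, mu.-integrable setT (EFin \o (fun z => p N z v * hs N j k (v, z) ^+ 2)) /\
    N%:R * \int[mu]_z (p N z v * hs N j k (v, z) ^+ 2) <= n N * M
  & (\int[mu]_z (p N z v * L N (v, z))%:E <= (n N * M / N%:R)%:E)%E] by move: v Vv; near: N.
have iF k : mu.-integrable setT (EFin \o (fun z => p N z v + p N z v * sc N v z k ^+ 4)).
  by have := integrableD measurableT (ip v N0) (mom k).1.
have x24 (x : R) : x ^+ 2 <= 1 + x ^+ 4.
  have -> : x ^+ 4 = (x ^+ 2) ^+ 2 by rewrite -exprM.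
  by move: (x ^+ 2) => y; have := sqr_ge0 (y - 1); have := sqr_ge0 y; rewrite sqrrB expr1n; lra.
split=> [k|j k].
  apply: integrable_le (iF k); first by apply: measurable_funM; [exact: mpv|exact: msc].
  move=> z; have /andP[p0 _] := p01 z v N0; rewrite normrM ger0_norm// -{2}[p N z v]mulr1 -mulrDr.
  apply: ler_wpM2l => //; set x := sc N v z k.
  have := x24 x; have -> : x ^+ 4 = `|x| ^+ 4 by rewrite (exprM _ 2 2) -(real_normK (num_real x)) -exprM.
  have := norm_pow_le (const_mx x : 'cV[R]_1) (isT : (0 < 1 <= 4)%N).
  rewrite big_ord1 mxE expr1 => h _; apply: le_trans (_ : _ <= `|(const_mx x : 'cV[R]_1)|) _.
    by have := coord_le_norm (const_mx x : 'cV[R]_1) 0; rewrite mxE.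
  apply: le_trans h _; have -> // : x ^+ 4 = `|x| ^+ 4.
  by rewrite (exprM _ 2 2) -(real_normK (num_real x)) -exprM.
have i2 := integrableD measurableT (iF j) (iF k).
apply: (@integrable_le _ _ _ mu _ (fun z => (p N z v + p N z v * sc N v z j ^+ 4) + (p N z v + p N z v * sc N v z k ^+ 4))).
- by apply: measurable_funM; [exact: mpv|apply: measurable_funM; exact: msc].
- move=> z; have /andP[p0 _] := p01 z v N0; rewrite normrM ger0_norm//.
  move: (sc N v z j) (sc N v z k) => x y.
  have -> : p N z v + p N z v * x ^+ 4 + (p N z v + p N z v * y ^+ 4) =
    p N z v * ((1 + x ^+ 4) + (1 + y ^+ 4)) by ring.
  apply: ler_wpM2l => //; have := x24 x; have := x24 y.
  have := sqr_ge0 (x + y); have := sqr_ge0 (x - y); have := sqr_ge0 x; have := sqr_ge0 y.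
  rewrite sqrrB sqrrD ler_norml mulr2n; move: (x ^+ 2) (y ^+ 2) (x ^+ 4) (y ^+ 4) (x * y) => a b e f g *.
  by apply/andP; split; lra.
by have := i2.
Unshelve. all: by end_near. Qed.

Let xi_mean : \forall N \near \oo, forall v, V v ->
  (forall j, \int[mu]_z (p N z v * (xi N (v, z) : 'cV[R]_d) j 0) = 0) /\
  (forall i j, N%:R * \int[mu]_z (p N z v * ((xi N (v, z) : 'cV[R]_d) i 0 * (xi N (v, z) : 'cV[R]_d) j 0)) =
     \sum_a \sum_b invmx S i a * invmx S j b * SigN N v a b).
Proof.
near=> N => v Vv.
have N0 : (0 < N)%N by near: N; exact: nbhs_infty_gt.
have nN0 : 0 < n N by near: N.
have [m1 m2 _] : [/\
  forall k, \int[mu]_z (p N z v * sc N v z k) = 0,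
  forall j k, N%:R * \int[mu]_z (p N z v * (sc N v z j * sc N v z k)) = n N * SigN N v j k
  & forall j k, N%:R * \int[mu]_z (p N z v * hs N j k (v, z)) = - (n N * SigN N v j k)].
  by move: v Vv; near: N.
have [i1 i2] : (forall k, mu.-integrable setT (EFin \o (fun z => p N z v * sc N v z k))) /\
  (forall j k, mu.-integrable setT (EFin \o (fun z => p N z v * (sc N v z j * sc N v z k)))).
  by move: v Vv {m1 m2}; near: N.
set a := (Num.sqrt (n N))^-1.
have a2 : a ^+ 2 * n N = 1 by rewrite /a exprVn sqr_sqrtr ?(ltW nN0)// mulVf// gt_eqF.
split=> [j|i j].
  under eq_Rintegral do rewrite xiE mulr_sumr.
  have iz k : mu.-integrable setT (EFin \o (fun z => p N z v * (a * invmx S j k * sc N v z k))).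
    have := integrableZl measurableT (a * invmx S j k) (i1 k).
    by apply: eq_integrable => // z _ /=; rewrite -EFinM mulrCA.
  rewrite (Rintegral_sum_seq _ iz).2; apply: big1 => k _.
  under eq_Rintegral do rewrite mulrCA.
  by rewrite RintegralZl// m1 mulr0.
have -> : (fun z => p N z v * ((xi N (v, z) : 'cV[R]_d) i 0 * (xi N (v, z) : 'cV[R]_d) j 0)) =
   (fun z => \sum_b \sum_b' (a ^+ 2 * (invmx S i b * invmx S j b')) * (p N z v * (sc N v z b * sc N v z b'))).
  apply/funext => z; rewrite !xiE big_distrlr/= mulr_sumr; apply: eq_bigr => b _.
  by rewrite mulr_sumr; apply: eq_bigr => b' _; rewrite -/a; ring.
have iz b b' : mu.-integrable setT (EFin \o (fun z => (a ^+ 2 * (invmx S i b * invmx S j b')) * (p N z v * (sc N v z b * sc N v z b')))).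
  by have := integrableZl measurableT (a ^+ 2 * (invmx S i b * invmx S j b')) (i2 b b').
rewrite (Rintegral_sum_seq _ (fun b => (Rintegral_sum_seq (index_enum 'I_d) (iz b)).1)).2 mulr_sumr.
apply: eq_bigr => b _; rewrite (Rintegral_sum_seq _ (iz b)).2 mulr_sumr; apply: eq_bigr => b' _.
rewrite RintegralZl// mulrCA m2.
by rewrite -[RHS]mulr1 -[X in _ = _ * X]a2; ring.
Unshelve. all: by end_near. Qed.

Let Y N w : borelV R d := state Z (pilot N) (delta N) (xi N) N w.

Let mY N : (0 < N)%N -> measurable_fun setT (Y N).
Proof. by move=> N0; exact: (measurable_state mZ (mpilot N) (mdelta N) (mxi N0)). Qed.

Let YE N w k : (Y N w : 'cV[R]_d) k 0 =
  \sum_(i < N) (delta N i w)%:R * (xi N (pilot N w, Z i w) : 'cV[R]_d) k 0.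
Proof. by rewrite /Y /state summxE; apply: eq_bigr => i _; rewrite mxE. Qed.

Let invsqrt_small (C e x : R) : 0 < e -> 0 < x -> (C / e) ^+ 2 <= x -> C * (Num.sqrt x)^-1 <= e.
Proof.
move=> e0 x0 h; rewrite ler_pdivrMr ?sqrtr_gt0// mulrC -ler_pdivrMr//.
by apply: le_trans (ler_norm _) _; rewrite -sqrtr_sqr ler_sqrt// ltW.
Qed.

(** Covariance of the transformed score when the score has covariance S: the product of the inverse
    of S, S, and the inverse of S. *)
Let inv_cov i j : invmx S i j = \sum_a \sum_b invmx S i a * invmx S j b * S a b.
Proof.
have -> : invmx S i j = (invmx S *m S *m (invmx S)^T) i j.
  by rewrite mulVmx// mul1mx trmx_inv ST.
rewrite mxE exchange_big/=; apply: eq_bigr => b _; rewrite !mxE mulr_suml.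
by apply: eq_bigr => a _; ring.
Qed.

Let covariance_bound (A : 'M[R]_d) eta i j : 0 <= eta -> (forall a b, `|A a b - S a b| <= eta) ->
  `|\sum_a \sum_b invmx S i a * invmx S j b * A a b - \sum_(u <- l) u i 0 * u j 0| <= d%:R * (d%:R * (c * c * eta)).
Proof.
move=> eta0 H; rewrite -lE inv_cov -sumrB; apply: le_trans (ler_norm_sum _ _ _) _.
apply: sum_le_const => a; rewrite -sumrB; apply: le_trans (ler_norm_sum _ _ _) _.
apply: sum_le_const => b; rewrite -mulrBr normrM; apply: ler_pM => //.
by rewrite normrM; apply: ler_pM => //; exact: entry_le_abs_sum.
Qed.

Let clt_smooth h : smooth h -> \int[P]_w h (Y N w) @[N --> \oo] --> \int[gauss l]_u h u.
Proof.
move=> sh; have mh := smooth_measurable sh.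
move: sh => [K [G [H [K0 hK GK HK tay]]]].
apply: (iffRL (@cvgrPdist_le _ R^o nat \oo _ _ _)) => e e0.
set I := \int[gauss l]_u h u.
have IK : `|I| <= K by exact: Rint_bound.
set M3 := \int[gauss l]_u (`|(u : 'cV[R]_d)| ^+ 3).
pose C3 := c ^+ 3 * (d%:R * (1 + M)).
have C30 : 0 <= C3 by rewrite /C3 !mulr_ge0 ?exprn_ge0// addr_ge0.
pose D := K * (d%:R ^+ 2 * (d%:R * (d%:R * (c * c)))).
have D0 : 0 <= D by rewrite /D !mulr_ge0// exprn_ge0.
pose eta := e / (4 * (D + 1)).
have D1 : 0 < 4 * (D + 1) by rewrite mulr_gt0// ltr_wpDl.
have eta0 : 0 < eta by rewrite divr_gt0.
pose e' := e / (8 * (K + 1)).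
have K1 : 0 < 8 * (K + 1) by rewrite mulr_gt0// ltr_wpDl.
have e'0 : 0 < e' by rewrite divr_gt0.
have [W [mW WV Wp HW]] := concentration eta0.
have mW1 N : measurable_fun setT (fun w => \1_W (pilot N w) : R).
  by apply: (measurableT_comp _ (mpilot N)); exact: measurable_indic.
have mhY N : (0 < N)%N -> measurable_fun setT (fun w => h (Y N w)).
  by move=> N0; exact: (measurableT_comp mh (mY N0)).
pose F N w := h (Y N w).
pose G1 N w := \1_W (pilot N w) * h (Y N w).
pose G2 N w := \1_W (pilot N w) * I.
(* Outside W the value is replaced by its Gaussian limit I, so the integral of [GG] minus I is
   exactly the difference bounded by [clt_bound]. *)
pose GG N w := G1 N w + (I - G2 N w).
have iW w : (\1_W w : R) = 1 \/ (\1_W w : R) = 0.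
  by rewrite indicE; case: (_ \in _); [left|right].
have mG1 N : (0 < N)%N -> measurable_fun setT (G1 N).
  by move=> N0; apply: measurable_funM => //; exact: mhY.
have mG2 N : measurable_fun setT (G2 N) by exact: measurable_funM.
have G1K N w : `|G1 N w| <= K.
  by rewrite /G1; case: (iW (pilot N w)) => ->; rewrite ?mul1r ?mul0r ?normr0.
have G2K N w : `|G2 N w| <= K.
  by rewrite /G2; case: (iW (pilot N w)) => ->; rewrite ?mul1r ?mul0r ?normr0.
have FG : whp P e' (fun N w => `|F N w - GG N w| <= 0).
  apply: whp_le (Wp _ e'0) => //; near=> N => w Ww.
  by rewrite /F /GG /G1 /G2 indicE mem_set// !mul1r subrr addr0 subrr normr0.
have mF' : \forall N \near \oo, measurable_fun setT (F N).
  by near=> N; apply: mhY; near: N; exact: nbhs_infty_gt.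
have mGG : \forall N \near \oo, measurable_fun setT (GG N).
  near=> N; apply: measurable_funD; last exact: measurable_funB.
  by apply: mG1; near: N; exact: nbhs_infty_gt.
have GGK N w : `|GG N w| <= K.
  by rewrite /GG /G1 /G2; case: (iW (pilot N w)) => ->;
    rewrite ?mul1r ?mul0r ?subrr ?addr0 ?subr0 ?add0r.
have close := whp_Rintegral (lexx 0) mF' mGG (fun N w => hK (Y N w)) GGK FG.
near=> N.
have N0 : (0 < N)%N by near: N; exact: nbhs_infty_gt.
have Nr0 : 0 < N%:R :> R by rewrite ltr0n.
have nN0 : 0 < n N by near: N.
have B1 : `|\int[P]_w F N w - \int[P]_w GG N w| <= 0 + 2 * K * e' by near: N.
have xm : forall v r, V v -> (0 < r <= 4)%N ->
  mu.-integrable setT (EFin \o (fun z => p N z v * `|(xi N (v, z) : 'cV[R]_d)| ^+ r)) /\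
  N%:R * \int[mu]_z (p N z v * `|(xi N (v, z) : 'cV[R]_d)| ^+ r) <=
    (Num.sqrt (n N))^-1 ^+ r * (c ^+ r * (d%:R * (n N * (1 + M)))).
  by near: N.
have xe : forall v, V v ->
  (forall j, \int[mu]_z (p N z v * (xi N (v, z) : 'cV[R]_d) j 0) = 0) /\
  (forall i j, N%:R * \int[mu]_z (p N z v * ((xi N (v, z) : 'cV[R]_d) i 0 * (xi N (v, z) : 'cV[R]_d) j 0)) =
     \sum_a \sum_b invmx S i a * invmx S j b * SigN N v a b).
  by near: N.
have HWN : forall v j k, W v -> `|SigN N v j k - S j k| <= eta by near: N.
(* The third moment sums to order n times n^(-3/2), that is, 1 / sqrt n. *)
pose tau := (Num.sqrt (n N))^-1 * C3.
have tau0 : 0 <= tau by rewrite mulr_ge0// invr_ge0 sqrtr_ge0.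
have tauE : (Num.sqrt (n N))^-1 ^+ 3 * (c ^+ 3 * (d%:R * (n N * (1 + M)))) = tau.
  rewrite /tau /C3 -[X in d%:R * (X * _)](@sqr_sqrtr _ (n N)) ?(ltW nN0)//.
  by field; rewrite gt_eqF// sqrtr_gt0.
have B2 := @clt_bound _ _ _ _ _ _ P mu N Z (pilot N) (delta N) (p N) mZ (mpilot N) (mdelta N) (mp N0)
  (fun z v => p01 z v N0) (next N0) N0 W mW d (xi N) (mxi N0) l h K G H mh hK HK tay
  (d%:R * (d%:R * (c * c * eta))) tau.
have {}B2 : `|\int[P]_w G1 N w - \int[P]_w G2 N w| <=
    K * (d%:R ^+ 2 * (d%:R * (d%:R * (c * c * eta))) + tau + Num.sqrt (N%:R^-1) * M3).
  apply: B2 => //.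
  - by move=> v /WV Vv; exact: (xm v 3%N Vv isT).1.
  - by move=> v /WV Vv; rewrite -tauE; exact: (xm v 3%N Vv isT).2.
  - by move=> v j /WV Vv; exact: (xe v Vv).1.
  - move=> v i j Wv; rewrite (xe v (WV _ Wv)).2; apply: covariance_bound; first exact: ltW.
    by move=> a b; exact: HWN.
  - by apply: mulr_ge0 => //; apply: mulr_ge0 => //; apply: mulr_ge0; [exact: mulr_ge0|exact: ltW].
have iG1 := bounded_integrable P (mG1 N N0) (G1K N).
have iG2 := bounded_integrable P (mG2 N) (G2K N).
have iI : P.-integrable setT (EFin \o (fun w : Omega => I)).
  by apply: (@bounded_integrable _ _ _ P _ `|I|).
have eGG : \int[P]_w GG N w = \int[P]_w G1 N w + (I - \int[P]_w G2 N w).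
  rewrite /GG RintegralD//; last by have := integrableB measurableT iI iG2.
  by congr (_ + _); rewrite RintegralB// Rint_cst.
have b1 : 2 * K * e' <= e / 4.
  have : e = e' * (8 * (K + 1)) by rewrite /e' divfK// gt_eqF.
  have : 0 <= K * e' by rewrite mulr_ge0// ltW.
  lra.
have b2 : K * (d%:R ^+ 2 * (d%:R * (d%:R * (c * c * eta)))) <= e / 4.
  have : e = eta * (4 * (D + 1)) by rewrite /eta divfK// gt_eqF.
  have -> : K * (d%:R ^+ 2 * (d%:R * (d%:R * (c * c * eta)))) = D * eta by rewrite /D; ring.
  have : 0 <= D * eta by rewrite mulr_ge0// ltW.
  lra.
have e8 : 0 < e / 8 by rewrite divr_gt0.
have b3 : K * tau <= e / 8.
  rewrite /tau mulrCA mulrC; apply: invsqrt_small => //; near: N.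
  by move/cvgryPge : n_infty; apply.
have b4 : K * (Num.sqrt (N%:R^-1) * M3) <= e / 8.
  rewrite sqrtrV// mulrCA mulrC; apply: invsqrt_small => //; near: N.
  exact: nbhs_infty_ger.
rewrite eGG in B1; rewrite !mulrDr in B2.
move: B1 B2; rewrite -/(F N) !ler_norml => /andP[x1 x2] /andP[x3 x4].
by apply/andP; split; lra.
Unshelve. all: by end_near. Qed.

Let tightness e : 0 < e -> exists2 A, 0 < A & whp P e (fun N w => `|(Y N w : 'cV[R]_d)| <= A).
Proof.
move=> e0; have [W [mW WV Wp _]] := concentration (ltr01 : 0 < 1 :> R).
pose e' := e / (d%:R + 1).
have d1 : 0 < d%:R + 1 :> R by rewrite ltr_wpDl.
have e'0 : 0 < e' by rewrite divr_gt0.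
have H j : exists A, 0 < A /\ whp P e' (fun N w => `|(Y N w : 'cV[R]_d) j 0| < A).
  pose phi N u := (xi N u : 'cV[R]_d) j 0.
  have mphi N : (0 < N)%N -> measurable_fun setT (phi N).
    by move=> N0; exact: (measurableT_comp (measurable_coord j) (mxi N0)).
  have C0 : 0 <= c ^+ 2 * (d%:R * (1 + M)) by rewrite !mulr_ge0 ?exprn_ge0// addr_ge0.
  have HT : \forall N \near \oo, forall v, W v ->
     [/\ mu.-integrable setT (EFin \o (fun z => p N z v * phi N (v, z) ^+ 2)),
      N%:R * \int[mu]_z (p N z v * phi N (v, z) ^+ 2) <= c ^+ 2 * (d%:R * (1 + M))
     & \int[mu]_z (p N z v * phi N (v, z)) = 0].
    near=> N => v /WV Vv.
    have N0 : (0 < N)%N by near: N; exact: nbhs_infty_gt.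
    have nN0 : 0 < n N by near: N.
    have xm : forall v r, V v -> (0 < r <= 4)%N ->
      mu.-integrable setT (EFin \o (fun z => p N z v * `|(xi N (v, z) : 'cV[R]_d)| ^+ r)) /\
      N%:R * \int[mu]_z (p N z v * `|(xi N (v, z) : 'cV[R]_d)| ^+ r) <=
      (Num.sqrt (n N))^-1 ^+ r * (c ^+ r * (d%:R * (n N * (1 + M)))).
      by clear v Vv; near: N.
    have [i1 i2] := xm v 2%N Vv isT.
    have pw z : `|p N z v * phi N (v, z) ^+ 2| <= p N z v * `|(xi N (v, z) : 'cV[R]_d)| ^+ 2.
      have /andP[p0 _] := p01 z v N0; have pp : 0 <= p N z v * phi N (v, z) ^+ 2 by apply: mulr_ge0 => //; exact: sqr_ge0.
      rewrite ger0_norm//; apply: ler_wpM2l => //.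
      rewrite -(real_normK (num_real (phi N (v, z)))); apply: lerXn2r; rewrite ?nnegrE//.
      exact: coord_le_norm.
    have mf : measurable_fun setT (fun z => p N z v * phi N (v, z) ^+ 2).
      apply: measurable_funM; first exact: mpv.
      apply: (measurableT_comp (f := fun x : R => x ^+ 2)); first exact: measurable_funX.
      exact: (measurable_fun_pair2 v (mphi N N0)).
    have i3 := integrable_le mf pw i1; split => //.
      apply: le_trans (_ : _ <= N%:R * \int[mu]_z (p N z v * `|(xi N (v, z) : 'cV[R]_d)| ^+ 2)) _.
        rewrite ler_wpM2l//; apply: le_Rintegral => // z _; apply: le_trans (pw z); exact: ler_norm.
      apply: le_trans i2 _; rewrite exprVn sqr_sqrtr ?(ltW nN0)//.
      by rewrite le_eqVlt; apply/orP; left; apply/eqP; field; rewrite gt_eqF.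
    have h : (forall j, \int[mu]_z (p N z v * (xi N (v, z) : 'cV[R]_d) j 0) = 0) /\
      (forall i j, N%:R * \int[mu]_z (p N z v * ((xi N (v, z) : 'cV[R]_d) i 0 * (xi N (v, z) : 'cV[R]_d) j 0)) =
       \sum_a \sum_b invmx S i a * invmx S j b * SigN N v a b).
      by clear xm i1 i2 pw mf i3; move: v Vv; near: N.
    exact: h.1.
  have [A A0 HA] := @tight_whp _ _ _ _ _ _ P mu Z pilot delta p mZ mpilot mdelta mp p01 next phi W _ C0 mphi mW Wp HT _ e'0.
  by exists A; split => //; apply: whp_le HA => //; near=> N => w; rewrite YE.
have [A HA] := choice H.
exists (\sum_j A j + 1).
  by rewrite ltr_wpDl// sumr_ge0// => j _; rewrite ltW//; exact: (HA j).1.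
apply: whp_le (whp_forall (fun j => (HA j).2)).
  rewrite card_ord /e' mulrCA ger_pMr// ler_pdivrMr// mul1r lerDl//.
near=> N => w h; apply: norm_le_coord.
  by rewrite addr_ge0// sumr_ge0// => j _; rewrite ltW//; exact: (HA j).1.
move=> j; apply: le_trans (ltW (h j)) _; rewrite (bigD1 j)//= -addrA lerDl addr_ge0//.
by rewrite sumr_ge0// => k _; rewrite ltW//; exact: (HA k).1.
Unshelve. all: by end_near. Qed.

Let hessian_lln e rho : 0 < e -> 0 < rho -> whp P e (fun N w => forall j k,
  `|(n N)^-1 * (\sum_(i < N) (delta N i w)%:R * hs N j k (pilot N w, Z i w)) + S j k| <= rho).
Proof.
move=> e0 rho0; pose D : R := #|{: 'I_d * 'I_d}|%:R.
have D1 : 0 < D + 1 by rewrite ltr_wpDl.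
have e'0 : 0 < e / (D + 1) by rewrite divr_gt0.
have H (jk : 'I_d * 'I_d) : whp P (e / (D + 1)) (fun N w =>
   `|(n N)^-1 * (\sum_(i < N) (delta N i w)%:R * hs N jk.1 jk.2 (pilot N w, Z i w)) + S jk.1 jk.2| <= rho).
  case: jk => j k /=; pose phi N u := (n N)^-1 * hs N j k u.
  have mphi N : (0 < N)%N -> measurable_fun setT (phi N).
    by move=> N0; apply: measurable_funM => //; exact: mhs.
  have := @lln_whp _ _ _ _ _ _ P mu Z pilot delta p mZ mpilot mdelta mp p01 next phi (- S j k) rho rho0 mphi.
  move=> LL; apply: whp_le (LL _ _ e'0) => //.
    near=> N => w; have -> : \sum_(i < N) (delta N i w)%:R * phi N (pilot N w, Z i w) =
        (n N)^-1 * \sum_(i < N) (delta N i w)%:R * hs N j k (pilot N w, Z i w).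
      by rewrite mulr_sumr; apply: eq_bigr => i _; rewrite /phi mulrCA.
    by rewrite opprK => /ltW.
  move=> eta eta0; have [W [mW WV Wp HW]] := concentration eta0.
  exists W; split => //; near=> N => v Wv; have Vv := WV _ Wv.
  have N0 : (0 < N)%N by near: N; exact: nbhs_infty_gt.
  have nN0 : 0 < n N by near: N.
  have [_ mom _] : [/\
    forall k, mu.-integrable setT (EFin \o (fun z => p N z v * sc N v z k ^+ 4)) /\
      N%:R * \int[mu]_z (p N z v * sc N v z k ^+ 4) <= n N * M,
    forall j k, mu.-integrable setT (EFin \o (fun z => p N z v * hs N j k (v, z) ^+ 2)) /\
      N%:R * \int[mu]_z (p N z v * hs N j k (v, z) ^+ 2) <= n N * M
    & (\int[mu]_z (p N z v * L N (v, z))%:E <= (n N * M / N%:R)%:E)%E] by move: v Vv {Wv}; near: N.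
  have [_ _ mn] : [/\
    forall k, \int[mu]_z (p N z v * sc N v z k) = 0,
    forall j k, N%:R * \int[mu]_z (p N z v * (sc N v z j * sc N v z k)) = n N * SigN N v j k
    & forall j k, N%:R * \int[mu]_z (p N z v * hs N j k (v, z)) = - (n N * SigN N v j k)].
    by move: v Vv {Wv mom}; near: N.
  have hW : `|SigN N v j k - S j k| <= eta by move: v Wv {Vv mom mn}; near: N; apply: filterS HW => ? h v; exact: h.
  have [i1 b1] := mom j k.
  have i2 : mu.-integrable setT (EFin \o (fun z => (n N)^-1 ^+ 2 * (p N z v * hs N j k (v, z) ^+ 2))).
    by have := integrableZl measurableT ((n N)^-1 ^+ 2) i1.
  have eq2 : (fun z => p N z v * phi N (v, z) ^+ 2) = (fun z => (n N)^-1 ^+ 2 * (p N z v * hs N j k (v, z) ^+ 2)).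
    by apply/funext => z; rewrite /phi exprMn; ring.
  rewrite eq2; split => //.
    rewrite RintegralZl// mulrCA; apply: le_trans (_ : _ <= (n N)^-1 ^+ 2 * (n N * M)) _.
      by rewrite ler_wpM2l// exprn_ge0// invr_ge0 ltW.
    (* Dividing the Hessian terms by n brings their summed second moment down to M / n, which tends
       to 0. *)
    have -> : (n N)^-1 ^+ 2 * (n N * M) = M / n N by field; rewrite gt_eqF.
    rewrite ler_pdivrMr// mulrC -ler_pdivrMr//; near: N.
    by move/cvgryPge : n_infty; apply.
  have i3 : mu.-integrable setT (EFin \o (fun z => p N z v * hs N j k (v, z))).
    have i4 : mu.-integrable setT (EFin \o (fun z => p N z v + p N z v * hs N j k (v, z) ^+ 2)).
      by have := integrableD measurableT (ip v N0) i1.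
    apply: integrable_le i4.
      by apply: measurable_funM; [exact: mpv|exact: (measurable_fun_pair2 v (mhs j k N0))].
    move=> z; have /andP[p0 p1] := p01 z v N0; rewrite normrM ger0_norm// -{2}[p N z v]mulr1 -mulrDr.
    apply: ler_wpM2l => //; rewrite -(real_normK (num_real (hs N j k (v, z)))).
    move: (`|hs N j k (v, z)|) => t; have := sqr_ge0 (t - 1); have := sqr_ge0 t; rewrite sqrrB expr1n; lra.
  have -> : \int[mu]_z (p N z v * phi N (v, z)) = (n N)^-1 * \int[mu]_z (p N z v * hs N j k (v, z)).
    by rewrite -RintegralZl//; apply: eq_Rintegral => z _; rewrite /phi mulrCA.
  rewrite (_ : _ - _ = - (SigN N v j k - S j k)) ?normrN// mulrCA mn; field.
  by rewrite gt_eqF.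
apply: whp_le (whp_forall H).
  by rewrite -/D mulrCA ger_pMr// ler_pdivrMr// mul1r lerDl.
by near=> N => w h j k; exact: (h (j, k)).
Unshelve. all: by end_near. Qed.

Let curvature e : 0 < e -> exists2 A, 0 < A & whp P e (fun N w =>
  \sum_(i < N) (delta N i w)%:R * L N (pilot N w, Z i w) <= A * n N).
Proof.
move=> e0; have [W [mW WV Wp _]] := concentration (ltr01 : 0 < 1 :> R).
(* Markov's inequality gives the probability n M / (A n), and this A makes it at most e / 2. *)
pose A := 2 * M / e + 1.
have A1 : 0 < A by rewrite ltr_wpDl// divr_ge0 ?(ltW e0)// mulr_ge0.
exists A => //; apply: (whp_imp Wp e0); near=> N.
have N0 : (0 < N)%N by near: N; exact: nbhs_infty_gt.
have nN0 : 0 < n N by near: N.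
have An0 : 0 < A * n N by rewrite mulr_gt0.
have mom : forall v, V v -> (\int[mu]_z (p N z v * L N (v, z))%:E <= (n N * M / N%:R)%:E)%E.
  by near: N; apply: filterS moments => N' h v /h[].
have C0 : 0 <= n N * M by rewrite mulr_ge0// ltW.
have [mB PB] := @sampled_markov _ _ _ _ _ _ P mu Z pilot delta p mZ mpilot mdelta mp p01 next N W (L N) (n N * M) (A * n N)
  N0 mW (mL N0) (fun u => L0 u N0) An0 C0 (fun v Wv => mom v (WV _ Wv)).
eexists; split; [exact: mB| |].
  apply: le_trans PB _; rewrite lee_fin ler_pdivrMr//.
  have -> : e / 2 * (A * n N) = n N * M + e / 2 * n N by rewrite /A; field; rewrite gt_eqF.
  by rewrite lerDl mulr_ge0 ?divr_ge0// ltW.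
by move=> w nB Ww; rewrite leNgt; apply/negP => h; apply: nB; split => //; exact: ltW.
Unshelve. all: by end_near. Qed.

Let hat_close e rho : 0 < e -> 0 < rho -> whp P e (fun N w =>
  `|Num.sqrt (n N) *: ((hat N w : 'cV[R]_d) - theta) - (Y N w : 'cV[R]_d)| <= rho).
Proof.
move=> e0 rho0; have e5 : 0 < e / 5 by rewrite divr_gt0.
have [A2 A20 HY] := tightness e5; have [A1 A10 HL] := curvature e5.
(* 1/2 for the absorption in [onestep_error], and rho / (2 A2) so that its bound 2 A2 kappa is at
   most rho. *)
pose kappa := Num.min 2^-1 (rho / (2 * A2)).
have A22 : 0 < 2 * A2 by rewrite mulr_gt0.
have k0 : 0 < kappa by rewrite lt_min invr_gt0 ltr0n divr_gt0.
have cd0 : 0 <= c * (d%:R + A1) by rewrite mulr_ge0// addr_ge0// ltW.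
(* One radius for the Hessian error and for the deviation of the estimator, making the contraction
   factor at most kappa. *)
pose r := kappa / (c * (d%:R + A1) + 1).
have cd1 : 0 < c * (d%:R + A1) + 1 by rewrite ltr_wpDl.
have r0 : 0 < r by rewrite divr_gt0.
have HH := hessian_lln e5 r0; have HC := consistent e5 r0; have HS := score_expansion e5.
apply: whp_le (whp_and (whp_and HY HL) (whp_and HH (whp_and HC HS))); first lra.
near=> N => w [[hY hL] [hH [hC hS]]].
have nN0 : 0 < n N by near: N.
pose sv : 'cV[R]_d := \col_k \sum_(i < N) (delta N i w)%:R * sc N (pilot N w) (Z i w) k.
have YE' : (Y N w : 'cV[R]_d) = (Num.sqrt (n N))^-1 *: (invmx S *m sv).
  apply/colP => k; rewrite YE !mxE mulr_sumr.
  under eq_bigr do rewrite xiE mulr_sumr.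
  rewrite exchange_big/=; apply: eq_bigr => a _; rewrite mxE !mulr_sumr.
  by apply: eq_bigr => i _; ring.
have hS' k : `|sv k 0 + \sum_j (\sum_(i < N) (delta N i w)%:R * hs N j k (pilot N w, Z i w))
             * ((hat N w : 'cV[R]_d) - theta) j 0|
   <= (\sum_(i < N) (delta N i w)%:R * L N (pilot N w, Z i w))
     * `|(hat N w : 'cV[R]_d) - theta| ^+ 2 by rewrite mxE; exact: hS.
have := @onestep_error R d S sv ((hat N w : 'cV[R]_d) - theta) (Y N w) _ _ (n N) r A1 A2 kappa
  ST Su nN0 (ltW A10) (ltW r0) YE' hS' hH hL hC hY.
have h1 : abs_sum (invmx S) * ((d%:R + A1) * r) <= kappa.
  rewrite mulrA -/c /r mulrA ler_pdivrMr// mulrC ler_wpM2l ?(ltW k0)//.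
  by rewrite lerDl.
have h2 : kappa <= 2^-1 by rewrite ge_min lexx.
move=> /(_ h1 h2) /le_trans; apply.
have : kappa <= rho / (2 * A2) by rewrite ge_min lexx orbT.
by rewrite ler_pdivlMr// mulrC.
Unshelve. all: by end_near. Qed.

Lemma one_step_cvg h : smooth h ->
  \int[P]_w h (Num.sqrt (n N) *: ((hat N w : 'cV[R]_d) - theta)) @[N --> \oo] --> \int[gauss l]_u h u.
Proof.
move=> sh; have CLT := clt_smooth sh; have mh := smooth_measurable sh.
have [C C0 hC] := smooth_lipschitz sh; have [K K0 hK] := smooth_bounded sh.
apply: (iffRL (@cvgrPdist_le _ R^o nat \oo _ _ _)) => e e0.
have CLT' := iffLR (@cvgrPdist_le _ R^o nat \oo _ _ _) CLT (e / 2) (divr_gt0 e0 (ltr0n _ 2)).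
pose e' := e / (8 * (K + 1)).
have K1 : 0 < 8 * (K + 1) by rewrite mulr_gt0// ltr_wpDl.
have e'0 : 0 < e' by rewrite divr_gt0.
have rho0 : 0 < e / (4 * C) by rewrite divr_gt0// mulr_gt0.
pose F N w := h (Num.sqrt (n N) *: ((hat N w : 'cV[R]_d) - theta)).
pose G N w := h (Y N w).
have FG : whp P e' (fun N w => `|F N w - G N w| <= e / 4).
  apply: whp_le (hat_close e'0 rho0) => //; near=> N => w hw.
  have -> : F N w = h ((Y N w : 'cV[R]_d) +
      (Num.sqrt (n N) *: ((hat N w : 'cV[R]_d) - theta) - (Y N w : 'cV[R]_d))).
    by rewrite /F [in RHS]addrC subrK.
  apply: le_trans (hC _ _) _; apply: le_trans (ler_wpM2l (ltW C0) hw) _.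
  by rewrite le_eqVlt; apply/orP; left; apply/eqP; field; rewrite gt_eqF.
have mF : \forall N \near \oo, measurable_fun setT (F N).
  near=> N; apply: (measurableT_comp mh); apply: measurable_borelVZ => //.
  by apply: (@measurable_borelVD _ _ _ _ (hat N) (fun=> - theta)).
have mG : \forall N \near \oo, measurable_fun setT (G N).
  near=> N; apply: (measurableT_comp mh); apply: mY; near: N; exact: nbhs_infty_gt.
have e40 : 0 <= e / 4 by rewrite divr_ge0// ltW.
have close := whp_Rintegral e40 mF mG (fun N w => hK _) (fun N w => hK _) FG.
near=> N.
have b1 : `|\int[P]_w F N w - \int[P]_w G N w| <= e / 4 + 2 * K * e' by near: N.
have b2 : `|\int[gauss l]_u h u - \int[P]_w h (Y N w)| <= e / 2 by near: N; exact: CLT'.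
have b3 : 2 * K * e' <= e / 4.
  have : e = e' * (8 * (K + 1)) by rewrite /e' divfK// gt_eqF.
  have : 0 <= K * e' by rewrite mulr_ge0// ltW.
  lra.
rewrite -/(F N); move: b1 b2; rewrite -/(G N) !ler_norml => /andP[x1 x2] /andP[x3 x4].
by apply/andP; split; lra.
Unshelve. all: by end_near. Qed.

End one_step.

(** * Calculus with partial derivatives only *)

Section partial.
Context {R : realType} {d : nat}.
Implicit Types (f g : 'cV[R]_d -> R) (x t a u : 'cV[R]_d).

Local Notation dd j f := ('D_(basisv j) f).

Let along_quotient f x j (s : R) :
  (fun h : R => h^-1 *: (((fun s => f (x + s *: basisv j)) \o shift s) (h *: 1) - f (x + s *: basisv j))) =
  (fun h : R => h^-1 *: ((f \o shift (x + s *: basisv j)) (h *: basisv j) - f (x + s *: basisv j))).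
Proof.
apply/funext => h /=; congr (_ *: (f _ - _)).
by rewrite [h *: 1]mulr1 scalerDl addrCA.
Qed.

Lemma is_derive_along f x j (s df : R) : is_derive (x + s *: basisv j) (basisv j) f df ->
  is_derive s 1 (fun s => f (x + s *: basisv j)) df.
Proof.
move=> [dr <-]; apply: DeriveDef; first by rewrite /derivable along_quotient.
by rewrite /derive along_quotient.
Qed.

Lemma along_is_derive f x j (s df : R) : is_derive s 1 (fun s => f (x + s *: basisv j)) df ->
  is_derive (x + s *: basisv j) (basisv j) f df.
Proof.
move=> [dr <-]; apply: DeriveDef; first by move: dr; rewrite /derivable along_quotient.
by rewrite /derive along_quotient.
Qed.

Lemma partial_mvt f x j (s : R) :
  (forall r, (0 <= r <= s) || (s <= r <= 0) -> derivable f (x + r *: basisv j) (basisv j)) ->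
  exists2 r, (0 <= r <= s) || (s <= r <= 0) &
    f (x + s *: basisv j) - f x = dd j f (x + r *: basisv j) * s.
Proof.
move=> df; pose phi r := f (x + r *: basisv j); pose dphi r := dd j f (x + r *: basisv j).
have phi0 : phi 0 = f x by rewrite /phi scale0r addr0.
have dp r : (0 <= r <= s) || (s <= r <= 0) -> is_derive r 1 phi (dphi r).
  by move=> /df /derivableP; exact: is_derive_along.
have [s0|s0] := leP 0 s.
  have [||r] := @MVT_segment R phi dphi 0 s s0.
  - by move=> r; rewrite in_itv/= => /andP[a b]; apply: dp; rewrite (ltW a) (ltW b).
  - apply: derivable_within_continuous => r; rewrite in_itv/= => h.
    by have [] := dp r; rewrite ?h.
  rewrite in_itv/= => h; rewrite phi0 subr0 => e; exists r => //.
  by rewrite h.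
have [||r] := @MVT_segment R phi dphi s 0 (ltW s0).
- by move=> r; rewrite in_itv/= => /andP[a b]; apply: dp; rewrite (ltW a) (ltW b) orbT.
- apply: derivable_within_continuous => r; rewrite in_itv/= => h.
  by have [] := dp r; rewrite ?h ?orbT.
rewrite in_itv/= => h; rewrite phi0 sub0r mulrN => e; exists r; first by rewrite h orbT.
by rewrite -[LHS]opprB -/(phi s) e opprK.
Qed.

(** The box with opposite corners a and t. A segment would not do: with partial derivatives alone,
    paths run parallel to the axes. *)
Definition between a t u := forall i : 'I_d,
  (a i 0 <= u i 0 <= t i 0) || (t i 0 <= u i 0 <= a i 0).

Lemma between_trans a t u x : between a t u -> between a u x -> between a t x.
Proof.
by move=> h1 h2 i; have := h1 i; have := h2 i; case/orP => /andP[e1 e2] /orP[]/andP[e3 e4];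
  apply/orP; (try by left; apply/andP; split; lra); right; apply/andP; split; lra.
Qed.

Lemma between_norm a t u : between a t u -> `|u - a| <= `|t - a|.
Proof.
move=> h; apply: norm_le_coord => // i; apply: le_trans (coord_le_norm _ i); rewrite !mxE.
have := h i; move: (a i 0) (t i 0) (u i 0) => r1 r2 r3.
by case/orP => /andP[e1 e2]; [rewrite !ger0_norm|rewrite !ler0_norm]; lra.
Qed.

(** The path from a to t changes one coordinate at a time, [mix k] having the first k coordinates of
    t. Each leg is a mean value theorem in one variable and stays in the box. *)
Lemma partial_path f a t (c : 'I_d -> R) (b : R) : 0 <= b ->
  (forall u j, between a t u -> derivable f u (basisv j) /\ `|dd j f u - c j| <= b) ->
  `|f t - f a - \sum_j c j * (t - a) j 0| <= d%:R * (b * `|t - a|).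
Proof.
move=> b0 H.
pose mix (k : nat) : 'cV[R]_d := \col_i if (i < k)%N then t i 0 else a i 0.
have m0 : mix 0%N = a by apply/colP => i; rewrite mxE ltn0.
have md : mix d = t by apply/colP => i; rewrite mxE ltn_ord.
have -> : f t - f a = \sum_(k < d) (f (mix k.+1) - f (mix k)).
  by rewrite -{1}md -{1}m0 -(telescope_sumr (fun k => f (mix k)) (leq0n d)) big_mkord.
rewrite -sumrB; apply: le_trans (ler_norm_sum _ _ _) _; apply: sum_le_const => j.
have mixS : mix j.+1 = mix j + (t - a) j 0 *: basisv j.
  apply/colP => i; rewrite !mxE ltnS andbT; case: (ltngtP i j) => [ij|ij|ij].
  - by rewrite -val_eqE (ltn_eqF ij) mulr0 addr0.
  - by rewrite -val_eqE (gtn_eqF ij) mulr0 addr0.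
  - by rewrite (val_inj ij) eqxx mulr1 addrC subrK.
have bt r : (0 <= r <= (t - a) j 0) || ((t - a) j 0 <= r <= 0) -> between a t (mix j + r *: basisv j).
  move=> hr i; rewrite !mxE andbT; case: (ltngtP i j) => [ij|ij|ij].
  - by rewrite -val_eqE (ltn_eqF ij) mulr0 addr0 lexx; have := le_total (a i 0) (t i 0); case/orP => ->; rewrite ?orbT.
  - by rewrite -val_eqE (gtn_eqF ij) mulr0 addr0 lexx; have := le_total (a i 0) (t i 0); case/orP => ->; rewrite ?orbT.
  - rewrite (val_inj ij) eqxx mulr1; move: hr; rewrite !mxE; move: (a j 0) (t j 0) => r1 r2.
    by case/orP => /andP[e1 e2]; apply/orP; [left|right]; apply/andP; split; lra.
have [r hr e] := @partial_mvt f (mix j) j ((t - a) j 0) (fun r hr => (H _ j (bt r hr)).1).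
rewrite mixS e -mulrBl normrM; apply: ler_pM => //; first exact: (H _ j (bt r hr)).2.
exact: coord_le_norm.
Qed.

Lemma partial_lipschitz f a t (b : R) : 0 <= b ->
  (forall u j, between a t u -> derivable f u (basisv j) /\ `|dd j f u| <= b) ->
  `|f t - f a| <= d%:R * (b * `|t - a|).
Proof.
move=> b0 H; have := @partial_path f a t (fun=> 0) b b0.
rewrite big1 ?subr0 => [|j _]; last by rewrite mul0r.
by apply => u j /(H u j)[? ?]; rewrite subr0.
Qed.

(** [partial_path] with the gradient at a as reference, its variation over the box being bounded by
    [partial_lipschitz] applied to each partial derivative. *)
Lemma partial_taylor f a t (b : R) : 0 <= b ->
  (forall u j, between a t u -> derivable f u (basisv j)) ->
  (forall u j k, between a t u -> derivable (dd j f) u (basisv k) /\ `|dd k (dd j f) u| <= b) ->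
  `|f t - f a - \sum_j dd j f a * (t - a) j 0| <= d%:R * (d%:R * (b * `|t - a|) * `|t - a|).
Proof.
move=> b0 H1 H2; apply: partial_path => [|u j bu]; first by rewrite !mulr_ge0.
split; first exact: H1.
have H w k : between a u w -> derivable (dd j f) w (basisv k) /\ `|dd k (dd j f) w| <= b.
  by move=> bw; apply: H2; exact: between_trans bw.
apply: (le_trans (@partial_lipschitz (dd j f) a u b b0 H)).
by apply: ler_wpM2l => //; apply: ler_wpM2l => //; exact: between_norm.
Qed.

Lemma partial_max f x j (r : R) : 0 < r ->
  (forall s, `|s| < r -> derivable f (x + s *: basisv j) (basisv j)) ->
  (forall s, `|s| < r -> f (x + s *: basisv j) <= f x) -> dd j f x = 0.
Proof.
move=> r0 df fm; pose phi s := f (x + s *: basisv j).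
have itv s : s \in `]-r, r[%R -> `|s| < r by rewrite in_itv/= ltr_norml.
have dphi s : s \in `]-r, r[%R -> derivable phi s 1.
  by move=> /itv/df/derivableP/is_derive_along[].
have x0 : x + 0 *: basisv j = x by rewrite scale0r addr0.
have i0 : (0 : R) \in `]-r, r[%R by rewrite in_itv/= r0 oppr_lt0 r0.
have d0 : is_derive (0 : R) (1 : R) phi 0.
  apply: (@derive1_at_max R phi (- r) r 0) => //; first by lra.
  by move=> s /itv/fm; rewrite /phi x0.
by have := along_is_derive d0; rewrite x0 => -[].
Qed.

Lemma near_ball_norm (c : 'cV[R]_d) (r : R) u : `|u - c| < r -> \forall u' \near u, `|u' - c| < r.
Proof.
move=> ur; apply/nbhs_ballP; exists (r - `|u - c|); first by rewrite /= subr_gt0.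
move=> w; rewrite -ball_normE/= => uw.
have -> : w - c = (u - c) - (u - w) by rewrite opprB [RHS]addrC addrA subrK.
by apply: le_lt_trans (ler_normB _ _) _; rewrite addrC -ltrBrDr.
Qed.

(** The regularity hypotheses concern logarithms, so the derivatives of the density and of pibar are
    deduced from those of their logarithms through the exponential. *)
Lemma partial_expR (F G : 'cV[R]_d -> R) u j : (\forall u' \near u, expR (G u') = F u') ->
  derivable G u (basisv j) -> is_derive u (basisv j) F (F u * dd j G u).
Proof.
move=> FG dG; have x0 : u + 0 *: basisv j = u by rewrite scale0r addr0.
have Fu : F u = expR (G u) by rewrite (nbhs_singleton FG).
apply: near_eq_is_derive FG _.
rewrite Fu -{1}x0; apply: along_is_derive.
have d1 : is_derive (0 : R) 1 (fun s => G (u + s *: basisv j)) (dd j G u).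
  by apply: is_derive_along; rewrite x0; exact/derivableP.
have d2 := is_derive_expR (G (u + 0 *: basisv j)).
by have := is_derive1_comp d2 d1; rewrite x0.
Qed.

Lemma pderiv_expR (F G : 'cV[R]_d -> R) a (r : R) : 0 < r ->
  (forall u, `|u - a| < r -> F u = expR (G u)) ->
  (forall u j, `|u - a| < r -> derivable G u (basisv j)) ->
  (forall j k, derivable (dd k G) a (basisv j)) ->
  (forall j, dd j F a = F a * dd j G a) /\
  (forall j k, dd j (dd k F) a = F a * (dd j (dd k G) a + dd j G a * dd k G a)).
Proof.
move=> r0 FG d1 d2.
have nr u : `|u - a| < r -> \forall u' \near u, expR (G u') = F u'.
  by move=> /near_ball_norm; apply: filterS => w /FG.
have D1 u j : `|u - a| < r -> is_derive u (basisv j) F (F u * dd j G u).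
  by move=> ur; apply: partial_expR (nr u ur) _; exact: d1.
have aa : `|a - a| < r by rewrite subrr normr0.
split=> [j|j k]; first by have [] := D1 a j aa.
have e : \near a, dd k F a = (F * dd k G) a.
  near=> u; have ur : `|u - a| < r by near: u; exact: near_ball_norm.
  by have [] := D1 u k ur.
rewrite (near_eq_derive _ e) deriveM; last 2 first.
- by have [] := D1 a j aa.
- exact: d2.
have [_ ->] := D1 a j aa; rewrite /GRing.scale/=; ring.
Unshelve. all: by end_near. Qed.

Lemma pderiv_zero (F : 'cV[R]_d -> R) a (r : R) : 0 < r ->
  (forall u, `|u - a| < r -> F u = 0) ->
  (forall j, dd j F a = 0) /\ (forall j k, dd j (dd k F) a = 0).
Proof.
move=> r0 F0.
have D1 u j : `|u - a| < r -> dd j F u = 0.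
  move=> ur; have e : \near u, F u = cst 0 u.
    by near=> w; apply: F0; near: w; exact: near_ball_norm.
  by rewrite (near_eq_derive _ e) derive_cst.
have aa : `|a - a| < r by rewrite subrr normr0.
split=> [j|j k]; first exact: D1.
have e : \near a, dd k F a = cst 0 a.
  by near=> w; apply: D1; near: w; exact: near_ball_norm.
by rewrite (near_eq_derive _ e) derive_cst.
Unshelve. all: by end_near. Qed.

(** A partial derivative is a pointwise limit of difference quotients with steps 1 / (m0 + m + 1),
    where m0 keeps the displaced points in the ball on which measurability is known. *)
Lemma measurable_partial dT (T : measurableType dT) (D : set T) (F : T -> 'cV[R]_d -> R) a (r : R) u j :
  `|u - a| < r -> (forall w, `|w - a| < r -> measurable_fun D (F^~ w)) ->
  (forall z, D z -> derivable (F z) u (basisv j)) ->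
  measurable_fun D (fun z => dd j (F z) u).
Proof.
move=> ur mF dF.
have [m0 hm0] : exists m0 : nat, forall m, `|u + (m0 + m).+1%:R^-1 *: basisv j - a| < r.
  have e0 : 0 < r - `|u - a| by rewrite subr_gt0.
  have [m0 _ hm] := near_infty_natSinv_lt (PosNum e0).
  exists m0 => m; have := hm (m0 + m)%N (leq_addr _ _) => /= h.
  rewrite addrAC; apply: le_lt_trans (ler_normD _ _) _; rewrite -ltrBrDl.
  apply: le_lt_trans h; rewrite normrZ gtr0_norm ?invr_gt0// ler_piMr ?invr_ge0//.
  by apply: norm_le_coord => // i; rewrite mxE normr_nat lern1 leq_b1.
pose h m := fun z => (m0 + m).+1%:R * (F z (u + (m0 + m).+1%:R^-1 *: basisv j) - F z u).
apply: (measurable_fun_cvg (h := h)) => [m|z Dz].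
  apply: measurable_funM => //; apply: measurable_funB; exact: mF.
have dz := dF z Dz; rewrite /derivable in dz.
have u0 : (fun m => (m0 + m).+1%:R^-1 : R) @ \oo --> (0 : R).
  exact: (cvg_comp _ _ (@cvg_addnl m0) (@cvg_harmonic R)).
have un0 m : (m0 + m).+1%:R^-1 != 0 :> R by rewrite invr_eq0 pnatr_eq0.
have H := iffLR (cvgr_dnbhsP _ _ _) dz (fun m => (m0 + m).+1%:R^-1) (conj un0 u0).
have -> : h^~ z = (fun m => ((m0 + m).+1%:R^-1)^-1 *: ((F z \o shift u) ((m0 + m).+1%:R^-1 *: basisv j) - F z u)).
  apply/funext => m; rewrite /h invrK /= [_ *: _ + u]addrC; congr (_ * (_ - _)).
exact: H.
Unshelve. all: by end_near. Qed.

End partial.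

(** * A measurable constant in the Taylor expansion of the score *)

Section taylor_constant.
Context {R : realType} {d : nat}.
Context {dT : measure_display} {T : measurableType dT}.
Local Notation dd j f := ('D_(basisv j) f).
Variables (D : set T) (F : T -> 'cV[R]_d -> R) (a : 'cV[R]_d) (r : R) (b : T -> R).
Hypothesis mD : measurable D.
Hypothesis r0 : 0 < r.
Hypothesis mF : forall w, `|w - a| < r -> measurable_fun D (F^~ w).
Hypothesis F3 : forall z, D z -> forall (js : seq 'I_d) j w, (size js <= 2)%N ->
  `|w - a| < r -> derivable (pderiv js (F z)) w (basisv j).
Hypothesis Fb : forall z, D z -> forall j1 j2 j3 w, `|w - a| < r ->
  `|pderiv [:: j1; j2; j3] (F z) w| <= b z.

Lemma measurable_pderiv1 w k : `|w - a| < r -> measurable_fun D (fun z => dd k (F z) w).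
Proof.
move=> wr; apply: (measurable_partial wr mF) => z Dz.
exact: (@F3 _ Dz [::] _ _ isT).
Qed.

Lemma measurable_pderiv2 w j k : `|w - a| < r -> measurable_fun D (fun z => dd j (dd k (F z)) w).
Proof.
move=> wr; apply: (@measurable_partial _ _ _ _ _ (fun z => dd k (F z)) a r w j wr).
  by move=> u; exact: measurable_pderiv1.
by move=> z Dz; exact: (@F3 _ Dz [:: k] _ _ isT).
Qed.

Definition taylor_rem z k t :=
  dd k (F z) t - dd k (F z) a - \sum_j dd j (dd k (F z)) a * (t - a) j 0.

Let between_ball t u : `|t - a| < r -> between a t u -> `|u - a| < r.
Proof. by move=> tr /between_norm; move/le_lt_trans; apply. Qed.

Let aa : `|a - a| < r. Proof. by rewrite subrr normr0. Qed.

Lemma taylor_rem_le z k t : D z -> `|t - a| < r ->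
  `|taylor_rem z k t| <= d%:R ^+ 2 * `|b z| * `|t - a| ^+ 2.
Proof.
move=> Dz tr; have := @partial_taylor R d (dd k (F z)) a t `|b z| (normr_ge0 _).
have -> : d%:R * (d%:R * (`|b z| * `|t - a|) * `|t - a|) = d%:R ^+ 2 * `|b z| * `|t - a| ^+ 2 by ring.
apply.
  by move=> u j /(between_ball tr) ur; exact: (@F3 _ Dz [:: k] _ _ isT).
move=> u j i /(between_ball tr) ur; split; first exact: (@F3 _ Dz [:: j; k] _ _ isT).
by apply: le_trans (ler_norm _); exact: Fb.
Qed.

Let code (m : nat) : option ('I_d * 'cV[rat]_d) := unpickle m.
Let rpt (q : 'cV[rat]_d) : 'cV[R]_d := \col_i ratr (q i 0).
(** Remainder over squared distance at the m-th pair of a coordinate and a rational point. Numbers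
    that code no pair and points outside the ball give 0, so the supremum over m is a supremum of
    measurable functions. *)
Let ratio (m : nat) z : R := if code m is Some kq then
  (if `|rpt kq.2 - a| < r then `|taylor_rem z kq.1 (rpt kq.2)| / `|rpt kq.2 - a| ^+ 2 else 0)
  else 0.

Let mratio m : measurable_fun D (ratio m).
Proof.
rewrite /ratio; case: (code m) => [[k q]|] /=; last exact: measurable_cst.
have [tr|_] := boolP (`|rpt q - a| < r); last exact: measurable_cst.
apply: measurable_funM => //; apply: (measurableT_comp (f := fun x : R => `|x|)) => //.
apply: measurable_funB.
  by apply: measurable_funB; exact: measurable_pderiv1.
by apply: measurable_sum => j; apply: measurable_funM => //; exact: measurable_pderiv2.
Qed.

Let ratio_ge0 m z : 0 <= ratio m z.
Proof.
by rewrite /ratio; case: (code m) => [[k q]|]//=; case: ifP => // _; rewrite divr_ge0// exprn_ge0.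
Qed.

Let ratio_le m z : D z -> ratio m z <= d%:R ^+ 2 * `|b z|.
Proof.
move=> Dz; have b0 : 0 <= d%:R ^+ 2 * `|b z| by rewrite mulr_ge0// exprn_ge0.
rewrite /ratio; case: (code m) => [[k q]|]//=; case: ifP => // tr.
have [->|t0] := eqVneq (`|rpt q - a|) 0; first by rewrite expr0n/= invr0 mulr0.
have n0 : 0 < `|rpt q - a| ^+ 2 by rewrite exprn_gt0// lt0r t0 normr_ge0.
by rewrite ler_pdivrMr//; exact: (taylor_rem_le k Dz tr).
Qed.

Let ratio_ub z : D z -> has_ubound (range (ratio^~ z)).
Proof. by move=> Dz; exists (d%:R ^+ 2 * `|b z|) => _ [m _ <-]; exact: ratio_le. Qed.

Let L0 z := sups (ratio^~ z) 0.

Let L0E z : L0 z = sup (range (ratio^~ z)).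
Proof.
rewrite /L0 /sups /=; congr sup; apply/seteqP; split => [_ [k _ <-]|_ [k _ <-]]; first by exists k.
by exists k.
Qed.

Let ratio_L0 m z : D z -> ratio m z <= L0 z.
Proof. by move=> Dz; rewrite L0E; apply: ub_le_sup; [exact: ratio_ub|exists m]. Qed.

Let L0_ge0 z : D z -> 0 <= L0 z.
Proof. by move=> Dz; exact: le_trans (ratio_ge0 0%N z) (ratio_L0 0%N Dz). Qed.

Let L0_le z : D z -> L0 z <= d%:R ^+ 2 * `|b z|.
Proof.
move=> Dz; rewrite L0E; apply: ge_sup; first by exists (ratio 0%N z), 0%N.
by move=> _ [m _ <-]; exact: ratio_le.
Qed.

Let rem_rat z k q : D z -> `|rpt q - a| < r ->
  `|taylor_rem z k (rpt q)| <= L0 z * `|rpt q - a| ^+ 2.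
Proof.
move=> Dz tr; have := ratio_L0 (pickle (k, q)) Dz.
rewrite /ratio /code pickleK/= tr; have [t0|t0] := eqVneq (`|rpt q - a|) 0.
  by move=> _; have := taylor_rem_le k Dz tr; rewrite t0 expr0n/= !mulr0.
have n0 : 0 < `|rpt q - a| ^+ 2 by rewrite exprn_gt0// lt0r t0 normr_ge0.
by rewrite ler_pdivrMr.
Qed.

Let second z (k : 'I_d) : R := \sum_j `|dd j (dd k (F z)) a|.

Let rem_lip z k t u : D z -> (forall w, between t u w -> `|w - a| < r) ->
  `|taylor_rem z k u - taylor_rem z k t| <=
    (d%:R * (second z k + d%:R * (`|b z| * r)) + second z k) * `|u - t|.
Proof.
move=> Dz btw.
have s0 : 0 <= second z k by exact: sumr_ge0.
have B0 : 0 <= second z k + d%:R * (`|b z| * r) by rewrite addr_ge0// !mulr_ge0// ltW.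
have H : `|dd k (F z) u - dd k (F z) t| <= d%:R * ((second z k + d%:R * (`|b z| * r)) * `|u - t|).
  apply: (@partial_lipschitz R d (dd k (F z)) t u _ B0) => w j /btw wr; split; first exact: (@F3 _ Dz [:: k] _ _ isT).
  have h : `|dd j (dd k (F z)) w - dd j (dd k (F z)) a| <= d%:R * (`|b z| * `|w - a|).
    apply: (@partial_lipschitz R d (dd j (dd k (F z))) a w _ (normr_ge0 (b z))) => v i /(between_ball wr) vr; split; first exact: (@F3 _ Dz [:: j; k] _ _ isT).
    by apply: le_trans (ler_norm _); exact: Fb.
  rewrite -(subrK (dd j (dd k (F z)) a) (dd j (dd k (F z)) w)).
  apply: le_trans (ler_normD _ _) _; rewrite addrC lerD//.
    by rewrite /second (bigD1 j)//= lerDl sumr_ge0.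
  by apply: le_trans h _; rewrite ler_wpM2l// ler_wpM2l// ltW.
have -> : taylor_rem z k u - taylor_rem z k t =
  (dd k (F z) u - dd k (F z) t) - \sum_j dd j (dd k (F z)) a * (u - t) j 0.
  have -> : \sum_j dd j (dd k (F z)) a * (u - t) j 0 =
    \sum_j dd j (dd k (F z)) a * (u - a) j 0 - \sum_j dd j (dd k (F z)) a * (t - a) j 0.
    by rewrite -sumrB; apply: eq_bigr => j _; rewrite !mxE; ring.
  by rewrite /taylor_rem; ring.
apply: le_trans (ler_normB _ _) _; rewrite mulrDl lerD//; first by rewrite -mulrA.
apply: le_trans (ler_norm_sum _ _ _) _; rewrite /second mulr_suml; apply: ler_sum => j _.
by rewrite normrM ler_wpM2l// coord_le_norm.
Qed.

(** The remainder is Lipschitz in t by [rem_lip], so the bound passes from rational points to all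
    points of the ball. *)
Let rem_bound z k t : D z -> `|t - a| < r -> `|taylor_rem z k t| <= L0 z * `|t - a| ^+ 2.
Proof.
move=> Dz tr; set C := d%:R * (second z k + d%:R * (`|b z| * r)) + second z k.
have C0 : 0 <= C.
  by rewrite /C addr_ge0 ?mulr_ge0 ?addr_ge0 ?sumr_ge0// !mulr_ge0// ltW.
have L00 := L0_ge0 Dz; have x0 := normr_ge0 (t - a); set x := `|t - a| in tr x0 *.
apply/ler_addgt0Pr => e e0.
(* A rational point is taken within h of t. The choice of h keeps the box between them inside the
   ball and makes the cost C h of moving, plus the growth of L0 (x + h)^2 over L0 x^2, at most e. *)
pose C' := C + L0 z * (2 * x + 1) + 1.
have Lx0 : 0 <= L0 z * (2 * x + 1) by rewrite mulr_ge0// addr_ge0// mulr_ge0.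
have C'0 : 0 < C' by rewrite ltr_wpDl// addr_ge0.
pose h := Num.min (Num.min 1 ((r - x) / 2)) (e / C').
have rx : 0 < (r - x) / 2 by rewrite divr_gt0// subr_gt0.
have h0 : 0 < h by rewrite !lt_min ltr01 rx divr_gt0.
have h1 : h <= 1 by rewrite !ge_min lexx.
have h2 : h <= (r - x) / 2 by rewrite !ge_min lexx !orbT.
have h3 : h <= e / C' by rewrite ge_min lexx orbT.
have [q hq] := dense_ratr t h0.
have tq : `|rpt q - t| <= h.
  by apply: norm_le_coord => [|j]; [exact: ltW|rewrite !mxE distrC ltW].
have wb w : between t (rpt q) w -> `|w - a| <= x + h.
  move=> /between_norm wt; have -> : w - a = (t - a) + (w - t) by rewrite [RHS]addrC addrA subrK.
  by apply: le_trans (ler_normD _ _) _; rewrite lerD// (le_trans wt).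
have xh : x + h < r by lra.
have bq : between t (rpt q) (rpt q) by move=> i; rewrite lexx andbT; exact: le_total.
have qx := wb _ bq; have qr := le_lt_trans qx xh.
have R1 := rem_rat k Dz qr.
have R2 : `|taylor_rem z k (rpt q) - taylor_rem z k t| <= C * h.
  apply: le_trans (_ : _ <= C * `|rpt q - t|) _; last by rewrite ler_wpM2l.
  by apply: rem_lip => // w /wb wx; exact: le_lt_trans xh.
have R3 : L0 z * `|rpt q - a| ^+ 2 <= L0 z * x ^+ 2 + L0 z * (2 * x + 1) * h.
  apply: le_trans (_ : _ <= L0 z * (x + h) ^+ 2) _.
    rewrite ler_wpM2l//; apply: lerXn2r; rewrite ?nnegrE//.
    by rewrite addr_ge0// ltW.
  rewrite -mulrA -mulrDr ler_wpM2l//.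
  have : h * h <= h * 1 by rewrite ler_wpM2l// ltW.
  rewrite sqrrD mulr2n expr2; lra.
have R4 : C' * h <= e by rewrite mulrC -ler_pdivlMr.
have R5 : C' * h = C * h + L0 z * (2 * x + 1) * h + h by rewrite /C'; ring.
have -> : taylor_rem z k t = taylor_rem z k (rpt q) - (taylor_rem z k (rpt q) - taylor_rem z k t) by ring.
apply: le_trans (ler_normB _ _) _.
lra.
Qed.

(** No measurability is asked of b, which serves only to make the supremum finite; L is measurable
    by construction and can be evaluated at the random pilot. *)
Lemma taylor_constant : exists L : T -> R, [/\ measurable_fun setT L,
  forall z, 0 <= L z, forall z, D z -> L z <= d%:R ^+ 2 * `|b z|
  & forall z k t, D z -> `|t - a| < r -> `|taylor_rem z k t| <= L z * `|t - a| ^+ 2].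
Proof.
exists (L0 \_ D); split.
- have h := measurable_fun_sups 0 ratio_ub mratio.
  exact: (iffLR (measurable_restrictT _ mD) h).
- by move=> z; rewrite patchE; case: ifPn => // /set_mem; exact: L0_ge0.
- by move=> z Dz; rewrite patchE mem_set//; exact: L0_le.
- by move=> z k t Dz; rewrite patchE mem_set//; exact: rem_bound.
Qed.

End taylor_constant.

(** * Weighted means over the response at a fixed covariate *)

Section weighted.
Context {R : realType} {dY : measure_display} {Y : measurableType dY}.
Variables (nu : {measure set Y -> \bar R}) (w : Y -> R).
Hypothesis mw : measurable_fun setT w.
Hypothesis w0 : forall y, 0 <= w y.
Hypothesis iw : nu.-integrable setT (EFin \o w).
Implicit Types phi psi : Y -> R.

Definition wintegrable phi := nu.-integrable setT (EFin \o (fun y => w y * phi y)).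
Definition wmean phi := \int[nu]_y (w y * phi y).
Let W := \int[nu]_y w y.

Lemma wintegrable_le phi psi : measurable_fun setT phi -> (forall y, `|phi y| <= psi y) ->
  wintegrable psi -> wintegrable phi.
Proof.
move=> mphi le; apply: integrable_le => [|y]; first exact: measurable_funM.
by rewrite normrM ger0_norm// ler_wpM2l.
Qed.

Lemma wintegrableD phi psi : wintegrable phi -> wintegrable psi ->
  wintegrable (fun y => phi y + psi y).
Proof.
move=> i1 i2; have := integrableD measurableT i1 i2; apply: eq_integrable => // y _.
by rewrite /= mulrDr EFinD.
Qed.

Lemma wintegrableZ c phi : wintegrable phi -> wintegrable (fun y => c * phi y).
Proof.
move=> i1; have := integrableZl measurableT c i1; apply: eq_integrable => // y _.
by rewrite /= mulrCA EFinM.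
Qed.

Lemma wintegrable_cst c : wintegrable (fun=> c).
Proof.
have := integrableZl measurableT c iw; apply: eq_integrable => // y _.
by rewrite /= mulrC EFinM.
Qed.

Lemma wmeanD phi psi : wintegrable phi -> wintegrable psi ->
  wmean (fun y => phi y + psi y) = wmean phi + wmean psi.
Proof.
move=> i1 i2; rewrite /wmean -RintegralD//; apply: eq_Rintegral => y _.
by rewrite mulrDr.
Qed.

Lemma wmeanZ c phi : wintegrable phi -> wmean (fun y => c * phi y) = c * wmean phi.
Proof.
move=> i1; rewrite /wmean -RintegralZl//; apply: eq_Rintegral => y _.
by rewrite mulrCA.
Qed.

Lemma wmean_cst c : wmean (fun=> c) = c * W.
Proof.
rewrite /wmean /W -RintegralZl//; apply: eq_Rintegral => y _.
by rewrite mulrC.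
Qed.

Lemma wmean_le phi psi : wintegrable phi -> wintegrable psi -> (forall y, phi y <= psi y) ->
  wmean phi <= wmean psi.
Proof. by move=> i1 i2 le; apply: le_Rintegral => // y _; rewrite ler_wpM2l. Qed.

(** Integrate against w the tangent line of Phi at m. The total mass W of the weight is not
    normalised to 1. *)
Lemma wjensen (Phi dPhi : R -> R) phi m :
  (forall s t, Phi s + dPhi s * (t - s) <= Phi t) ->
  wintegrable phi -> wintegrable (Phi \o phi) -> m * W = wmean phi ->
  Phi m * W <= wmean (Phi \o phi).
Proof.
move=> tg i1 i2 mE; pose psi y := Phi m - dPhi m * m + dPhi m * phi y.
have i3 : wintegrable psi by apply: wintegrableD; [exact: wintegrable_cst|exact: wintegrableZ].
have -> : Phi m * W = wmean psi.
  by rewrite wmeanD ?wmean_cst ?wmeanZ -?mE;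
    [ring|exact: i1|exact: wintegrable_cst|exact: wintegrableZ].
apply: wmean_le => // y; rewrite /psi /=; have := tg m (phi y); rewrite mulrBr; lra.
Qed.

Section identities.
Context {d : nat}.
Variables (l : 'I_d -> Y -> R) (l2 : 'I_d -> 'I_d -> Y -> R) (A B : Y -> R).
Variables (m : 'I_d -> R) (m2 : 'I_d -> 'I_d -> R).
Hypotheses (ml : forall k, measurable_fun setT (l k)) (ml2 : forall j k, measurable_fun setT (l2 j k)).
Hypotheses (lA : forall k y, l k y ^+ 4 <= A y) (lB : forall j k y, l2 j k y ^+ 2 <= B y).
Hypotheses (iA : wintegrable A) (iB : wintegrable B) (W0 : 0 < W).
Hypothesis mE : forall k, m k * W = wmean (l k).
Hypothesis m2E : forall j k, (m2 j k + m j * m k) * W = wmean (fun y => l2 j k y + l j y * l k y).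

Let pow4 (x : R) : x ^+ 4 = (x ^+ 2) ^+ 2. Proof. by rewrite -exprM. Qed.
Let sq1 (x : R) : `|x| <= 1 + x ^+ 2.
Proof.
rewrite -(real_normK (num_real x)); move: (`|x|) => t.
by have := sqr_ge0 (t - 1); have := sqr_ge0 t; rewrite sqrrB expr1n; lra.
Qed.
Let ab2 (x y : R) : `|x * y| <= x ^+ 2 + y ^+ 2.
Proof.
have := sqr_ge0 (x + y); have := sqr_ge0 (x - y); have := sqr_ge0 x; have := sqr_ge0 y.
by rewrite sqrrB sqrrD ler_norml => *; apply/andP; split; lra.
Qed.

Let il4 k : wintegrable (fun y => l k y ^+ 4).
Proof.
apply: wintegrable_le iA; first exact: measurable_funX.
by move=> y; rewrite ger0_norm// pow4 sqr_ge0.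
Qed.

Let il22 k : wintegrable (fun y => l k y ^+ 2).
Proof.
apply: wintegrable_le (wintegrableD (wintegrable_cst 1) iA); first exact: measurable_funX.
move=> y; rewrite ger0_norm ?sqr_ge0//; have := lA k y; rewrite pow4.
by have := sq1 (l k y ^+ 2); rewrite ger0_norm ?sqr_ge0//; lra.
Qed.

Let il k : wintegrable (l k).
Proof. by apply: wintegrable_le (wintegrableD (wintegrable_cst 1) (il22 k)) => // y; exact: sq1. Qed.

Lemma wintegrable_prod j k : wintegrable (fun y => l j y * l k y).
Proof.
apply: wintegrable_le (wintegrableD (il22 j) (il22 k)); first exact: measurable_funM.
by move=> y; exact: ab2.
Qed.

Let il2q j k : wintegrable (fun y => l2 j k y ^+ 2).
Proof.
apply: wintegrable_le iB; first exact: measurable_funX.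
by move=> y; rewrite ger0_norm ?sqr_ge0.
Qed.

Let il2 j k : wintegrable (l2 j k).
Proof. by apply: wintegrable_le (wintegrableD (wintegrable_cst 1) (il2q j k)) => // y; exact: sq1. Qed.

Lemma wmean_score k : wintegrable (fun y => l k y - m k) /\ wmean (fun y => l k y - m k) = 0.
Proof.
have ic := wintegrable_cst (- m k).
split; first exact: (wintegrableD (il k) ic).
by rewrite (wmeanD (il k) ic) wmean_cst -mE mulNr subrr.
Qed.

(** The total mass times the covariance under the normalised weight, that is, conditionally on the
    unit being sampled. *)
Definition wcov j k := wmean (fun y => l j y * l k y) - wmean (l j) * wmean (l k) / W.

Lemma wmean_cov j k : wintegrable (fun y => (l j y - m j) * (l k y - m k)) /\
  wmean (fun y => (l j y - m j) * (l k y - m k)) = wcov j k.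
Proof.
have E : (fun y => (l j y - m j) * (l k y - m k)) =
  (fun y => l j y * l k y + (- m j * l k y + (- m k * l j y + m j * m k))).
  by apply/funext => y; ring.
have i1 := wintegrableD (wintegrableZ (- m k) (il j)) (wintegrable_cst (m j * m k)).
have i2 := wintegrableD (wintegrableZ (- m j) (il k)) i1.
rewrite E; split; first exact: (wintegrableD (wintegrable_prod j k) i2).
rewrite (wmeanD (wintegrable_prod j k) i2) (wmeanD (wintegrableZ (- m j) (il k)) i1).
rewrite (wmeanD (wintegrableZ (- m k) (il j)) (wintegrable_cst (m j * m k))).
rewrite wmean_cst (wmeanZ (- m j) (il k)) (wmeanZ (- m k) (il j)) /wcov -!mE; field.
by rewrite gt_eqF.
Qed.

(** The information identity for sampled responses. In the application [m] and [m2] are the first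
    and second derivatives of log pibar; [m2E] expresses the second derivative of pibar in two ways,
    and what remains is minus the covariance of the scores. *)
Lemma wmean_hess j k : wintegrable (fun y => l2 j k y - m2 j k) /\
  wmean (fun y => l2 j k y - m2 j k) = - wcov j k.
Proof.
have ic := wintegrable_cst (- m2 j k).
split; first exact: (wintegrableD (il2 j k) ic).
rewrite (wmeanD (il2 j k) ic) wmean_cst /wcov -!mE.
have := m2E j k; rewrite (wmeanD (il2 j k) (wintegrable_prod j k)) => e.
have -> : wmean (l2 j k) = (m2 j k + m j * m k) * W - wmean (fun y => l j y * l k y) by rewrite e addrK.
by field; rewrite gt_eqF.
Qed.

Let jensen2 phi c : wintegrable phi -> wintegrable (fun y => phi y ^+ 2) -> c * W = wmean phi ->
  c ^+ 2 * W <= wmean (fun y => phi y ^+ 2).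
Proof.
move=> i1 i2 e; apply: (@wjensen (fun x => x ^+ 2) (fun x => 2 * x) _ _ _ i1 i2 e) => s t.
by have := sqr_ge0 (t - s); rewrite sqrrB mulr2n; lra.
Qed.

Let m4 k : m k ^+ 4 * W <= wmean A.
Proof.
apply: (@le_trans _ _ (wmean (fun y => l k y ^+ 4))); last exact: wmean_le.
apply: (@wjensen (fun x => x ^+ 4) (fun x => 4 * x ^+ 3) _ _ _ (il k) (il4 k) (mE k)) => s t.
(* The gap between t^4 and its tangent at s, written as a sum of squares. *)
have : 0 <= (t ^+ 2 - s ^+ 2) ^+ 2 + 2 * (s * (t - s)) ^+ 2.
  by apply: addr_ge0; [exact: sqr_ge0|apply: mulr_ge0 => //; exact: sqr_ge0].
nra.
Qed.

(** (s - t)^4 <= 8 (s^4 + t^4), and the fourth power of [m] is at most the mean of A by Jensen: 16 =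
    8 + 8. *)
Lemma wmean_score4 k : wintegrable (fun y => (l k y - m k) ^+ 4) /\
  wmean (fun y => (l k y - m k) ^+ 4) <= 16 * wmean A.
Proof.
have le y : (l k y - m k) ^+ 4 <= 8 * A y + 8 * m k ^+ 4.
  have := lA k y; move: (l k y) (m k) => s t h.
  have h1 : (s - t) ^+ 2 <= 2 * (s ^+ 2 + t ^+ 2).
    by have := sqr_ge0 (s + t); rewrite sqrrB sqrrD; lra.
  have h2 : ((s - t) ^+ 2) ^+ 2 <= (2 * (s ^+ 2 + t ^+ 2)) ^+ 2.
    by apply: lerXn2r => //; rewrite nnegrE ?sqr_ge0// mulr_ge0// addr_ge0 ?sqr_ge0.
  have h3 : (s ^+ 2 + t ^+ 2) ^+ 2 <= 2 * (s ^+ 4 + t ^+ 4).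
    by rewrite !pow4; have := sqr_ge0 (s ^+ 2 - t ^+ 2); rewrite sqrrB sqrrD; lra.
  rewrite pow4; apply: le_trans h2 _; rewrite exprMn.
  have : (2 : R) ^+ 2 = 4 by ring.
  by move=> ->; lra.
have iB' := wintegrableD (wintegrableZ 8 iA) (wintegrable_cst (8 * m k ^+ 4)).
have i1 : wintegrable (fun y => (l k y - m k) ^+ 4).
  apply: wintegrable_le iB'; first by apply: measurable_funX; exact: measurable_funB.
  by move=> y; rewrite ger0_norm// pow4 sqr_ge0.
split => //; apply: le_trans (wmean_le i1 iB' le) _.
rewrite (wmeanD (wintegrableZ 8 iA) (wintegrable_cst _)) wmeanZ// wmean_cst.
by have := m4 k; lra.
Qed.

(** Jensen applies to the combination [m2] + [m] [m], the mean of u, and not to [m2] alone. Writing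
    m2^2 <= 2 (m2 + m_j m_k)^2 + m_j^4 + m_k^4 and u^2 <= 2 B + 2 A, the total is 2 B + 2 (4 B + 4 A
    + 2 A). *)
Lemma wmean_hess2 j k : wintegrable (fun y => (l2 j k y - m2 j k) ^+ 2) /\
  wmean (fun y => (l2 j k y - m2 j k) ^+ 2) <= 10 * wmean B + 12 * wmean A.
Proof.
have sqD (s t : R) : (s + t) ^+ 2 <= 2 * s ^+ 2 + 2 * t ^+ 2.
  by have := sqr_ge0 (s - t); rewrite sqrrB sqrrD; lra.
have le y : (l2 j k y - m2 j k) ^+ 2 <= 2 * B y + 2 * m2 j k ^+ 2.
  by have := lB j k y; have := sqD (l2 j k y) (- m2 j k); rewrite sqrrN; lra.
have iB' := wintegrableD (wintegrableZ 2 iB) (wintegrable_cst (2 * m2 j k ^+ 2)).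
have i1 : wintegrable (fun y => (l2 j k y - m2 j k) ^+ 2).
  apply: wintegrable_le iB'; first by apply: measurable_funX; exact: measurable_funB.
  by move=> y; rewrite ger0_norm ?sqr_ge0.
split => //; apply: le_trans (wmean_le i1 iB' le) _.
rewrite (wmeanD (wintegrableZ 2 iB) (wintegrable_cst _)) wmeanZ// wmean_cst.
pose u y := l2 j k y + l j y * l k y.
have iu : wintegrable u := wintegrableD (il2 j k) (wintegrable_prod j k).
have i2 := wintegrableD (wintegrableZ 2 iB) (wintegrableZ 2 iA).
have ule y : u y ^+ 2 <= 2 * B y + 2 * A y.
  have h1 := sqD (l2 j k y) (l j y * l k y); rewrite -/(u y) in h1.
  have h2 : (l j y * l k y) ^+ 2 = l j y ^+ 2 * l k y ^+ 2 by rewrite exprMn.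
  have h3 := lB j k y; have h4 := lA j y; have h5 := lA k y; rewrite pow4 in h4; rewrite pow4 in h5.
  have h6 := sqr_ge0 (l j y ^+ 2 - l k y ^+ 2); rewrite sqrrB in h6.
  rewrite h2 in h1; move: (u y ^+ 2) (l2 j k y ^+ 2) (l j y ^+ 2) (l k y ^+ 2) h1 h3 h4 h5 h6 => *.
  lra.
have iu2 : wintegrable (fun y => u y ^+ 2).
  apply: wintegrable_le i2; last by move=> y; rewrite ger0_norm ?sqr_ge0.
  by apply: measurable_funX; apply: measurable_funD => //; exact: measurable_funM.
have J := jensen2 iu iu2 (m2E j k).
have J2 : wmean (fun y => u y ^+ 2) <= 2 * wmean B + 2 * wmean A.
  by apply: le_trans (wmean_le iu2 i2 ule) _; rewrite wmeanD ?wmeanZ//; exact: wintegrableZ.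
have h1 : m2 j k ^+ 2 <= 2 * (m2 j k + m j * m k) ^+ 2 + (m j ^+ 4 + m k ^+ 4).
  have := sqD (m2 j k + m j * m k) (- (m j * m k)); rewrite addrK sqrrN.
  move: ((m2 j k + m j * m k) ^+ 2) (m2 j k ^+ 2) => a b h.
  have h' : (m j * m k) ^+ 2 = m j ^+ 2 * m k ^+ 2 by rewrite exprMn.
  rewrite h' in h.
  have : 2 * (m j ^+ 2 * m k ^+ 2) <= m j ^+ 4 + m k ^+ 4.
    by rewrite !pow4; have := sqr_ge0 (m j ^+ 2 - m k ^+ 2); rewrite sqrrB; lra.
  by move=> *; lra.
have h2 := ler_wpM2r (ltW W0) h1.
have := m4 j; have := m4 k; lra.
Qed.

End identities.
End weighted.

(** * Integrals under the law of one observation *)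

Section joint_law.
Context {R : realType} {dX dY : measure_display}.
Context {X : measurableType dX} {Y : measurableType dY}.
Variables (muX : {sigma_finite_measure set X -> \bar R}) (muY : {sigma_finite_measure set Y -> \bar R}).
Variables (f0 : X * Y -> R) (fX : X -> R) (mu : probability (X * Y)%type R).
Hypotheses (mf0 : measurable_fun setT f0) (f00 : forall z, 0 <= f0 z).
Hypotheses (mfX : measurable_fun setT fX) (fX0 : forall x, 0 <= fX x).
Let jd z := f0 z * fX z.1.
Hypothesis mu_density : forall D, measurable D ->
  (mu D = \int[muX \x muY]_(z in D) (jd z)%:E)%E.

Let mjd : measurable_fun setT jd.
Proof. by apply: measurable_funM => //; exact: (measurableT_comp mfX measurable_fst). Qed.

Let jd0 z : 0 <= jd z. Proof. exact: mulr_ge0. Qed.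

Lemma ge0_joint_integral (phi : X * Y -> R) : measurable_fun setT phi -> (forall z, 0 <= phi z) ->
  (\int[mu]_z (phi z)%:E = \int[muX \x muY]_z (phi z * jd z)%:E)%E.
Proof.
move=> mphi phi0; have mi : measurable_fun setT (@idfun (X * Y)%type) by exact: measurable_id.
have mE : measurable_fun setT (fun z => (phi z)%:E) by exact/measurable_EFinP.
have E0 z : (0 <= (phi z)%:E)%E by rewrite lee_fin.
exact: (@integral_density _ _ _ _ R (muX \x muY)%E mu idfun jd mi mjd jd0 mu_density _ mE E0).
Qed.

Lemma joint_integral (phi : X * Y -> R) : measurable_fun setT phi ->
  (\int[mu]_z (phi z)%:E = \int[muX \x muY]_z (phi z * jd z)%:E)%E.
Proof.
move=> mphi; rewrite integralE [RHS]integralE.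
have mp : measurable_fun setT (fun z => Num.max (phi z) 0).
  by apply: measurable_maxr => //; exact: measurable_cst.
have mn : measurable_fun setT (fun z => Num.max (- phi z) 0).
  by apply: measurable_maxr => //; exact: measurableT_comp.
congr (_ - _)%E.
- transitivity (\int[mu]_z (Num.max (phi z) 0)%:E)%E.
    by apply: eq_integral => z _; rewrite funeposE EFin_max.
  rewrite ge0_joint_integral//; last by move=> z; rewrite le_max lexx orbT.
  by apply: eq_integral => z _; rewrite funeposE -EFin_max maxr_pMl// mul0r.
- transitivity (\int[mu]_z (Num.max (- phi z) 0)%:E)%E.
    by apply: eq_integral => z _; rewrite funenegE EFin_max EFinN.
  rewrite ge0_joint_integral//; last by move=> z; rewrite le_max lexx orbT.
  by apply: eq_integral => z _; rewrite funenegE -EFinN -EFin_max maxr_pMl// mul0r mulNr.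
Qed.

Lemma joint_integrable (phi : X * Y -> R) : measurable_fun setT phi ->
  mu.-integrable setT (EFin \o phi) ->
  (muX \x muY)%E.-integrable setT (EFin \o (fun z => phi z * jd z)).
Proof.
move=> mphi /integrableP[_ fi]; apply/integrableP; split.
  by apply/measurable_EFinP; exact: measurable_funM.
move: fi; congr (_ < +oo)%E.
have mn : measurable_fun setT (fun z => `|phi z|) by exact: measurableT_comp.
transitivity (\int[mu]_z (`|phi z|)%:E)%E; first by [].
rewrite ge0_joint_integral//; apply: eq_integral => z _ /=.
by rewrite normrM (ger0_norm (jd0 z)).
Qed.

Variable good : X -> Prop.
Hypothesis good_ae : {ae muX, forall x, fX x != 0 -> good x}.

Let inner_fin (phi : X * Y -> R) x :
  muY.-integrable setT (EFin \o (fun y => f0 (x, y) * phi (x, y))) ->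
  (\int[muY]_y (phi (x, y) * jd (x, y))%:E =
    (fX x * \int[muY]_y (f0 (x, y) * phi (x, y)))%:E)%E.
Proof.
move=> i; rewrite -RintegralZl// /Rintegral.
have iZ : muY.-integrable setT (EFin \o (fun y => fX x * (f0 (x, y) * phi (x, y)))).
  by have := integrableZl measurableT (fX x) i.
rewrite fineK; last exact: (integrable_fin_num measurableT iZ).
by apply: eq_integral => y _; rewrite /jd; congr EFin; rewrite /=; ring.
Qed.

Let inner0 (phi : X * Y -> R) x : fX x = 0 ->
  (\int[muY]_y (phi (x, y) * jd (x, y))%:E = 0)%E.
Proof.
by move=> x0; rewrite (eq_integral (cst 0%E)) ?integral0// => y _; rewrite /jd/= x0 !mulr0.
Qed.

(** The inequality between inner integrals at good x is integrated in x by Tonelli; where [fX]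
    vanishes both sides are 0. *)
Lemma joint_le (G1 G2 : X * Y -> R) :
  measurable_fun setT G1 -> measurable_fun setT G2 -> (forall z, 0 <= G1 z) -> (forall z, 0 <= G2 z) ->
  (forall x, good x -> [/\ muY.-integrable setT (EFin \o (fun y => f0 (x, y) * G1 (x, y))),
     muY.-integrable setT (EFin \o (fun y => f0 (x, y) * G2 (x, y)))
   & \int[muY]_y (f0 (x, y) * G1 (x, y)) <= \int[muY]_y (f0 (x, y) * G2 (x, y))]) ->
  (\int[mu]_z (G1 z)%:E <= \int[muX \x muY]_z (G2 z * jd z)%:E)%E.
Proof.
move=> m1 m2 G10 G20 H; rewrite ge0_joint_integral//.
have mj (G : X * Y -> R) : measurable_fun setT G -> measurable_fun setT (fun z => (G z * jd z)%:E).
  by move=> mG; apply/measurable_EFinP; exact: measurable_funM.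
have j0 (G : X * Y -> R) : (forall z, 0 <= G z) -> forall z, (0 <= (G z * jd z)%:E)%E.
  by move=> G0 z; rewrite lee_fin mulr_ge0.
rewrite (fubini_tonelli1 _ (mj _ m1) (j0 _ G10)) (fubini_tonelli1 _ (mj _ m2) (j0 _ G20)).
have iF (G : X * Y -> R) : (forall z, 0 <= G z) ->
    forall x, setT x -> (0 <= fubini_F muY (fun z => (G z * jd z)%:E) x)%E.
  by move=> G0 x _; apply: integral_ge0 => y _; exact: j0.
apply: ae_ge0_le_integral => //; [exact: iF|exact: measurable_fun_fubini_tonelli_F (mj _ m1) (j0 _ G10)
  |exact: iF|exact: measurable_fun_fubini_tonelli_F (mj _ m2) (j0 _ G20)|].
apply: filterS good_ae => x gx _; rewrite /fubini_F.
have [x0|x0] := eqVneq (fX x) 0; first by rewrite !inner0.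
have [i1 i2 le] := H x (gx x0).
by rewrite !inner_fin// lee_fin ler_wpM2l.
Qed.

(** phi and psi need not agree pointwise, only after integration over y. psi enters through its
    product with the joint density, since that is the integrability which finiteness of the Sigma
    integrand supplies. *)
Lemma joint_eq (phi psi : X * Y -> R) :
  measurable_fun setT phi -> mu.-integrable setT (EFin \o phi) ->
  (muX \x muY)%E.-integrable setT (EFin \o (fun z => psi z * jd z)) ->
  (forall x, good x -> [/\ muY.-integrable setT (EFin \o (fun y => f0 (x, y) * phi (x, y))),
     muY.-integrable setT (EFin \o (fun y => f0 (x, y) * psi (x, y)))
   & \int[muY]_y (f0 (x, y) * phi (x, y)) = \int[muY]_y (f0 (x, y) * psi (x, y))]) ->
  \int[mu]_z phi z = fine (\int[muX \x muY]_z (psi z * jd z)%:E)%E.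
Proof.
move=> mphi iphi ipsi H; rewrite /Rintegral joint_integral//; congr fine.
have iphi' := joint_integrable mphi iphi.
rewrite -(integral12_prod_meas1 iphi') -(integral12_prod_meas1 ipsi).
apply: ae_eq_integral => //; [exact: measurable_fubini_F iphi'|exact: measurable_fubini_F ipsi|].
apply: filterS good_ae => x gx _; rewrite /fubini_F.
have [x0|x0] := eqVneq (fX x) 0; first by rewrite /= !inner0.
have [i1 i2 e] := H x (gx x0).
by rewrite /= !inner_fin// e.
Qed.

End joint_law.

Section joint_good.
Context {R : realType} {dX dY : measure_display}.
Context {X : measurableType dX} {Y : measurableType dY}.
Variables (muX : {sigma_finite_measure set X -> \bar R}) (muY : {sigma_finite_measure set Y -> \bar R}).
Variables (f0 : X * Y -> R) (fX : X -> R).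
Hypotheses (mf0 : measurable_fun setT f0) (f00 : forall z, 0 <= f0 z).
Hypotheses (mfX : measurable_fun setT fX) (fX0 : forall x, 0 <= fX x).

Lemma joint_good (G : X * Y -> R) : measurable_fun setT G -> (forall z, 0 <= G z) ->
  (\int[muX \x muY]_z (G z * (f0 z * fX z.1))%:E < +oo)%E ->
  {ae muX, forall x, fX x != 0 ->
    muY.-integrable setT (EFin \o (fun y => f0 (x, y) * G (x, y)))}.
Proof.
move=> mG G0 fin.
have mjd : measurable_fun setT (fun z => G z * (f0 z * fX z.1)).
  apply: measurable_funM => //; apply: measurable_funM => //.
  exact: (measurableT_comp mfX measurable_fst).
have i : (muX \x muY)%E.-integrable setT (EFin \o (fun z => G z * (f0 z * fX z.1))).
  apply/integrableP; split; first exact/measurable_EFinP.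
  move: fin; congr (_ < +oo)%E; apply: eq_integral => z _ /=.
  by rewrite ger0_norm// !mulr_ge0.
apply: filterS (ae_integrable1 i) => x ix x0.
have := integrableZl measurableT (fX x)^-1 ix; apply: eq_integrable => // y _ /=.
by rewrite -EFinM; congr EFin; field.
Qed.

End joint_good.

(** * Derivatives of the density and of the mean sampling probability *)

Section model.
Context {R : realType} {dX dY : measure_display}.
Context {X : measurableType dX} {Y : measurableType dY} {d q : nat}.
Variable muX : {sigma_finite_measure set X -> \bar R}.
Variable muY : {sigma_finite_measure set Y -> \bar R}.
Variables (Theta : set 'cV[R]_d) (theta : 'cV[R]_d).
Variables (f : 'cV[R]_d -> X -> Y -> R) (fX : X -> R).
Variables (n : nat -> R) (p : nat -> X -> Y -> 'cV[R]_q -> R).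
Hypothesis hf : conditional_density_family muY f Theta.
Hypothesis hp : sampling_probabilities muX muY f fX theta p n.
Variable r : R.
Hypothesis r0 : 0 < r.
Hypothesis rTheta : forall t, `|t - theta| < r -> interior Theta t.
Local Notation dd j g := ('D_(basisv j) g).

Lemma ball_Theta t : `|t - theta| < r -> Theta t.
Proof. by move=> /rTheta; exact: interior_subset. Qed.

Lemma theta_ball : `|theta - theta| < r. Proof. by rewrite subrr normr0. Qed.

Let mfz t : Theta t -> measurable_fun setT (fun z : X * Y => f t z.1 z.2).
Proof. by case: hf => h _ _ _; exact: h. Qed.

Let f0 t x y : Theta t -> 0 <= f t x y.
Proof. by case: hf => _ h _ _; exact: h. Qed.

Let f1 t x : Theta t -> (\int[muY]_y (f t x y)%:E = 1)%E.
Proof. by case: hf => _ _ h _; exact: h. Qed.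

Let fsupp t t' x y : Theta t -> Theta t' -> 0 < f t x y -> 0 < f t' x y.
Proof. by case: hf => _ _ _; exact. Qed.

Lemma p01 N z (v : borelV R q) : (0 < N)%N -> 0 <= p N z.1 z.2 v <= 1.
Proof. by move=> N0; case: hp => _ h _; have /andP[/ltW -> ->] := h N z.1 z.2 v N0. Qed.

Let p_gt0 N x y v : (0 < N)%N -> 0 < p N x y v.
Proof. by move=> N0; case: hp => _ h _; have /andP[] := h N x y v N0. Qed.

Lemma measurable_p N : (0 < N)%N ->
  measurable_fun setT (fun u : (X * Y) * borelV R q => p N u.1.1 u.1.2 u.2).
Proof. by move=> N0; case: hp => h _ _; exact: h. Qed.

Let mfy t x : Theta t -> measurable_fun setT (fun y => f t x y).
Proof. by move=> /mfz tT; exact: (measurable_fun_pair2 x tT). Qed.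

Let mpy N x (v : borelV R q) : (0 < N)%N -> measurable_fun setT (fun y => p N x y v).
Proof.
move=> N0; have h : measurable_fun setT (fun y : Y => ((x, y), v)).
  by apply: measurable_fun_pair => //; exact: measurable_fun_pair.
exact: (measurableT_comp (measurable_p N0) h).
Qed.

Let if1 t x : Theta t -> muY.-integrable setT (EFin \o (fun y => f t x y)).
Proof.
move=> tT; apply/integrableP; split; first by apply/measurable_EFinP; exact: mfy.
rewrite (eq_integral (fun y => (f t x y)%:E)); first by rewrite f1// ltry.
by move=> y _ /=; rewrite ger0_norm// f0.
Qed.

Lemma weight_integrable t N x (v : borelV R q) : Theta t -> (0 < N)%N ->
  muY.-integrable setT (EFin \o (fun y => f t x y * p N x y v)).
Proof.
move=> tT N0; apply: integrable_le (if1 x tT).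
  by apply: measurable_funM; [exact: mfy|exact: mpy].
move=> y; have /andP[p0 p1] := p01 (x, y) v N0.
by rewrite normrM (ger0_norm p0) (ger0_norm (f0 _ _ tT)) ler_piMr// f0.
Qed.

(** The sampling probability is positive everywhere, so a vanishing integral would make the density
    vanish almost everywhere, against its total mass 1. *)
Lemma pibar_gt0 t N x (v : borelV R q) : Theta t -> (0 < N)%N -> 0 < pibar muY f p N x v t.
Proof.
move=> tT N0; have i := weight_integrable x v tT N0.
have pos y : 0 <= f t x y * p N x y v.
  by rewrite mulr_ge0 ?f0//; exact/ltW/p_gt0.
rewrite lt0r; apply/andP; split; last exact: Rintegral_ge0.
apply/negP => /eqP e0.
have fin := integrable_fin_num measurableT i.
have e1 : (\int[muY]_y (f t x y * p N x y v)%:E = 0)%E.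
  by rewrite -(fineK fin) -[fine _]/(pibar muY f p N x v t) e0.
have mE : measurable_fun setT (EFin \o (fun y => f t x y * p N x y v)) := measurable_int muY i.
have : (\int[muY]_y `|(f t x y * p N x y v)%:E| = 0)%E.
  by rewrite -e1; apply: eq_integral => y _ /=; rewrite ger0_norm.
move/(ae_eq_integral_abs muY measurableT mE) => ae0.
have : (\int[muY]_y (f t x y)%:E = \int[muY]_y cst 0 y)%E.
  apply: ae_eq_integral => //; first by apply/measurable_EFinP; exact: mfy.
  apply: filterS ae0 => y h _; have /eqP := h I; rewrite eqe mulf_eq0 => /orP[/eqP->//|].
  by rewrite (gt_eqF (p_gt0 x y v N0)).
by rewrite f1// integral0 => /eqP; rewrite onee_eq0.
Qed.

Lemma measurable_pibar t N : Theta t -> (0 < N)%N ->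
  measurable_fun setT (fun u : borelV R q * (X * Y) => pibar muY f p N u.2.1 u.1 t).
Proof.
move=> tT N0; pose F (w : (borelV R q * (X * Y)) * Y) := (f t w.1.2.1 w.2 * p N w.1.2.1 w.2 w.1.1)%:E.
have mx : measurable_fun setT (fun w : (borelV R q * (X * Y)) * Y => (w.1.2.1, w.2)).
  apply: measurable_fun_pair => //; apply: (measurableT_comp measurable_fst).
  exact: (measurableT_comp measurable_snd measurable_fst).
have mv : measurable_fun setT (fun w : (borelV R q * (X * Y)) * Y => ((w.1.2.1, w.2), w.1.1)).
  apply: measurable_fun_pair => //; exact: (measurableT_comp measurable_fst measurable_fst).
have mF : measurable_fun setT F.
  apply/measurable_EFinP; apply: measurable_funM; first exact: (measurableT_comp (mfz tT) mx).
  exact: (measurableT_comp (measurable_p N0) mv).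
have F0 w : (0 <= F w)%E by rewrite lee_fin mulr_ge0 ?f0//; exact/ltW/p_gt0.
have := measurable_fun_fubini_tonelli_F (m2 := muY) _ mF F0.
by move=> /(measurableT_comp (fine_measurable measurableT)); exact.
Qed.

Lemma measurable_loglik t : Theta t -> measurable_fun setT (fun z : X * Y => loglik f z.1 z.2 t).
Proof. by move=> tT; exact: (measurableT_comp (@measurable_ln R) (mfz tT)). Qed.

Lemma measurable_log_pibar t N : Theta t -> (0 < N)%N ->
  measurable_fun setT (fun u : borelV R q * (X * Y) => log_pibar muY f p N u.2.1 u.1 t).
Proof. by move=> tT N0; exact: (measurableT_comp (@measurable_ln R) (measurable_pibar tT N0)). Qed.

Section derivatives.
Variables (x : X) (v : borelV R q) (N : nat).
Hypothesis N0 : (0 < N)%N.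
Hypothesis pl : forall y, partials3 (interior Theta) (loglik f x y).
Hypothesis pb : partials3 (interior Theta) (log_pibar muY f p N x v).

(* Off the common support both sides vanish, since f t x y = 0 for all t. *)
Lemma density_partial y :
  (forall j, dd j (fun t => f t x y) theta = f theta x y * dd j (loglik f x y) theta) /\
  (forall j k, dd j (dd k (fun t => f t x y)) theta = f theta x y *
     (dd j (dd k (loglik f x y)) theta + dd j (loglik f x y) theta * dd k (loglik f x y) theta)).
Proof.
have T0 := ball_Theta theta_ball.
have [fy|fy] := ltP 0 (f theta x y).
  apply: (pderiv_expR r0) => [u ur|u j ur|j k].
  - by rewrite /loglik lnK// posrE; apply: fsupp fy => //; exact: ball_Theta.
  - exact: (@pl y [::] j u isT (rTheta ur)).
  - exact: (@pl y [:: k] j theta isT (rTheta theta_ball)).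
have fe t : Theta t -> f t x y = 0.
  move=> tT; apply/eqP; rewrite eq_le f0// andbT leNgt; apply/negP => /(fsupp tT T0).
  by rewrite ltNge fy.
have [e1 e2] := @pderiv_zero R d (fun t => f t x y) theta r r0 (fun u ur => fe u (ball_Theta ur)).
by split=> [j|j k]; rewrite ?e1 ?e2 fe// mul0r.
Qed.

Lemma pibar_partial :
  (forall j, dd j (pibar muY f p N x v) theta =
     pibar muY f p N x v theta * dd j (log_pibar muY f p N x v) theta) /\
  (forall j k, dd j (dd k (pibar muY f p N x v)) theta = pibar muY f p N x v theta *
     (dd j (dd k (log_pibar muY f p N x v)) theta
      + dd j (log_pibar muY f p N x v) theta * dd k (log_pibar muY f p N x v) theta)).
Proof.
apply: (pderiv_expR r0) => [u ur|u j ur|j k].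
- by rewrite /log_pibar lnK// posrE; apply: pibar_gt0 => //; exact: ball_Theta.
- exact: (@pb [::] j u isT (rTheta ur)).
- exact: (@pb [:: k] j theta isT (rTheta theta_ball)).
Qed.

Hypothesis hd : forall js : seq 'I_d, (size js <= 2)%N -> pderiv js (pibar muY f p N x v) theta =
  \int[muY]_y (pderiv js (fun t => f t x y) theta * p N x y v).

Let w y := f theta x y * p N x y v.

(** Both sides are the derivative of pibar: on the left through its logarithm, on the right under
    the integral sign and through the logarithm of the density. *)
Lemma score_mean_identity k :
  dd k (log_pibar muY f p N x v) theta * \int[muY]_y w y =
  wmean muY w (fun y => dd k (loglik f x y) theta).
Proof.
have := @hd [:: k] isT; rewrite /= (pibar_partial).1 mulrC => e.
rewrite -[\int[muY]_y w y]/(pibar muY f p N x v theta) e.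
apply: eq_Rintegral => y _; rewrite (density_partial y).1 /w; ring.
Qed.

Lemma hessian_mean_identity j k :
  (dd j (dd k (log_pibar muY f p N x v)) theta
   + dd j (log_pibar muY f p N x v) theta * dd k (log_pibar muY f p N x v) theta) * \int[muY]_y w y =
  wmean muY w (fun y => dd j (dd k (loglik f x y)) theta
    + dd j (loglik f x y) theta * dd k (loglik f x y) theta).
Proof.
have := @hd [:: j; k] isT; rewrite /= (pibar_partial).2 mulrC => e.
rewrite -[\int[muY]_y w y]/(pibar muY f p N x v theta) e.
apply: eq_Rintegral => y _; rewrite (density_partial y).2 /w; ring.
Qed.

End derivatives.
End model.

Section frobenius.
Context {R : realType}.

Lemma frob_sqr m n (A : 'M[R]_(m, n)) : frob A ^+ 2 = \sum_i \sum_j A i j ^+ 2.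
Proof.
have E : \tr (A^T *m A) = \sum_i \sum_j A i j ^+ 2.
  rewrite /mxtrace exchange_big/=; apply: eq_bigr => j _; rewrite mxE.
  by apply: eq_bigr => i _; rewrite mxE expr2.
rewrite /frob sqr_sqrtr E//; apply: sumr_ge0 => i _; apply: sumr_ge0 => j _; exact: sqr_ge0.
Qed.

Lemma entry_le_frob m n (A : 'M[R]_(m, n)) i j : A i j ^+ 2 <= frob A ^+ 2.
Proof.
rewrite frob_sqr (bigD1 i)//= (bigD1 j)//= -addrA lerDl addr_ge0//.
  by apply: sumr_ge0 => k _; exact: sqr_ge0.
by apply: sumr_ge0 => k _; apply: sumr_ge0 => l _; exact: sqr_ge0.
Qed.

Lemma entry_le_frob4 m n (A : 'M[R]_(m, n)) i j : A i j ^+ 4 <= frob A ^+ 4.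
Proof.
by rewrite !(exprM _ 2 2); apply: lerXn2r; rewrite ?nnegrE ?sqr_ge0//; exact: entry_le_frob.
Qed.

End frobenius.

Lemma bounded_momentP (R : realType) (dX dY : measure_display)
  (X : measurableType dX) (Y : measurableType dY) (d q : nat)
  (muX : {sigma_finite_measure set X -> \bar R}) (muY : {sigma_finite_measure set Y -> \bar R})
  (f : 'cV[R]_d -> X -> Y -> R) (fX : X -> R) (theta : 'cV[R]_d)
  (p : nat -> X -> Y -> 'cV[R]_q -> R) (n : nat -> R) (U : set 'cV[R]_q)
  (g : 'cV[R]_q -> X -> Y -> R) : n N @[N --> \oo] --> +oo ->
  bounded_moment muX muY f fX theta p n U g ->
  exists2 M : R, 0 <= M & \forall N \near \oo, forall v, U v ->
    (Exy muX muY f fX theta (fun x y => (p N x y v * g v x y)%R) <= (n N * M / N%:R)%:E)%E.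
Proof.
move=> hn; rewrite /bounded_moment /limn_esup /limf_esup => /ereal_inf_lt[_ [A nA <-] Afin].
set s := ereal_sup _ in Afin.
have [M M0 sM] : exists2 M : R, 0 <= M & (s <= M%:E)%E.
  move: Afin; case: s => [a _|//|_].
    by exists (Num.max a 0); rewrite ?lee_fin le_max lexx ?orbT.
  by exists 0; rewrite ?leNye.
exists M => //; near=> N => v Uv.
have N0 : (0 < N)%N by near: N; exact: nbhs_infty_gt.
have Nr0 : 0 < N%:R :> R by rewrite ltr0n.
have n0 : 0 < n N by near: N; move/cvgryPgt : hn; apply.
have AN : A N by near: N.
set E := Exy _ _ _ _ _ _.
have h : ((N%:R / n N)%:E * E <= M%:E)%E.
  apply: le_trans sM; rewrite /s; apply: (@le_trans _ _ (ereal_sup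
     [set ((N%:R / n N)%:E * Exy muX muY f fX theta (fun x y => (p N x y vt * g vt x y)%R))%E
        | vt in U])).
    by apply: ereal_sup_ubound; exists v.
  by apply: ereal_sup_ubound; exists N.
have c0 : 0 <= n N / N%:R by rewrite divr_ge0// ltW.
have := lee_wpmul2l (_ : (0 <= (n N / N%:R)%:E)%E) h; rewrite lee_fin => /(_ c0).
rewrite muleA -!EFinM (_ : n N / N%:R * (N%:R / n N) = 1); last by field; rewrite !gt_eqF.
by rewrite mul1e mulrAC.
Unshelve. all: by end_near. Qed.

(** * Moments of the sampled score and Hessian at a fixed pilot value *)

Section fixed_pilot.
Context {R : realType} {dX dY : measure_display}.
Context {X : measurableType dX} {Y : measurableType dY} {d q : nat}.
Variable muX : {sigma_finite_measure set X -> \bar R}.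
Variable muY : {sigma_finite_measure set Y -> \bar R}.
Variables (Theta : set 'cV[R]_d) (theta : 'cV[R]_d).
Variables (f : 'cV[R]_d -> X -> Y -> R) (fX : X -> R).
Variables (n : nat -> R) (p : nat -> X -> Y -> 'cV[R]_q -> R).
Hypothesis hf : conditional_density_family muY f Theta.
Hypothesis hfX : covariate_density muX fX.
Hypothesis hp : sampling_probabilities muX muY f fX theta p n.
Variable r : R.
Hypothesis r0 : 0 < r.
Hypothesis rTheta : forall t, `|t - theta| < r -> interior Theta t.
Local Notation dd j g := ('D_(basisv j) g).
Variable mu : probability (X * Y)%type R.
Hypothesis mu_density : forall D, measurable D ->
  (mu D = \int[muX \x muY]_(z in D) (joint_density f fX theta z)%:E)%E.
Variables (N : nat) (v : borelV R q).
Hypothesis N0 : (0 < N)%N.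
Hypothesis pl : forall x y, partials3 (interior Theta) (loglik f x y).
Hypothesis pb : forall x, partials3 (interior Theta) (log_pibar muY f p N x v).
Hypothesis hd : forall x (js : seq 'I_d), (size js <= 2)%N -> pderiv js (pibar muY f p N x v) theta =
  \int[muY]_y (pderiv js (fun t => f t x y) theta * p N x y v).
Let T0 : Theta theta := ball_Theta rTheta (theta_ball theta r0).
Let l k (z : X * Y) := dd k (loglik f z.1 z.2) theta.
Let l2 j k (z : X * Y) := dd j (dd k (loglik f z.1 z.2)) theta.
Let m k x := dd k (log_pibar muY f p N x v) theta.
Let m2 j k x := dd j (dd k (log_pibar muY f p N x v)) theta.
Let pz (z : X * Y) := p N z.1 z.2 v.
Let A (z : X * Y) := frob (score f theta z.1 z.2) ^+ 4.
Let B (z : X * Y) := frob (info f theta z.1 z.2) ^+ 2.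
Let fz (z : X * Y) := f theta z.1 z.2.
Hypothesis ml : forall k, measurable_fun setT (l k).
Hypothesis ml2 : forall j k, measurable_fun setT (l2 j k).
Hypothesis mm : forall k, measurable_fun setT (fun z : X * Y => m k z.1).
Hypothesis mm2 : forall j k, measurable_fun setT (fun z : X * Y => m2 j k z.1).
Hypothesis Afin : (Exy muX muY f fX theta (fun x y => p N x y v * frob (score f theta x y) ^+ 4)%R < +oo)%E.
Hypothesis Bfin : (Exy muX muY f fX theta (fun x y => p N x y v * frob (info f theta x y) ^+ 2)%R < +oo)%E.
Hypothesis Sfin : SigmaN_finite muX muY f fX theta p N v.

Let mfz : measurable_fun setT fz. Proof. by case: hf => h _ _ _; exact: h. Qed.
Let fz0 z : 0 <= fz z. Proof. by case: hf => _ h _ _; exact: h. Qed.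
Let mfX : measurable_fun setT fX. Proof. by case: hfX. Qed.
Let fX0 x : 0 <= fX x. Proof. by case: hfX => _ h _; exact: h. Qed.
Let mpz : measurable_fun setT pz. Proof. exact: (measurable_fun_pair1 v (measurable_p hp N0)). Qed.
Let p01z z : 0 <= pz z <= 1. Proof. exact: (p01 hp z v N0). Qed.

Let scE x y k : score f theta x y k 0 = l k (x, y). Proof. by rewrite mxE. Qed.
Let infoE x y j k : info f theta x y j k = l2 j k (x, y). Proof. by rewrite mxE. Qed.

Let mB : measurable_fun setT B.
Proof.
rewrite (_ : B = (fun z => \sum_i \sum_j l2 i j z ^+ 2)).
  by apply: measurable_sum => i; apply: measurable_sum => j; exact: measurable_funX.
apply/funext => -[x y]; rewrite /B frob_sqr; apply: eq_bigr => i _; apply: eq_bigr => j _.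
by rewrite infoE.
Qed.

Let mA : measurable_fun setT A.
Proof.
rewrite (_ : A = (fun z => (\sum_i l i z ^+ 2) ^+ 2)).
  by apply: measurable_funX; apply: measurable_sum => i; exact: measurable_funX.
apply/funext => -[x y]; rewrite /A (exprM _ 2 2) frob_sqr; congr (_ ^+ 2).
by apply: eq_bigr => i _; rewrite big_ord1 scE.
Qed.

Let A0 z : 0 <= A z. Proof. by rewrite /A (exprM _ 2 2) sqr_ge0. Qed.
Let B0 z : 0 <= B z. Proof. exact: sqr_ge0. Qed.

Let w x y := fz (x, y) * pz (x, y).
Let mw x : measurable_fun setT (w x).
Proof. by apply: measurable_funM; [exact: (measurable_fun_pair2 x mfz)|exact: (measurable_fun_pair2 x mpz)]. Qed.
Let w0 x y : 0 <= w x y. Proof. by rewrite mulr_ge0//; case/andP: (p01z (x, y)). Qed.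
Let iw x : muY.-integrable setT (EFin \o w x).
Proof. exact: (weight_integrable hf hp x v T0 N0). Qed.
Let W0 x : 0 < \int[muY]_y w x y.
Proof. exact: (pibar_gt0 hf hp x v T0 N0). Qed.

(** Covariates at which the moments of the score and of the Hessian are finite in y. Finiteness of
    the joint moments gives this for almost every x with nonzero density. *)
Let good x := wintegrable muY (w x) (fun y => A (x, y)) /\ wintegrable muY (w x) (fun y => B (x, y)).

Let good_ae : {ae muX, forall x, fX x != 0 -> good x}.
Proof.
have conv (F : X * Y -> R) x : muY.-integrable setT (EFin \o (fun y => fz (x, y) * (pz (x, y) * F (x, y)))) ->
    wintegrable muY (w x) (fun y => F (x, y)).
  by apply: eq_integrable => // y _ /=; rewrite /w mulrA.
have gA := joint_good mfz fz0 mfX fX0 (G := fun z => pz z * A z).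
have gB := joint_good mfz fz0 mfX fX0 (G := fun z => pz z * B z).
have pA z : 0 <= pz z * A z by rewrite mulr_ge0//; case/andP: (p01z z).
have pB z : 0 <= pz z * B z by rewrite mulr_ge0//; case/andP: (p01z z).
have hA := gA muX muY (measurable_funM mpz mA) pA Afin.
have hB := gB muX muY (measurable_funM mpz mB) pB Bfin.
apply: filterS2 hA hB => x h1 h2 x0; split; apply: conv; [exact: h1|exact: h2].
Qed.

Let lA x k y : l k (x, y) ^+ 4 <= A (x, y).
Proof. by rewrite -scE; exact: entry_le_frob4. Qed.
Let lB x j k y : l2 j k (x, y) ^+ 2 <= B (x, y).
Proof. by rewrite -infoE; exact: entry_le_frob. Qed.
Let mlx x k : measurable_fun setT (fun y => l k (x, y)). Proof. exact: (measurable_fun_pair2 x (ml k)). Qed.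
Let ml2x x j k : measurable_fun setT (fun y => l2 j k (x, y)). Proof. exact: (measurable_fun_pair2 x (ml2 j k)). Qed.
Let E1 x k : m k x * \int[muY]_y w x y = wmean muY (w x) (fun y => l k (x, y)).
Proof. exact: (score_mean_identity hf hp r0 rTheta N0 (@pl x) (@pb x) (@hd x)). Qed.
Let E2 x j k : (m2 j k x + m j x * m k x) * \int[muY]_y w x y =
  wmean muY (w x) (fun y => l2 j k (x, y) + l j (x, y) * l k (x, y)).
Proof. exact: (hessian_mean_identity hf hp r0 rTheta N0 (@pl x) (@pb x) (@hd x)). Qed.

Let intE (F : X * Y -> R) x : wintegrable muY (w x) (fun y => F (x, y)) ->
  muY.-integrable setT (EFin \o (fun y => fz (x, y) * (pz (x, y) * F (x, y)))).
Proof. by apply: eq_integrable => // y _ /=; rewrite /w mulrA. Qed.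

Let meanE (F : X * Y -> R) x :
  \int[muY]_y (fz (x, y) * (pz (x, y) * F (x, y))) = wmean muY (w x) (fun y => F (x, y)).
Proof. by apply: eq_Rintegral => y _; rewrite /w mulrA. Qed.

Let sm k (z : X * Y) := l k z - m k z.1.
Let hm j k (z : X * Y) := l2 j k z - m2 j k z.1.
Let msm k : measurable_fun setT (sm k). Proof. exact: measurable_funB. Qed.
Let mhm j k : measurable_fun setT (hm j k). Proof. exact: measurable_funB. Qed.

Let p0 z : 0 <= pz z. Proof. by case/andP: (p01z z). Qed.

Let mj (F : X * Y -> R) : measurable_fun setT F ->
  measurable_fun setT (fun z => (pz z * F z * joint_density f fX theta z)%:E).
Proof.
move=> mF; apply/measurable_EFinP; apply: measurable_funM; first exact: measurable_funM.
by apply: measurable_funM => //; exact: (measurableT_comp mfX measurable_fst).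
Qed.

Let j0 (F : X * Y -> R) : (forall z, 0 <= F z) ->
  forall z, (0 <= (pz z * F z * joint_density f fX theta z)%:E)%E.
Proof.
move=> F0 z; rewrite lee_fin; apply: mulr_ge0; first exact: mulr_ge0.
by apply: mulr_ge0; [exact: (fz0 z)|exact: fX0].
Qed.

Let ExyZ (F : X * Y -> R) (c : R) : measurable_fun setT F -> (forall z, 0 <= F z) -> 0 <= c ->
  (c%:E * Exy muX muY f fX theta (fun x y => p N x y v * F (x, y))%R =
   \int[muX \x muY]_z (c%:E * (pz z * F z * joint_density f fX theta z)%:E))%E.
Proof.
move=> mF F0 c0; rewrite ge0_integralZl//; [|exact: mj|by move=> z _; exact: j0].
by congr (_ * _)%E; apply: eq_integral => -[x y] _.
Qed.

Lemma score4_le k : (\int[mu]_z (pz z * sm k z ^+ 4)%:E <=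
  16%:E * Exy muX muY f fX theta (fun x y => p N x y v * frob (score f theta x y) ^+ 4)%R)%E.
Proof.
have m1 : measurable_fun setT (fun z => pz z * sm k z ^+ 4).
  by apply: measurable_funM => //; exact: measurable_funX.
have m2' : measurable_fun setT (fun z => pz z * (16 * A z)).
  by apply: measurable_funM => //; exact: measurable_funM.
have g1 z : 0 <= pz z * sm k z ^+ 4 by rewrite mulr_ge0// (exprM _ 2 2) sqr_ge0.
have g2 z : 0 <= pz z * (16 * A z) := mulr_ge0 (p0 z) (mulr_ge0 (ler0n _ 16) (A0 z)).
apply: le_trans (joint_le mfz fz0 mfX fX0 mu_density good_ae m1 m2' g1 g2 _) _.
  move=> x [iA iB].
  have [i1 le1] := wmean_score4 (mw x) (w0 x) (iw x) (mlx x) (lA x) iA (E1 x) k.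
  split; [exact: (intE (F := fun z => sm k z ^+ 4))|apply: (intE (F := fun z => 16 * A z)); exact: wintegrableZ|].
  rewrite (meanE (fun z => sm k z ^+ 4)) (meanE (fun z => 16 * A z)).
  by rewrite (wmeanZ _ iA).
have -> := ExyZ mA A0 (ler0n _ 16).
rewrite le_eqVlt; apply/orP; left; apply/eqP; apply: eq_integral => z _.
by rewrite -EFinM /joint_density; congr EFin; rewrite /fz; ring.
Qed.

Lemma hess2_le j k : (\int[mu]_z (pz z * hm j k z ^+ 2)%:E <=
  10%:E * Exy muX muY f fX theta (fun x y => p N x y v * frob (info f theta x y) ^+ 2)%R +
  12%:E * Exy muX muY f fX theta (fun x y => p N x y v * frob (score f theta x y) ^+ 4)%R)%E.
Proof.
have m1 : measurable_fun setT (fun z => pz z * hm j k z ^+ 2).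
  by apply: measurable_funM => //; exact: measurable_funX.
have m2' : measurable_fun setT (fun z => pz z * (10 * B z + 12 * A z)).
  by apply: measurable_funM => //; apply: measurable_funD; exact: measurable_funM.
have g1 z : 0 <= pz z * hm j k z ^+ 2 by rewrite mulr_ge0// sqr_ge0.
have g2 z : 0 <= pz z * (10 * B z + 12 * A z) :=
  mulr_ge0 (p0 z) (addr_ge0 (mulr_ge0 (ler0n _ 10) (B0 z)) (mulr_ge0 (ler0n _ 12) (A0 z))).
apply: le_trans (joint_le mfz fz0 mfX fX0 mu_density good_ae m1 m2' g1 g2 _) _.
  move=> x [iA iB].
  have [i1 le1] := wmean_hess2 (mw x) (w0 x) (iw x) (mlx x) (ml2x x) (lA x) (lB x) iA iB (W0 x) (E1 x) (E2 x) j k.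
  have iAB := wintegrableD (wintegrableZ 10 iB) (wintegrableZ 12 iA).
  split; [exact: (intE (F := fun z => hm j k z ^+ 2))|exact: (intE (F := fun z => 10 * B z + 12 * A z))|].
  rewrite (meanE (fun z => hm j k z ^+ 2)) (meanE (fun z => 10 * B z + 12 * A z)).
  by rewrite (wmeanD (wintegrableZ 10 iB) (wintegrableZ 12 iA)) !wmeanZ.
have eB := ExyZ mB B0 (ler0n _ 10); have eA := ExyZ mA A0 (ler0n _ 12).
rewrite eA eB -ge0_integralD//.
- rewrite le_eqVlt; apply/orP; left; apply/eqP; apply: eq_integral => z _.
  by rewrite -!EFinM -EFinD /joint_density; congr EFin; rewrite /fz; ring.
- by move=> z _; apply: mule_ge0; [rewrite lee_fin|exact: j0].
- by apply: measurable_funeM; exact: mj.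
- by move=> z _; apply: mule_ge0; [rewrite lee_fin|exact: j0].
- by apply: measurable_funeM; exact: mj.
Qed.

Let ip : mu.-integrable setT (EFin \o pz).
Proof.
by apply: (@bounded_integrable _ _ _ mu _ 1) => // z; have /andP[a b] := p01z z; rewrite ger0_norm.
Qed.

Let Exy_lt (a b : R) (x y : \bar R) : 0 <= a -> 0 <= b -> (x < +oo)%E -> (y < +oo)%E -> (0 <= x)%E -> (0 <= y)%E ->
  (a%:E * x + b%:E * y < +oo)%E.
Proof.
move=> a0 b0; case: x => [x _|//|//]; case: y => [y _|//|//] _ _.
by rewrite -!EFinM -EFinD ltry.
Qed.

Let Exy_ge0 (F : X * Y -> R) : (forall z, 0 <= F z) ->
  (0 <= Exy muX muY f fX theta (fun x y => p N x y v * F (x, y))%R)%E.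
Proof.
move=> F0; apply: integral_ge0 => -[x y] _; rewrite lee_fin; apply: mulr_ge0.
  by apply: mulr_ge0; [case/andP: (p01z (x, y))|exact: F0].
by apply: mulr_ge0; [exact: (fz0 (x, y))|exact: fX0].
Qed.

Lemma score4_integrable k : mu.-integrable setT (EFin \o (fun z => pz z * sm k z ^+ 4)).
Proof.
apply/integrableP; split.
  by apply/measurable_EFinP; apply: measurable_funM => //; exact: measurable_funX.
apply: (@le_lt_trans _ _ (\int[mu]_z (pz z * sm k z ^+ 4)%:E)%E).
  rewrite le_eqVlt; apply/orP; left; apply/eqP; apply: eq_integral => z _ /=.
  by rewrite ger0_norm// mulr_ge0// (exprM _ 2 2) sqr_ge0.
apply: le_lt_trans (score4_le k) _.
have := @Exy_lt 16 0 _ _ (ler0n _ 16) (lexx 0) Afin Afin (Exy_ge0 A0) (Exy_ge0 A0).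
by rewrite mul0e adde0.
Qed.

Lemma hess2_integrable j k : mu.-integrable setT (EFin \o (fun z => pz z * hm j k z ^+ 2)).
Proof.
apply/integrableP; split.
  by apply/measurable_EFinP; apply: measurable_funM => //; exact: measurable_funX.
apply: (@le_lt_trans _ _ (\int[mu]_z (pz z * hm j k z ^+ 2)%:E)%E).
  rewrite le_eqVlt; apply/orP; left; apply/eqP; apply: eq_integral => z _ /=.
  by rewrite ger0_norm// mulr_ge0// sqr_ge0.
apply: le_lt_trans (hess2_le j k) _.
exact: (@Exy_lt 10 12 _ _ (ler0n _ 10) (ler0n _ 12) Bfin Afin (Exy_ge0 B0) (Exy_ge0 A0)).
Qed.

Let dom (F G : X * Y -> R) : measurable_fun setT F -> (forall z, `|F z| <= 1 + G z) ->
  mu.-integrable setT (EFin \o (fun z => pz z * G z)) ->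
  mu.-integrable setT (EFin \o (fun z => pz z * F z)).
Proof.
move=> mF FG iG; have := integrableD measurableT ip iG => iS.
have iS' : mu.-integrable setT (EFin \o (fun z => pz z + pz z * G z)) by [].
apply: integrable_le iS'; first exact: measurable_funM.
move=> z; have /andP[a b] := p01z z.
by rewrite normrM ger0_norm// -{2}[pz z]mulr1 -mulrDr ler_wpM2l.
Qed.

Let abs1 (x : R) : `|x| <= 1 + x ^+ 2.
Proof.
rewrite -(real_normK (num_real x)); move: (`|x|) => t.
by have := sqr_ge0 (t - 1); have := sqr_ge0 t; rewrite sqrrB expr1n; lra.
Qed.
Let abs2 (x : R) : x ^+ 2 <= 1 + x ^+ 4.
Proof. by have := abs1 (x ^+ 2); rewrite ger0_norm ?sqr_ge0// -exprM. Qed.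

Let fz_int x : muY.-integrable setT (EFin \o (fun y => fz (x, y))) /\ \int[muY]_y fz (x, y) = 1.
Proof.
have h : (\int[muY]_y (fz (x, y))%:E = 1)%E by case: hf => _ _ h _; exact: h.
split; last by rewrite /Rintegral h.
apply/integrableP; split.
  by apply/measurable_EFinP; exact: (measurable_fun_pair2 x mfz).
rewrite (eq_integral (fun y => (fz (x, y))%:E)); first by rewrite h ltry.
by move=> y _ /=; rewrite ger0_norm.
Qed.

Let SI j k (z : X * Y) := Sigma_integrand muY f theta p N v z.1 z.2 j k.

(** The subtracted part of the Sigma integrand does not depend on y and the density has mass 1, so
    integrating over y leaves exactly the covariance of [wcov]. *)
Let SI_inner x j k : good x ->
  muY.-integrable setT (EFin \o (fun y => fz (x, y) * SI j k (x, y))) /\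
  \int[muY]_y (fz (x, y) * SI j k (x, y)) =
    wcov muY (w x) (fun k y => l k (x, y)) j k.
Proof.
move=> [iA iB].
have i1 := wintegrable_prod (mw x) (w0 x) (iw x) (mlx x) (lA x) iA j k.
pose a i := wmean muY (w x) (fun y => l i (x, y)).
pose c := a j * a k / \int[muY]_y w x y.
have cE i : condE muY f theta x (fun y' => score f theta x y' i 0 * p N x y' v) = a i.
  by apply: eq_Rintegral => y _; rewrite scE /w /fz /pz /=; ring.
have pE : condE muY f theta x (fun y' => p N x y' v) = \int[muY]_y w x y.
  by apply: eq_Rintegral => y _; rewrite /w /fz /pz /=; ring.
have SIE y : fz (x, y) * SI j k (x, y) = w x y * (l j (x, y) * l k (x, y)) + - c * fz (x, y).
  rewrite /SI /Sigma_integrand /outer2 !mxE !big_ord1 !mxE pE !cE.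
  have -> : pderiv [:: j] (loglik f x y) theta = l j (x, y) by [].
  have -> : pderiv [:: k] (loglik f x y) theta = l k (x, y) by [].
  have cc : (\int[muY]_y w x y)^-1 * (a j * a k) = c by rewrite mulrC.
  rewrite cc {cc} /w; move: c (fz (x, y)) (l j (x, y)) (l k (x, y)) => c' F s t.
  by rewrite /pz /=; move: (p N x y v) => P; ring.
have [ifz efz] := fz_int x.
have i2 : muY.-integrable setT (EFin \o (fun y => - c * fz (x, y))).
  by have := integrableZl measurableT (- c) ifz.
have FE : (fun y => fz (x, y) * SI j k (x, y)) =
   (fun y => w x y * (l j (x, y) * l k (x, y)) + - c * fz (x, y)) by apply/funext.
rewrite FE; split.
  by have := integrableD measurableT i1 i2.
by rewrite RintegralD// RintegralZl// efz mulr1 /wcov -/(wmean _ _ _).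
Qed.

Lemma score_mean k : \int[mu]_z (pz z * sm k z) = 0.
Proof.
have is1 : mu.-integrable setT (EFin \o (fun z => pz z * sm k z)).
  apply: (dom (G := fun z => 1 + sm k z ^+ 4)) => //.
    by move=> z; apply: le_trans (abs1 _) _; rewrite lerD2l.
  have := integrableD measurableT ip (score4_integrable k); apply: eq_integrable => // z _ /=.
  by rewrite mulrDr mulr1 EFinD.
have i0 : (muX \x muY)%E.-integrable setT (EFin \o (fun z : X * Y => (fun=> 0) z * (fz z * fX z.1))).
  by apply: eq_integrable (integrable0 _ _) => // z _ /=; rewrite mul0r.
have mps : measurable_fun setT (fun z => pz z * sm k z) by exact: measurable_funM.
rewrite (joint_eq mfz fz0 mfX fX0 mu_density good_ae mps is1 i0); last first.
  move=> x [iA iB].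
  have [i1 e1] := wmean_score (mw x) (w0 x) (iw x) (mlx x) (lA x) iA (E1 x) k.
  split; [exact: (intE (F := sm k))| |].
    by apply: eq_integrable (integrable0 _ _) => // y _ /=; rewrite mulr0.
  rewrite (meanE (sm k)) e1 /Rintegral (eq_integral (cst 0%E)) ?integral0// => y _.
  by rewrite mulr0.
by rewrite (eq_integral (cst 0%E)) ?integral0// => z _; rewrite mul0r.
Qed.

(** The product of centred scores and the Sigma integrand differ as functions of y but have the same
    integral over y, by [wmean_cov] and [SI_inner]. *)
Lemma score_cov j k : \int[mu]_z (pz z * (sm j z * sm k z)) =
  fine (Exy muX muY f fX theta (fun x y => Sigma_integrand muY f theta p N v x y j k)).
Proof.
have is1 : mu.-integrable setT (EFin \o (fun z => pz z * (sm j z * sm k z))).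
  apply: (dom (G := fun z => 1 + (sm j z ^+ 4 + sm k z ^+ 4))); first exact: measurable_funM.
    move=> z; have := abs2 (sm j z); have := abs2 (sm k z); move: (sm j z) (sm k z) => s t.
    have := sqr_ge0 (s + t); have := sqr_ge0 (s - t); have := sqr_ge0 s; have := sqr_ge0 t.
    by rewrite sqrrB sqrrD ler_norml => *; apply/andP; split; lra.
  have i2 := integrableD measurableT (score4_integrable j) (score4_integrable k).
  have := integrableD measurableT ip i2; apply: eq_integrable => // z _ /=.
  by rewrite !mulrDr mulr1 !EFinD.
have mps : measurable_fun setT (fun z => pz z * (sm j z * sm k z)).
  by apply: measurable_funM => //; exact: measurable_funM.
rewrite (joint_eq mfz fz0 mfX fX0 mu_density good_ae mps is1 (psi := SI j k))//; first exact: Sfin.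
move=> x gx; have [iA iB] := gx.
have [i1 e1] := wmean_cov (mw x) (w0 x) (iw x) (mlx x) (lA x) iA (W0 x) (E1 x) j k.
have [i2 e2] := SI_inner j k gx.
split => //; first exact: (intE (F := fun z => sm j z * sm k z)).
by rewrite (meanE (fun z => sm j z * sm k z)) e1 e2.
Qed.

(** The sign is put inside the integral so that the comparison is with the Sigma integrand itself,
    through [wmean_hess] and [SI_inner]. *)
Lemma hess_mean j k : \int[mu]_z (pz z * hm j k z) =
  - fine (Exy muX muY f fX theta (fun x y => Sigma_integrand muY f theta p N v x y j k)).
Proof.
have is1 : mu.-integrable setT (EFin \o (fun z => pz z * hm j k z)).
  apply: (dom (G := fun z => hm j k z ^+ 2)) => //; exact: hess2_integrable.
have is2 : mu.-integrable setT (EFin \o (fun z => pz z * - hm j k z)).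
  have := integrableN is1; apply: eq_integrable => // z _ /=.
  by rewrite mulrN EFinN.
have mps : measurable_fun setT (fun z => pz z * - hm j k z).
  by apply: measurable_funM => //; exact: measurableT_comp.
apply: oppr_inj; rewrite opprK.
have <- : \int[mu]_z (pz z * - hm j k z) = - \int[mu]_z (pz z * hm j k z).
  rewrite -[RHS]mulN1r -RintegralZl//; apply: eq_Rintegral => z _; ring.
rewrite (joint_eq mfz fz0 mfX fX0 mu_density good_ae mps is2 (psi := SI j k))//; first exact: Sfin.
move=> x gx; have [iA iB] := gx.
have [i1 e1] := wmean_hess (mw x) (w0 x) (iw x) (mlx x) (ml2x x) (lA x) (lB x) iA iB (W0 x) (E1 x) (E2 x) j k.
have [i2 e2] := SI_inner j k gx.
have i3 := wintegrableZ (-1) i1.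
have hE : (fun y => - hm j k (x, y)) = (fun y => -1 * (l2 j k (x, y) - m2 j k x)).
  by apply/funext => y; rewrite mulN1r.
split => //; first by apply: (intE (F := fun z => - hm j k z)); rewrite hE.
by rewrite (meanE (fun z => - hm j k z)) hE (wmeanZ _ i1) e1 e2 mulN1r opprK.
Qed.

End fixed_pilot.

(** * Convergence hypotheses as statements on events and entries *)

Section whp_facts.
Context {R : realType} {dO : measure_display} {Omega : measurableType dO}.
Variable P : probability Omega R.

Lemma whp_ae e (Q : nat -> Omega -> Prop) : 0 <= e ->
  (forall N, {ae P, forall w, Q N w}) -> whp P e Q.
Proof.
move=> e0 H; near=> N; have [A [mA PA QA]] := H N; exists A; split => //.
  by rewrite PA lee_fin.
by move=> w nA; apply: contrapT => nQ; apply: nA; exact: QA.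
Unshelve. all: by end_near. Qed.

Lemma measurable_frob d : measurable_fun setT (fun v : borelV R d => frob (v : 'cV[R]_d)).
Proof.
rewrite (_ : (fun v => _) = (fun v : borelV R d => Num.sqrt (\sum_j ((v : 'cV[R]_d) j 0) ^+ 2))).
  apply: (measurableT_comp (f := @Num.sqrt R)).
    by apply: continuous_measurable_fun; exact: sqrt_continuous.
  by apply: measurable_sum => j; apply: measurable_funX; exact: measurable_coord.
by apply/funext => v; rewrite frobE.
Qed.

(** The exceptional set is measured with the Frobenius norm, which dominates the max norm. *)
Lemma cvg_in_probability_whp d (V : nat -> Omega -> borelV R d) (l : 'cV[R]_d) :
  (forall N, measurable_fun setT (V N)) -> cvg_in_probability P V l ->
  forall e rho, 0 < e -> 0 < rho -> whp P e (fun N w => `|(V N w : 'cV[R]_d) - l| < rho).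
Proof.
move=> mV cV e rho e0 rho0; have := cV rho rho0.
move=> /fine_cvgP[_ /(iffLR (@cvgrPdist_le _ R^o nat \oo _ _ _)) /(_ _ e0) H].
near=> N.
have HN : `|0 - fine (P [set w | rho <= frob ((V N w : 'cV[R]_d) - l)])| <= e by near: N; exact: H.
pose A := [set w | rho <= frob ((V N w : 'cV[R]_d) - l)].
have mA : measurable A.
  have mD : measurable_fun setT ((fun w => (V N w : 'cV[R]_d) - l) : Omega -> borelV R d).
    by apply: measurable_borelV => j; rewrite (_ : (fun x => _) = (fun w => (V N w : 'cV[R]_d) j 0 - l j 0));
      [apply: measurable_funB => //; exact: (measurableT_comp (measurable_coord j) (mV N))
      |apply/funext => w; rewrite !mxE].
  have : measurable_fun setT (fun w => rho <= frob ((V N w : 'cV[R]_d) - l)).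
    by apply: measurable_fun_ler => //; exact: (measurableT_comp (@measurable_frob d) mD).
  by move=> /(_ measurableT [set true] I); rewrite setTI.
exists A; split => //.
  move: HN; rewrite -/A sub0r normrN ger0_norm ?fine_ge0// => h.
  by rewrite -(fineK (fin_num_measure P A mA)) lee_fin.
move=> w nA; apply: le_lt_trans (norm_le_frob _) _; rewrite ltNge; apply/negP => h; exact: nA.
Unshelve. all: by end_near. Qed.

End whp_facts.

Section uniform_limits.
Context {R : realType} {q d : nat}.
Variables (U : set 'cV[R]_q) (F : nat -> 'cV[R]_q -> 'M[R]_d) (S : 'cV[R]_q -> 'M[R]_d).

Lemma uniform_cvg_entries e : 0 < e -> {uniform U, F @ \oo --> S} ->
  \forall N \near \oo, forall v, U v -> forall j k, `|F N v j k - S v j k| < e.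
Proof.
move=> e0 /(_ [set h | forall v, U v -> forall j k, `|h v j k - S v j k| < e]) H.
apply: H; apply/uniform_nbhs; exists [set xy : 'M[R]_d * 'M[R]_d | ball xy.1 e xy.2]; split.
  exact: (@entourage_ball R _ (PosNum e0)).
move=> h Hh v Uv j k; rewrite distrC.
have [_ H1] : 0 < e /\ forall j k, ball (S v j k) e (h v j k) := Hh v Uv.
exact: (H1 j k).
Qed.

(** [v0] is interior to U, so continuity within U is continuity at [v0]. *)
Lemma within_continuous_entries e v0 : 0 < e -> nbhs v0 U -> {within U, continuous S} ->
  \forall v \near v0, forall j k, `|S v j k - S v0 j k| < e.
Proof.
move=> e0 nU /(_ v0); rewrite /continuous_at -(nbhs_subspace_interior (nU : U° v0)) => cS.
have : nbhs (S v0) [set A | forall j k, `|A j k - S v0 j k| < e].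
  apply/nbhs_ballP; exists e => // A h j k; rewrite distrC.
  have [_ H1] : 0 < e /\ forall j k, ball (S v0 j k) e (A j k) := h.
  exact: (H1 j k).
by move=> /cS.
Qed.

End uniform_limits.

Section sampling_next.
Context {R : realType} {dX dY dO : measure_display}.
Context {X : measurableType dX} {Y : measurableType dY} {Omega : measurableType dO} {d q : nat}.
Variable muX : {sigma_finite_measure set X -> \bar R}.
Variable muY : {sigma_finite_measure set Y -> \bar R}.
Variables (f : 'cV[R]_d -> X -> Y -> R) (fX : X -> R) (theta : 'cV[R]_d).
Variable p : nat -> X -> Y -> 'cV[R]_q -> R.
Variables (P : probability Omega R) (Z : nat -> Omega -> X * Y).
Variables (pilot : nat -> Omega -> borelV R q) (delta : nat -> nat -> Omega -> bool).
Hypothesis hZ : iid_data muX muY f fX theta P Z.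
Hypothesis hpilot : pilot_independent P Z pilot.
Hypothesis hdelta : poisson_sampling p P Z pilot delta.

Lemma sampling_next (mZ0 : measurable_fun setT (Z 0%N)) N : (0 < N)%N ->
  measurable_fun setT (fun u : (X * Y) * borelV R q => p N u.1.1 u.1.2 u.2) ->
  (forall z (v : borelV R q), 0 <= p N z.1 z.2 v <= 1) ->
  next_property P (law P mZ0) N Z (pilot N) (delta N) (fun z v => p N z.1 z.2 v).
Proof.
move=> N0 mp p01 m xi mxi k Psi kN mPsi Psi0.
have [mZ indZ lawZ] := hZ; have [mpilot indp] := hpilot N; have [mdelta pois] := hdelta.
apply: (@next_indicator _ _ _ _ _ _ _ P (law P mZ0) N Z (pilot N) (delta N) (fun z v => p N z.1 z.2 v)) => //.
- by move=> i D mD; rewrite lawZ// -(lawZ 0%N).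
- by move=> b C mC; have := pois N b C N0 mC.
Qed.

End sampling_next.

(** * The estimating equation of the maximizer *)

Section estimating_equation.
Context {R : realType} {dX dY dO : measure_display}.
Context {X : measurableType dX} {Y : measurableType dY} {Omega : measurableType dO} {d q : nat}.
Variable muX : {sigma_finite_measure set X -> \bar R}.
Variable muY : {sigma_finite_measure set Y -> \bar R}.
Variables (Theta : set 'cV[R]_d) (theta : 'cV[R]_d).
Variables (f : 'cV[R]_d -> X -> Y -> R) (fX : X -> R).
Variables (n : nat -> R) (p : nat -> X -> Y -> 'cV[R]_q -> R).
Hypothesis hf : conditional_density_family muY f Theta.
Hypothesis hfX : covariate_density muX fX.
Hypothesis hp : sampling_probabilities muX muY f fX theta p n.
Hypothesis hn : n N @[N --> \oo] --> +oo.
Variables (P : probability Omega R) (Z : nat -> Omega -> X * Y).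
Variables (pilot : nat -> Omega -> borelV R q) (vtp : 'cV[R]_q).
Variables (delta : nat -> nat -> Omega -> bool) (hat : nat -> Omega -> borelV R d).
Hypothesis hmax : is_maximizer muY f p P Z pilot delta Theta hat.
Variable r : R.
Hypothesis r0 : 0 < r.
Hypothesis rTheta : forall t, `|t - theta| < r -> interior Theta t.
Local Notation dd j g := ('D_(basisv j) g).

Variable V : set (borelV R q).
Hypothesis mV : measurable V.
Variable B : 'cV[R]_q -> X -> Y -> R.
Hypothesis loglik3 : forall v x y, V v -> partials3 (interior Theta) (loglik f x y) /\
  third_bounded (interior Theta) (loglik f x y) (B v x y).
Hypothesis pibar3 : forall N v x y, (0 < N)%N -> V v ->
  partials3 (interior Theta) (log_pibar muY f p N x v) /\
  third_bounded (interior Theta) (log_pibar muY f p N x v) (B v x y).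

Notation T := (borelV R q * (X * Y))%type.

Definition loglik_at (u : T) := loglik f u.2.1 u.2.2.
Definition log_pibar_at N (u : T) := log_pibar muY f p N u.2.1 u.1.

Let D : set T := [set u | V u.1].

Let mD : measurable D.
Proof. by have := @measurable_fst _ _ (borelV R q) (X * Y)%type measurableT V mV; rewrite setTI. Qed.

Let mF1 t : `|t - theta| < r -> measurable_fun D (fun u => loglik_at u t).
Proof.
move=> /(ball_Theta rTheta) tT; apply: measurable_funTS.
exact: (measurableT_comp (measurable_loglik hf tT) measurable_snd).
Qed.

Let mF2 N t : (0 < N)%N -> `|t - theta| < r -> measurable_fun D (fun u => log_pibar_at N u t).
Proof.
move=> N0 /(ball_Theta rTheta) tT; apply: measurable_funTS.
exact: (measurable_log_pibar hf hp tT N0).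
Qed.

Let F13 u : D u -> forall (js : seq 'I_d) j t, (size js <= 2)%N -> `|t - theta| < r ->
  derivable (pderiv js (loglik_at u)) t (basisv j).
Proof.
by move=> Du js j t sj /rTheta tT; have [h _] := loglik3 u.2.1 u.2.2 Du; exact: (h js j t sj tT).
Qed.

Let F23 N u : (0 < N)%N -> D u -> forall (js : seq 'I_d) j t, (size js <= 2)%N -> `|t - theta| < r ->
  derivable (pderiv js (log_pibar_at N u)) t (basisv j).
Proof.
by move=> N0 Du js j t sj /rTheta tT; have [h _] := pibar3 u.2.1 u.2.2 N0 Du; exact: (h js j t sj tT).
Qed.

Let b (u : T) := B u.1 u.2.1 u.2.2.

Let Fb1 u : D u -> forall j1 j2 j3 t, `|t - theta| < r ->
  `|pderiv [:: j1; j2; j3] (loglik_at u) t| <= b u.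
Proof. by move=> Du j1 j2 j3 t /rTheta tT; have [_ h] := loglik3 u.2.1 u.2.2 Du; exact: h. Qed.

Let Fb2 N u : (0 < N)%N -> D u -> forall j1 j2 j3 t, `|t - theta| < r ->
  `|pderiv [:: j1; j2; j3] (log_pibar_at N u) t| <= b u.
Proof. by move=> N0 Du j1 j2 j3 t /rTheta tT; have [_ h] := pibar3 u.2.1 u.2.2 N0 Du; exact: h. Qed.

Let tb : `|theta - theta| < r := theta_ball theta r0.

(** Extended by zero for pilots outside V, so as to be measurable jointly in the pilot and the
    observation on the whole space. *)
Definition score_term N : T -> borelV R d := fun u =>
  \col_k ((fun u => dd k (loglik_at u) theta - dd k (log_pibar_at N u) theta) \_ [set u | V u.1]) u.

Definition hess_term N j k : T -> R :=
  (fun u => dd j (dd k (loglik_at u)) theta - dd j (dd k (log_pibar_at N u)) theta) \_ [set u | V u.1].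

Lemma score_termE N v z k : V v -> (score_term N (v, z) : 'cV[R]_d) k 0 =
  dd k (loglik f z.1 z.2) theta - dd k (log_pibar muY f p N z.1 v) theta.
Proof. by move=> Vv; rewrite mxE patchE mem_set. Qed.

Lemma hess_termE N v z j k : V v -> hess_term N j k (v, z) =
  dd j (dd k (loglik f z.1 z.2)) theta - dd j (dd k (log_pibar muY f p N z.1 v)) theta.
Proof. by move=> Vv; rewrite /hess_term patchE mem_set. Qed.

Lemma measurable_score_term N : (0 < N)%N -> measurable_fun setT (score_term N).
Proof.
move=> N0; apply: measurable_borelV => k; rewrite (_ : (fun u => _) =
  ((fun u => dd k (loglik_at u) theta - dd k (log_pibar_at N u) theta) \_ D)); last first.
  by apply/funext => u; rewrite mxE.
apply: (iffLR (measurable_restrictT _ mD)); apply: measurable_funB.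
  exact: (measurable_pderiv1 mF1 F13 k tb).
exact: (measurable_pderiv1 (fun w => @mF2 N w N0) (fun u => @F23 N u N0) k tb).
Qed.

Lemma measurable_hess_term N j k : (0 < N)%N -> measurable_fun setT (hess_term N j k).
Proof.
move=> N0; apply: (iffLR (measurable_restrictT _ mD)); apply: measurable_funB.
  exact: (measurable_pderiv2 mF1 F13 j k tb).
exact: (measurable_pderiv2 (fun w => @mF2 N w N0) (fun u => @F23 N u N0) j k tb).
Qed.

Lemma measurable_loglik_section v k : V v ->
  measurable_fun setT (fun z : X * Y => dd k (loglik f z.1 z.2) theta).
Proof.
move=> Vv; have := measurable_fun_pair2 v (iffLR (measurable_restrictT _ mD) (measurable_pderiv1 mF1 F13 k tb)).
by congr (measurable_fun _ _); apply/funext => z; rewrite patchE mem_set.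
Qed.

Lemma measurable_loglik_section2 v j k : V v ->
  measurable_fun setT (fun z : X * Y => dd j (dd k (loglik f z.1 z.2)) theta).
Proof.
move=> Vv; have := measurable_fun_pair2 v (iffLR (measurable_restrictT _ mD) (measurable_pderiv2 mF1 F13 j k tb)).
by congr (measurable_fun _ _); apply/funext => z; rewrite patchE mem_set.
Qed.

Lemma measurable_log_pibar_section N v k : (0 < N)%N -> V v ->
  measurable_fun setT (fun z : X * Y => dd k (log_pibar muY f p N z.1 v) theta).
Proof.
move=> N0 Vv; have := measurable_fun_pair2 v (iffLR (measurable_restrictT _ mD)
  (measurable_pderiv1 (fun w => @mF2 N w N0) (fun u => @F23 N u N0) k tb)).
by congr (measurable_fun _ _); apply/funext => z; rewrite patchE mem_set.
Qed.

Lemma measurable_log_pibar_section2 N v j k : (0 < N)%N -> V v ->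
  measurable_fun setT (fun z : X * Y => dd j (dd k (log_pibar muY f p N z.1 v)) theta).
Proof.
move=> N0 Vv; have := measurable_fun_pair2 v (iffLR (measurable_restrictT _ mD)
  (measurable_pderiv2 (fun w => @mF2 N w N0) (fun u => @F23 N u N0) j k tb)).
by congr (measurable_fun _ _); apply/funext => z; rewrite patchE mem_set.
Qed.

(** The sum of the Taylor constants of the log-likelihood and of log pibar. Unlike B, it comes with
    joint measurability in the pilot and the observation, as [sampled_markov] requires. *)
Lemma curvature_exists : exists L : nat -> T -> R, forall N, (0 < N)%N ->
  [/\ measurable_fun setT (L N), forall u, 0 <= L N u,
      forall u, V u.1 -> L N u <= 2 * (d%:R ^+ 2 * `|B u.1 u.2.1 u.2.2|)
    & forall u k t, V u.1 -> `|t - theta| < r ->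
      `|taylor_rem loglik_at theta u k t - taylor_rem (log_pibar_at N) theta u k t|
        <= L N u * `|t - theta| ^+ 2].
Proof.
have [L1 [mL1 L10 L1b L1t]] := taylor_constant mD r0 mF1 F13 Fb1.
suff /choice[L HL] : forall N : nat, exists L : T -> R, (0 < N)%N ->
  [/\ measurable_fun setT L, forall u, 0 <= L u,
      forall u, V u.1 -> L u <= 2 * (d%:R ^+ 2 * `|B u.1 u.2.1 u.2.2|)
    & forall u k t, V u.1 -> `|t - theta| < r ->
      `|taylor_rem loglik_at theta u k t - taylor_rem (log_pibar_at N) theta u k t|
        <= L u * `|t - theta| ^+ 2] by exists L.
case=> [|N']; first by exists (fun=> 0).
set N := N'.+1; have N0 : (0 < N)%N by [].
have [L2 [mL2 L20 L2b L2t]] := taylor_constant mD r0 (fun w => @mF2 N w N0) (fun u => @F23 N u N0)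
  (fun u => @Fb2 N u N0).
exists (fun u => L1 u + L2 u) => _; split.
- exact: measurable_funD.
- by move=> u; rewrite addr_ge0.
- by move=> u Vu; have := L1b u Vu; have := L2b u Vu; rewrite /b; lra.
- move=> u k t Vu tr; apply: le_trans (ler_normB _ _) _; rewrite mulrDl lerD//.
    exact: L1t.
  exact: L2t.
Qed.

Variable L : nat -> T -> R.
Hypothesis LT : forall N u k t, (0 < N)%N -> V u.1 -> `|t - theta| < r ->
  `|taylor_rem loglik_at theta u k t - taylor_rem (log_pibar_at N) theta u k t|
    <= L N u * `|t - theta| ^+ 2.
Hypothesis pilotV : forall e, 0 < e -> whp P e (fun N w => V (pilot N w)).
Hypothesis consistent : forall e rho, 0 < e -> 0 < rho ->
  whp P e (fun N w => `|(hat N w : 'cV[R]_d) - theta| < rho).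

Let ellS_derive N w k t : (0 < N)%N -> V (pilot N w) -> `|t - theta| < r ->
  is_derive t (basisv k) (ellS muY f p Z pilot delta N w)
    (\sum_(i < N) (delta N i w)%:R *
      (dd k (loglik_at (pilot N w, Z i w)) t - dd k (log_pibar_at N (pilot N w, Z i w)) t)).
Proof.
move=> N0 Vw tr.
pose h (i : 'I_N) : 'cV[R]_d -> R := (delta N i w)%:R *:
  (loglik_at (pilot N w, Z i w) - log_pibar_at N (pilot N w, Z i w)).
pose C := \sum_(i < N) (delta N i w)%:R * ln (p N (Z i w).1 (Z i w).2 (pilot N w)).
have -> : ellS muY f p Z pilot delta N w = \sum_i h i + cst C.
  by apply/funext => u; rewrite /ellS /= fctE fct_sumE.
have dh i : is_derive t (basisv k) (h i) ((delta N i w)%:R *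
      (dd k (loglik_at (pilot N w, Z i w)) t - dd k (log_pibar_at N (pilot N w, Z i w)) t)).
  have d1 : is_derive t (basisv k) (loglik_at (pilot N w, Z i w)) (dd k (loglik_at (pilot N w, Z i w)) t).
    by apply/derivableP; exact: (@F13 (pilot N w, Z i w) Vw [::] k t isT tr).
  have d2 : is_derive t (basisv k) (log_pibar_at N (pilot N w, Z i w)) (dd k (log_pibar_at N (pilot N w, Z i w)) t).
    by apply/derivableP; exact: (@F23 N (pilot N w, Z i w) N0 Vw [::] k t isT tr).
  exact: is_deriveZ.
by apply: is_derive_eq; rewrite addr0.
Qed.

(** With high probability the maximizer lies in the ball around [theta], inside the interior of
    Theta, and is therefore a critical point. Expanding its score around [theta] leaves the
    remainders, bounded unit by unit by L. *)
Lemma score_expansion_whp e : 0 < e -> whp P e (fun N w => forall k,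
  `|\sum_(i < N) (delta N i w)%:R * (score_term N (pilot N w, Z i w) : 'cV[R]_d) k 0
    + \sum_j (\sum_(i < N) (delta N i w)%:R * hess_term N j k (pilot N w, Z i w))
             * ((hat N w : 'cV[R]_d) - theta) j 0|
  <= (\sum_(i < N) (delta N i w)%:R * L N (pilot N w, Z i w))
     * `|(hat N w : 'cV[R]_d) - theta| ^+ 2).
Proof.
move=> e0; have e2 : 0 < e / 2 by rewrite divr_gt0.
have Hm := whp_ae (P := P) (lexx 0) (fun N => (hmax N).2).
apply: whp_le (whp_and Hm (whp_and (pilotV e2) (consistent e2 r0))); first lra.
near=> N => w [[hT hM] [Vw hr]] k.
have N0 : (0 < N)%N by near: N; exact: nbhs_infty_gt.
set t := (hat N w : 'cV[R]_d) in hr hT hM *.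
(* Segments parallel to the axes of length less than r - |t - theta| stay in the ball, so t is an
   interior maximum along each axis. *)
have score0 : dd k (ellS muY f p Z pilot delta N w) t = 0.
  have s0 : 0 < r - `|t - theta| by rewrite subr_gt0.
  have near_t s : `|s| < r - `|t - theta| -> `|t + s *: basisv k - theta| < r.
    move=> hs; rewrite addrAC; apply: le_lt_trans (ler_normD _ _) _.
    rewrite -ltrBrDl; apply: le_lt_trans hs.
    rewrite normrZ ler_piMr//; apply: norm_le_coord => // i.
    by rewrite mxE normr_nat lern1 leq_b1.
  apply: (partial_max s0) => s /near_t hs.
    by have [] := ellS_derive k N0 Vw hs.
  by apply: hM; exact: (ball_Theta rTheta).
have [_ dE] := ellS_derive k N0 Vw hr; rewrite score0 in dE.
pose rem i := taylor_rem loglik_at theta (pilot N w, Z i w) k t -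
   taylor_rem (log_pibar_at N) theta (pilot N w, Z i w) k t.
(* The score at t is zero, so the linear part of the expansion is the opposite of the sum of the
   remainders. *)
have -> : \sum_(i < N) (delta N i w)%:R * (score_term N (pilot N w, Z i w) : 'cV[R]_d) k 0
    + \sum_j (\sum_(i < N) (delta N i w)%:R * hess_term N j k (pilot N w, Z i w)) * (t - theta) j 0 =
    - \sum_(i < N) (delta N i w)%:R * rem i.
  have -> : \sum_j (\sum_(i < N) (delta N i w)%:R * hess_term N j k (pilot N w, Z i w)) * (t - theta) j 0 =
     \sum_(i < N) (delta N i w)%:R * \sum_j hess_term N j k (pilot N w, Z i w) * (t - theta) j 0.
    under eq_bigr do rewrite mulr_suml.
    rewrite exchange_big/=; apply: eq_bigr => i _; rewrite mulr_sumr.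
    by apply: eq_bigr => j _; rewrite mulrA.
  apply/eqP; rewrite -addr_eq0; apply/eqP; rewrite [RHS]dE -!big_split/=; apply: eq_bigr => i _.
  rewrite score_termE// /rem /taylor_rem.
  have -> : \sum_j hess_term N j k (pilot N w, Z i w) * (t - theta) j 0 =
    \sum_j dd j (dd k (loglik_at (pilot N w, Z i w))) theta * (t - theta) j 0 -
    \sum_j dd j (dd k (log_pibar_at N (pilot N w, Z i w))) theta * (t - theta) j 0.
    by rewrite -sumrB; apply: eq_bigr => j _; rewrite hess_termE// mulrBl.
  rewrite -[dd k (loglik f _ _) theta]/(dd k (loglik_at (pilot N w, Z i w)) theta).
  rewrite -[dd k (log_pibar _ _ _ _ _ _) theta]/(dd k (log_pibar_at N (pilot N w, Z i w)) theta).
  have alg (c a1 a2 a3 a4 a5 a6 : R) : c * (a1 - a2) + c * (a5 - a6) + c * (a3 - a1 - a5 - (a4 - a2 - a6)) =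
    c * (a3 - a4) by ring.
  exact: alg.
rewrite normrN; apply: le_trans (ler_norm_sum _ _ _) _; rewrite mulr_suml; apply: ler_sum => i _.
rewrite normrM ger0_norm// -mulrA ler_wpM2l//.
exact: LT.
Unshelve. all: by end_near. Qed.

End estimating_equation.

(** * Asymptotic normality of the subsample estimator *)

Lemma measurable_norm_ball (R : realType) q (c : 'cV[R]_q) (s : R) :
  measurable [set v : borelV R q | `|(v : 'cV[R]_q) - c| < s].
Proof.
have m : measurable_fun setT (fun v : borelV R q => `|(v : 'cV[R]_q) - c|).
  have mn : measurable_fun setT ((fun x => `|x|) : borelV R q -> R).
    by apply: continuous_borelV; exact: norm_continuous.
  have md : measurable_fun setT ((fun v => (v : 'cV[R]_q) - c) : borelV R q -> borelV R q).
    by apply: (@measurable_borelVD _ _ _ _ id (fun=> - c)).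
  exact: (measurableT_comp mn md).
have : measurable_fun setT (fun v : borelV R q => `|(v : 'cV[R]_q) - c| < s) by exact: measurable_fun_ltr.
by move=> /(_ measurableT [set true] I); rewrite setTI.
Qed.

Lemma nbhs_norm_ball (R : realType) q (c : 'cV[R]_q) (A : set 'cV[R]_q) : nbhs c A ->
  exists2 s : R, 0 < s & forall v, `|v - c| < s -> A v.
Proof.
move=> /nbhs_ballP[s /= s0 hs]; exists s => // v vs; apply: hs.
by rewrite -ball_normE /= distrC.
Qed.

Lemma Rintegral_le_EFin (R : realType) dT (T : measurableType dT) (mu : {measure set T -> \bar R})
  (F : T -> R) (c : R) : mu.-integrable setT (EFin \o F) ->
  (\int[mu]_z (F z)%:E <= c%:E)%E -> \int[mu]_z F z <= c.
Proof. by move=> i; have fin := integrable_fin_num measurableT i; rewrite -(fineK fin) lee_fin. Qed.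

(** The limit law is produced together with the laws of its linear forms, which determine it. *)
Theorem theorem5 (R : realType) (dX dY dO : measure_display)
  (X : measurableType dX) (Y : measurableType dY) (Omega : measurableType dO)
  (d q : nat)
  (muX : {sigma_finite_measure set X -> \bar R})
  (muY : {sigma_finite_measure set Y -> \bar R})
  (* model *)
  (Theta : set 'cV[R]_d) (theta : 'cV[R]_d)
  (f : 'cV[R]_d -> X -> Y -> R) (fX : X -> R)
  (hf : conditional_density_family muY f Theta)
  (hfX : covariate_density muX fX)
  (htheta : (interior Theta) theta)
  (* subsampling probabilities and average subsample size *)
  (n : nat -> R) (p : nat -> X -> Y -> 'cV[R]_q -> R)
  (hp : sampling_probabilities muX muY f fX theta p n)
  (hn : n N @[N --> \oo] --> +oo)
  (* data, pilot, sampling indicators, estimator *)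
  (P : probability Omega R) (Z : nat -> Omega -> X * Y)
  (pilot : nat -> Omega -> borelV R q) (vtp : 'cV[R]_q)
  (delta : nat -> nat -> Omega -> bool)
  (thetahat : nat -> Omega -> borelV R d)
  (hZ : iid_data muX muY f fX theta P Z)
  (hpilot : pilot_independent P Z pilot)
  (hpilot_cvg : cvg_in_probability P pilot vtp)
  (hdelta : poisson_sampling p P Z pilot delta)
  (hmax : is_maximizer muY f p P Z pilot delta Theta thetahat)
  (hconsistent : cvg_in_probability P thetahat theta)
  (* the neighborhood of the limit of the pilot *)
  (U : set 'cV[R]_q) (hU : nbhs vtp U)
  (hdiff : diff_under_integral muY f theta p U)
  (* (1') *)
  (h1_score : bounded_moment muX muY f fX theta p n U
     (fun _ x y => frob (score f theta x y) ^+ 4))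
  (h1_hessian : bounded_moment muX muY f fX theta p n U
     (fun _ x y => frob (info f theta x y) ^+ 2))
  (* (2') *)
  (hTheta : compact Theta)
  (B : 'cV[R]_q -> X -> Y -> R)
  (hB_meas : forall vt, U vt -> measurable_fun setT (fun z : X * Y => B vt z.1 z.2))
  (h2_loglik : forall vt x y, U vt ->
     partials3 (interior Theta) (loglik f x y) /\
     third_bounded (interior Theta) (loglik f x y) (B vt x y))
  (h2_pibar : forall N vt x y, (0 < N)%N -> U vt ->
     partials3 (interior Theta) (log_pibar muY f p N x vt) /\
     third_bounded (interior Theta) (log_pibar muY f p N x vt) (B vt x y))
  (h2_B : bounded_moment muX muY f fX theta p n U B)
  (* (3') *)
  (Sigma : 'cV[R]_q -> 'M[R]_d)
  (h3_cvg : {uniform U, SigmaN muX muY f fX theta p n @ \oo --> Sigma})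
  (h3_SigmaN : \forall N \near \oo,
     {within U, continuous (SigmaN muX muY f fX theta p n N)} /\
     forall vt, U vt -> SigmaN_finite muX muY f fX theta p N vt /\
       posdef (SigmaN muX muY f fX theta p n N vt))
  (h3_Sigma : {within U, continuous Sigma} /\
     forall vt, U vt -> posdef (Sigma vt)) :
  exists nu : probability (borelV R d) R,
    is_mvnormal nu 0 (invmx (Sigma vtp)) /\
    cvg_in_distribution P
      (fun N w => Num.sqrt (n N) *: ((thetahat N w : 'cV[R]_d) - theta)) nu.

Proof.
have Uvtp : U vtp := nbhs_singleton hU.
have [r r0 rTheta] := nbhs_norm_ball (nbhs_interior htheta).
have [rv rv0 rvU] := nbhs_norm_ball hU.
(* An open ball is measurable, whereas the neighborhood U need not be. *)
pose V : set (borelV R q) := [set v | `|(v : 'cV[R]_q) - vtp| < rv].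
have mV : measurable V by exact: measurable_norm_ball.
have VU v : V v -> U v by exact: rvU.
have [mZ indZ lawZ] := hZ; have [mdelta _] := hdelta.
have mpilot N : measurable_fun setT (pilot N) by have [] := hpilot N.
have mhat N : measurable_fun setT (thetahat N) by have [] := hmax N.
pose mu := law P (mZ 0%N).
have mu_density D : measurable D ->
    (mu D = \int[muX \x muY]_(z in D) (joint_density f fX theta z)%:E)%E.
  by move=> mD; rewrite -(lawZ 0%N).
have T0 := ball_Theta rTheta (theta_ball theta r0).
have mfz : measurable_fun setT (fun z : X * Y => f theta z.1 z.2) by case: hf => h _ _ _; exact: h.
have fz0 (z : X * Y) : 0 <= f theta z.1 z.2 by case: hf => _ h _ _; exact: h.
have [mfX fX0 _] := hfX.
pose p' N (z : X * Y) (v : borelV R q) := p N z.1 z.2 v.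
have mp N : (0 < N)%N -> measurable_fun setT (fun u : (X * Y) * borelV R q => p' N u.1 u.2) by exact: (measurable_p hp).
have p01' N z v : (0 < N)%N -> 0 <= p' N z v <= 1 by exact: (p01 hp).
have next N : (0 < N)%N -> next_property P mu N Z (pilot N) (delta N) (p' N).
  move=> N0; apply: (sampling_next hZ hpilot hdelta (mZ 0%N) N0); first exact: mp.
  by move=> z v; exact: p01'.
have pilotW s : 0 < s -> forall e, 0 < e ->
    whp P e (fun N w => `|(pilot N w : 'cV[R]_q) - vtp| < s).
  by move=> s0 e e0; exact: (cvg_in_probability_whp mpilot hpilot_cvg).
have hatW := cvg_in_probability_whp mhat hconsistent.
have l3 v x y : V v -> partials3 (interior Theta) (loglik f x y) /\
    third_bounded (interior Theta) (loglik f x y) (B v x y) by move=> /VU; exact: h2_loglik.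
have b3 N v x y : (0 < N)%N -> V v -> partials3 (interior Theta) (log_pibar muY f p N x v) /\
    third_bounded (interior Theta) (log_pibar muY f p N x v) (B v x y).
  by move=> N0 /VU; exact: h2_pibar.
have [L HL] := curvature_exists hf hp r0 rTheta mV l3 b3.
have [M1 M10 HM1] := bounded_momentP hn h1_score.
have [M2 M20 HM2] := bounded_momentP hn h1_hessian.
have [M3 M30 HM3] := bounded_momentP hn h2_B.
(* One constant for the three moment bounds: 16 M1 for the score, 10 M2 + 12 M1 for the Hessian, 2
   d^2 M3 for the curvature. *)
pose M := 16 * M1 + (10 * M2 + 12 * M1) + 2 * d%:R ^+ 2 * M3.
have M0 : 0 <= M by rewrite /M !addr_ge0 ?mulr_ge0.
pose S := Sigma vtp; have pS : posdef S := h3_Sigma.2 vtp Uvtp.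
have [l [lE lN]] := posdef_inv_decomp pS.
pose s := score_term muY theta f p V; pose hs := hess_term muY theta f p V.
have n0 : \forall N \near \oo, 0 < n N by move/cvgryPgt : hn; apply.
pose SigN N (v : borelV R q) := SigmaN muX muY f fX theta p n N v.
have pl v : V v -> forall x y, partials3 (interior Theta) (loglik f x y).
  by move=> Vv x y; exact: (l3 v x y Vv).1.
have pb N v : (0 < N)%N -> V v -> forall x, partials3 (interior Theta) (log_pibar muY f p N x v).
  by move=> N0 Vv x; exact: (h2_pibar N v x point N0 (VU v Vv)).1.
have hd N v : (0 < N)%N -> V v -> forall x (js : seq 'I_d), (size js <= 2)%N ->
    pderiv js (pibar muY f p N x v) theta =
    \int[muY]_y (pderiv js (fun t => f t x y) theta * p N x y v).
  by move=> N0 Vv x js sj; exact: (hdiff N x v js N0 (VU v Vv) sj).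
have ml v (Vv : V v) := fun k => measurable_loglik_section hf r0 rTheta mV l3 k Vv.
have ml2 v (Vv : V v) := fun j k => measurable_loglik_section2 hf r0 rTheta mV l3 j k Vv.
have mm N v (N0 : (0 < N)%N) (Vv : V v) := fun k =>
  measurable_log_pibar_section hf hp r0 rTheta mV b3 k N0 Vv.
have mm2 N v (N0 : (0 < N)%N) (Vv : V v) := fun j k =>
  measurable_log_pibar_section2 hf hp r0 rTheta mV b3 j k N0 Vv.
have moments : \forall N \near \oo, forall v, V v -> [/\
  forall k, mu.-integrable setT (EFin \o (fun z => p' N z v * (s N (v, z) : 'cV[R]_d) k 0 ^+ 4)) /\
    N%:R * \int[mu]_z (p' N z v * (s N (v, z) : 'cV[R]_d) k 0 ^+ 4) <= n N * M,
  forall j k, mu.-integrable setT (EFin \o (fun z => p' N z v * hs N j k (v, z) ^+ 2)) /\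
    N%:R * \int[mu]_z (p' N z v * hs N j k (v, z) ^+ 2) <= n N * M
  & (\int[mu]_z (p' N z v * L N (v, z))%:E <= (n N * M / N%:R)%:E)%E].
  near=> N => v Vv; have Uv := VU v Vv.
  have N0 : (0 < N)%N by near: N; exact: nbhs_infty_gt.
  have Nr0 : 0 < N%:R :> R by rewrite ltr0n.
  have nN0 : 0 < n N by near: N.
  have A1 : (Exy muX muY f fX theta (fun x y => p N x y v * frob (score f theta x y) ^+ 4)%R <= (n N * M1 / N%:R)%:E)%E.
    by move: v Vv Uv; near: N; apply: filterS HM1 => N' h v _ Uv; exact: h.
  have A2 : (Exy muX muY f fX theta (fun x y => p N x y v * frob (info f theta x y) ^+ 2)%R <= (n N * M2 / N%:R)%:E)%E.
    by clear A1; move: v Vv Uv; near: N; apply: filterS HM2 => N' h v _ Uv; exact: h.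
  have A3 : (Exy muX muY f fX theta (fun x y => p N x y v * B v x y)%R <= (n N * M3 / N%:R)%:E)%E.
    by clear A1 A2; move: v Vv Uv; near: N; apply: filterS HM3 => N' h v _ Uv; exact: h.
  have Af := le_lt_trans A1 (ltry _); have Bf := le_lt_trans A2 (ltry _).
  have t1 : 0 <= n N * M1 / N%:R by rewrite divr_ge0 ?mulr_ge0// ltW.
  have t2 : 0 <= n N * M2 / N%:R by rewrite divr_ge0 ?mulr_ge0// ltW.
  have t3 : 0 <= n N * M3 / N%:R by rewrite divr_ge0 ?mulr_ge0// ltW.
  have ME : n N * M / N%:R = 16 * (n N * M1 / N%:R) + (10 * (n N * M2 / N%:R) + 12 * (n N * M1 / N%:R))
      + 2 * d%:R ^+ 2 * (n N * M3 / N%:R) by rewrite /M; field; rewrite gt_eqF.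
  have t3' : 0 <= 2 * d%:R ^+ 2 * (n N * M3 / N%:R) by rewrite mulr_ge0.
  have toN (x : R) : x <= n N * M / N%:R -> N%:R * x <= n N * M by rewrite ler_pdivlMr// mulrC.
  split=> [k|j k|].
  - have -> : (fun z => p' N z v * (s N (v, z) : 'cV[R]_d) k 0 ^+ 4) =
      (fun z : X * Y => p N z.1 z.2 v * ('D_(basisv k) (loglik f z.1 z.2) theta -
         'D_(basisv k) (log_pibar muY f p N z.1 v) theta) ^+ 4).
      by apply/funext => z; rewrite score_termE.
    have i := score4_integrable hf hfX hp r0 rTheta mu_density N0 (pl v Vv) (pb N v N0 Vv) (hd N v N0 Vv)
      (ml v Vv) (ml2 v Vv) (mm N v N0 Vv) Af Bf k.
    have le := score4_le hf hfX hp r0 rTheta mu_density N0 (pl v Vv) (pb N v N0 Vv) (hd N v N0 Vv)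
      (ml v Vv) (ml2 v Vv) (mm N v N0 Vv) Af Bf k.
    split; first exact: i.
    apply: toN; apply: (Rintegral_le_EFin i); apply: (le_trans le).
    apply: (@le_trans _ _ (16%:E * (n N * M1 / N%:R)%:E)%E); first by apply: lee_wpmul2l.
    by rewrite -EFinM lee_fin ME; lra.
  - have -> : (fun z => p' N z v * hs N j k (v, z) ^+ 2) =
      (fun z : X * Y => p N z.1 z.2 v * ('D_(basisv j) ('D_(basisv k) (loglik f z.1 z.2)) theta -
         'D_(basisv j) ('D_(basisv k) (log_pibar muY f p N z.1 v)) theta) ^+ 2).
      by apply/funext => z; rewrite /hs hess_termE.
    have i := hess2_integrable hf hfX hp r0 rTheta mu_density N0 (pl v Vv) (pb N v N0 Vv) (hd N v N0 Vv)
      (ml v Vv) (ml2 v Vv) (mm2 N v N0 Vv) Af Bf j k.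
    have le := hess2_le hf hfX hp r0 rTheta mu_density N0 (pl v Vv) (pb N v N0 Vv) (hd N v N0 Vv)
      (ml v Vv) (ml2 v Vv) (mm2 N v N0 Vv) Af Bf j k.
    split; first exact: i.
    apply: toN; apply: (Rintegral_le_EFin i); apply: (le_trans le).
    apply: (@le_trans _ _ (10%:E * (n N * M2 / N%:R)%:E + 12%:E * (n N * M1 / N%:R)%:E)%E).
      by apply: leeD; apply: lee_wpmul2l.
    by rewrite -!EFinM -EFinD lee_fin ME; lra.
  have [mLN LN0 LNb _] := HL N N0.
  (* Nonnegativity of B comes from a third derivative that it dominates, hence from an index in
     ['I_d]; in dimension 0 the curvature constant is zero anyway. *)
  have [d0|d0] := posnP d.
    have dz : d%:R = 0 :> R by rewrite d0.
    rewrite (eq_integral (cst 0%E)) ?integral0 ?lee_fin; first by rewrite ME; lra.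
    move=> z _; have := LNb (v, z) Vv; rewrite dz expr0n/= mul0r mulr0 => h.
    have -> : L N (v, z) = 0 by apply/le_anti; rewrite h LN0.
    by rewrite mulr0.
  have Bz z : 0 <= B v z.1 z.2.
    have [_ h] := l3 v z.1 z.2 Vv; apply: le_trans (normr_ge0 _) _.
    exact: (h (Ordinal d0) (Ordinal d0) (Ordinal d0) theta (rTheta _ (theta_ball theta r0))).
  have mBv := hB_meas v Uv.
  have pz0 z : 0 <= p' N z v by have /andP[] := p01' N z v N0.
  have mpv : measurable_fun setT (fun z => p' N z v) := measurable_fun_pair1 v (mp N N0).
  pose c : R := 2 * d%:R ^+ 2.
  have c0 : 0 <= c by rewrite mulr_ge0.
  have mG : measurable_fun setT (fun z : X * Y => p' N z v * (c * B v z.1 z.2)).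
    by apply: measurable_funM => //; exact: measurable_funM.
  have G0 z : 0 <= p' N z v * (c * B v z.1 z.2) := mulr_ge0 (pz0 z) (mulr_ge0 c0 (Bz z)).
  apply: (@le_trans _ _ (\int[mu]_z (p' N z v * (c * B v z.1 z.2))%:E)%E).
    apply: ge0_le_integral => //.
    - by move=> z _; rewrite lee_fin mulr_ge0.
    - by apply/measurable_EFinP; apply: measurable_funM => //; exact: (measurable_fun_pair2 v mLN).
    - exact/measurable_EFinP.
    - move=> z _; rewrite lee_fin ler_wpM2l//; have := LNb (v, z) Vv.
      by rewrite /= ger0_norm// /c mulrA.
  rewrite (ge0_joint_integral mfz fz0 mfX fX0 mu_density mG G0).
  have -> : (\int[muX \x muY]_z (p' N z v * (c * B v z.1 z.2) * (f theta z.1 z.2 * fX z.1))%:E =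
     c%:E * Exy muX muY f fX theta (fun x y => p N x y v * B v x y)%R)%E.
    rewrite /Exy -ge0_integralZl//.
    - by apply: eq_integral => z _; rewrite -EFinM /joint_density /p'; congr EFin; ring.
    - apply/measurable_EFinP; apply: measurable_funM; first exact: measurable_funM.
      by apply: measurable_funM => //; exact: (measurableT_comp mfX measurable_fst).
    - move=> z _; rewrite lee_fin; apply: mulr_ge0; first exact: (mulr_ge0 (pz0 z) (Bz z)).
      by apply: mulr_ge0; [exact: fz0|exact: fX0].
  apply: (@le_trans _ _ (c%:E * (n N * M3 / N%:R)%:E)%E); first by apply: lee_wpmul2l.
  by rewrite -EFinM lee_fin ME /c; lra.
have means : \forall N \near \oo, forall v, V v -> [/\
  forall k, \int[mu]_z (p' N z v * (s N (v, z) : 'cV[R]_d) k 0) = 0,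
  forall j k, N%:R * \int[mu]_z (p' N z v * ((s N (v, z) : 'cV[R]_d) j 0 * (s N (v, z) : 'cV[R]_d) k 0)) = n N * SigN N v j k
  & forall j k, N%:R * \int[mu]_z (p' N z v * hs N j k (v, z)) = - (n N * SigN N v j k)].
  near=> N => v Vv; have Uv := VU v Vv.
  have N0 : (0 < N)%N by near: N; exact: nbhs_infty_gt.
  have Nr0 : 0 < N%:R :> R by rewrite ltr0n.
  have nN0 : 0 < n N by near: N.
  have Af : (Exy muX muY f fX theta (fun x y => p N x y v * frob (score f theta x y) ^+ 4)%R < +oo)%E.
    move: v Vv Uv; near: N; apply: filterS HM1 => N' h v _ Uv.
    exact: le_lt_trans (h v Uv) (ltry _).
  have Bf : (Exy muX muY f fX theta (fun x y => p N x y v * frob (info f theta x y) ^+ 2)%R < +oo)%E.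
    clear Af; move: v Vv Uv; near: N; apply: filterS HM2 => N' h v _ Uv.
    exact: le_lt_trans (h v Uv) (ltry _).
  have Sf : SigmaN_finite muX muY f fX theta p N v.
    clear Af Bf; move: v Vv Uv; near: N; apply: filterS h3_SigmaN => N' [_ h] v _ Uv.
    exact: (h v Uv).1.
  have SE j k : n N * SigN N v j k = N%:R *
      fine (Exy muX muY f fX theta (fun x y => Sigma_integrand muY f theta p N v x y j k)).
    by rewrite /SigN /SigmaN !mxE; field; rewrite gt_eqF.
  split=> [k|j k|j k].
  - have -> : (fun z => p' N z v * (s N (v, z) : 'cV[R]_d) k 0) =
      (fun z : X * Y => p N z.1 z.2 v * ('D_(basisv k) (loglik f z.1 z.2) theta -
         'D_(basisv k) (log_pibar muY f p N z.1 v) theta)).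
      by apply/funext => z; rewrite score_termE.
    exact: (score_mean hf hfX hp r0 rTheta mu_density N0 (pl v Vv) (pb N v N0 Vv) (hd N v N0 Vv)
      (ml v Vv) (ml2 v Vv) (mm N v N0 Vv) Af Bf k).
  - rewrite SE; congr (_ * _).
    have -> : (fun z => p' N z v * ((s N (v, z) : 'cV[R]_d) j 0 * (s N (v, z) : 'cV[R]_d) k 0)) =
      (fun z : X * Y => p N z.1 z.2 v * (('D_(basisv j) (loglik f z.1 z.2) theta -
         'D_(basisv j) (log_pibar muY f p N z.1 v) theta) * ('D_(basisv k) (loglik f z.1 z.2) theta -
         'D_(basisv k) (log_pibar muY f p N z.1 v) theta))).
      by apply/funext => z; rewrite !score_termE.
    exact: (score_cov hf hfX hp r0 rTheta mu_density N0 (pl v Vv) (pb N v N0 Vv) (hd N v N0 Vv)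
      (ml v Vv) (ml2 v Vv) (mm N v N0 Vv) Af Bf Sf j k).
  - rewrite SE -mulrN; congr (_ * _).
    have -> : (fun z => p' N z v * hs N j k (v, z)) =
      (fun z : X * Y => p N z.1 z.2 v * ('D_(basisv j) ('D_(basisv k) (loglik f z.1 z.2)) theta -
         'D_(basisv j) ('D_(basisv k) (log_pibar muY f p N z.1 v)) theta)).
      by apply/funext => z; rewrite /hs hess_termE.
    exact: (hess_mean hf hfX hp r0 rTheta mu_density N0 (pl v Vv) (pb N v N0 Vv) (hd N v N0 Vv)
      (ml v Vv) (ml2 v Vv) (mm2 N v N0 Vv) Af Bf Sf j k).
have n_mean N v : (0 < N)%N -> N%:R * \int[mu]_z p' N z v = n N.
  move=> N0; have Nr0 : 0 < N%:R :> R by rewrite ltr0n.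
  have mpv : measurable_fun setT (fun z => p' N z v) := measurable_fun_pair1 v (mp N N0).
  rewrite /Rintegral (joint_integral mfz fz0 mfX fX0 mu_density mpv).
  have [_ _ h] := hp; have := h N v N0; rewrite /Exy => e.
  have -> : (\int[muX \x muY]_z (p' N z v * (f theta z.1 z.2 * fX z.1))%:E = (n N / N%:R)%:E)%E.
    by rewrite -e.
  by rewrite /= mulrC divfK// gt_eqF.
have conc eta : 0 < eta -> exists W, [/\ measurable W, W `<=` V,
    forall e, 0 < e -> whp P e (fun N w => W (pilot N w))
  & \forall N \near \oo, forall v j k, W v -> `|SigN N v j k - S j k| <= eta].
  move=> eta0; have eta2 : 0 < eta / 2 by rewrite divr_gt0.
  (* Half of eta pays for the continuity of Sigma at the limit of the pilot, which fixes the radius;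
     the other half pays for the uniform convergence of SigmaN. *)
  have [s1 s10 hs1] := nbhs_norm_ball (within_continuous_entries eta2 hU h3_Sigma.1).
  have s20 : 0 < Num.min rv s1 by rewrite lt_min rv0.
  exists [set v : borelV R q | `|(v : 'cV[R]_q) - vtp| < Num.min rv s1]; split.
  - exact: measurable_norm_ball.
  - by move=> v /=; rewrite lt_min => /andP[].
  - exact: pilotW.
  apply: filterS (uniform_cvg_entries eta2 h3_cvg) => N h v j k /=; rewrite lt_min => /andP[v1 v2].
  have h1 := h v (rvU v v1) j k; have h2 := hs1 v v2 j k.
  rewrite -(subrK (Sigma v j k) (SigN N v j k)) -addrA; apply: le_trans (ler_normD _ _) _.
  by rewrite /S /SigN; lra.
have cons e rho : 0 < e -> 0 < rho -> whp P e (fun N w => `|(thetahat N w : 'cV[R]_d) - theta| <= rho).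
  by move=> e0 rho0; apply: whp_le (hatW e rho e0 rho0) => //; near=> N => w /ltW.
have ms N : (0 < N)%N -> measurable_fun setT (s N) by exact: (measurable_score_term hf hp r0 rTheta mV l3 b3).
have mhs N j k : (0 < N)%N -> measurable_fun setT (hs N j k).
  by exact: (measurable_hess_term hf hp r0 rTheta mV l3 b3).
have mL N : (0 < N)%N -> measurable_fun setT (L N) by move=> /HL[].
have L0 N u : (0 < N)%N -> 0 <= L N u by move=> /HL[].
have LT N u k t : (0 < N)%N -> V u.1 -> `|t - theta| < r ->
  `|taylor_rem (loglik_at f) theta u k t - taylor_rem (log_pibar_at muY f p N) theta u k t|
    <= L N u * `|t - theta| ^+ 2 by move=> /HL[_ _ _ h]; exact: h.
have score := score_expansion_whp hmax r0 rTheta l3 b3 LT (pilotW rv rv0) hatW.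
exists (gauss l); split => //.
have mD N : measurable_fun setT
    ((fun w => Num.sqrt (n N) *: ((thetahat N w : 'cV[R]_d) - theta)) : Omega -> borelV R d).
  apply: measurable_borelVZ => //.
  by apply: (@measurable_borelVD _ _ _ _ (thetahat N) (fun=> - theta)).
(* The sum of the variances of the coordinates bounds each of them. *)
apply: (portmanteau mD (C := \sum_j \sum_(v <- l) (v j 0) ^+ 2)) => [j|h sh].
  apply: le_trans (gauss_sqr_fin l j) _; rewrite lee_fin (bigD1 j)//= lerDl.
  by apply: sumr_ge0 => i _; apply: sumr_ge0 => v _; exact: sqr_ge0.
exact: (one_step_cvg mZ mpilot mdelta mp p01' next hn n_mean ms mhs mL L0 mhat M0 moments means conc
  cons score pS.1 (posdef_unit pS) lE sh).
Unshelve. all: by end_near. Qed.
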